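(* There exist an absolute constant $A_0>1$ and, for every integer $j\ge 0$, a constant $C_j>1$ such that the following holds. Let $T>0$, $A\ge A_0$, and let $u$ be a classical axisymmetric solution of the 3D incompressible Navier--Stokes equations on $[0,T]\times\mathbb{R}^3$ satisfying $$\|u\|_{L^\infty([0,T];L^{3,\infty}(\mathbb{R}^3))}\le A .$$ Then for every integer $j\ge 0$ and every $t\in(0,T]$, $$\|\nabla^j u(t)\|_{L^\infty(\mathbb{R}^3)}\le t^{-\frac{1+j}{2}}\exp\exp\left(A^{C_j}\right).$$
   Context: The 3D incompressible Navier--Stokes equations are $\partial_t u-\Delta u+(u\cdot\nabla)u+\nabla p=0$, $\operatorname{div}u=0$ in $\mathbb{R}^3$, for a velocity $u$ and pressure $p$; a classical (strong) solution is a smooth one satisfying the equations pointwise. In cylindrical coordinates $(r,\theta,x_3)$ with basis vectors $e_r,e_\theta,e_3$ write $u=u_re_r+u_\theta e_\theta+u_3e_3$; $u$ is axisymmetric if $\partial_\theta u_r=\partial_\theta u_\theta=\partial_\theta u_3=0$. The weak $L^3$ norm is $\|f\|_{L^{3,\infty}}=\sup_{\lambda>0}\lambda\,|\{|f|\ge\lambda\}|^{1/3}$. *)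

(* Defs.v *)
From HB Require Import structures.
From mathcomp Require Import all_boot all_order all_algebra.
From mathcomp Require Import all_classical all_reals all_analysis.

Set Implicit Arguments.
Unset Strict Implicit.
Unset Printing Implicit Defensive.

Import Order.TTheory GRing.Theory Num.Theory.
Import numFieldNormedType.Exports.

Local Open Scope classical_set_scope.
Local Open Scope ring_scope.

Section Space.
Context {R : realType}.

Definition vec3 (a b c : R) : 'rV[R]_3 := \row_(i < 3) [:: a; b; c]`_i.

Definition ebasis (i : 'I_3) : 'rV[R]_3 := delta_mx 0 i.

Definition dot (v w : 'rV[R]_3) : R := \sum_(i < 3) v 0 i * w 0 i.

(* The library norm on row vectors is the sup norm. *)
Definition enorm (v : 'rV[R]_3) : R := Num.sqrt (dot v v).

(* Three-dimensional Lebesgue measure lives on triples; a function on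
   row vectors is transported to triples by [of_triple]. *)
Definition vol3 : {measure set (measurableTypeR R * measurableTypeR R
                                * measurableTypeR R) -> \bar R} :=
  ((@lebesgue_measure R \x @lebesgue_measure R) \x @lebesgue_measure R)%E.

Definition of_triple (q : measurableTypeR R * measurableTypeR R
                          * measurableTypeR R) : 'rV[R]_3 :=
  vec3 q.1.1 q.1.2 q.2.

Definition weakL3_norm (f : 'rV[R]_3 -> 'rV[R]_3) : \bar R :=
  ereal_sup [set (l%:E * vol3 [set q | (l <= enorm (f (of_triple q)))%R]
                           `^ (3^-1))%E | l in [set l : R | 0 < l]].

Definition Linfty_norm (g : 'rV[R]_3 -> R) : \bar R :=
  ('N[vol3]_+oo [EFin \o (g \o of_triple)])%E.

(* Essential supremum over [0, T]; the extension by 0 outside the interval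
   does not affect the norm of a function with values in [0, +oo]. *)
Definition Linfty_weakL3_norm (T : R) (u : R -> 'rV[R]_3 -> 'rV[R]_3) :
    \bar R :=
  let N : R -> \bar R := (fun t => weakL3_norm (u t)) \_ `[0, T] in
  ('N[@lebesgue_measure R]_+oo [N])%E.

End Space.

Section Calculus.
Context {R : realType}.

Definition dx {V : normedModType R} (i : 'I_3) (f : 'rV[R]_3 -> V) :
    'rV[R]_3 -> V :=
  'D_(ebasis i) f.

(* Time derivative of a function defined for times in [I]: it is one-sided at
   the end points of [I] and does not see the values of [f] outside [I]. *)
Definition dt_quotient {V : normedModType R} (f : R -> 'rV[R]_3 -> V)
    (t : R) (x : 'rV[R]_3) (h : R) : V :=
  h^-1 *: (f (t + h) x - f t x).

Definition dt_filter (I : set R) (t : R) : set_system R :=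
  within [set h | I (t + h)] 0^'.

Definition dt {V : normedModType R} (I : set R) (f : R -> 'rV[R]_3 -> V) :
    R -> 'rV[R]_3 -> V :=
  fun t x => lim (dt_quotient f t x @ dt_filter I t).

(* Mixed space-time derivative along a word of variables; [None] stands for
   time and [Some i] for the i-th space variable. *)
Definition dtx {V : normedModType R} (I : set R) (o : option 'I_3)
    (f : R -> 'rV[R]_3 -> V) : R -> 'rV[R]_3 -> V :=
  if o is Some i then fun t => dx i (f t) else dt I f.

Definition mixed {V : normedModType R} (I : set R) (w : seq (option 'I_3))
    (f : R -> 'rV[R]_3 -> V) : R -> 'rV[R]_3 -> V :=
  foldr (dtx I) f w.

(* C^oo on I x R^3, up to the end points of I: partial derivatives of all
   orders exist and are jointly continuous there. *)
Definition smooth {V : normedModType R} (I : set R)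
    (f : R -> 'rV[R]_3 -> V) : Prop :=
  forall w : seq (option 'I_3),
    {within I `*` setT,
       continuous (fun z : R * 'rV[R]_3 => mixed I w f z.1 z.2)} /\
    (forall t x, I t ->
       cvg (dt_quotient (mixed I w f) t x @ dt_filter I t) /\
       (forall i, derivable (mixed I w f t) x (ebasis i))).

Definition laplacian {V : normedModType R} (f : 'rV[R]_3 -> V) :
    'rV[R]_3 -> V :=
  fun x => \sum_(i < 3) dx i (dx i f) x.

Definition grad (f : 'rV[R]_3 -> R) (x : 'rV[R]_3) : 'rV[R]_3 :=
  \row_(i < 3) dx i f x.

Definition divergence (v : 'rV[R]_3 -> 'rV[R]_3) (x : 'rV[R]_3) : R :=
  \sum_(i < 3) (dx i v x) 0 i.

Definition advect (v w : 'rV[R]_3 -> 'rV[R]_3) (x : 'rV[R]_3) : 'rV[R]_3 :=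
  \sum_(i < 3) v x 0 i *: dx i w x.

(* |nabla^j v| is the Euclidean norm of the tensor of all the j-th order
   partial derivatives of all the components of v. *)
Definition nabla_norm (j : nat) (v : 'rV[R]_3 -> 'rV[R]_3) (x : 'rV[R]_3) : R :=
  Num.sqrt (\sum_(w : j.-tuple 'I_3) enorm (foldr dx v w x) ^+ 2).

End Calculus.

Section NavierStokes.
Context {R : realType}.

Definition navier_stokes (I : set R) (u : R -> 'rV[R]_3 -> 'rV[R]_3)
    (p : R -> 'rV[R]_3 -> R) : Prop :=
  forall t x, I t ->
    dt I u t x - laplacian (u t) x + advect (u t) (u t) x + grad (p t) x = 0 /\
    divergence (u t) x = 0.

Definition classical_solution (T : R) (u : R -> 'rV[R]_3 -> 'rV[R]_3) : Prop :=
  exists p : R -> 'rV[R]_3 -> R,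
    [/\ smooth `[0, T] u, smooth `[0, T] p & navier_stokes `[0, T] u p].

Definition cyl (r th z : R) : 'rV[R]_3 := vec3 (r * cos th) (r * sin th) z.
Definition e_r (th : R) : 'rV[R]_3 := vec3 (cos th) (sin th) 0.
Definition e_th (th : R) : 'rV[R]_3 := vec3 (- sin th) (cos th) 0.
Definition e_3 : 'rV[R]_3 := vec3 0 0 1.

Definition axisymmetric (v : 'rV[R]_3 -> 'rV[R]_3) : Prop :=
  forall r th z : R, 0 < r ->
    [/\ is_derive th 1 (fun s => dot (v (cyl r s z)) (e_r s)) 0,
        is_derive th 1 (fun s => dot (v (cyl r s z)) (e_th s)) 0 &
        is_derive th 1 (fun s => dot (v (cyl r s z)) e_3) 0].

End NavierStokes.

(* Main.v *)
(* A solution is rescaled about a point where a scale-invariant magnitude [magn],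
   built from the derivatives of the velocity and of the vorticity, is nearly
   maximal; the magnitude is then 1 at the centre and at most 2 on a parabolic
   cylinder of size [K].  Interior gradient bounds (maximum principle) for the
   vorticity equation and for [lap u = - curl curl u] show that the magnitude at
   the centre is small as soon as the velocity is small near the centre.

   Away from the axis axial symmetry spreads a large velocity over a solid
   torus, which the weak L^3 bound excludes; this gives [magn * r <= A^k].  It
   remains to show that, for [K = exp exp (A^k)], the velocity is small within
   distance [A^k] of the axis:
   - The circulation [r u_theta] solves a drift-diffusion equation and vanishes on
     the axis.  Testing [S - r u_theta] against a bump finds a point where it is
     not small, and a barrier on a moving disc carries this lower bound to the
     next unit of time.  The oscillation thus drops by the factor
     [1 - exp (- A^k)] at each dyadic scale, and is tiny after [exp (A^k)] scales.
   - The source of the equation of [omega_theta / r] is then negligible and its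
     boundary values at large [r] are small, so that a barrier argument makes
     [omega_theta] small.
   - [u_r] solves an elliptic equation with right-hand side
     [d omega_theta / d x_3], vanishes on the axis and is small at large [r], hence
     is small by the maximum principle; [u_3] follows by integrating
     [d u_3 / d r = d u_r / d x_3 - omega_theta] inwards. *)

Require Import Defs.
From HB Require Import structures.
From mathcomp Require Import all_boot all_order all_algebra.
From mathcomp Require Import all_classical all_reals all_analysis.
From mathcomp Require Import ring lra zify.

Set Implicit Arguments.
Unset Strict Implicit.
Unset Printing Implicit Defensive.

Import Order.TTheory GRing.Theory Num.Theory.
Import numFieldNormedType.Exports.

Local Open Scope classical_set_scope.
Local Open Scope ring_scope.

(** * One-variable calculus *)

Section OneVariable.
Context {R : realType}.
Implicit Types (f g : R -> R) (x a b c : R).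

(** The two exponentials have separate origins. The barrier for [omega_theta / r] must reach out to
    a radius, a power of A, beyond which decay makes the vorticity small, and it grows like exp
    (r^2); so the swirl has to be below the inverse of a single exponential of a power of A. Each
    dyadic scale improves the circulation only by the factor 1 - exp (- A^k), so about exp (A^k)
    scales are spent, and 2 to this power is the size [K].

    The pressure is the obstacle to local estimates, as nothing bounds it. It disappears from the
    vorticity equation, and its angular derivative is shown to vanish on the half-plane y = 0.
    Velocity and vorticity enter the magnitude with derivatives of the same order: the velocity
    gains its top derivative from the vorticity by an elliptic estimate, the vorticity its own by a
    parabolic one, so that no order is lost.

    Axial symmetry trades y-derivatives for radial ones. All equations are therefore written for
    Cartesian components on the half-plane y = 0, where the first two components are the radial and
    the angular one. *)

Definition dR f x a := is_derive x (1 : R) f a.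

Lemma dRe f x a b : dR f x a -> a = b -> dR f x b.
Proof. by move=> h <-. Qed.
Lemma dRc c x : dR (fun=> c) x 0.
Proof. exact: is_derive_cst. Qed.
Lemma dRid x : dR (fun s => s) x 1.
Proof. exact: is_derive_id. Qed.
Lemma dRD f g x a b : dR f x a -> dR g x b -> dR (fun s => f s + g s) x (a + b).
Proof. by move=> hf hg; exact: is_deriveD. Qed.
Lemma dRN f x a : dR f x a -> dR (fun s => - f s) x (- a).
Proof. by move=> hf; exact: is_deriveN. Qed.
Lemma dRM f g x a b :
  dR f x a -> dR g x b -> dR (fun s => f s * g s) x (a * g x + f x * b).
Proof.
move=> hf hg; have := @is_deriveM _ _ f g x 1 a b hf hg.
by move=> h; apply: (dRe h); rewrite /GRing.scale/=; ring.
Qed.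
Lemma dRX f x a n : dR f x a -> dR (fun s => f s ^+ n) x (n%:R * f x ^+ n.-1 * a).
Proof. by move=> hf; have := @is_deriveX _ _ f n x 1 a hf; rewrite exprfctE. Qed.
Lemma dRX2 f x a : dR f x a -> dR (fun s => f s ^+ 2) x (2 * f x * a).
Proof. by move=> /(@dRX _ _ _ 2); rewrite /= expr1. Qed.
Lemma dRcomp f g x a b : dR f x a -> dR g (f x) b -> dR (fun s => g (f s)) x (b * a).
Proof.
move=> hf hg.
apply: DeriveDef.
  apply/derivable1_diffP; apply: (@differentiable_comp _ _ _ _ f g).
    by apply/derivable1_diffP; case: hf.
  by apply/derivable1_diffP; case: hg.
have h : derivable f x 1 by case: hf.
have h' : derivable g (f x) 1 by case: hg.
have := derive1_comp h h'.
rewrite !derive1E; case: hf => _ <-; case: hg => _ <-.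
exact.
Qed.
Lemma dRV f x a : f x != 0 -> dR f x a -> dR (fun s => (f s)^-1) x (- (f x) ^- 2 * a).
Proof.
move=> fx0 hf; apply: DeriveDef.
  by apply: (@derivableV _ _ f) => //; case: hf.
have df : derivable f x 1 by case: hf.
have := deriveV fx0 df.
by case: hf => _ <-.
Qed.
Lemma dR_exp x : dR (fun s => expR s) x (expR x).
Proof. exact: is_derive_expR. Qed.
Lemma dR_cont f x a : dR f x a -> {for x, continuous f}.
Proof.
by case=> hf _; apply: differentiable_continuous; apply/derivable1_diffP.
Qed.
Lemma dR_near f g x a : (\forall s \near x, f s = g s) -> dR f x a -> dR g x a.
Proof. exact: near_eq_is_derive. Qed.
Lemma dR_uniq f x a b : dR f x a -> dR f x b -> a = b.
Proof. by case=> _ <- [_ <-]. Qed.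

Lemma dR_MVT f (df : R -> R) a b : a < b ->
  (forall s, a <= s <= b -> dR f s (df s)) ->
  exists2 c, a < c < b & f b - f a = df c * (b - a).
Proof.
move=> ab h; have [| |c cab ->] := MVT ab (f := f) (df := df).
- by move=> x; rewrite in_itv/= => /andP[? ?]; apply: h; rewrite !ltW.
- apply: continuous_in_subspaceT => x; rewrite inE/= in_itv/= => xab.
  exact: dR_cont (h _ xab).
- by exists c => //; move: cab; rewrite in_itv.
Qed.

Lemma dR_lip f (df : R -> R) a b B : 
  (forall s, Num.min a b <= s <= Num.max a b -> dR f s (df s) /\ `|df s| <= B) ->
  `|f b - f a| <= B * `|b - a|.
Proof.
move=> h; have [ab|ba|->] := ltgtP a b; last by rewrite !subrr normr0 mulr0.
- have [|c /andP[c1 c2] ->] := @dR_MVT f df a b ab.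
    move=> s sab; apply: (h s _).1.
    by rewrite (min_idPl (ltW ab)) (max_idPr (ltW ab)).
  rewrite normrM ler_wpM2r//; apply: (h c _).2.
  by rewrite (min_idPl (ltW ab)) (max_idPr (ltW ab)) !ltW.
- have [|c /andP[c1 c2] e] := @dR_MVT f df b a ba.
    move=> s sab; apply: (h s _).1.
    by rewrite (min_idPr (ltW ba)) (max_idPl (ltW ba)).
  rewrite distrC e [`|b - a|]distrC normrM ler_wpM2r//; apply: (h c _).2.
  by rewrite (min_idPr (ltW ba)) (max_idPl (ltW ba)) !ltW.
Qed.

(** If [c] were positive, [df] would be positive just to the right of 0, and the mean value theorem
    would make [f] exceed [f 0]. The second derivative is asked for at the point only. *)
Lemma dR_max2 f (df : R -> R) c e : 0 < e ->
  (forall s, `|s| < e -> dR f s (df s)) -> dR df 0 c ->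
  (forall s, `|s| < e -> f s <= f 0) -> df 0 = 0 /\ c <= 0.
Proof.
move=> e0 hf hdf fmax.
have df0 : df 0 = 0.
  have : is_derive (0 : R) 1 f 0.
    apply: (@derive1_at_max _ f (- e) e).
    - by lra.
    - by move=> t; rewrite in_itv/= => /andP[? ?]; case: (hf t) => //; rewrite ltr_norml; apply/andP.
    - by rewrite in_itv/=; lra.
    - by move=> t; rewrite in_itv/= => /andP[? ?]; apply: fmax; rewrite ltr_norml; apply/andP.
  by apply: dR_uniq; apply: hf; rewrite normr0.
split => //; rewrite leNgt; apply/negP => c0.
have : \forall h \near 0^', c / 2 < h^-1 * df h.
  have [d1 d2] := hdf.
  have : h^-1 *: (df (h *: 1 + 0) - df 0) @[h --> 0^'] --> c.
    by rewrite -d2; exact: d1.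
  have cc : c / 2 < c by lra.
  move=> /(_ _ (lt_nbhsr cc))[d d0 hd].
  exists d => // h hd1 hd2.
  by have := hd h hd1 hd2; rewrite /= df0 subr0 addr0 /GRing.scale/= mulr1.
move=> [d /= d0 hd].
pose m := Num.min d e / 2.
have md : 0 < m < d /\ m < e.
  by rewrite /m; split; [apply/andP; split|]; have [?|?] := leP d e; lra.
case: md => /andP[m0 md] me.
have [|x /andP[x0 xm] hx] := @dR_MVT f df 0 m m0.
  by move=> s /andP[s0 sm]; apply: hf; rewrite ger0_norm//; lra.
have := hd x; rewrite /ball_ /= sub0r normrN gtr0_norm// => /(_ _ _)/=.
move=> /(_ (lt_trans xm md)); rewrite gt_eqF// => /(_ isT) h1.
have dfx : 0 < df x.
  by have : 0 < x^-1 * df x; [apply: lt_trans h1; lra|rewrite pmulr_rgt0// invr_gt0].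
have := fmax m; rewrite gtr0_norm// => /(_ me).
apply/negP; rewrite -ltNge -subr_gt0 hx subr0; exact: mulr_gt0.
Qed.

(** For the time variable: a parabolic extremum may sit at the final time, where only the past is
    available for comparison. *)
Lemma dR_max_left f c e : 0 < e -> dR f 0 c ->
  (forall s, - e < s <= 0 -> f s <= f 0) -> 0 <= c.
Proof.
move=> e0 [d1 d2] fmax; rewrite leNgt; apply/negP => c0.
have : h^-1 *: (f (h *: 1 + 0) - f 0) @[h --> 0^'] --> c by rewrite -d2; exact: d1.
have cc : c < c / 2 by lra.
move=> /(_ _ (lt_nbhsl cc))[d /= d0 hd].
pose m := Num.min d e / 2.
have md : 0 < m < d /\ m < e.
  by rewrite /m; split; [apply/andP; split|]; have [?|?] := leP d e; lra.
case: md => /andP[m0 md] me.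
have := hd (- m); rewrite /ball_ /= sub0r opprK gtr0_norm// => /(_ md).
have mN : - m != 0 by lra.
move=> /(_ mN); rewrite /= addr0 /GRing.scale/= mulr1 => h1.
have h2 : 0 < f (- m) - f 0.
  have h3 : (- m)^-1 * (f (- m) - f 0) < 0 by apply: lt_trans h1 _; lra.
  by rewrite nmulr_rlt0 in h3 => //; rewrite invr_lt0; lra.
have h4 : f (- m) <= f 0 by apply: fmax; lra.
lra.
Qed.

End OneVariable.

Ltac dR_step := first [ eassumption | match goal with
  | |- dR (fun s => ?c) _ _ => exact: dRc
  | |- dR (fun s => s) _ _ => exact: dRid
  | |- dR (fun s => @?f s + @?g s) ?y _ => refine (@dRD _ f g y _ _ _ _)
  | |- dR (fun s => - @?f s) ?y _ => refine (@dRN _ f y _ _)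
  | |- dR (fun s => @?f s * @?g s) ?y _ => refine (@dRM _ f g y _ _ _ _)
  | |- dR (fun s => @?f s ^+ 2) ?y _ => refine (@dRX2 _ f y _ _)
  | |- dR (fun s => @?f s ^+ ?n) ?y _ => refine (@dRX _ f y _ n _)
  end ].
Ltac dR_auto := apply: dRe; [ repeat dR_step | cbv beta ].

(** * Smooth functions on space-time *)

Section SpaceTime.
Context {R : realType}.
Local Notation E := (R * 'rV[R]_3)%type.
Implicit Types (F G : E -> R) (z c : E) (U : set E) (o : option 'I_3) (a b : R).

Definition dirv (o : option 'I_3) : E :=
  if o is Some i then (0, ebasis i) else (1, 0).

Definition pd (o : option 'I_3) (F : E -> R) : E -> R := 'D_(dirv o) F.

Definition near_pt (d : R) (z z' : E) : Prop :=
  `|z'.1 - z.1| < d /\ forall i, `|z'.2 0 i - z.2 0 i| < d.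

Lemma near_ptP d z z' : 0 < d -> near_pt d z z' <-> `|z - z'| < d.
Proof.
move=> d0; split.
- move=> [h1 h2]; rewrite prod_normE gt_max; apply/andP; split.
    by rewrite /= distrC.
  rewrite [X in X < _]/Num.Def.normr/= mx_normrE; apply: bigmax_lt => //= -[i j] _ /=.
  by rewrite !mxE ord1 distrC.
- rewrite prod_normE gt_max => /andP[h1 h2]; split; first by rewrite distrC.
  move=> i; apply: le_lt_trans h2; rewrite [leRHS]/Num.Def.normr/= mx_normrE.
  by apply: le_trans (le_bigmax _ _ (0, i)); rewrite /= !mxE distrC.
Qed.

Lemma nbhs_near_pt z (A : set E) : nbhs z A <-> exists2 d, 0 < d & forall z', near_pt d z z' -> A z'.
Proof.
split=> [/nbhs_ballP[d /= d0 h]|[d d0 h]].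
  by exists d => // z' hz'; apply: h; rewrite -ball_normE/=; apply/near_ptP.
apply/nbhs_ballP; exists d => //= z' hz'; apply: h.
by move: hz'; rewrite -ball_normE/= => /near_ptP; apply.
Qed.

Lemma cont_nearP F z : {for z, continuous F} <-> forall e, 0 < e ->
  exists2 d, 0 < d & forall z', near_pt d z z' -> `|F z' - F z| < e.
Proof.
split.
- move=> cF e e0; have /cvgrPdist_lt/(_ _ e0)/nbhs_near_pt[d d0 h] := cF.
  by exists d => // z' /h; rewrite distrC.
- move=> h; apply/cvgrPdist_lt => e e0; apply/nbhs_near_pt.
  by have [d d0 hd] := h e e0; exists d => // z' /hd; rewrite distrC.
Qed.

Definition cE F z := {for z, continuous F}.
Lemma cE_cst (x : R) z : cE (fun=> x) z. Proof. exact: cvg_cst. Qed.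
Lemma cE_D F G z : cE F z -> cE G z -> cE (fun z => F z + G z) z.
Proof. by move=> ? ?; exact: cvgD. Qed.
Lemma cE_N F z : cE F z -> cE (fun z => - F z) z.
Proof. by move=> ?; exact: cvgN. Qed.
Lemma cE_M F G z : cE F z -> cE G z -> cE (fun z => F z * G z) z.
Proof. by move=> ? ?; exact: cvgM. Qed.
Lemma cE_X F z n : cE F z -> cE (fun z => F z ^+ n) z.
Proof.
move=> cF; elim: n => [|n IH]; first exact: cE_cst.
have -> : (fun z => F z ^+ n.+1) = (fun z => F z * F z ^+ n) by apply/funext => y; rewrite exprS.
exact: cE_M.
Qed.
Lemma cE_fst z : cE (fun z' : E => z'.1) z.
Proof. by apply/cont_nearP => e e0; exists e => // z' []. Qed.
Lemma cE_snd z i : cE (fun z' : E => z'.2 0 i) z.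
Proof. by apply/cont_nearP => e e0; exists e => // z' []. Qed.

Definition pt (t x y w : R) : E := (t, vec3 x y w).

Lemma pt0 t x y w : (pt t x y w).2 0 0 = x. Proof. by rewrite mxE. Qed.
Lemma pt1 t x y w : (pt t x y w).2 0 1 = y. Proof. by rewrite mxE. Qed.
Lemma pt2 t x y w : (pt t x y w).2 0 2 = w. Proof. by rewrite mxE. Qed.

Lemma I3P (P : 'I_3 -> Prop) : P 0 -> P 1 -> P 2 -> forall i, P i.
Proof.
move=> p0 p1 p2 [[|[|[|//]]] h].
- by have -> : Ordinal h = 0 by apply: val_inj.
- by have -> : Ordinal h = 1 by apply: val_inj.
- by have -> : Ordinal h = 2 by apply: val_inj.
Qed.

Lemma sum3 (V : nmodType) (f : 'I_3 -> V) : \sum_(i < 3) f i = f 0 + f 1 + f 2.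
Proof.
rewrite !big_ord_recl big_ord0 addr0 addrA; congr (f _ + f _ + f _); exact: val_inj.
Qed.

Lemma E_eq z z' : z.1 = z'.1 -> (forall i, z.2 0 i = z'.2 0 i) -> z = z'.
Proof.
case: z z' => [t x] [t' x'] /= -> h; congr pair; apply/rowP; exact: h.
Qed.

Lemma ptE z : z = pt z.1 (z.2 0 0) (z.2 0 1) (z.2 0 2).
Proof. by apply: E_eq => //; apply: I3P; rewrite ?pt0 ?pt1 ?pt2. Qed.

(** Kronecker delta on space-time indices. It holds the coordinates of [dirv], so that shifts along
    all axes are computed in the same way. *)
Definition dco (o o' : option 'I_3) : R := (o == o')%:R.

Lemma dirv1 o : (dirv o).1 = dco o None.
Proof. by case: o. Qed.
Lemma dirv2 o i : (dirv o).2 0 i = dco o (Some i).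
Proof. by case: o => [j|]; rewrite /dirv /ebasis !mxE //= /dco/= eq_sym. Qed.

Lemma shift1 s o z : (s *: dirv o + z).1 = s * dco o None + z.1.
Proof. by rewrite /= -dirv1. Qed.
Lemma shift2 s o z i : (s *: dirv o + z).2 0 i = s * dco o (Some i) + z.2 0 i.
Proof. by rewrite !mxE -dirv2. Qed.

Lemma shift_near s o z d : `|s| < d -> near_pt d z (s *: dirv o + z).
Proof.
move=> sd; split=> [|i]; rewrite ?shift1 ?shift2 addrK normrM.
  by rewrite /dco normr_nat; case: eqP => _ /=; rewrite ?mulr1 ?mulr0 //; exact: le_lt_trans (normr_ge0 s) sd.
by rewrite /dco normr_nat; case: eqP => _ /=; rewrite ?mulr1 ?mulr0 //; exact: le_lt_trans (normr_ge0 s) sd.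
Qed.

Lemma dR_slice0 F z (v : E) : derivable F z v ->
  dR (fun s => F (s *: v + z)) 0 ('D_v F z).
Proof.
move=> h; apply: DeriveDef; first exact: (derivable1P F z v).1.
rewrite /derive; set g1 := fun h => h^-1 *: _; set g2 := fun h => h^-1 *: _.
suff -> : g1 = g2 by [].
by rewrite funeqE /g1 /g2 => s /=; rewrite addr0 scale0r add0r [_%:A]mulr1.
Qed.

Lemma dR_slice F z o s : derivable F (s *: dirv o + z) (dirv o) ->
  dR (fun s => F (s *: dirv o + z)) s (pd o F (s *: dirv o + z)).
Proof.
move=> h; have h1 := dR_slice0 h.
have h2 : dR (fun s' : R => s' - s) s 1 by dR_auto; ring.
have : dR (fun s' : R => F ((s' - s) *: dirv o + (s *: dirv o + z))) s ('D_(dirv o) F (s *: dirv o + z) * 1).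
  by apply: (dRcomp (f := fun s' => s' - s) (g := fun s' => F (s' *: dirv o + (s *: dirv o + z))) h2); rewrite subrr.
rewrite mulr1 => h3.
suff -> : (fun s0 => F (s0 *: dirv o + z)) = (fun s' : R => F ((s' - s) *: dirv o + (s *: dirv o + z))) by [].
by apply/funext => s'; rewrite addrA -scalerDl subrK.
Qed.

Lemma slice_derivable F z o d : dR (fun s => F (s *: dirv o + z)) 0 d ->
  derivable F z (dirv o) /\ pd o F z = d.
Proof.
move=> h; have h1 : derivable F z (dirv o) by apply/derivable1P; case: h.
by split => //; have := dR_slice0 h1 => h2; exact: dR_uniq h2 h.
Qed.

Fixpoint Cn (n : nat) (U : set E) (F : E -> R) : Prop :=
  (forall z, U z -> {for z, continuous F}) /\
  (if n is m.+1 then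
     (forall o z, U z -> derivable F z (dirv o)) /\ (forall o, Cn m U (pd o F))
   else True).

Definition smf (U : set E) (F : E -> R) : Prop := forall n, Cn n U F.

Lemma smf_pd U F o : smf U F -> smf U (pd o F).
Proof. by move=> h n; have [_ [_]] := h n.+1; apply. Qed.
Lemma smf_cont U F z : smf U F -> U z -> {for z, continuous F}.
Proof. by move=> h; have [+ _] := h 0%N; apply. Qed.
Lemma smf_der U F o z : smf U F -> U z -> derivable F z (dirv o).
Proof. by move=> h; have [_ [+ _]] := h 1%N; apply. Qed.

Lemma smf_slice U F z o s : smf U F -> U (s *: dirv o + z) ->
  dR (fun s => F (s *: dirv o + z)) s (pd o F (s *: dirv o + z)).
Proof. by move=> sF Uz; apply: dR_slice; exact: smf_der sF Uz. Qed.

Lemma smf_slice0 U F z o : smf U F -> U z -> dR (fun s => F (s *: dirv o + z)) 0 (pd o F z).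
Proof. by move=> sF Uz; apply: dR_slice0; exact: smf_der sF Uz. Qed.

Lemma open_near U z : open U -> U z -> exists2 d, 0 < d & forall z', near_pt d z z' -> U z'.
Proof. by move=> oU Uz; apply/nbhs_near_pt; exact: open_nbhs_nbhs. Qed.

Lemma pd_eq U F G o z : open U -> (forall z, U z -> F z = G z) -> U z -> pd o F z = pd o G z.
Proof.
move=> oU FG Uz; apply: near_eq_derive; apply/nbhs_near_pt.
by have [d d0 h] := open_near oU Uz; exists d => // z' /h; exact: FG.
Qed.

Lemma cont_eq U F G z : open U -> (forall z, U z -> F z = G z) -> U z ->
  {for z, continuous F} -> {for z, continuous G}.
Proof.
move=> oU FG Uz /cont_nearP h; apply/cont_nearP => e /h[d1 d10 h1].
have [d2 d20 h2] := open_near oU Uz.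
exists (Num.min d1 d2); first by rewrite lt_min d10.
have w d (z' : E) : Num.min d1 d2 <= d -> near_pt (Num.min d1 d2) z z' -> near_pt d z z'.
  by move=> le [n1 n2]; split=> [|i]; apply: lt_le_trans le.
move=> z' n; rewrite -!FG//; first by apply: h1; apply: w n; rewrite ge_min lexx.
by apply: h2; apply: w n; rewrite ge_min lexx orbT.
Qed.

Lemma Cn_eq n U F G : open U -> (forall z, U z -> F z = G z) -> Cn n U F -> Cn n U G.
Proof.
move=> oU; elim: n F G => [|n IH] F G FG [cF].
  by move=> _; split => // z Uz; apply: (cont_eq oU FG Uz); exact: cF.
move=> [dF CF]; split=> [z Uz|]; last (split=> [ o z Uz|o]).
- by apply: (cont_eq oU FG Uz); exact: cF.
- apply: near_eq_derivable (dF _ _ Uz); apply/nbhs_near_pt.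
  by have [d d0 h] := open_near oU Uz; exists d => // z' /h; exact: FG.
- by apply: IH (CF o) => z Uz; apply: (pd_eq _ oU FG).
Qed.

Lemma smf_eq U F G : open U -> (forall z, U z -> F z = G z) -> smf U F -> smf U G.
Proof. by move=> oU FG h n; exact: Cn_eq (h n). Qed.

Lemma smf_cst U k0 : smf U (fun=> k0).
Proof.
move=> n; elim: n k0 => [|n IH] k0.
  by split => // z _; exact: cvg_cst.
split=> [z _|]; first exact: cvg_cst.
split=> [ o z _|o]; first exact: derivable_cst.
have -> : pd o (fun=> k0) = fun=> 0 by apply/funext => z; exact: derive_cst.
exact: IH.
Qed.

Lemma pd_cst o k0 z : pd o (fun=> k0) z = 0.
Proof. exact: derive_cst. Qed.

Lemma pdD U F G o z : smf U F -> smf U G -> U z ->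
  pd o (fun z => F z + G z) z = pd o F z + pd o G z.
Proof. by move=> sF sG Uz; apply: deriveD; [exact: smf_der sF Uz|exact: smf_der sG Uz]. Qed.
Lemma pdM U F G o z : smf U F -> smf U G -> U z ->
  pd o (fun z => F z * G z) z = pd o F z * G z + F z * pd o G z.
Proof.
move=> sF sG Uz; have := deriveM (smf_der (o := o) sF Uz) (smf_der (o := o) sG Uz).
rewrite /GRing.scale/= /pd => h; rewrite [RHS]addrC [X in _ + X]mulrC; exact: h.
Qed.
Lemma pdZ U F k o z : smf U F -> U z ->
  pd o (fun z => k * F z) z = k * pd o F z.
Proof. by move=> sF Uz; have := deriveZ k (smf_der (o := o) sF Uz). Qed.
Lemma pdN U F o z : smf U F -> U z -> pd o (fun z => - F z) z = - pd o F z.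
Proof. by move=> sF Uz; have := deriveN (smf_der (o := o) sF Uz). Qed.
Lemma pdB U F G o z : smf U F -> smf U G -> U z ->
  pd o (fun z => F z - G z) z = pd o F z - pd o G z.
Proof. by move=> sF sG Uz; apply: deriveB; [exact: smf_der sF Uz|exact: smf_der sG Uz]. Qed.

Lemma smfD U F G : open U -> smf U F -> smf U G -> smf U (fun z => F z + G z).
Proof.
move=> oU sF sG n; elim: n F G sF sG => [|n IH] F G sF sG.
  by split => // z Uz; apply: cvgD; [exact: smf_cont sF _|exact: smf_cont sG _].
split=> [z Uz|]; first by apply: cvgD; [exact: smf_cont sF _|exact: smf_cont sG _].
split=> [ o z Uz|o]; first by apply: derivableD; [exact: smf_der sF _|exact: smf_der sG _].
apply: (@Cn_eq n U (fun z => pd o F z + pd o G z)) => // [z Uz|]; first by rewrite (pdD _ sF sG Uz).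
by apply: IH; exact: smf_pd.
Qed.

Lemma CnD n U F G : open U -> Cn n U F -> Cn n U G -> Cn n U (fun z => F z + G z).
Proof.
move=> oU; elim: n F G => [|n IH] F G [c1 h1] [c2 h2].
  by split => // z Uz; apply: cvgD; [exact: c1|exact: c2].
case: h1 => d1 h1; case: h2 => d2 h2.
split=> [z Uz|]; first by apply: cvgD; [exact: c1|exact: c2].
split=> [ o z Uz|o]; first by apply: derivableD; [exact: d1|exact: d2].
apply: (@Cn_eq n U (fun z => pd o F z + pd o G z)) => // [z Uz|].
  by symmetry; apply: deriveD; [exact: d1|exact: d2].
by apply: IH; [exact: h1|exact: h2].
Qed.

Lemma smfM U F G : open U -> smf U F -> smf U G -> smf U (fun z => F z * G z).
Proof.
move=> oU sF sG n; elim: n F G sF sG => [|n IH] F G sF sG.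
  by split => // z Uz; apply: cvgM; [exact: smf_cont sF _|exact: smf_cont sG _].
split=> [z Uz|]; first by apply: cvgM; [exact: smf_cont sF _|exact: smf_cont sG _].
split=> [ o z Uz|o]; first by apply: derivableM; [exact: smf_der sF _|exact: smf_der sG _].
apply: (@Cn_eq n U (fun z => pd o F z * G z + F z * pd o G z)) => // [z Uz|].
  by rewrite (pdM _ sF sG Uz).
by apply: CnD => //; apply: IH => //; exact: smf_pd.
Qed.

Lemma smfZ U F k : open U -> smf U F -> smf U (fun z => k * F z).
Proof. by move=> oU sF; apply: smfM => //; exact: smf_cst. Qed.
Lemma smfN U F : open U -> smf U F -> smf U (fun z => - F z).
Proof.
move=> oU sF; apply: (@smf_eq U (fun z => -1 * F z)) => // [z _|]; first by rewrite mulN1r.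
exact: smfZ.
Qed.
Lemma smfB U F G : open U -> smf U F -> smf U G -> smf U (fun z => F z - G z).
Proof. by move=> oU sF sG; apply: smfD => //; exact: smfN. Qed.

Lemma smf_sum U (I : Type) (r : seq I) (F : I -> E -> R) : open U ->
  (forall i, smf U (F i)) -> smf U (fun z => \sum_(i <- r) F i z).
Proof.
move=> oU sF; elim: r => [|i r IH].
  by apply: (@smf_eq U (fun=> 0)) => // [z _|]; [rewrite big_nil|exact: smf_cst].
apply: (@smf_eq U (fun z => F i z + \sum_(j <- r) F j z)) => // [z _|].
  by rewrite big_cons.
exact: smfD.
Qed.
Lemma pd_sum U (I : Type) (r : seq I) (F : I -> E -> R) o z : open U ->
  (forall i, smf U (F i)) -> U z ->
  pd o (fun z => \sum_(i <- r) F i z) z = \sum_(i <- r) pd o (F i) z.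
Proof.
move=> oU sF Uz; elim: r => [|i r IH].
  by rewrite big_nil -[RHS](pd_cst o 0 z); apply: (@pd_eq U) => // z' _; rewrite big_nil.
rewrite big_cons -IH -(pdD _ (sF i) (smf_sum r oU sF))//.
by apply: (@pd_eq U) => // z' _; rewrite big_cons.
Qed.

(** The mean value theorem in the direction [o], applied to the increment in the direction [o'], and
    then once more in the direction [o']. *)
Lemma second_difference U F z o o' h : smf U F -> 0 < h ->
  (forall s s', 0 <= s <= h -> 0 <= s' <= h -> U (s' *: dirv o' + (s *: dirv o + z))) ->
  exists s s', [/\ 0 < s < h, 0 < s' < h &
    F (h *: dirv o' + (h *: dirv o + z)) - F (h *: dirv o + z) - F (h *: dirv o' + z) + F z
    = h ^+ 2 * pd o' (pd o F) (s' *: dirv o' + (s *: dirv o + z))].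
Proof.
move=> sF h0 hU.
have hh : 0 <= h <= h by rewrite lexx ltW.
have h00 : 0 <= (0:R) <= h by rewrite lexx ltW.
have sw s s' : s' *: dirv o' + (s *: dirv o + z) = s *: dirv o + (s' *: dirv o' + z).
  by rewrite addrCA.
have e0 s : 0 *: dirv o' + (s *: dirv o + z) = s *: dirv o + z by rewrite scale0r add0r.
have [|s /andP[s0 sh]] := @dR_MVT _ (fun s => F (s *: dirv o + (h *: dirv o' + z)) - F (s *: dirv o + z))
    (fun s => pd o F (s *: dirv o + (h *: dirv o' + z)) - pd o F (s *: dirv o + z)) 0 h h0.
  move=> s sh; apply: dRD; last apply: dRN; apply: smf_slice sF _.
    by rewrite -sw; exact: hU.
  by rewrite -e0; exact: hU.
rewrite subr0 !scale0r !add0r => h1.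
have [|s' /andP[s'0 s'h]] := @dR_MVT _ (fun s' => pd o F (s' *: dirv o' + (s *: dirv o + z)))
    (fun s' => pd o' (pd o F) (s' *: dirv o' + (s *: dirv o + z))) 0 h h0.
  move=> s' sh'; apply: smf_slice (smf_pd o sF) _; apply: hU => //.
  by rewrite !ltW.
rewrite subr0 !scale0r !add0r => h2.
exists s, s'; split; [exact/andP|exact/andP|].
move: h1; rewrite -!sw h2 => h1.
by rewrite expr2 [RHS]mulrC mulrA -h1; ring.
Qed.

(** The second difference divided by [h ^+ 2] is symmetric in the two directions, and by continuity
    it tends to each of the two mixed derivatives. *)
Lemma pdC U F o o' z : open U -> smf U F -> U z ->
  pd o' (pd o F) z = pd o (pd o' F) z.
Proof.
move=> oU sF Uz.
have key (o1 o2 : option 'I_3) (e : R) : 0 < e -> exists2 d, 0 < d & forall h, 0 < h < d ->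
    `|(F (h *: dirv o1 + (h *: dirv o2 + z)) - F (h *: dirv o1 + z) - F (h *: dirv o2 + z) + F z) / h ^+ 2
      - pd o2 (pd o1 F) z| < e.
  move=> e0.
  have /cont_nearP/(_ _ e0)[d1 d10 h1] := smf_cont (smf_pd o2 (smf_pd o1 sF)) Uz.
  have [d2 d20 h2] := open_near oU Uz.
  exists (Num.min d1 d2 / 2); first by rewrite divr_gt0// lt_min d10.
  have nn h s s' : 0 < h < Num.min d1 d2 / 2 -> 0 <= s <= h -> 0 <= s' <= h ->
      near_pt d1 z (s' *: dirv o2 + (s *: dirv o1 + z)) /\ near_pt d2 z (s' *: dirv o2 + (s *: dirv o1 + z)).
    rewrite ltr_pdivlMr// lt_min => /and3P[hh0 hd1 hd2] /andP[s0 sh] /andP[s'0 s'h].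
    have w : forall d : R, h * 2 < d -> near_pt d z (s' *: dirv o2 + (s *: dirv o1 + z)).
      move=> d hd; split=> [|i]; rewrite ?shift1 ?shift2 addrA addrK.
        by rewrite /dco; case: eqP; case: eqP => _ _; rewrite ?mulr1 ?mulr0 ger0_norm; lra.
      by rewrite /dco; case: eqP; case: eqP => _ _; rewrite ?mulr1 ?mulr0 ger0_norm; lra.
    by split; exact: w.
  move=> h hh; have [h0 _] := andP hh.
  have [|s [s' [hs hs' e1]]] := @second_difference U F z o1 o2 h sF h0.
    by move=> s s' hs hs'; apply: h2; have [] := nn h s s' hh hs hs'.
  have -> : F (h *: dirv o1 + (h *: dirv o2 + z)) - F (h *: dirv o1 + z) - F (h *: dirv o2 + z) + F z =
    h ^+ 2 * pd o2 (pd o1 F) (s' *: dirv o2 + (s *: dirv o1 + z)).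
    by rewrite -e1 [h *: dirv o1 + (_ + _)]addrCA.
  rewrite mulrAC divff ?mul1r; last by rewrite expf_neq0// gt_eqF.
  case/andP: hs => ? ?; case/andP: hs' => ? ?.
  by apply: h1; have [] := nn h s s' hh; rewrite ?ltW.
apply/eqP; rewrite -subr_eq0 -normr_eq0; apply/eqP.
apply: le_anti; rewrite normr_ge0 andbT; apply/ler_addgt0Pl => e e0; rewrite addr0.
have e20 : 0 < e / 2 by lra.
have [d1 d10 h1] := key o o' _ e20.
have [d2 d20 h2] := key o' o _ e20.
pose h := Num.min d1 d2 / 2.
have hh : 0 < h /\ h < d1 /\ h < d2.
  by rewrite /h; case: (leP d1 d2) => ?; lra.
case: hh => hh0 [hh1 hh2].
have := h1 h; rewrite hh0 hh1 => /(_ isT) {}h1.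
have := h2 h; rewrite hh0 hh2 => /(_ isT); rewrite [h *: dirv o' + (_ + _)]addrCA => {}h2.
set A := _ / _ in h1 h2.
have eA : A = (F (h *: dirv o + (h *: dirv o' + z)) - F (h *: dirv o' + z) - F (h *: dirv o + z) + F z) / h ^+ 2.
  by rewrite /A; congr (_ / _); ring.
rewrite -eA in h2; clear eA.
clearbody A; move: h1 h2; move: A (pd o' _ _) (pd o _ _) => A P Q h1 h2.
have := ler_distD A P Q; rewrite [`|P - A|]distrC; lra.
Qed.

(* Diagonal affine maps cover the scalings, translations, reflections and the
   freezing of a variable. *)
Definition aff (c : E) (l : option 'I_3 -> R) (z : E) : E :=
  (c.1 + l None * z.1, \row_i (c.2 0 i + l (Some i) * z.2 0 i)).

Lemma aff_shift c l s o z : aff c l (s *: dirv o + z) = (s * l o) *: dirv o + aff c l z.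
Proof.
have a1 z' : (aff c l z').1 = c.1 + l None * z'.1 by [].
have a2 z' i : (aff c l z').2 0 i = c.2 0 i + l (Some i) * z'.2 0 i by rewrite mxE.
apply: E_eq => [|i]; first rewrite a1 !shift1 a1.
  by rewrite /dco; case: eqP => [->|_] /=; ring.
by rewrite a2 !shift2 a2 /dco; case: eqP => [->|_] /=; ring.
Qed.

Lemma pd_aff F c l o z : derivable F (aff c l z) (dirv o) ->
  derivable (F \o aff c l) z (dirv o) /\ pd o (F \o aff c l) z = l o * pd o F (aff c l z).
Proof.
move=> h; apply: slice_derivable.
have h2 : dR (fun s : R => s * l o) 0 (l o) by dR_auto; ring.
have h1 := dR_slice0 h; rewrite -[0](mul0r (l o)) in h1.
have := dRcomp h2 h1; rewrite mulrC.
suff -> : (fun s => (F \o aff c l) (s *: dirv o + z)) = (fun s => F ((s * l o) *: dirv o + aff c l z)) by [].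
by apply/funext => s /=; rewrite aff_shift.
Qed.

Lemma aff_cont F c l z : {for aff c l z, continuous F} -> {for z, continuous (F \o aff c l)}.
Proof.
move=> /cont_nearP h; apply/cont_nearP => e /h[d d0 hd].
pose L := 1 + `|l None| + \sum_(i < 3) `|l (Some i)|.
have L1 o : `|l o| < L.
  case: o => [i|]; rewrite /L; last first.
    by have : 0 <= \sum_(i < 3) `|l (Some i)|; [exact: sumr_ge0|lra].
  have : `|l (Some i)| <= \sum_(i < 3) `|l (Some i)|.
    by rewrite (bigD1 i)//= lerDl sumr_ge0.
  by have := normr_ge0 (l None); lra.
have L0 : 0 < L by apply: le_lt_trans (L1 None).
have wk (o : option 'I_3) x y : `|x - y| < d / L -> `|l o * x - l o * y| < d.
  rewrite -mulrBr normrM ltr_pdivlMr// mulrC => hxy; apply: le_lt_trans hxy.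
  by rewrite ler_wpM2r// ltW.
exists (d / L); first exact: divr_gt0.
move=> z' [h1 h2]; apply: hd; split => [|i] /=; rewrite ?mxE opprD addrACA subrr add0r.
  exact: wk.
exact: wk.
Qed.

Lemma smf_aff U V F c l : (forall z, V z -> U (aff c l z)) -> open V ->
  smf U F -> smf V (F \o aff c l).
Proof.
move=> VU oV sF n; elim: n F sF => [|n IH] F sF.
  by split => // z Vz; apply: aff_cont; apply: smf_cont sF _; exact: VU.
split=> [z Vz|]; first by apply: aff_cont; apply: smf_cont sF _; exact: VU.
split=> [ o z Vz|o].
  by have [] := @pd_aff F c l o z; first exact: (smf_der sF (VU _ Vz)).
apply: (@Cn_eq n V (fun z => l o * (pd o F \o aff c l) z)) => // [z Vz|].
  by have [_ ->] := @pd_aff F c l o z (smf_der sF (VU _ Vz)).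
have CnZ G k : Cn n V G -> Cn n V (fun z => k * G z).
  elim: (n) G => [|m IHm] G [cG hG].
    by split => // z Vz; apply: cvgM; [exact: cvg_cst|exact: cG].
  case: hG => dG hG.
  split=> [z Vz|]; first by apply: cvgM; [exact: cvg_cst|exact: cG].
  split=> [ o' z Vz|o']; first by apply: derivableZ; exact: dG.
  apply: (@Cn_eq m V (fun z => k * pd o' G z)) => // [z Vz|].
    by rewrite /pd; symmetry; apply: deriveZ; exact: dG.
  by apply: IHm; exact: hG.
by apply: CnZ; apply: IH; exact: smf_pd.
Qed.

Definition slab (a b : R) : set E := [set z : E | a < z.1 < b].

Lemma slab_open a b : open (slab a b).
Proof.
rewrite openE => z /= /andP[az zb]; apply/nbhs_near_pt.
exists (Num.min (z.1 - a) (b - z.1)); first by rewrite lt_min !subr_gt0 az zb.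
move=> z' [+ _]; rewrite lt_min !ltr_norml /slab/= => /andP[/andP[? ?] /andP[? ?]].
by apply/andP; lra.
Qed.

Lemma slab_shift a b i s z : slab a b (s *: dirv (Some i) + z) <-> slab a b z.
Proof. by rewrite /slab /mkset shift1 /dco /= mulr0 add0r. Qed.

(** Backward parabolic cylinder with [z] in the centre of its top. The section is a cube, which
    suits reflections and coordinatewise distances. *)
Definition cyQ (z : E) (r : R) : set E :=
  [set z' : E | z.1 - r ^+ 2 <= z'.1 <= z.1 /\ forall i, `|z'.2 0 i - z.2 0 i| <= r].

Lemma box_compact (a b : R) (lo hi : 'I_3 -> R) :
  compact [set z : E | a <= z.1 <= b /\ forall i, lo i <= z.2 0 i <= hi i].
Proof.
have h1 := @rV_compact R 3 (fun i => `[lo i, hi i]%classic) (fun i => @segment_compact R (lo i) (hi i)).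
have h2 : compact (`[a, b]%classic : set R) by exact: segment_compact.
have := compact_setX h2 h1; congr compact.
Qed.

Lemma cyQ_compact z r : compact (cyQ z r).
Proof.
have := @box_compact (z.1 - r ^+ 2) z.1 (fun i => z.2 0 i - r) (fun i => z.2 0 i + r).
congr compact; apply/seteqP; split => z' /= [h1 h2]; split => // i; have := h2 i.
  by rewrite ler_distl.
by rewrite ler_distl.
Qed.

Lemma compact_max (K : set E) F : K !=set0 -> compact K ->
  (forall z, K z -> {for z, continuous F}) ->
  exists2 z, K z & forall z', K z' -> F z' <= F z.
Proof.
move=> K0 cK cF; have [|z zK h] := @compact_EVT_max E R F K K0 cK.
  apply: continuous_in_subspaceT => z; rewrite inE; exact: cF.
by exists z; [rewrite -inE|move=> z' /mem_set; exact: h].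
Qed.

End SpaceTime.

Ltac cE_step := match goal with
  | |- cE (fun z => ?c) _ => exact: cE_cst
  | |- cE (fun z => @?f z + @?g z) ?y => refine (@cE_D _ f g y _ _)
  | |- cE (fun z => - @?f z) ?y => refine (@cE_N _ f y _)
  | |- cE (fun z => @?f z * @?g z) ?y => refine (@cE_M _ f g y _ _)
  | |- cE (fun z => @?f z ^+ ?n) ?y => refine (@cE_X _ f y n _)
  | |- _ => first [assumption | exact: cE_snd | exact: cE_fst]
  end.
Ltac cE_auto := repeat cE_step.
Global Opaque pd smf.

(** * Interior gradient bound for the heat equation *)

Section HeatGradient.
Context {R : realType}.
Local Notation E := (R * 'rV[R]_3)%type.
Implicit Types (w : E -> R) (z : E) (i j k : 'I_3).

Definition lap w z : R := \sum_(k < 3) pd (Some k) (pd (Some k) w) z.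

Lemma dR_le (g : R -> R) (B d e : R) : 0 < e -> dR g 0 d -> g 0 = 0 ->
  (forall s, 0 <= s < e -> g s <= B * s) -> d <= B.
Proof.
move=> e0 dg g0 h; rewrite -subr_ge0.
(* Reversing [s] turns the comparison on the right of 0 into a maximum from the left. *)
pose f s := g (- s) + B * s.
apply: (@dR_max_left _ f (B - d) e e0).
  have h1 : dR (fun s : R => - s) 0 (-1) by dR_auto.
  have h2 : dR g (- 0) d by rewrite oppr0.
  have h3 := dRcomp h1 h2.
  by rewrite /f; dR_auto; ring.
move=> s /andP[s1 s2]; rewrite /f oppr0 g0 mulr0 addr0.
have := h (- s); rewrite mulrN; have -> : 0 <= - s < e by lra.
by move=> /(_ isT); lra.
Qed.

(** Reflection in the plane through [z] orthogonal to the i-th axis, written as a diagonal affine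
    map so that the facts on [aff] apply. *)
Definition reflect_co i z : E -> E :=
  aff (0, \row_j (if j == i then 2 * z.2 0 i else 0)) (fun o => if o == Some i then -1 else 1).

Lemma reflect_co1 i z z' : (reflect_co i z z').1 = z'.1.
Proof. by rewrite /= add0r mul1r. Qed.
Lemma reflect_co2 i z z' j :
  (reflect_co i z z').2 0 j = if j == i then 2 * z.2 0 i - z'.2 0 i else z'.2 0 j.
Proof.
rewrite !mxE; have -> : (Some j == Some i) = (j == i) by [].
by case: eqP => [->|_]; rewrite ?mulN1r// add0r mul1r.
Qed.

Lemma dco_diag i j : @dco R (Some i) (Some j) = (i == j)%:R.
Proof. by []. Qed.
Lemma dcoNS i : @dco R None (Some i) = 0. Proof. by []. Qed.
Lemma dcoSN i : @dco R (Some i) None = 0. Proof. by []. Qed.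
Lemma dcoNN : @dco R None None = 1. Proof. by []. Qed.

(** The contradiction at an interior maximum of the difference minus twice the barrier. The second
    derivatives add up to at most [- 4 * q - 2 * F] and the time derivative is at least [- 2 * q],
    so the heat operator is at least [2 * q + 2 * F], whereas the equations at the point and at its
    mirror image allow only [2 * F]. *)
Lemma barrier_arith (q F A1 A2 A3 A4 A5 A6 A7 A8 e0 e1 e2 : R) : 0 < q ->
  e0 + e1 + e2 = 1 -> 0 <= A1 - A2 + 2 * q ->
  A3 - A4 <= 2 * (q * (2 - 8 * e0) - F * e0) ->
  A5 - A6 <= 2 * (q * (2 - 8 * e1) - F * e1) ->
  A7 - A8 <= 2 * (q * (2 - 8 * e2) - F * e2) ->
  A1 - (A3 + A5 + A7) <= F -> - (A2 - (A4 + A6 + A8)) <= F -> False.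
Proof.
move=> q0 e012 h1 h2 h3 h4 h5 h6.
have e : e0 = 1 - e1 - e2 by lra.
by rewrite e in h2; nra.
Qed.

(* Half the difference of [w] and its reflection in the i-th variable vanishes on
   the plane of reflection, and is compared with the barrier [psi]. *)
Section Barrier.
Variables (a b : R) (w : E -> R) (i : 'I_3) (z : E) (r W F : R).
Hypotheses (sw : smf (slab a b) w) (az : a < z.1 - r ^+ 2) (zb : z.1 < b)
  (r0 : 0 < r) (W0 : 0 < W) (F0 : 0 <= F).
Hypothesis wW : forall z', cyQ z r z' -> `|w z'| <= W.
Hypothesis wF : forall z', cyQ z r z' -> `|pd None w z' - lap w z'| <= F.

Let q := W / r ^+ 2.
Let bar (y0 y1 y2 tau s : R) : R :=
  q * (y0 ^+ 2 + y1 ^+ 2 + y2 ^+ 2 + tau + 4 * (s * (r - s))) + F / 2 * (s * (r - s)).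
Let psi (z' : E) : R :=
  bar (z'.2 0 0 - z.2 0 0) (z'.2 0 1 - z.2 0 1) (z'.2 0 2 - z.2 0 2) (z.1 - z'.1)
      (z'.2 0 i - z.2 0 i).
Let rf := reflect_co i z.
Let h (z' : E) := w z' - w (rf z') - 2 * psi z'.
Let K : set E := [set z' | cyQ z r z' /\ 0 <= z'.2 0 i - z.2 0 i].

Let q0 : 0 < q. Proof. by rewrite divr_gt0// exprn_gt0. Qed.
Let qr : q * r ^+ 2 = W. Proof. by rewrite divfK// gt_eqF// exprn_gt0. Qed.

Let slabQ z' : cyQ z r z' -> slab a b z'.
Proof. by move=> [/andP[h1 h2] _]; apply/andP; split; [exact: lt_le_trans h1|exact: le_lt_trans h2 _]. Qed.

Let rfQ z' : cyQ z r z' -> cyQ z r (rf z').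
Proof.
move=> [h1 h2]; split=> [|j]; first by rewrite reflect_co1.
rewrite reflect_co2; case: eqP => [->|_]; last exact: h2.
by rewrite (_ : _ - _ = - (z'.2 0 i - z.2 0 i)) ?normrN//; ring.
Qed.

Let rf_shift s j z' : rf (s *: dirv (Some j) + z') =
  (s * (if j == i then -1 else 1)) *: dirv (Some j) + rf z'.
Proof. by rewrite /rf /reflect_co aff_shift; congr (_ *: _ + _); congr (_ * _); case: ifP. Qed.

Let rf_shiftN s z' : rf (s *: dirv None + z') = s *: dirv None + rf z'.
Proof. by rewrite /rf /reflect_co aff_shift /= mulr1. Qed.

Let d2psi j z' : exists dpsi : R -> R,
  (forall s, dR (fun s => psi (s *: dirv (Some j) + z')) s (dpsi s)) /\
  dR dpsi 0 (q * (2 - 8 * (j == i)%:R) - F * (j == i)%:R).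
Proof.
rewrite /psi; set y0 := z.2 0 0; set y1 := z.2 0 1; set y2 := z.2 0 2; set yi := z.2 0 i.
set D := fun k => @dco R (Some j) (Some k).
pose c0 := z'.2 0 0 - y0; pose c1 := z'.2 0 1 - y1; pose c2 := z'.2 0 2 - y2; pose ci := z'.2 0 i - yi.
pose d0 := D 0; pose d1 := D 1; pose d2 := D 2; pose di := D i.
have E1 : (fun s => bar ((s *: dirv (Some j) + z').2 0 0 - y0) ((s *: dirv (Some j) + z').2 0 1 - y1)
   ((s *: dirv (Some j) + z').2 0 2 - y2) (z.1 - (s *: dirv (Some j) + z').1) ((s *: dirv (Some j) + z').2 0 i - yi))
  = (fun s => bar (s * d0 + c0) (s * d1 + c1) (s * d2 + c2) (z.1 - z'.1) (s * di + ci)).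
  by apply/funext => s; rewrite !shift2 shift1 dcoSN mulr0 add0r -!addrA.
rewrite E1 /bar.
exists (fun s => q * (2 * (s * d0 + c0) * d0 + 2 * (s * d1 + c1) * d1 + 2 * (s * d2 + c2) * d2
   + 4 * (di * (r - (s * di + ci)) - (s * di + ci) * di)) + F / 2 * (di * (r - (s * di + ci)) - (s * di + ci) * di)).
split=> [s|].
  by move: (z.1 - z'.1) => tau; clearbody c0 c1 c2 ci d0 d1 d2 di q; dR_auto; ring.
have -> : q * (2 - 8 * (j == i)%:R) - F * (j == i)%:R =
   q * (2 * (d0 ^+ 2 + d1 ^+ 2 + d2 ^+ 2) - 8 * di ^+ 2) - F * di ^+ 2.
  have -> : d0 ^+ 2 + d1 ^+ 2 + d2 ^+ 2 = 1.
    by rewrite /d0 /d1 /d2 /D !dco_diag; move: j {D d0 d1 d2 di E1}; apply: I3P => /=; ring.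
  have -> : di ^+ 2 = (j == i)%:R :> R by rewrite /di /D dco_diag; case: eqP; rewrite ?expr1n ?expr0n.
  by ring.
by clearbody c0 c1 c2 ci d0 d1 d2 di q; dR_auto; field.
Qed.

Let psi_cont z' : {for z', continuous psi}.
Proof.
by change (cE (fun z' => bar (z'.2 0 0 - z.2 0 0) (z'.2 0 1 - z.2 0 1) (z'.2 0 2 - z.2 0 2) (z.1 - z'.1)
      (z'.2 0 i - z.2 0 i)) z'); rewrite /bar; cE_auto.
Qed.

(** A positive maximum cannot lie on the plane of reflection, where the difference vanishes, nor on
    the lateral or initial faces, where [psi >= W]; at the remaining points [barrier_arith]
    applies. *)
Let h_le0 z' : K z' -> h z' <= 0.
Proof.
have cK : compact K.
  have := @box_compact R (z.1 - r ^+ 2) z.1 (fun j => if j == i then z.2 0 j else z.2 0 j - r)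
    (fun j => z.2 0 j + r).
  congr compact; apply/seteqP; split => [y /= [h1 h2]|y /= [[h1 h2] h3]].
    split; first split => // j.
      by have := h2 j; rewrite ler_distl; case: eqP => [->|_]//; have := r0; lra.
    by have := h2 i; rewrite eqxx; lra.
  split => // j; have := h2 j; rewrite ler_distl; case: eqP => [->|_]//.
  by move=> /andP[_ ->]; rewrite andbT; lra.
have Kz : K z.
  split; last by rewrite subrr.
  split=> [|j]; last by rewrite subrr normr0 ltW.
  by rewrite lexx andbT gerBl sqr_ge0.
have ch y : K y -> {for y, continuous h}.
  move=> [Ky _]; apply: cvgB; last by apply: cvgM; [exact: cvg_cst|exact: psi_cont].
  apply: cvgB; first exact: (smf_cont sw (slabQ Ky)).
  by apply: aff_cont; exact: (smf_cont sw (slabQ (rfQ Ky))).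
have [y Ky ymax] := compact_max (ex_intro _ z Kz) cK ch.
move=> Kz'; apply: le_trans (ymax _ Kz') _; rewrite leNgt; apply/negP => hy.
have [[Qt Qx] s0] := Ky.
have Q : cyQ z r y by [].
pose s := y.2 0 i - z.2 0 i.
have sr : s <= r by have := Qx i; rewrite ler_norml => /andP[].
have tau0 : 0 <= z.1 - y.1 by lra.
have ss0 : 0 <= s * (r - s) by apply: mulr_ge0 => //; lra.
have wle : w y - w (rf y) <= 2 * W.
  have := wW Q; have := wW (rfQ Q); rewrite !ler_norml; lra.
have psilt : psi y < W.
  by move: hy; rewrite /h; have := wle; lra.
have psi_ge (X : R) : X <= (y.2 0 0 - z.2 0 0) ^+ 2 + (y.2 0 1 - z.2 0 1) ^+ 2 + (y.2 0 2 - z.2 0 2) ^+ 2 + (z.1 - y.1) ->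
    q * X <= psi y.
  move=> hX; rewrite /psi /bar -/s.
  apply: le_trans (_ : q * ((y.2 0 0 - z.2 0 0) ^+ 2 + (y.2 0 1 - z.2 0 1) ^+ 2 + (y.2 0 2 - z.2 0 2) ^+ 2 + (z.1 - y.1)) <= _).
    by rewrite ler_wpM2l// ltW.
  have p1 : 0 <= q * (4 * (s * (r - s))) by rewrite mulr_ge0 ?(ltW q0)// mulr_ge0.
  have p2 : 0 <= F / 2 * (s * (r - s)) by rewrite mulr_ge0// divr_ge0.
  by rewrite [leRHS](_ : _ = q * (4 * (s * (r - s))) + F / 2 * (s * (r - s)) + q * ((y.2 0 0 - z.2 0 0) ^+ 2 + (y.2 0 1 - z.2 0 1) ^+ 2 + (y.2 0 2 - z.2 0 2) ^+ 2 + (z.1 - y.1))) ?lerDr ?addr_ge0//; ring.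
have sq j : (y.2 0 j - z.2 0 j) ^+ 2 <= (y.2 0 0 - z.2 0 0) ^+ 2 + (y.2 0 1 - z.2 0 1) ^+ 2 + (y.2 0 2 - z.2 0 2) ^+ 2.
  have := sqr_ge0 (y.2 0 0 - z.2 0 0); have := sqr_ge0 (y.2 0 1 - z.2 0 1); have := sqr_ge0 (y.2 0 2 - z.2 0 2).
  by move: j; apply: I3P; lra.
have xlt j : `|y.2 0 j - z.2 0 j| < r.
  rewrite lt_neqAle Qx andbT; apply/eqP => e.
  have : q * r ^+ 2 <= psi y by apply: psi_ge; have := sq j; rewrite -real_normK ?num_real// e; lra.
  by rewrite qr; lra.
have tlt : z.1 - r ^+ 2 < y.1.
  rewrite ltNge; apply/negP => e.
  have : q * r ^+ 2 <= psi y.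
    apply: psi_ge.
    have := sqr_ge0 (y.2 0 0 - z.2 0 0); have := sqr_ge0 (y.2 0 1 - z.2 0 1); have := sqr_ge0 (y.2 0 2 - z.2 0 2).
    lra.
  by rewrite qr; lra.
have spos : 0 < s.
  rewrite lt_neqAle s0 andbT eq_sym; apply/eqP => e.
  have rfy : rf y = y.
    apply: E_eq; first by rewrite reflect_co1.
    by move=> j; rewrite reflect_co2; case: eqP => [->|//]; move: e; rewrite /s; lra.
  have : 0 <= psi y.
    rewrite -(mulr0 q); apply: psi_ge.
    have := sqr_ge0 (y.2 0 0 - z.2 0 0); have := sqr_ge0 (y.2 0 1 - z.2 0 1); have := sqr_ge0 (y.2 0 2 - z.2 0 2).
    lra.
  by move: hy; rewrite /h rfy; lra.
have ht : 0 <= pd None w y - pd None w (rf y) + 2 * q.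
  have e0 : 0 < y.1 - (z.1 - r ^+ 2) by lra.
  apply: (@dR_max_left _ (fun s => h (s *: dirv None + y)) _ _ e0).
    have E2 : (fun s => h (s *: dirv None + y)) =
        (fun s => w (s *: dirv None + y) - w (s *: dirv None + rf y) - 2 * (psi y - q * s)).
      apply/funext => s1; rewrite /h rf_shiftN; congr (_ - 2 * _).
      rewrite /psi !shift2 shift1 !dcoNS dcoNN !mulr0 !add0r /bar; ring.
    rewrite E2.
    have h1 := smf_slice0 None sw (slabQ Q); have h2 := smf_slice0 None sw (slabQ (rfQ Q)).
    by dR_auto; ring.
  move=> s1 /andP[s11 s12]; rewrite scale0r add0r; apply: ymax.
  have tE : (s1 *: dirv None + y).1 = s1 + y.1 by rewrite shift1 dcoNN mulr1.
  have xE j : (s1 *: dirv None + y).2 0 j = y.2 0 j by rewrite shift2 dcoNS mulr0 add0r.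
  split; last by rewrite xE.
  by split=> [|j]; rewrite ?tE ?xE//; lra.
have hx j : pd (Some j) (pd (Some j) w) y - pd (Some j) (pd (Some j) w) (rf y)
    <= 2 * (q * (2 - 8 * (j == i)%:R) - F * (j == i)%:R).
  have [dpsi [hd1 hd2]] := d2psi j y.
  pose e := Num.min (r - `|y.2 0 j - z.2 0 j|) s.
  have e0 : 0 < e by rewrite lt_min spos subr_gt0 xlt.
  pose l : R := if j == i then -1 else 1.
  have l2 : l * l = 1 by rewrite /l; case: ifP => _; ring.
  have E2 : (fun s => h (s *: dirv (Some j) + y)) =
        (fun s => w (s *: dirv (Some j) + y) - w ((s * l) *: dirv (Some j) + rf y) - 2 * (psi (s *: dirv (Some j) + y))).
    by apply/funext => s1; rewrite /h rf_shift.
  pose dh s := pd (Some j) w (s *: dirv (Some j) + y) - l * pd (Some j) w ((s * l) *: dirv (Some j) + rf y) - 2 * dpsi s.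
  have dl s1 : dR (fun s : R => s * l) s1 l by clearbody l; dR_auto; ring.
  have [| | |_ hc] := @dR_max2 R (fun s => h (s *: dirv (Some j) + y)) dh
    (pd (Some j) (pd (Some j) w) y - pd (Some j) (pd (Some j) w) (rf y) - 2 * (q * (2 - 8 * (j == i)%:R) - F * (j == i)%:R)) e e0.
  - move=> s1 _; rewrite E2 /dh.
    have h1 : dR (fun s => w (s *: dirv (Some j) + y)) s1 (pd (Some j) w (s1 *: dirv (Some j) + y)).
      by apply: smf_slice sw _; apply/slab_shift; exact: slabQ.
    have h2 : dR (fun s => w ((s * l) *: dirv (Some j) + rf y)) s1 (pd (Some j) w ((s1 * l) *: dirv (Some j) + rf y) * l).
      apply: (dRcomp (f := fun s => s * l) (g := fun s => w (s *: dirv (Some j) + rf y))) => //.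
      by apply: smf_slice sw _; apply/slab_shift; apply: slabQ; exact: rfQ.
    by have h3 := hd1 s1; apply: dRe; [repeat dR_step|]; cbv beta; rewrite [_ * l]mulrC; ring.
  - rewrite /dh.
    have h1 := smf_slice0 (Some j) (smf_pd (Some j) sw) (slabQ Q).
    have h2 : dR (fun s => pd (Some j) w ((s * l) *: dirv (Some j) + rf y)) 0 (pd (Some j) (pd (Some j) w) (rf y) * l).
      apply: (dRcomp (f := fun s => s * l) (g := fun s => pd (Some j) w (s *: dirv (Some j) + rf y)) (dl 0)).
      rewrite mul0r.
      exact: smf_slice0 (smf_pd (Some j) sw) (slabQ (rfQ Q)).
    apply: dRe; first by repeat dR_step.
    cbv beta; move: (pd (Some j) (pd (Some j) w) (rf y)) (pd (Some j) (pd (Some j) w) y) => A B.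
    by rewrite mul0r add0r mul0r add0r [A * l]mulrC mulrA l2 mul1r.
  - move=> s1 s1e; rewrite scale0r add0r; apply: ymax.
    move: s1e; rewrite lt_min => /andP[s11 s12].
    have tE : (s1 *: dirv (Some j) + y).1 = y.1 by rewrite shift1 dcoSN mulr0 add0r.
    have xE k : (s1 *: dirv (Some j) + y).2 0 k = s1 * (j == k)%:R + y.2 0 k by rewrite shift2 dco_diag.
    split; last first.
      rewrite xE; case: eqP => _; rewrite ?mulr1 ?mulr0 ?add0r//.
      by move: s12 s0; rewrite -/s ltr_norml /s => /andP[? ?] ?; lra.
    split=> [|k]; first by rewrite tE.
    rewrite xE; case: eqP => [<-|_]; rewrite ?mulr1 ?mulr0 ?add0r//.
    by rewrite -addrA; apply: le_trans (ler_normD _ _) _; lra.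
  - by rewrite subr_le0 in hc.
have lapE y' : lap w y' = pd (Some 0) (pd (Some 0) w) y' + pd (Some 1) (pd (Some 1) w) y'
    + pd (Some 2) (pd (Some 2) w) y' by exact: sum3.
have /ler_normlP[f1 f2] := wF Q; have /ler_normlP[f3 f4] := wF (rfQ Q).
rewrite !lapE in f1 f2 f3 f4.
have e012 : ((0 : 'I_3) == i)%:R + ((1 : 'I_3) == i)%:R + ((2 : 'I_3) == i)%:R = 1 :> R.
  by move: (i); apply: I3P => /=; ring.
exact: barrier_arith q0 e012 ht (hx 0) (hx 1) (hx 2) f2 f3.
Qed.

(** Along the i-th axis through [z], [h_le0] bounds the increment of [w] between [- s] and [s] by
    [2 * B * s], where [B] is the right-hand side; the slope of this increment at 0 is twice the
    derivative. *)
Lemma heat_gradient_pos : pd (Some i) w z <= 4 * W / r + F * r / 2.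
Proof.
have Qz : cyQ z r z.
  split=> [|j]; last by rewrite subrr normr0 ltW.
  by rewrite lexx andbT gerBl sqr_ge0.
have h1 := smf_slice0 (Some i) sw (slabQ Qz).
have h2 : dR (fun s : R => w ((- s) *: dirv (Some i) + z)) 0 (- pd (Some i) w z).
  have hN : dR (fun s : R => - s) 0 (-1) by dR_auto.
  have h1' : dR (fun s : R => w (s *: dirv (Some i) + z)) (- 0) (pd (Some i) w z) by rewrite oppr0.
  by have := dRcomp hN h1'; rewrite mulrN1.
pose B := 4 * W / r + F * r / 2.
suff : 2 * pd (Some i) w z <= 2 * B by rewrite ler_pM2l.
apply: (@dR_le (fun s => w (s *: dirv (Some i) + z) - w ((- s) *: dirv (Some i) + z)) _ _ r r0).
- by dR_auto; ring.
- by rewrite oppr0 subrr.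
move=> s /andP[s0 sr].
have Kp : K (s *: dirv (Some i) + z).
  have tE : (s *: dirv (Some i) + z).1 = z.1 by rewrite shift1 dcoSN mulr0 add0r.
  have xE k : (s *: dirv (Some i) + z).2 0 k = s * (i == k)%:R + z.2 0 k by rewrite shift2 dco_diag.
  split; last by rewrite xE eqxx mulr1 addrK.
  split=> [|k]; first by rewrite tE lexx andbT gerBl sqr_ge0.
  by rewrite xE addrK; case: eqP => _; rewrite ?mulr1 ?mulr0 ?normr0 ?ger0_norm// ltW.
have := h_le0 Kp; rewrite /h.
have -> : rf (s *: dirv (Some i) + z) = (- s) *: dirv (Some i) + z.
  rewrite rf_shift eqxx mulrN1; congr (_ + _); apply: E_eq; first by rewrite reflect_co1.
  by move=> k; rewrite reflect_co2; case: eqP => // ->; ring.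
have -> : psi (s *: dirv (Some i) + z) = q * (s ^+ 2 + 4 * (s * (r - s))) + F / 2 * (s * (r - s)).
  rewrite /psi !shift2 shift1 dcoSN mulr0 add0r !dco_diag eqxx subrr mulr1 !addrK /bar.
  move: (i); apply: I3P => /=; ring.
have hB : q * (s ^+ 2 + 4 * (s * (r - s))) + F / 2 * (s * (r - s)) <= B * s.
  have -> : B * s = q * (4 * r * s) + F / 2 * (s * r).
    by rewrite /B /q; field; rewrite gt_eqF.
  apply: lerD; apply: ler_wpM2l; rewrite ?(ltW q0) ?divr_ge0//.
    by have := sqr_ge0 s; rewrite -subr_ge0; nra.
  by rewrite ler_wpM2l//; lra.
by move: hB; lra.
Qed.

End Barrier.

Lemma heat_gradient (a b : R) w i z (r W F : R) : smf (slab a b) w ->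
  a < z.1 - r ^+ 2 -> z.1 < b -> 0 < r ->
  (forall z', cyQ z r z' -> `|w z'| <= W) ->
  (forall z', cyQ z r z' -> `|pd None w z' - lap w z'| <= F) ->
  `|pd (Some i) w z| <= 4 * W / r + F * r / 2.
Proof.
move=> sw az zb r0 wW wF.
have oS := @slab_open R a b.
have slabQ z' : cyQ z r z' -> slab a b z'.
  by move=> [/andP[h1 h2] _]; apply/andP; split; [exact: lt_le_trans h1|exact: le_lt_trans h2 _].
have Qz : cyQ z r z.
  split=> [|j]; last by rewrite subrr normr0 ltW.
  by rewrite lexx andbT gerBl sqr_ge0.
have W0 : 0 <= W by apply: le_trans (wW z Qz).
have F0 : 0 <= F by apply: le_trans (wF z Qz).
apply/ler_addgt0Pr => e e0.
(* The barrier needs a positive amplitude while [W] may be 0; the enlargement costs exactly [e] in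
   the bound. *)
pose W' := W + e * r / 4.
have W'0 : 0 < W' by rewrite ltr_wpDl// divr_gt0// mulr_gt0.
have WW' : W <= W' by rewrite lerDl ltW// divr_gt0// mulr_gt0.
have -> : 4 * W / r + F * r / 2 + e = 4 * W' / r + F * r / 2.
  by rewrite /W'; field; rewrite gt_eqF.
have NE o z' : slab a b z' -> pd o (fun z => - w z) z' = - pd o w z' by move=> h; exact: (pdN _ sw h).
rewrite ler_norml; apply/andP; split; last first.
  apply: heat_gradient_pos sw az zb r0 W'0 F0 _ wF => z' /wW h; exact: le_trans h WW'.
rewrite lerNl -NE; last exact: slabQ.
apply: heat_gradient_pos (smfN oS sw) az zb r0 W'0 F0 _ _ => z' Qz'.
  by rewrite normrN; apply: le_trans (wW _ Qz') WW'.
have -> : lap (fun z => - w z) z' = - lap w z'.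
  rewrite /lap -sumrN; apply: eq_bigr => k _.
  rewrite -(pdN _ (smf_pd (Some k) sw) (slabQ _ Qz')).
  apply: (pd_eq _ oS _ (slabQ _ Qz')) => y Sy; exact: NE.
by rewrite NE -?opprD ?normrN; [exact: wF|exact: slabQ].
Qed.

End HeatGradient.

(** * Solutions and their vorticity *)

Lemma ler_norm3 (R : realType) (x y z c : R) :
  `|x| <= c -> `|y| <= c -> `|z| <= c -> `|x + (y - z)| <= 3 * c.
Proof.
move=> hx hy hz; apply: le_trans (ler_normD _ _) _.
have := ler_normB y z; lra.
Qed.

Lemma ler_norm_sum3 (R : realType) (f : 'I_3 -> R) c :
  (forall k, `|f k| <= c) -> `|\sum_(k < 3) f k| <= 3 * c.
Proof.
move=> h; apply: le_trans (ler_norm_sum _ _ _) _; rewrite sum3.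
have := h 0; have := h 1; have := h 2; lra.
Qed.

(** * Derivatives along words of space variables *)

Section Words.
Context {R : realType}.
Local Notation E := (R * 'rV[R]_3)%type.
Implicit Types (F G : E -> R) (z : E) (i j k : 'I_3) (w : seq 'I_3) (U : set E).

Definition pds w F : E -> R := foldr (fun i G => pd (Some i) G) F w.

Lemma pds_rcons w i F : pds (rcons w i) F = pds w (pd (Some i) F).
Proof. by rewrite /pds foldr_rcons. Qed.

Lemma smf_pds U w F : smf U F -> smf U (pds w F).
Proof. by move=> sF; elim: w => //= i w IH; exact: smf_pd. Qed.

Lemma pds_eq U w F G z : open U -> (forall z, U z -> F z = G z) -> U z -> pds w F z = pds w G z.
Proof.
move=> oU FG; elim: w z => [|i w IH] z Uz /=; first exact: FG.
exact: (pd_eq _ oU).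
Qed.

Lemma pd_pds U o w F z : open U -> smf U F -> U z -> pd o (pds w F) z = pds w (pd o F) z.
Proof.
move=> oU sF; elim: w z => [//|i w IH] z Uz /=.
rewrite (pdC _ _ oU (smf_pds w sF) Uz).
exact: (pd_eq _ oU).
Qed.

Lemma pdsD U w F G z : open U -> smf U F -> smf U G -> U z ->
  pds w (fun z => F z + G z) z = pds w F z + pds w G z.
Proof.
move=> oU sF sG; elim: w z => [//|i w IH] z Uz /=.
by rewrite -(pdD _ (smf_pds w sF) (smf_pds w sG) Uz); exact: (pd_eq _ oU).
Qed.
Lemma pdsN U w F z : open U -> smf U F -> U z ->
  pds w (fun z => - F z) z = - pds w F z.
Proof.
move=> oU sF; elim: w z => [//|i w IH] z Uz /=.
by rewrite -(pdN _ (smf_pds w sF) Uz); exact: (pd_eq _ oU).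
Qed.
Lemma pdsB U w F G z : open U -> smf U F -> smf U G -> U z ->
  pds w (fun z => F z - G z) z = pds w F z - pds w G z.
Proof. by move=> oU sF sG Uz; rewrite (pdsD w oU sF (smfN oU sG) Uz) (pdsN w oU sG Uz). Qed.
Lemma pds_sum3 U w (F : 'I_3 -> E -> R) z : open U -> (forall k, smf U (F k)) -> U z ->
  pds w (fun z => \sum_(k < 3) F k z) z = \sum_(k < 3) pds w (F k) z.
Proof.
move=> oU sF; elim: w z => [//|i w IH] z Uz /=.
rewrite (pd_eq (G := fun z => \sum_(k < 3) pds w (F k) z) _ oU IH Uz).
by rewrite (pd_sum _ _ oU _ Uz)// => k; exact: smf_pds.
Qed.

Lemma smf_lap U F : open U -> smf U F -> smf U (lap F).
Proof. by move=> oU sF; apply: smf_sum => // k; do 2 apply: smf_pd. Qed.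

Lemma lapB U F G z : open U -> smf U F -> smf U G -> U z ->
  lap (fun z => F z - G z) z = lap F z - lap G z.
Proof.
move=> oU sF sG Uz; rewrite /lap -sumrB; apply: eq_bigr => k _.
rewrite -(pdB _ (smf_pd _ sF) (smf_pd _ sG) Uz).
apply: (pd_eq _ oU _ Uz) => z' Uz'; exact: (pdB _ sF sG Uz').
Qed.

Lemma pds_lap U w F z : open U -> smf U F -> U z -> lap (pds w F) z = pds w (lap F) z.
Proof.
move=> oU sF Uz; rewrite /lap (pds_sum3 w oU _ Uz); last by move=> k; do 2 apply: smf_pd.
apply: eq_bigr => k _; rewrite -(pd_pds _ w oU (smf_pd _ sF) Uz).
apply: (pd_eq _ oU _ Uz) => z' Uz'; exact: (pd_pds _ w oU sF Uz').
Qed.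

Lemma pd_lap U o F z : open U -> smf U F -> U z -> pd o (lap F) z = lap (pd o F) z.
Proof.
move=> oU sF Uz; rewrite /lap (pd_sum _ _ oU _ Uz); last by move=> k; do 2 apply: smf_pd.
apply: eq_bigr => k _; rewrite (pdC _ _ oU (smf_pd _ sF) Uz).
apply: (pd_eq _ oU _ Uz) => z' Uz'; exact: (pdC _ _ oU sF Uz').
Qed.

(** The Leibniz rule by induction on the order, peeling off the innermost derivative; each
    derivation at most doubles the number of terms. *)
Lemma pdsM_bound U n F G z (B C : R) : open U -> smf U F -> smf U G -> U z ->
  (forall w, (size w <= n)%N -> `|pds w F z| <= B) ->
  (forall w, (size w <= n)%N -> `|pds w G z| <= C) ->
  forall w, (size w <= n)%N -> `|pds w (fun z => F z * G z) z| <= 2 ^+ n * (B * C).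
Proof.
move=> oU + + Uz; elim: n F G => [|n IH] F G sF sG hF hG w.
  rewrite leqn0 size_eq0 => /eqP -> /=; rewrite expr0 mul1r normrM.
  by apply: ler_pM => //; [exact: (hF [::])|exact: (hG [::])].
have B0 : 0 <= B by apply: le_trans (hF [::] isT).
have C0 : 0 <= C by apply: le_trans (hG [::] isT).
case: (lastP w) => [_|{}w i].
  rewrite /= normrM; apply: le_trans (_ : B * C <= _).
    by apply: ler_pM => //; [exact: (hF [::])|exact: (hG [::])].
  by rewrite ler_peMl ?mulr_ge0// exprn_ege1// ler1n.
rewrite size_rcons ltnS => sw; rewrite pds_rcons.
rewrite (pds_eq (G := fun z => pd (Some i) F z * G z + F z * pd (Some i) G z) w oU _ Uz); last first.
  by move=> z' Uz'; exact: (pdM _ sF sG Uz').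
rewrite (pdsD w oU _ _ Uz); [|by apply: smfM => //; exact: smf_pd|by apply: smfM => //; exact: smf_pd].
apply: le_trans (ler_normD _ _) _; rewrite exprS -mulrA mulrDl mul1r; apply: lerD.
  apply: IH => //; first exact: smf_pd.
    by move=> w' sw'; rewrite -pds_rcons; apply: hF; rewrite size_rcons.
  by move=> w' sw'; apply: hG; exact: leqW.
apply: IH => //; first exact: smf_pd.
  by move=> w' sw'; apply: hF; exact: leqW.
by move=> w' sw'; rewrite -pds_rcons; apply: hG; rewrite size_rcons.
Qed.

End Words.

Section Solutions.
Context {R : realType}.
Local Notation E := (R * 'rV[R]_3)%type.
Implicit Types (z : E) (i j k : 'I_3) (w : seq 'I_3).

(* [sol_tube] stands for the weak L^3 bound, in a form that is invariant under
   scaling; the factor 8 allows it to hold at every time rather than at almost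
   every time. *)
Record sol (a b A : R) (u : 'I_3 -> E -> R) (p : E -> R) : Prop := Sol {
  sol_u : forall i, smf (slab a b) (u i);
  sol_p : smf (slab a b) p;
  sol_ns : forall z k, slab a b z ->
    pd None (u k) z - lap (u k) z + (\sum_(i < 3) u i z * pd (Some i) (u k) z) + pd (Some k) p z = 0;
  sol_div : forall z, slab a b z -> \sum_(i < 3) pd (Some i) (u i) z = 0;
  sol_ax : forall t x y h r : R, a < t < b -> 0 < r -> x ^+ 2 + y ^+ 2 = r ^+ 2 ->
    [/\ r * u 0 (pt t x y h) = x * u 0 (pt t r 0 h) - y * u 1 (pt t r 0 h),
        r * u 1 (pt t x y h) = y * u 0 (pt t r 0 h) + x * u 1 (pt t r 0 h) &
        u 2 (pt t x y h) = u 2 (pt t r 0 h)];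
  sol_tube : forall t r0 h0 s l : R, a < t < b -> 0 < s -> 2 * s <= r0 -> 0 < l ->
    (forall r h, `|r - r0| <= s -> `|h - h0| <= s -> l ^+ 2 <= \sum_(i < 3) u i (pt t r 0 h) ^+ 2) ->
    l ^+ 3 * r0 * s ^+ 2 <= 8 * A ^+ 3
}.

Variables (a b A : R) (u : 'I_3 -> E -> R) (p : E -> R).
Hypothesis hs : sol a b A u p.
Let U := slab a b.
Let oU : open U. Proof. exact: slab_open. Qed.
Let su i : smf U (u i). Proof. exact: (sol_u hs). Qed.

(** The curl as an antisymmetric matrix. On the half-plane y = 0, [vort u 2 0] is the angular
    vorticity. *)
Definition vort (u : 'I_3 -> E -> R) i j z : R := pd (Some i) (u j) z - pd (Some j) (u i) z.

Lemma smf_vort i j : smf U (vort u i j).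
Proof. by apply: smfB => //; exact: smf_pd. Qed.

Lemma pd_vort o i j z : U z ->
  pd o (vort u i j) z = pd o (pd (Some i) (u j)) z - pd o (pd (Some j) (u i)) z.
Proof. by move=> Uz; apply: (pdB _ _ _ Uz); exact: smf_pd. Qed.

Lemma lap_vort i j z : U z ->
  lap (vort u i j) z = lap (pd (Some i) (u j)) z - lap (pd (Some j) (u i)) z.
Proof. by move=> Uz; apply: (lapB oU _ _ Uz); exact: smf_pd. Qed.

(** The right-hand side is the Laplacian minus a derivative of the divergence. *)
Lemma lap_vort_u j z : U z -> lap (u j) z = \sum_(k < 3) pd (Some k) (vort u k j) z.
Proof.
move=> Uz; have h : \sum_(k < 3) pd (Some k) (vort u k j) z =
    lap (u j) z - pd (Some j) (fun z => \sum_(k < 3) pd (Some k) (u k) z) z.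
  rewrite (pd_sum _ _ oU _ Uz); last by move=> k; exact: smf_pd.
  rewrite /lap -sumrB; apply: eq_bigr => k _.
  by rewrite (pd_vort (Some k) k j Uz) (pdC (Some j) (Some k) oU (su k) Uz).
rewrite h (pd_eq (G := fun=> 0) _ oU _ Uz); first by rewrite pd_cst subr0.
by move=> z' Uz' /=; exact: (sol_div hs Uz').
Qed.

Definition vort_rhs i j z : R :=
  \sum_(k < 3) (u k z * pd (Some k) (vort u i j) z
    + (pd (Some i) (u k) z * pd (Some k) (u j) z - pd (Some j) (u k) z * pd (Some k) (u i) z)).

(** Antisymmetrising the gradient of the momentum equation removes the pressure, whose second
    derivatives are symmetric, and turns the convection term into [vort_rhs]. *)
Lemma vort_eq i j z : U z ->
  pd None (vort u i j) z - lap (vort u i j) z = - vort_rhs i j z.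
Proof.
move=> Uz.
have dns i' j' : pd None (pd (Some i') (u j')) z - lap (pd (Some i') (u j')) z
   + (\sum_(k < 3) (pd (Some i') (u k) z * pd (Some k) (u j') z + u k z * pd (Some i') (pd (Some k) (u j')) z))
   + pd (Some i') (pd (Some j') p) z = 0.
  have s1 := smf_pd None (su j').
  have s2 := smf_lap oU (su j').
  have s3 : smf U (fun z => \sum_(k < 3) u k z * pd (Some k) (u j') z).
    by apply: (smf_sum _ oU) => k; exact: (smfM oU (su k) (smf_pd _ (su j'))).
  have s4 := smf_pd (Some j') (sol_p hs).
  have := pd_eq (F := fun z => pd None (u j') z - lap (u j') z + (\sum_(k < 3) u k z * pd (Some k) (u j') z) + pd (Some j') p z)
     (G := fun=> 0) (Some i') oU (fun z Uz => sol_ns hs (z := z) j' Uz) Uz.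
  rewrite pd_cst (pdD _ (smfD oU (smfB oU s1 s2) s3) s4 Uz) (pdD _ (smfB oU s1 s2) s3 Uz) (pdB _ s1 s2 Uz).
  rewrite (pd_lap _ oU (su j') Uz) (pdC _ _ oU (su j') Uz) (pd_sum _ _ oU _ Uz); last first.
    by move=> k; exact: (smfM oU (su k) (smf_pd _ (su j'))).
  have -> : \sum_(k <- index_enum 'I_3) pd (Some i') (fun z => u k z * pd (Some k) (u j') z) z =
    \sum_(k < 3) (pd (Some i') (u k) z * pd (Some k) (u j') z + u k z * pd (Some i') (pd (Some k) (u j')) z).
    by apply: eq_bigr => k _; rewrite (pdM _ (su k) (smf_pd _ (su j')) Uz).
  by [].
have hk k : u k z * pd (Some k) (vort u i j) z = u k z * pd (Some i) (pd (Some k) (u j)) z - u k z * pd (Some j) (pd (Some k) (u i)) z.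
  by rewrite (pd_vort _ _ _ Uz) mulrBr (pdC _ _ oU (su j) Uz) (pdC _ _ oU (su i) Uz).
pose S i' j' := \sum_(k < 3) (pd (Some i') (u k) z * pd (Some k) (u j') z + u k z * pd (Some i') (pd (Some k) (u j')) z).
have eS : vort_rhs i j z = S i j - S j i.
  rewrite /vort_rhs /S -sumrB; apply: eq_bigr => k _; rewrite hk.
  move: (u k z) (pd _ _ z) (pd _ _ z) (pd _ _ z) (pd _ _ z) (pd _ _ z) (pd _ _ z) => *; ring.
have e1 := dns i j; have e2 := dns j i.
rewrite -/(S i j) in e1; rewrite -/(S j i) in e2.
rewrite (pdC (Some j) (Some i) oU (sol_p hs) Uz) in e1.
rewrite (pd_vort _ _ _ Uz) (lap_vort _ _ Uz) eS.
move: e1 e2 {eS hk dns}; move: (S i j) (S j i) (pd _ (pd _ p) z) (pd None _ z) (pd None _ z) (lap _ z) (lap _ z).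
by move=> S1 S2 P a1 a2 a3 a4; lra.
Qed.

Lemma smf_vort_rhs i j : smf U (vort_rhs i j).
Proof.
apply: smf_sum => // k; apply: smfD => //.
  by apply: smfM => //; apply: smf_pd; exact: smf_vort.
by apply: smfB => //; apply: smfM => //; exact: smf_pd.
Qed.

Lemma vort_rhs_bound n z (B : R) : U z ->
  (forall w i, (size w <= n.+1)%N -> `|pds w (u i) z| <= B) ->
  (forall w i j, (size w <= n.+1)%N -> `|pds w (vort u i j) z| <= B) ->
  forall w i j, (size w <= n)%N -> `|pds w (vort_rhs i j) z| <= 9 * (2 ^+ n * (B * B)).
Proof.
move=> Uz hu hv w i j sw.
have s1 k : smf U (fun z => u k z * pd (Some k) (vort u i j) z).
  by apply: smfM => //; apply: smf_pd; exact: smf_vort.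
have s2 k i' j' : smf U (fun z => pd (Some i') (u k) z * pd (Some k) (u j') z).
  by apply: smfM => //; exact: smf_pd.
rewrite (pds_sum3 w oU _ Uz); last by move=> k; apply: smfD => //; exact: smfB.
have hk k : `|pds w (fun z => u k z * pd (Some k) (vort u i j) z
    + (pd (Some i) (u k) z * pd (Some k) (u j) z - pd (Some j) (u k) z * pd (Some k) (u i) z)) z| <= 3 * (2 ^+ n * (B * B)).
  rewrite (pdsD w oU (s1 k) (smfB oU (s2 _ _ _) (s2 _ _ _)) Uz).
  rewrite (pdsB w oU (s2 _ _ _) (s2 _ _ _) Uz).
  have b1 : `|pds w (fun z => u k z * pd (Some k) (vort u i j) z) z| <= 2 ^+ n * (B * B).
    apply: (pdsM_bound oU _ _ Uz) sw => //; first by apply: smf_pd; exact: smf_vort.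
      by move=> w' sw'; apply: hu; exact: leqW.
    by move=> w' sw'; rewrite -pds_rcons; apply: hv; rewrite size_rcons.
  have b2 i' j' : `|pds w (fun z => pd (Some i') (u k) z * pd (Some k) (u j') z) z| <= 2 ^+ n * (B * B).
    apply: (pdsM_bound oU _ _ Uz) sw; [exact: smf_pd|exact: smf_pd| |].
      by move=> w' sw'; rewrite -pds_rcons; apply: hu; rewrite size_rcons.
    by move=> w' sw'; rewrite -pds_rcons; apply: hu; rewrite size_rcons.
  exact: ler_norm3 b1 (b2 _ _) (b2 _ _).
have -> : 9 * (2 ^+ n * (B * B)) = 3 * (3 * (2 ^+ n * (B * B))) by ring.
exact: ler_norm_sum3 hk.
Qed.

End Solutions.

(** * Small velocity makes all derivatives small *)

Section Smallness.
Context {R : realType}.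
Local Notation E := (R * 'rV[R]_3)%type.
Implicit Types (z : E) (i j k : 'I_3) (w : seq 'I_3).

(** The parabolic estimate for a function independent of time: [g] is composed with the map that
    freezes time at [z.1], and the result is smooth on a slab of any length. *)
Lemma elliptic_gradient (a b : R) (g : E -> R) i z (r W F : R) :
  smf (slab a b) g -> slab a b z -> 0 < r ->
  (forall z', z'.1 = z.1 -> (forall k, `|z'.2 0 k - z.2 0 k| <= r) -> `|g z'| <= W) ->
  (forall z', z'.1 = z.1 -> (forall k, `|z'.2 0 k - z.2 0 k| <= r) -> `|lap g z'| <= F) ->
  `|pd (Some i) g z| <= 4 * W / r + F * r / 2.
Proof.
move=> sg Sz r0 gW gF.
pose c : E := (z.1, 0); pose l (o : option 'I_3) : R := if o is Some _ then 1 else 0.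
have aff1 z' : (aff c l z').1 = z.1 by rewrite /= mul0r addr0.
have aff2 z' k : (aff c l z').2 0 k = z'.2 0 k by rewrite !mxE add0r mul1r.
have affS z' : slab a b (aff c l z') by rewrite /slab /mkset aff1.
have affz : aff c l z = z by apply: E_eq => [|k]; rewrite ?aff1 ?aff2.
pose a' := z.1 - r ^+ 2 - 1; pose b' := z.1 + 1.
have oS := @slab_open R a' b'.
have sF : smf (slab a' b') (g \o aff c l) by apply: (smf_aff _ oS sg) => z' _; exact: affS.
have pF o z' : pd o (g \o aff c l) z' = l o * pd o g (aff c l z').
  by have [_ ->] := @pd_aff R g c l o z' (smf_der sg (affS z')).
have pFF k z' : pd (Some k) (pd (Some k) (g \o aff c l)) z' = pd (Some k) (pd (Some k) g) (aff c l z').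
  have -> : pd (Some k) (g \o aff c l) = pd (Some k) g \o aff c l.
    by apply/funext => y; rewrite pF /= mul1r.
  have [_ ->] := @pd_aff R (pd (Some k) g) c l (Some k) z' (smf_der (smf_pd _ sg) (affS z')).
  by rewrite /= mul1r.
have h := @heat_gradient R a' b' (g \o aff c l) i z r W F sF.
have := h; rewrite pF affz /= mul1r; apply => //.
- by rewrite /a'; lra.
- by rewrite /b'; lra.
- by move=> z' [_ hz]; apply: gW => // k; rewrite aff2.
- move=> z' [_ hz]; rewrite pF /= mul0r sub0r normrN /lap.
  under eq_bigr do rewrite pFF.
  by apply: gF => // k; rewrite aff2.
Qed.

Definition ctrl m (B : R) (u : 'I_3 -> E -> R) z :=
  (forall w i, (size w <= m)%N -> `|pds w (u i) z| <= B) /\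
  (forall w i j, (size w <= m)%N -> `|pds w (vort u i j) z| <= B).

Lemma cyQ_sub z z' (r s : R) : 0 <= s -> s <= r -> cyQ z s z' -> cyQ z r z'.
Proof.
move=> s0 sr [/andP[h1 h2] h3]; split; last by move=> i; exact: le_trans (h3 i) sr.
rewrite h2 andbT; apply: le_trans h1; rewrite lerD2l lerN2 ler_sqr ?nnegrE//.
exact: le_trans sr.
Qed.

Lemma cyQ_refl z (r : R) : 0 <= r -> cyQ z r z.
Proof. by move=> r0; split=> [|i]; rewrite ?subrr ?normr0// lexx andbT gerBl sqr_ge0. Qed.

Lemma cyQ_slab a b z (r : R) z' : a < z.1 - r ^+ 2 -> z.1 < b -> cyQ z r z' -> slab a b z'.
Proof. by move=> h1 h2 [/andP[h3 h4] _]; apply/andP; split; [exact: lt_le_trans h3|exact: le_lt_trans h2]. Qed.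

(** Induction on the order. A derivative of order [k] of the velocity is small by induction, and its
    Laplacian is a sum of vorticity derivatives of order [k + 1], bounded by [3 * B]; the elliptic
    estimate on a small cube yields order [k + 1]. The radius is halved at each order. *)
Lemma small_velocity_derivatives m (B : R) (k : nat) : 0 < B -> (k <= m)%N -> forall e : R, 0 < e ->
  exists2 d : R, 0 < d & forall a b A u p, sol a b A u p -> forall z, a < z.1 - 1 -> z.1 < b ->
    (forall z', cyQ z 1 z' -> ctrl m B u z') ->
    (forall z' i, cyQ z 1 z' -> `|u i z'| <= d) ->
    forall z' w i, cyQ z (2 ^- k) z' -> (size w <= k)%N -> `|pds w (u i) z'| <= e.
Proof.
move=> B0; elim: k => [_|k IH km] e e0.
  exists e => // a b A u p _ z _ _ _ h z' w i; rewrite leqn0 size_eq0 expr0 invr1 => Q; move=> /eqP ->.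
  by apply: h.
pose q : R := 2 ^- k.+1.
have q0 : 0 < q by rewrite invr_gt0 exprn_gt0.
(* [rho] makes the contribution of the Laplacian at most [e / 2]; [e1], chosen afterwards, does the
   same for the term with [4 / rho]. *)
pose rho := Num.min q (e / (3 * B)).
have rho0 : 0 < rho by rewrite lt_min q0 divr_gt0// mulr_gt0.
pose e1 := Num.min e (e * rho / 8).
have e10 : 0 < e1 by rewrite lt_min e0 divr_gt0// mulr_gt0.
have [d d0 hd] := IH (ltnW km) e1 e10.
exists d => // a b A u p hs z az zb hc hu z' w i Qz' sw.
have kq : q <= 2 ^- k.
  by rewrite lef_pV2 ?posrE ?exprn_gt0// ler_eXn2l ?ltr1n//.
have k1 : (2 ^- k : R) <= 1 by rewrite invf_le1 ?exprn_gt0// exprn_ege1// ler1n.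
have Q1 y : cyQ z (2 ^- k) y -> cyQ z 1 y by apply: cyQ_sub => //; rewrite ltW// invr_gt0 exprn_gt0.
have Qk : cyQ z (2 ^- k) z' by apply: cyQ_sub kq Qz'; exact: ltW.
have [sk|sk] := leqP (size w) k.
  apply: le_trans (hd a b A u p hs z az zb hc hu z' w i Qk sk) _.
  by rewrite /e1 ge_min lexx.
have {sk sw} : size w = k.+1 by apply/eqP; rewrite eqn_leq sw.
case: w => [//|i0 w] /= [sw].
have S1 y : cyQ z 1 y -> slab a b y by apply: cyQ_slab; rewrite ?expr1n.
have oU := @slab_open R a b.
have Qr (y : E) : y.1 = z'.1 -> (forall j, `|y.2 0 j - z'.2 0 j| <= rho) -> cyQ z (2 ^- k) y.
  move=> y1 y2; case: Qz' => [/andP[h1 h2] h3]; split.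
    rewrite y1 h2 andbT; apply: le_trans h1; rewrite lerD2l lerN2 ler_sqr ?nnegrE// -/q; exact: ltW.
  move=> j; have e2 : (2 ^- k : R) = q + q by rewrite /q exprS invfM; field; rewrite expf_neq0// pnatr_eq0.
  rewrite e2; have -> : y.2 0 j - z.2 0 j = (y.2 0 j - z'.2 0 j) + (z'.2 0 j - z.2 0 j) by rewrite subrKA.
  apply: le_trans (ler_normD _ _) _; apply: lerD; last exact: h3.
  by apply: le_trans (y2 j) _; rewrite /rho ge_min lexx.
have := @elliptic_gradient a b (pds w (u i)) i0 z' rho e1 (3 * B) (smf_pds _ (sol_u hs i)) (S1 _ (Q1 _ Qk)) rho0.
have h1 : 4 * e1 / rho + 3 * B * rho / 2 <= e.
  have : 4 * e1 / rho <= e / 2.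
    rewrite ler_pdivrMr//; have : e1 <= e * rho / 8 by rewrite /e1 ge_min lexx orbT.
    by lra.
  have : rho <= e / (3 * B) by rewrite /rho ge_min lexx orbT.
  rewrite ler_pdivlMr ?mulr_gt0//; lra.
move=> h; apply: le_trans (h _ _) h1.
  move=> y y1 y2; apply: (hd a b A u p hs z az zb hc hu y w i); last by rewrite sw.
  exact: Qr.
move=> y y1 y2; have Qy := Qr y y1 y2; have Sy := S1 _ (Q1 _ Qy).
rewrite (pds_lap w oU (sol_u hs i) Sy) (pds_eq w oU (fun z Uz => lap_vort_u hs i Uz) Sy).
rewrite (pds_sum3 w oU _ Sy); last by move=> k'; apply: smf_pd; exact: (smf_vort hs).
apply: ler_norm_sum3 => k'; rewrite -pds_rcons.
by apply: (hc _ (Q1 _ Qy)).2; rewrite size_rcons sw.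
Qed.

(** The vorticity is small up to order [n] because the velocity is small up to order [n + 1]. The
    top order [n + 1] comes from the heat estimate applied to order [n], whose right-hand side
    contains no derivatives above order [n + 1]; thus the hypothesis is improved at its own
    order. *)
Lemma small_ctrl n (B e : R) : 0 < B -> 0 < e ->
  exists2 d : R, 0 < d & forall a b A u p, sol a b A u p -> forall z, a < z.1 - 1 -> z.1 < b ->
    (forall z', cyQ z 1 z' -> ctrl n.+1 B u z') ->
    (forall z' i, cyQ z 1 z' -> `|u i z'| <= d) -> ctrl n.+1 e u z.
Proof.
move=> B0 e0; pose F : R := 9 * (2 ^+ n * (B * B)).
have F0 : 0 < F by rewrite mulr_gt0// mulr_gt0 ?exprn_gt0// mulr_gt0.
pose q : R := 2 ^- n.+1.
have q0 : 0 < q by rewrite invr_gt0 exprn_gt0.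
pose rho := Num.min q (e / F).
have rho0 : 0 < rho by rewrite lt_min q0 divr_gt0.
pose e1 := Num.min (e / 2) (e * rho / 16).
have e10 : 0 < e1 by rewrite lt_min !divr_gt0// mulr_gt0.
have e1e : 2 * e1 <= e by have : e1 <= e / 2; [rewrite /e1 ge_min lexx|lra].
have [d d0 hd] := small_velocity_derivatives B0 (leqnn n.+1) e10.
exists d => // a b A u p hs z az zb hc hu.
have rq : rho <= q by rewrite /rho ge_min lexx.
have q1 : q <= 1 by rewrite invf_le1 ?exprn_gt0// exprn_ege1// ler1n.
have Q1 y : cyQ z rho y -> cyQ z 1 y by apply: cyQ_sub; [exact: ltW|exact: le_trans q1].
have S1 y : cyQ z 1 y -> slab a b y by apply: cyQ_slab; rewrite ?expr1n.
have oU := @slab_open R a b.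
have hu' y w i : cyQ z rho y -> (size w <= n.+1)%N -> `|pds w (u i) y| <= e1.
  by move=> Qy sw; apply: (hd a b A u p hs z az zb hc hu y w i) => //; apply: cyQ_sub rq Qy; exact: ltW.
have hv' y w i j : cyQ z rho y -> (size w <= n)%N -> `|pds w (vort u i j) y| <= 2 * e1.
  move=> Qy sw; rewrite (pdsB w oU (smf_pd _ (sol_u hs j)) (smf_pd _ (sol_u hs i)) (S1 _ (Q1 _ Qy))).
  rewrite -!pds_rcons; apply: le_trans (ler_normB _ _) _; rewrite mulrDl mul1r.
  by apply: lerD; apply: hu'; rewrite ?size_rcons.
have Qz : cyQ z rho z by apply: cyQ_refl; exact: ltW.
split=> [w i sw|w i j sw].
  by apply: le_trans (hu' z w i Qz sw) _; lra.
have [sn|sn] := leqP (size w) n.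
  by apply: le_trans (hv' z w i j Qz sn) _.
have {sn sw} : size w = n.+1 by apply/eqP; rewrite eqn_leq sw.
case: w => [//|i0 w] /= [sw].
have h1 : 4 * (2 * e1) / rho + F * rho / 2 <= e.
  have : 4 * (2 * e1) / rho <= e / 2.
    rewrite ler_pdivrMr//; have : e1 <= e * rho / 16 by rewrite /e1 ge_min lexx orbT.
    by lra.
  have : rho <= e / F by rewrite /rho ge_min lexx orbT.
  rewrite ler_pdivlMr//; lra.
have sv := smf_vort hs i j.
apply: le_trans h1; apply: (@heat_gradient R a b (pds w (vort u i j)) i0 z rho (2 * e1) F) => //.
- exact: smf_pds.
- apply: lt_le_trans az _; rewrite lerD2l lerN2 exprn_ile1//; [exact: ltW|exact: le_trans q1].
- by move=> z' Qz'; apply: hv'; rewrite ?sw.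
move=> z' Qz'; have Sz' := S1 _ (Q1 _ Qz').
rewrite (pd_pds _ w oU sv Sz') (pds_lap w oU sv Sz').
rewrite -(pdsB w oU (smf_pd _ sv) (smf_lap oU sv) Sz').
rewrite (pds_eq w oU (fun z Uz => vort_eq hs i j Uz) Sz').
rewrite (pdsN w oU (smf_vort_rhs hs i j) Sz') normrN.
have [c1 c2] := hc _ (Q1 _ Qz').
by apply: (@vort_rhs_bound R a b A u p hs n z' B Sz') => //; rewrite sw.
Qed.

End Smallness.

(** * Scaling and point selection *)

Section Roots.
Context {R : realType}.
Implicit Types x y : R.

(** The root of order [n + 1]; the shift keeps the order positive. *)
Definition rt (n : nat) x : R := `|x| `^ (n.+1%:R)^-1.

Lemma rt_ge0 n x : 0 <= rt n x. Proof. exact: powR_ge0. Qed.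
Lemma rtK n x : rt n x ^+ n.+1 = `|x|.
Proof. by rewrite /rt -powR_mulrn ?powR_ge0// -powRrM mulVf ?powRr1// pnatr_eq0. Qed.
Lemma rt_le n x y : 0 <= y -> (rt n x <= y) = (`|x| <= y ^+ n.+1).
Proof. by move=> y0; rewrite -(rtK n) ler_pXn2r ?nnegrE ?rt_ge0. Qed.
Lemma rt_eq n x y : 0 <= y -> `|x| = y ^+ n.+1 -> rt n x = y.
Proof. by move=> y0 h; apply/eqP; rewrite -(@eqrXn2 _ n.+1) ?rt_ge0// rtK h. Qed.
Lemma rtZ n l x : 0 <= l -> rt n (l ^+ n.+1 * x) = l * rt n x.
Proof.
move=> l0; apply: rt_eq; first by rewrite mulr_ge0 ?rt_ge0.
by rewrite exprMn rtK normrM ger0_norm ?exprn_ge0.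
Qed.

Lemma exprnD_ge n x y : 0 <= x -> 0 <= y -> x ^+ n.+1 + y ^+ n.+1 <= (x + y) ^+ n.+1.
Proof.
move=> x0 y0; elim: n => [|n IH]; first by rewrite !expr1.
rewrite [leRHS]exprS; apply: le_trans (_ : (x + y) * (x ^+ n.+1 + y ^+ n.+1) <= _); last first.
  by apply: ler_wpM2l => //; exact: addr_ge0.
rewrite mulrDl 2!mulrDr -!exprS -addrA lerD2l addrA lerDr.
by rewrite addr_ge0// mulr_ge0// exprn_ge0.
Qed.

(** Roots are subadditive, since powers are superadditive by [exprnD_ge]. Continuity of the
    magnitude where some derivative vanishes rests on this. *)
Lemma rt_dist n x y : `|rt n x - rt n y| <= rt n (x - y).
Proof.
have key a b : rt n a <= rt n b + rt n (a - b).
  rewrite rt_le ?addr_ge0 ?rt_ge0//; apply: le_trans (exprnD_ge _ (rt_ge0 _ _) (rt_ge0 _ _)).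
  by rewrite !rtK; have := ler_normD b (a - b); rewrite addrCA subrr addr0.
rewrite ler_norml; apply/andP; split; last by have := key x y; lra.
have := key y x; have -> : rt n (y - x) = rt n (x - y) by rewrite /rt distrC.
lra.
Qed.

Lemma rt_lt n x y : 0 < y -> `|x| < y ^+ n.+1 -> rt n x < y.
Proof. by move=> y0; rewrite -(rtK n) ltr_pXn2r ?nnegrE ?rt_ge0// ltW. Qed.

End Roots.

Section Selection.
Context {R : realType}.
Local Notation E := (R * 'rV[R]_3)%type.
Implicit Types (F G : E -> R) (z : E).

Lemma cE_rt n F z : cE F z -> cE (fun z => rt n (F z)) z.
Proof.
move=> /cont_nearP h; apply/cont_nearP => e e0.
have [d d0 hd] := h _ (exprn_gt0 n.+1 e0); exists d => // z' /hd h'.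
by apply: le_lt_trans (rt_dist _ _ _) _; exact: rt_lt.
Qed.

Lemma cE_norm F z : cE F z -> cE (fun z => `|F z|) z.
Proof.
move=> /cont_nearP h; apply/cont_nearP => e /h[d d0 hd]; exists d => // z' /hd.
exact: le_lt_trans (ler_dist_dist _ _).
Qed.

Lemma cE_min F G z : cE F z -> cE G z -> cE (fun z => Num.min (F z) (G z)) z.
Proof.
move=> cF cG; have -> : (fun z => Num.min (F z) (G z)) = (fun z => 2^-1 * (F z + G z - `|F z - G z|)).
  by apply/funext => y; rewrite minr_absE mulrC.
apply: cE_M; first exact: cE_cst.
by apply: cE_D; [exact: cE_D|apply: cE_N; apply: cE_norm; apply: cE_D => //; exact: cE_N].
Qed.

Lemma cE_sum (I : Type) (r : seq I) (F : I -> E -> R) z :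
  (forall i, cE (F i) z) -> cE (fun z => \sum_(i <- r) F i z) z.
Proof.
move=> h; elim: r => [|i r IH].
  have -> : (fun z => \sum_(i <- [::]) F i z) = (fun=> 0) by apply/funext => y; rewrite big_nil.
  exact: cE_cst.
have -> : (fun z => \sum_(j <- i :: r) F j z) = (fun z => F i z + \sum_(j <- r) F j z).
  by apply/funext => y; rewrite big_cons.
exact: cE_D.
Qed.

(* The point [z1] maximises [F] times the distance to the parabolic boundary. *)
Lemma selection F z0 (r N : R) : 0 < r -> 0 < N ->
  (forall z, cyQ z0 r z -> cE F z /\ 0 <= F z) -> 2 * N <= F z0 * r ->
  exists z1, [/\ cyQ z0 r z1, 0 < F z1, forall z, cyQ z1 (N / F z1) z -> cyQ z0 r z &
    forall z, cyQ z1 (N / F z1) z -> F z <= 2 * F z1].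
Proof.
move=> r0 N0 hF h0.
(* The distance to the parabolic boundary: the root of the time elapsed since the bottom, and the
   distances to the lateral faces. *)
pose D (z : E) : R := Num.min (rt 1 (z.1 - z0.1 + r ^+ 2))
  (Num.min (r - `|z.2 0 0 - z0.2 0 0|) (Num.min (r - `|z.2 0 1 - z0.2 0 1|) (r - `|z.2 0 2 - z0.2 0 2|))).
have cD z : cE D z.
  apply: cE_min; first by apply: cE_rt; cE_auto.
  by apply: cE_min; [|apply: cE_min]; apply: cE_D; (try exact: cE_cst); apply: cE_N; apply: cE_norm; cE_auto.
have DP z d : 0 <= d -> z0.1 - r ^+ 2 <= z.1 -> (d <= D z <-> d ^+ 2 <= z.1 - z0.1 + r ^+ 2 /\ forall i, `|z.2 0 i - z0.2 0 i| <= r - d).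
  move=> d0 hz; have t0 : 0 <= z.1 - z0.1 + r ^+ 2 by lra.
  rewrite /D !le_min; split.
    move=> /and4P[h1 h2 h3 h4]; split; last by apply: I3P; lra.
    have := rtK 1 (z.1 - z0.1 + r ^+ 2); rewrite ger0_norm// => <-.
    by rewrite ler_sqr ?nnegrE ?rt_ge0.
  move=> [h1 h2]; apply/and4P; split; [|have := h2 0; lra|have := h2 1; lra|have := h2 2; lra].
  rewrite -(@ler_pXn2r _ 2) ?nnegrE ?rt_ge0//.
  by have := rtK 1 (z.1 - z0.1 + r ^+ 2); rewrite ger0_norm// => ->.
have Qz0 : cyQ z0 r z0 by apply: cyQ_refl; exact: ltW.
have D0 : r <= D z0.
  apply/DP; [exact: ltW|by have := sqr_ge0 r; lra|].
  by rewrite subrr add0r; split => // i; rewrite !subrr normr0.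
have [z1 Qz1 zmax] := compact_max (F := fun z => F z * D z) (ex_intro _ z0 Qz0) (@cyQ_compact _ z0 r)
  (fun z Qz => cE_M (hF z Qz).1 (cD z)).
have [c1 F1] := hF z1 Qz1.
have FD : 2 * N <= F z1 * D z1.
  apply: le_trans (zmax _ Qz0); apply: le_trans h0 _.
  by apply: ler_wpM2l => //; exact: (hF z0 Qz0).2.
have F10 : 0 < F z1.
  rewrite lt_neqAle F1 andbT; apply/eqP => e; move: FD; rewrite -e mul0r; lra.
(* This radius is at most half of [D z1], so [D] stays above [D z1 / 2] on the small cylinder, and
   maximality costs a factor 2. *)
pose s := N / F z1.
have s0 : 0 < s by rewrite divr_gt0.
have sD : 2 * s <= D z1 by rewrite /s mulrA ler_pdivrMr// [D z1 * _]mulrC.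
have Dpos : 0 <= D z1 by lra.
have z1t : z0.1 - r ^+ 2 <= z1.1 by case: Qz1 => /andP[].
have [h1 h2] := (DP z1 (D z1) Dpos z1t).1 (lexx _).
have key z : cyQ z1 s z -> cyQ z0 r z /\ D z1 - s <= D z.
  move=> [/andP[h3 h4] h5].
  have sD2 : s ^+ 2 <= D z1 ^+ 2 by rewrite ler_sqr ?nnegrE; [lra|exact: ltW|].
  have ht : z0.1 - r ^+ 2 <= z.1 by lra.
  have hx i : `|z.2 0 i - z0.2 0 i| <= r - (D z1 - s).
    have -> : z.2 0 i - z0.2 0 i = (z.2 0 i - z1.2 0 i) + (z1.2 0 i - z0.2 0 i) by rewrite subrKA.
    apply: le_trans (ler_normD _ _) _; have := h2 i; have := h5 i; lra.
  split.
    split; last by move=> i; have := hx i; lra.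
    by rewrite ht/=; apply: le_trans h4 _; case: Qz1 => /andP[].
  apply/DP => //; first lra.
  split => //; have : (D z1 - s) ^+ 2 <= D z1 ^+ 2 - s ^+ 2; last lra.
  nra.
exists z1; split => // z Qz; first exact: (key z Qz).1.
have [Qz' hD] := key z Qz.
have := zmax z Qz'; have Fz := (hF z Qz').2.
have hD' : D z1 / 2 <= D z by lra.
move=> hm; have : F z * (D z1 / 2) <= F z1 * D z1.
  by apply: le_trans hm; apply: ler_wpM2l.
have D1 : 0 < D z1 by lra.
move: hm => _; move: (F z) (F z1) (D z1) D1 => x y d d0 h; rewrite -(@ler_pM2r _ d d0).
have -> : x * d = 2 * (x * (d / 2)) by field.
by rewrite -mulrA ler_pM2l.
Qed.

End Selection.

Section Scaling.
Context {R : realType}.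
Local Notation E := (R * 'rV[R]_3)%type.
Implicit Types (z : E) (i j k : 'I_3) (w : seq 'I_3).

Definition scl (l : R) (o : option 'I_3) : R := if o is Some _ then l else l ^+ 2.
(** Translations are made only in time and along the axis, since these preserve axial symmetry. *)
Definition sclmap (t0 h0 l : R) : E -> E := aff (pt t0 0 0 h0) (scl l).

Lemma sclmap1 t0 h0 l z : (sclmap t0 h0 l z).1 = t0 + l ^+ 2 * z.1.
Proof. by []. Qed.
Lemma sclmap2 t0 h0 l z i : (sclmap t0 h0 l z).2 0 i = (if i == 2 then h0 else 0) + l * z.2 0 i.
Proof. by rewrite mxE; congr (_ + _); move: i; apply: I3P; rewrite ?pt0 ?pt1 ?pt2. Qed.
Lemma sclmap_pt t0 h0 l t x y h :
  sclmap t0 h0 l (pt t x y h) = pt (t0 + l ^+ 2 * t) (l * x) (l * y) (h0 + l * h).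
Proof.
apply: E_eq => //; apply: I3P; rewrite sclmap2 /= ?pt0 ?pt1 ?pt2 ?add0r//.
Qed.

Definition usc (t0 h0 l : R) (u : 'I_3 -> E -> R) i z : R := l * u i (sclmap t0 h0 l z).

Variables (a b A : R) (u : 'I_3 -> E -> R) (p : E -> R).
Hypothesis hs : sol a b A u p.
Variables (t0 h0 l : R).
Hypothesis l0 : 0 < l.
Let a' := (a - t0) / l ^+ 2.
Let b' := (b - t0) / l ^+ 2.
Let l20 : 0 < l ^+ 2. Proof. exact: exprn_gt0. Qed.
Local Notation T := (sclmap t0 h0 l).
Local Notation v := (usc t0 h0 l u).

Lemma slab_sclmap z : slab a' b' z <-> slab a b (T z).
Proof.
rewrite /slab /mkset sclmap1 /a' /b' ltr_pdivrMr// ltr_pdivlMr//.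
by rewrite ltrBlDl ltrBrDl mulrC.
Qed.

Lemma pd_scl F (c : R) o z : smf (slab a b) F -> slab a' b' z ->
  pd o (fun z => c * F (T z)) z = c * scl l o * pd o F (T z).
Proof.
move=> sF Sz; have oS' := @slab_open R a' b'.
have sFT : smf (slab a' b') (F \o T) by apply: smf_aff sF => // y /slab_sclmap.
rewrite (pdZ c o sFT Sz) -mulrA; congr (_ * _).
by have [_ ->] := pd_aff (smf_der (o := o) sF ((slab_sclmap z).1 Sz)).
Qed.

Lemma pds_scl F (c : R) w z : smf (slab a b) F -> slab a' b' z ->
  pds w (fun z => c * F (T z)) z = c * l ^+ (size w) * pds w F (T z).
Proof.
move=> sF; elim: w z => [|i w IH] z Sz /=; first by rewrite expr0 mulr1.
rewrite (pd_eq (Some i) (@slab_open R a' b') IH Sz) (pd_scl _ _ (smf_pds w sF) Sz) /=.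
by rewrite exprSr mulrA.
Qed.

Lemma pds_usc w i z : slab a' b' z -> pds w (v i) z = l ^+ (size w).+1 * pds w (u i) (T z).
Proof. by move=> Sz; rewrite (pds_scl l w (sol_u hs i) Sz) exprS. Qed.

Lemma pds_vort_usc w i j z : slab a' b' z ->
  pds w (vort v i j) z = l ^+ (size w).+2 * pds w (vort u i j) (T z).
Proof.
move=> Sz; have oS' := @slab_open R a' b'.
have e y : slab a' b' y -> vort v i j y = l ^+ 2 * vort u i j (T y).
  move=> Sy; rewrite /vort (pd_scl l (Some i) (sol_u hs j) Sy) (pd_scl l (Some j) (sol_u hs i) Sy).
  by rewrite /= mulrBr expr2.
by rewrite (pds_eq w oS' e Sz) (pds_scl _ w (smf_vort hs i j) Sz) -exprD.
Qed.

(** Every term of the momentum equation acquires the factor [l ^+ 3]. The quantity bounded in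
    [sol_tube] is invariant, as a velocity level scales like an inverse length and the radius and
    width like lengths. *)
Lemma sol_usc : sol a' b' A v (fun z => l ^+ 2 * p (T z)).
Proof.
have oS' := @slab_open R a' b'.
have sT F : smf (slab a b) F -> smf (slab a' b') (F \o T).
  by move=> sF; apply: smf_aff sF => // y /slab_sclmap.
have sv i : smf (slab a' b') (v i) by exact: (smfZ l oS' (sT _ (sol_u hs i))).
have ptS t (x y h : R) : a' < t < b' -> a < t0 + l ^+ 2 * t < b.
  by move=> ht; have /slab_sclmap : slab a' b' (pt t x y h) by [].
split => //.
- exact: (smfZ _ oS' (sT _ (sol_p hs))).
- move=> z k Sz; have Sz' := (slab_sclmap z).1 Sz.
  rewrite (pd_scl _ _ (sol_u hs k) Sz) (pd_scl _ _ (sol_p hs) Sz).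
  have -> : lap (v k) z = l ^+ 3 * lap (u k) (T z).
    rewrite /lap mulr_sumr; apply: eq_bigr => i _.
    have := pds_usc [:: i; i] k Sz; exact.
  have -> : \sum_(i < 3) v i z * pd (Some i) (v k) z = l ^+ 3 * \sum_(i < 3) u i (T z) * pd (Some i) (u k) (T z).
    rewrite mulr_sumr; apply: eq_bigr => i _; rewrite (pd_scl _ _ (sol_u hs k) Sz) /usc /=.
    by move: (u i _) (pd _ _ _) => x y; ring.
  have := sol_ns hs k Sz'; rewrite /=.
  move: (pd None _ _) (lap _ _) (\sum_(i < 3) _) (pd _ p _) => x1 x2 x3 x4 h.
  have -> : l * l ^+ 2 * x1 - l ^+ 3 * x2 + l ^+ 3 * x3 + l ^+ 2 * l * x4 = l ^+ 3 * (x1 - x2 + x3 + x4) by ring.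
  by rewrite h mulr0.
- move=> z Sz; have Sz' := (slab_sclmap z).1 Sz.
  have -> : \sum_(i < 3) pd (Some i) (v i) z = l ^+ 2 * \sum_(i < 3) pd (Some i) (u i) (T z).
    by rewrite mulr_sumr; apply: eq_bigr => i _; rewrite (pd_scl _ _ (sol_u hs i) Sz) /= expr2.
  by rewrite (sol_div hs Sz') mulr0.
- move=> t x y h r ht r0 e; rewrite /usc !sclmap_pt mulr0.
  have [|||e1 e2 e3] := sol_ax hs (t := t0 + l ^+ 2 * t) (x := l * x) (y := l * y) (h0 + l * h) (r := l * r).
  + exact: (ptS t x y h ht).
  + exact: mulr_gt0.
  + by rewrite !exprMn -mulrDr e.
  split; last by rewrite e3.
    by rewrite [LHS]mulrA [r * l]mulrC e1; ring.
  by rewrite [LHS]mulrA [r * l]mulrC e2; ring.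
- move=> t r0 h1 s m ht s0 sr m0 H.
  have := sol_tube hs (t := t0 + l ^+ 2 * t) (r0 := l * r0) (h0 := h0 + l * h1) (s := l * s) (l := m / l).
  have -> : (m / l) ^+ 3 * (l * r0) * (l * s) ^+ 2 = m ^+ 3 * r0 * s ^+ 2 by field; rewrite gt_eqF.
  apply.
  + exact: (ptS t r0 0 h1 ht).
  + exact: mulr_gt0.
  + by rewrite mulrCA ler_pM2l.
  + exact: divr_gt0.
  move=> r h hr hh; have := H (r / l) ((h - h0) / l).
  have lne : l != 0 by rewrite gt_eqF.
  have -> : `|r / l - r0| <= s.
    have -> : r / l - r0 = (r - l * r0) / l by field.
    by rewrite normrM [`|l^-1|]gtr0_norm ?invr_gt0// ler_pdivrMr// [s * l]mulrC.
  have -> : `|(h - h0) / l - h1| <= s.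
    have -> : (h - h0) / l - h1 = (h - (h0 + l * h1)) / l by field.
    by rewrite normrM [`|l^-1|]gtr0_norm ?invr_gt0// ler_pdivrMr// [s * l]mulrC.
  move=> /(_ isT isT); rewrite expr_div_n ler_pdivrMr//.
  move=> hm; apply: le_trans hm _; rewrite mulr_suml; apply: ler_sum => i _.
  rewrite /usc sclmap_pt mulr0 exprMn mulrC.
  have -> : l * (r / l) = r by field.
  by have -> : h0 + l * ((h - h0) / l) = h by field.
Qed.

End Scaling.

(** * The magnitude and the control of derivatives *)

Section Magnitude.
Context {R : realType}.
Local Notation E := (R * 'rV[R]_3)%type.
Implicit Types (z : E) (i j k : 'I_3) (w : seq 'I_3) (u : 'I_3 -> E -> R).

Fixpoint all_words (n : nat) : seq (seq 'I_3) :=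
  if n is m.+1 then [seq i :: w | i <- enum 'I_3, w <- all_words m] else [:: [::]].
Definition words_le m : seq (seq 'I_3) := flatten [seq all_words n | n <- iota 0 m.+1].

Lemma all_wordsP n w : (w \in all_words n) = (size w == n).
Proof.
elim: n w => [|n IH] [|i w] //=.
  by apply/negbTE/allpairsP => -[[x y]] [].
rewrite eqSS -IH; apply/allpairsP/idP => [[[x y]] /= [_ h [_ ->]]|h] //.
by exists (i, w); rewrite mem_enum.
Qed.
Lemma words_leP m w : (w \in words_le m) = (size w <= m)%N.
Proof.
apply/flattenP/idP => [[s /mapP[n +->]]|h].
  by rewrite mem_iota all_wordsP => /andP[_ h] /eqP ->; rewrite -ltnS.
by exists (all_words (size w)); rewrite ?all_wordsP//; apply/mapP; exists (size w); rewrite // mem_iota.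
Qed.

(* [magn] scales like the inverse of a length. *)
Definition magn m u z : R :=
  \sum_(w <- words_le m) (\sum_(i < 3) rt (size w) (pds w (u i) z)
     + \sum_(i < 3) \sum_(j < 3) rt (size w).+1 (pds w (vort u i j) z)).

Lemma magn_ge0 m u z : 0 <= magn m u z.
Proof.
apply: sumr_ge0 => w _; apply: addr_ge0; first by apply: sumr_ge0 => *; exact: rt_ge0.
by apply: sumr_ge0 => *; apply: sumr_ge0 => *; exact: rt_ge0.
Qed.

Lemma magn_cont m a b A u p z : sol a b A u p -> slab a b z -> cE (magn m u) z.
Proof.
move=> hs Sz; apply: cE_sum => w; apply: cE_D.
  by apply: cE_sum => i; apply: cE_rt; exact: (smf_cont (smf_pds w (sol_u hs i)) Sz).
apply: cE_sum => i; apply: cE_sum => j; apply: cE_rt.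
exact: (smf_cont (smf_pds w (smf_vort hs i j)) Sz).
Qed.

Lemma ler_sum_seq (I : eqType) (r : seq I) (f : I -> R) (x : I) : (forall s : I, 0 <= f s) -> x \in r -> f x <= \sum_(s <- r) f s.
Proof.
move=> f0; elim: r => // y r IH; rewrite inE big_cons => /orP[/eqP ->|/IH h].
  by rewrite lerDl sumr_ge0.
by apply: le_trans h _; rewrite lerDr.
Qed.

(** As [L >= 1], the power [m + 2], which belongs to the top vorticity derivatives, dominates all
    the others. *)
Lemma ctrl_magn m u z (L : R) : 1 <= L -> magn m u z <= L -> ctrl m (L ^+ m.+2) u z.
Proof.
move=> L1 hM; have L0 : 0 <= L by lra.
have key w : (size w <= m)%N -> (forall i, `|pds w (u i) z| <= L ^+ (size w).+1) /\
   (forall i j, `|pds w (vort u i j) z| <= L ^+ (size w).+2).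
  move=> sw; pose f w := \sum_(i < 3) rt (size w) (pds w (u i) z)
     + \sum_(i < 3) \sum_(j < 3) rt (size w).+1 (pds w (vort u i j) z).
  have p1 w' : 0 <= \sum_(i < 3) rt (size w') (pds w' (u i) z) by apply: sumr_ge0 => *; exact: rt_ge0.
  have p2 w' i : 0 <= \sum_(j < 3) rt (size w').+1 (pds w' (vort u i j) z) by apply: sumr_ge0 => *; exact: rt_ge0.
  have p3 w' : 0 <= \sum_(i < 3) \sum_(j < 3) rt (size w').+1 (pds w' (vort u i j) z) by apply: sumr_ge0.
  have hf : f w <= L.
    by apply: le_trans hM; apply: (ler_sum_seq (f := f)); [move=> w'; exact: addr_ge0|rewrite words_leP].
  split=> [i|i j]; rewrite -rt_le//; apply: le_trans hf.
    apply: le_trans (_ : \sum_(i < 3) rt (size w) (pds w (u i) z) <= _); last by rewrite /f lerDl.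
    by rewrite (bigD1 i)//= lerDl sumr_ge0// => *; exact: rt_ge0.
  apply: le_trans (_ : \sum_(i < 3) \sum_(j < 3) rt (size w).+1 (pds w (vort u i j) z) <= _); last by rewrite /f lerDr.
  rewrite (bigD1 i)//= -[X in X <= _]addr0 lerD ?sumr_ge0//.
  by rewrite (bigD1 j)//= lerDl sumr_ge0// => *; exact: rt_ge0.
split=> [w i sw|w i j sw].
  by apply: le_trans ((key w sw).1 i) _; apply: ler_weXn2l => //; rewrite !ltnS ltnW.
by apply: le_trans ((key w sw).2 i j) _; apply: ler_weXn2l.
Qed.

Lemma pds_magn m u z w i : (size w <= m)%N -> `|pds w (u i) z| <= magn m u z ^+ (size w).+1.
Proof.
move=> sw; rewrite -rt_le ?magn_ge0//.
pose f w := \sum_(i < 3) rt (size w) (pds w (u i) z)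
     + \sum_(i < 3) \sum_(j < 3) rt (size w).+1 (pds w (vort u i j) z).
apply: le_trans (_ : f w <= _); last first.
  apply: (ler_sum_seq (f := f)); last by rewrite words_leP.
  move=> w'; apply: addr_ge0; apply: sumr_ge0 => *; first exact: rt_ge0.
  by apply: sumr_ge0 => *; exact: rt_ge0.
apply: le_trans (_ : \sum_(i < 3) rt (size w) (pds w (u i) z) <= _).
  by rewrite (bigD1 i)//= lerDl sumr_ge0// => *; exact: rt_ge0.
by rewrite /f lerDl; apply: sumr_ge0 => *; apply: sumr_ge0 => *; exact: rt_ge0.
Qed.

Lemma magn_small m : exists2 e : R, 0 < e & forall u z, ctrl m e u z -> magn m u z < 1.
Proof.
(* There are twelve roots per word, three for the velocity and nine for the vorticity; 13 and [n.+1]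
   make the total strictly less than 1. *)
pose n := size (words_le m); pose q : R := (13 * n.+1%:R)^-1.
have q0 : 0 < q by rewrite invr_gt0 mulr_gt0.
have q1 : q <= 1 by rewrite invf_le1 ?mulr_gt0// -natrM ler1n.
exists (q ^+ m.+2); first exact: exprn_gt0.
move=> u z [h1 h2].
have hw w : w \in words_le m -> \sum_(i < 3) rt (size w) (pds w (u i) z)
     + \sum_(i < 3) \sum_(j < 3) rt (size w).+1 (pds w (vort u i j) z) <= 12 * q.
  rewrite words_leP => sw.
  have k1 i : rt (size w) (pds w (u i) z) <= q.
    rewrite rt_le ?(ltW q0)//; apply: le_trans (h1 w i sw) _.
    by apply: ler_wiXn2l; rewrite ?(ltW q0)// !ltnS ltnW.
  have k2 i j : rt (size w).+1 (pds w (vort u i j) z) <= q.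
    rewrite rt_le ?(ltW q0)//; apply: le_trans (h2 w i j sw) _.
    by apply: ler_wiXn2l; rewrite ?(ltW q0)// !ltnS.
  have -> : 12 * q = \sum_(i < 3) q + \sum_(i < 3) \sum_(j < 3) q by rewrite !sum3; ring.
  by apply: lerD; apply: ler_sum => i _ //; apply: ler_sum => j _.
have : magn m u z <= \sum_(w <- words_le m) 12 * q.
  by rewrite /magn big_seq [leRHS]big_seq; exact: ler_sum.
move=> h; apply: le_lt_trans h _.
rewrite big_const_seq count_predT iter_addr addr0 -/n.
rewrite -[_ *+ n]mulr_natr; have hq : q * (13 * (n%:R + 1)) = 1.
  by rewrite natr1 /q mulVf// mulf_neq0// pnatr_eq0.
have qn : 0 <= q * n%:R by rewrite mulr_ge0// ltW.
have fin (x y : R) : 0 < y -> 0 <= y * x -> y * (13 * (x + 1)) = 1 -> 12 * y * x < 1.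
  move=> y0 yx h3; have h4 : 13 * (y * x) + 13 * y = 1 by rewrite -[RHS]h3; ring.
  by rewrite -mulrA; lra.
exact: fin q0 qn hq.
Qed.

Lemma magn_usc m a b A u p (t0 h0 l : R) z : sol a b A u p -> 0 < l ->
  slab ((a - t0) / l ^+ 2) ((b - t0) / l ^+ 2) z ->
  magn m (usc t0 h0 l u) z = l * magn m u (sclmap t0 h0 l z).
Proof.
move=> hs l0 Sz; rewrite /magn mulr_sumr; apply: eq_bigr => w _; rewrite mulrDr; congr (_ + _).
  rewrite mulr_sumr; apply: eq_bigr => i _.
  by rewrite (pds_usc hs h0 l0 w i Sz) rtZ// ltW.
rewrite mulr_sumr; apply: eq_bigr => i _; rewrite mulr_sumr; apply: eq_bigr => j _.
by rewrite (pds_vort_usc hs h0 l0 w i j Sz) rtZ// ltW.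
Qed.

End Magnitude.

(** * The bound away from the axis *)

Section FarEstimate.
Context {R : realType}.
Local Notation E := (R * 'rV[R]_3)%type.
Implicit Types (z : E) (i j k : 'I_3) (w : seq 'I_3).

Lemma exp2_bound (c : R) : exists k : nat, c <= 2 ^+ k.
Proof.
exists (Num.truncn c).+1; apply: le_trans (_ : (Num.truncn c).+1%:R <= _).
  have [c0|c0] := leP c 0; first by apply: le_trans c0 _.
  by rewrite ltW// truncnS_gt.
by rewrite -natrX ler_nat ltnW// ltn_expl.
Qed.

(** The two points are joined by three segments parallel to the axes, which stay in the box. *)
Lemma lipschitz_box (a b : R) (F : E -> R) z z' (s B : R) : smf (slab a b) F -> slab a b z ->
  z'.1 = z.1 -> (forall i, `|z'.2 0 i - z.2 0 i| <= s) ->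
  (forall i (y : E), y.1 = z.1 -> (forall j, `|y.2 0 j - z.2 0 j| <= s) -> `|pd (Some i) F y| <= B) ->
  `|F z' - F z| <= 3 * (B * s).
Proof.
move=> sF Sz t' hz hB.
have B0 : 0 <= B.
  apply: le_trans (hB 0 z _ _) => // j; rewrite subrr normr0.
  exact: le_trans (hz 0).
pose d i := z'.2 0 i - z.2 0 i.
have line i (y : E) (e : R) : y.1 = z.1 -> `|e| <= s -> (forall j, `|y.2 0 j - z.2 0 j| <= s) -> y.2 0 i = z.2 0 i ->
   `|F (e *: dirv (Some i) + y) - F y| <= B * s.
  move=> yt es ys yi.
  have := @dR_lip R (fun x => F (x *: dirv (Some i) + y)) (fun x => pd (Some i) F (x *: dirv (Some i) + y)) 0 e B.
  rewrite scale0r add0r subr0 => h; apply: le_trans (h _) _; last by rewrite ler_wpM2l.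
  move=> x hx.
  have yx : (x *: dirv (Some i) + y).1 = z.1 by rewrite shift1 dcoSN mulr0 add0r.
  split; first by apply: (smf_slice sF); apply/andP; rewrite yx; exact/andP.
  apply: hB => // j; rewrite shift2 dco_diag; case: eqP => [<-|_]; last by rewrite mulr0 add0r.
  rewrite mulr1 yi addrK; apply: le_trans es.
  by move: hx; have [e0|e0] := leP 0 e; rewrite ?(ger0_norm e0) ?(ltr0_norm e0) ler_norml; lra.
have s0 : 0 <= s by apply: le_trans (hz 0).
pose y1 := d 0 *: dirv (Some 0) + z; pose y2 := d 1 *: dirv (Some 1) + y1.
have e3 : z' = d 2 *: dirv (Some 2) + y2.
  apply: E_eq; first by rewrite /y2 /y1 !shift1 !dcoSN !mulr0 !add0r.
  by apply: I3P; rewrite /y2 /y1 !shift2 !dco_diag /d /=; ring.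
have y1t : y1.1 = z.1 by rewrite /y1 shift1 dcoSN mulr0 add0r.
have y2t : y2.1 = z.1 by rewrite /y2 shift1 dcoSN mulr0 add0r.
have y1x j : y1.2 0 j = d 0 * ((0 : 'I_3) == j)%:R + z.2 0 j by rewrite /y1 shift2 dco_diag.
have y2x j : y2.2 0 j = d 1 * ((1 : 'I_3) == j)%:R + y1.2 0 j by rewrite /y2 shift2 dco_diag.
have y1s j : `|y1.2 0 j - z.2 0 j| <= s.
  by rewrite y1x addrK; case: eqP => [_|_]; rewrite ?mulr1 ?mulr0 ?normr0//; exact: hz.
have y2s j : `|y2.2 0 j - z.2 0 j| <= s.
  rewrite y2x; move: j; apply: I3P; rewrite /= ?mulr0 ?add0r ?mulr1; [exact: y1s| |exact: y1s].
  by rewrite y1x /= mulr0 add0r addrK; exact: hz.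
have h1 := line 0 z (d 0) erefl (hz 0) (fun j => _) erefl.
have {}h1 : `|F y1 - F z| <= B * s by apply: h1 => j; rewrite subrr normr0.
have h2 : `|F y2 - F y1| <= B * s.
  by apply: line => //; [exact: hz|rewrite y1x /= mulr0 add0r].
have h3 : `|F z' - F y2| <= B * s.
  by rewrite e3; apply: line => //; [exact: hz|rewrite y2x y1x /= !mulr0 !add0r].
rewrite (_ : F z' - F z = (F z' - F y2) + (F y2 - F y1) + (F y1 - F z)); last by rewrite !subrKA.
apply: le_trans (ler_normD _ _) _; apply: le_trans (lerD (ler_normD _ _) (lexx _)) _.
by move: h1 h2 h3; move: `|_| `|_| `|_| (B * s) => x1 x2 x3 x4; lra.
Qed.

Lemma rot_sum (f g : 'I_3 -> R) x y r : 0 < r -> x ^+ 2 + y ^+ 2 = r ^+ 2 ->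
  [/\ r * f 0 = x * g 0 - y * g 1, r * f 1 = y * g 0 + x * g 1 & f 2 = g 2] ->
  \sum_(i < 3) f i ^+ 2 = \sum_(i < 3) g i ^+ 2.
Proof.
move=> r0 e [e1 e2 e3]; rewrite !sum3 e3; congr (_ + _).
move: e1 e2; move: (f 0) (f 1) (g 0) (g 1) => a1 a2 a3 a4 e1 e2.
have r2 : r ^+ 2 != 0 by rewrite expf_neq0// gt_eqF.
apply: (mulfI r2); rewrite mulrDr -!exprMn e1 e2 -e; ring.
Qed.

Lemma sol_rot a b A (u : 'I_3 -> E -> R) p t x y h r : sol a b A u p -> a < t < b -> 0 < r ->
  x ^+ 2 + y ^+ 2 = r ^+ 2 ->
  \sum_(i < 3) u i (pt t x y h) ^+ 2 = \sum_(i < 3) u i (pt t r 0 h) ^+ 2.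
Proof.
move=> hs ht r0 e.
exact: (rot_sum (f := fun i => u i (pt t x y h)) (g := fun i => u i (pt t r 0 h)) r0 e (sol_ax hs h ht r0 e)).
Qed.

Lemma half_dist (x y d e : R) : d < `|x| -> `|y - x| <= e -> e <= d / 2 -> d / 2 <= `|y|.
Proof. have := lerB_dist x y; rewrite distrC; lra. Qed.

Lemma dist_pred (x y N : R) : N <= `|x| -> `|y - x| <= 1 -> N - 1 <= `|y|.
Proof. have := lerB_dist x y; rewrite distrC; lra. Qed.

(** If the bound fails, a selected point rescaled to magnitude 1 is at a distance from the axis
    larger than a multiple of A^3; the alternative in the hypothesis keeps one coordinate at least
    [r] on the whole cylinder. By [small_ctrl] a velocity above the absolute constant [d] occurs
    within distance 1, and the derivative bound keeps it above [d / 2] in a box of size [s]. Rotated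
    about the axis, this contradicts [sol_tube]. *)
Lemma far_bound n : exists k : nat, forall a b A u p z (r : R), 2 <= A -> sol a b A u p ->
  0 < r -> a < z.1 - r ^+ 2 -> z.1 < b -> (2 * r <= `|z.2 0 0|) \/ (2 * r <= `|z.2 0 1|) ->
  magn n.+1 u z * r <= A ^+ k.
Proof.
have [e e0 he] := @magn_small R n.+1.
(* The bound given by [ctrl_magn] at order [n + 1] for a magnitude at most 2. *)
pose B : R := 2 ^+ n.+3.
have B0 : 0 < B by exact: exprn_gt0.
have B1 : 1 <= B by rewrite exprn_ege1// ler1n.
have BE : B = 2 ^+ n.+3 by [].
clearbody B.
have [d d0 hd] := small_ctrl n B0 e0.
(* Over a box of size [s] the velocity varies by at most [3 * (B * s) <= d / 2]. *)
pose s := Num.min 1 (d / (6 * B)).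
have s0 : 0 < s by rewrite lt_min ltr01 divr_gt0// mulr_gt0.
have s1 : s <= 1 by rewrite ge_min lexx.
have sd : 3 * (B * s) <= d / 2.
  have : s <= d / (6 * B) by rewrite ge_min lexx orbT.
  rewrite ler_pdivlMr ?mulr_gt0//; move: (s) (B) => s' B' h.
  by have -> : 3 * (B' * s') = s' * (6 * B') / 2 by [field]; lra.
pose c : R := 64 / (d ^+ 3 * s ^+ 2).
have c0 : 0 < c by rewrite divr_gt0// mulr_gt0 ?exprn_gt0.
have [k hk] := exp2_bound (2 * c + 8).
exists (k + 3)%N => a b A u p z r A2 hs r0 az zb hr.
have A0 : 0 <= A by lra.
(* [c] is such that [(d / 2) ^+ 3 * (N - 1) * s ^+ 2] exceeds [8 * A ^+ 3]. *)
pose N := c * A ^+ 3 + 4.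
have A31 : 1 <= A ^+ 3 by rewrite exprn_ege1//; lra.
have N4 : 4 <= N by rewrite /N lerDr mulr_ge0// ?ltW//; lra.
have [N1 N3] : 1 <= N /\ 0 < N - 1 by split; lra.
have [sN s2N] : s + 1 <= N /\ 2 * s <= N - 1 by split; lra.
have NA : 2 * N <= A ^+ (k + 3).
  apply: le_trans (_ : (2 * c + 8) * A ^+ 3 <= _); first by rewrite /N; nra.
  rewrite exprD ler_wpM2r ?exprn_ge0//; apply: le_trans hk _.
  by rewrite lerXn2r ?nnegrE.
have NE : N = c * A ^+ 3 + 4 by [].
clearbody N; clear A31.
apply: le_trans NA; rewrite leNgt; apply/negP => hM.
have [z1 [Qz1 L0 hQ hL]] : exists z1, [/\ cyQ z r z1, 0 < magn n.+1 u z1,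
    forall z', cyQ z1 (N / magn n.+1 u z1) z' -> cyQ z r z' &
    forall z', cyQ z1 (N / magn n.+1 u z1) z' -> magn n.+1 u z' <= 2 * magn n.+1 u z1].
  apply: selection => //; [lra| |exact: ltW].
  move=> z' Qz'; split; last exact: magn_ge0.
  exact: (@magn_cont R n.+1 a b A u p z' hs (cyQ_slab az zb Qz')).
set L := magn n.+1 u z1 in L0 hQ hL.
have NL0 : 0 < N / L by rewrite divr_gt0//; lra.
have hbot : z.1 - r ^+ 2 <= z1.1 - (N / L) ^+ 2 /\ z1.1 <= z.1.
  split; last by case: Qz1 => /andP[].
  have [|/andP[]//] := hQ (z1.1 - (N / L) ^+ 2, z1.2).
  split=> [/=|i]; last by rewrite subrr normr0 ltW.
  by rewrite lexx gerBl sqr_ge0.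
have NLr : N / L <= r by rewrite -ler_sqr ?nnegrE; [case: hbot; lra|exact: ltW|exact: ltW].
have NrL : N <= r * L by rewrite -ler_pdivrMr.
pose l := L^-1; have l0 : 0 < l by rewrite invr_gt0.
pose T := sclmap z1.1 (z1.2 0 2) l.
pose v := usc z1.1 (z1.2 0 2) l u.
pose a' := (a - z1.1) / l ^+ 2; pose b' := (b - z1.1) / l ^+ 2.
have hv := sol_usc hs z1.1 (z1.2 0 2) l0; rewrite -/v -/a' -/b' in hv.
pose y1 := pt 0 (L * z1.2 0 0) (L * z1.2 0 1) 0.
have lL : l * L = 1 by rewrite mulVf// gt_eqF.
have Ty1 : T y1 = z1.
  by rewrite /T sclmap_pt !mulr0 !addr0 !mulrA lL !mul1r [RHS](ptE z1).
have a'N : a' < 0 - N ^+ 2.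
  rewrite /a' ltr_pdivrMr ?exprn_gt0// sub0r mulNr.
  have -> : N ^+ 2 * l ^+ 2 = (N / L) ^+ 2 by rewrite -exprMn.
  case: hbot => hb _; move: ((N / L) ^+ 2) hb => x hb; lra.
have b'0 : 0 < b' by rewrite divr_gt0 ?exprn_gt0// subr_gt0; apply: le_lt_trans zb; case: hbot.
have QT (q : R) y : 0 <= q -> cyQ y1 q y -> cyQ z1 (q / L) (T y).
  move=> q0 [h1 h2]; rewrite -Ty1; split=> [|i].
    move: h1; rewrite !sclmap1 /= => /andP[h1 h3].
    rewrite /l; have L2 : 0 < L^-1 ^+ 2 by rewrite exprn_gt0// invr_gt0.
    rewrite mulr0 addr0 gerDl pmulr_rle0// h3 andbT exprMn mulrC lerD2l -mulrN ler_pM2l//; lra.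
  rewrite !sclmap2 opprD addrACA subrr add0r -mulrBr normrM gtr0_norm// /l mulrC.
  by rewrite ler_wpM2r ?invr_ge0 ?(ltW L0)//; exact: h2.
have S' (q : R) y : 0 <= q -> q <= N -> cyQ y1 q y -> slab a' b' y.
  move=> q0 qN [/andP[h1 h3] _]; apply/andP; split; last exact: le_lt_trans b'0.
  apply: lt_le_trans a'N (le_trans _ h1); rewrite lerD2l lerN2 ler_sqr ?nnegrE//; lra.
have hMv y : cyQ y1 N y -> magn n.+1 v y <= 2.
  move=> Qy; rewrite (magn_usc _ _ hs l0 (S' N y _ (lexx _) Qy)); last by lra.
  rewrite /l mulrC ler_pdivrMr//; apply: hL; apply: QT => //; lra.
have hcv y : cyQ y1 N y -> ctrl n.+1 B v y.
  by move=> /hMv h; rewrite BE; apply: (ctrl_magn (L := 2)) => //; lra.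
have hMv1 : magn n.+1 v y1 = 1.
  rewrite (magn_usc _ _ hs l0 (S' 0 y1 _ _ _)) ?lexx//; last by apply: cyQ_refl.
    by rewrite -/T Ty1 -/L.
  by lra.
clear hM hQ hL hMv hk hbot NLr.
have Q1N y : cyQ y1 1 y -> cyQ y1 N y by exact: cyQ_sub.
have [y2 [i [Qy2 hy2]]] : exists y2 i, cyQ y1 1 y2 /\ d < `|v i y2|.
  apply: contrapT => hn.
  have : magn n.+1 v y1 < 1.
    apply: he; apply: (hd a' b' A v _ hv y1) => //=.
    - by apply: lt_le_trans a'N _; rewrite lerD2l lerN2 exprn_ege1//.
    - by move=> y Qy; apply: hcv; exact: Q1N.
    - move=> y i Qy; rewrite leNgt; apply/negP => hy; apply: hn; by exists y, i.
  by rewrite hMv1 ltxx.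
clear Ty1 hMv1 QT BE.
have [/andP[t1 t2] x12] := Qy2.
rewrite expr1n /= sub0r in t1; rewrite /= in t2.
have ht2 : a' < y2.1 < b' by apply: (S' 1 y2) => //; lra.
pose X := y2.2 0 0; pose Y := y2.2 0 1; pose H := y2.2 0 2.
pose r2 := rt 1 (X ^+ 2 + Y ^+ 2).
have r2E : r2 ^+ 2 = X ^+ 2 + Y ^+ 2 by rewrite rtK ger0_norm// addr_ge0// sqr_ge0.
have r20 : 0 <= r2 by exact: rt_ge0.
have hc j : y1.2 0 j = L * z1.2 0 j -> 2 * r <= `|z.2 0 j| -> N - 1 <= `|y2.2 0 j|.
  move=> e1 e2; have e3 : r <= `|z1.2 0 j|.
    have [_ /(_ j)] := Qz1; have := lerB_dist (z.2 0 j) (z1.2 0 j); rewrite distrC; lra.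
  have e4 : N <= `|y1.2 0 j|.
    rewrite e1 normrM gtr0_norm//; apply: le_trans NrL _; rewrite mulrC ler_pM2l//.
  exact: dist_pred e4 (x12 j).
have r2N : N - 1 <= r2.
  rewrite -ler_sqr ?nnegrE// ?(ltW N3)//.
  rewrite r2E; case: hr => hr.
    have := hc 0 (pt0 _ _ _ _) hr; rewrite -/X => h.
    apply: le_trans (_ : X ^+ 2 <= _); last by rewrite lerDl sqr_ge0.
    by rewrite -[X ^+ 2]real_normK ?num_real// ler_sqr ?nnegrE// ltW.
  have := hc 1 (pt1 _ _ _ _) hr; rewrite -/Y => h.
  apply: le_trans (_ : Y ^+ 2 <= _); last by rewrite lerDr sqr_ge0.
  by rewrite -[Y ^+ 2]real_normK ?num_real// ler_sqr ?nnegrE// ltW.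
have d20 : 0 < d / 2 by rewrite divr_gt0.
have := sol_tube hv (t := y2.1) (r0 := r2) (h0 := H) (s := s) (l := d / 2) ht2 s0 _ d20.
have r2s : 2 * s <= r2 := le_trans s2N r2N.
move=> /(_ r2s) htube.
have : (d / 2) ^+ 3 * r2 * s ^+ 2 <= 8 * A ^+ 3.
  apply: htube => r' h' hr' hh'.
  have r'0 : 0 < r' by move: hr'; rewrite ler_norml; lra.
  have r2p : 0 < r2 := lt_le_trans N3 r2N.
  pose q := r' / r2.
  have e1 : (q * X) ^+ 2 + (q * Y) ^+ 2 = r' ^+ 2.
    by rewrite !exprMn -mulrDr -r2E /q; field; rewrite gt_eqF.
  rewrite -(sol_rot h' hv ht2 r'0 e1).
  set z' := pt y2.1 (q * X) (q * Y) h'.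
  have qX W : `|W| <= r2 -> `|q * W - W| <= s.
    move=> hW; have -> : q * W - W = (r' - r2) * (W / r2) by rewrite /q; field; rewrite gt_eqF.
    rewrite normrM -[s]mulr1; apply: ler_pM => //.
    by rewrite normrM [`|r2^-1|]gtr0_norm ?invr_gt0// ler_pdivrMr// mul1r.
  have Xr : `|X| <= r2.
    by rewrite -ler_sqr ?nnegrE// real_normK ?num_real// r2E lerDl sqr_ge0.
  have Yr : `|Y| <= r2.
    by rewrite -ler_sqr ?nnegrE// real_normK ?num_real// r2E lerDr sqr_ge0.
  have hz' j : `|z'.2 0 j - y2.2 0 j| <= s.
    by move: j; apply: I3P; rewrite ?pt0 ?pt1 ?pt2; [exact: qX|exact: qX|exact: hh'].
  have hlip : `|v i z' - v i y2| <= 3 * (B * s).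
    apply: (lipschitz_box (sol_u hv i) ht2 (s := s)) => // j y yt yx.
    suff Qy : cyQ y1 N y by have := (hcv y Qy).1 [:: j] i isT.
    split=> [/=|j'].
      rewrite yt t2 andbT sub0r; apply: le_trans t1; rewrite lerN2 exprn_ege1//.
    rewrite (_ : y.2 0 j' - _ = (y.2 0 j' - y2.2 0 j') + (y2.2 0 j' - y1.2 0 j')); last by rewrite subrKA.
    apply: le_trans (ler_normD _ _) _; exact: le_trans (lerD (yx j') (x12 j')) sN.
  have hvi : d / 2 <= `|v i z'|.
    exact: half_dist hy2 hlip sd.
  apply: le_trans (_ : v i z' ^+ 2 <= _).
    by rewrite -[leRHS]real_normK ?num_real// ler_sqr ?nnegrE// ltW.
  by rewrite (bigD1 i)//= lerDl sumr_ge0// => *; exact: sqr_ge0.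
apply/negP; rewrite -ltNge.
have ds0 : 0 < d ^+ 3 * s ^+ 2 by rewrite mulr_gt0 ?exprn_gt0.
have cE : c * (d ^+ 3 * s ^+ 2) = 64 by rewrite divfK// gt_eqF.
apply: lt_le_trans (_ : (d ^+ 3 * s ^+ 2) / 8 * (N - 1) <= _).
  have -> : d ^+ 3 * s ^+ 2 / 8 * (N - 1) = (c * (d ^+ 3 * s ^+ 2)) / 8 * A ^+ 3 + 3 / 8 * (d ^+ 3 * s ^+ 2).
    by rewrite NE; ring.
  by rewrite cE; have : 64 / 8 = 8 :> R by [field]; move=> ->; rewrite ltrDl mulr_gt0.
have -> : (d / 2) ^+ 3 * r2 * s ^+ 2 = d ^+ 3 * s ^+ 2 / 8 * r2 by field.
by rewrite ler_wpM2l// divr_ge0// ltW.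
Qed.

End FarEstimate.

(** * The equations on the half-plane [y = 0] *)

Section Chains.
Context {R : realType}.
Implicit Types (f g : R -> R) (x r : R).

Fixpoint dchain (n : nat) f : Prop :=
  if n is m.+1 then exists f', (forall x, 0 < x -> dR f x (f' x)) /\ dchain m f' else True.

Lemma dchain_le n m f : (n <= m)%N -> dchain m f -> dchain n f.
Proof.
elim: n m f => [//|n IH] [//|m] f nm [f' [h1 h2]]; exists f'; split => //.
exact: IH h2.
Qed.

Lemma dchainD n f g : dchain n f -> dchain n g -> dchain n (fun x => f x + g x).
Proof.
elim: n f g => [//|n IH] f g [f' [h1 h2]] [g' [h3 h4]].
exists (fun x => f' x + g' x); split; last exact: IH.
by move=> x x0; apply: dRD; [exact: h1|exact: h3].
Qed.

Lemma dchainM n f g : dchain n f -> dchain n g -> dchain n (fun x => f x * g x).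
Proof.
elim: n f g => [//|n IH] f g hf hg; have [f' [h1 h2]] := hf; have [g' [h3 h4]] := hg.
exists (fun x => f' x * g x + f x * g' x); split.
  by move=> x x0; apply: dRM; [exact: h1|exact: h3].
by apply: dchainD; apply: IH => //; exact: dchain_le (leqnSn n) _.
Qed.

Lemma dchainC n (c : R) : dchain n (fun=> c).
Proof. by elim: n c => [//|n IH] c; exists (fun=> 0); split => // x _; exact: dRc. Qed.

Lemma dchainN n f : dchain n f -> dchain n (fun x => - f x).
Proof.
elim: n f => [//|n IH] f [f' [h1 h2]]; exists (fun x => - f' x); split; last exact: IH.
by move=> x x0; apply: dRN; exact: h1.
Qed.

Lemma dchainV n : dchain n (fun x => x^-1).
Proof.
elim: n => [//|n IH]; exists (fun x => - (x^-1 * x^-1)); split; last first.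
  by apply: dchainN; exact: dchainM.
move=> x x0; have := @dRV R (fun s => s) x 1 (lt0r_neq0 x0) (dRid x).
by move=> h; apply: (dRe h); field; exact: lt0r_neq0.
Qed.

Let rho r y : R := Num.sqrt (r ^+ 2 + y ^+ 2).

Let rho_gt0 r y : 0 < r -> 0 < rho r y.
Proof. by move=> r0; rewrite sqrtr_gt0 ltr_wpDr ?sqr_ge0// exprn_gt0. Qed.

Let dR_rho r y : 0 < r -> dR (rho r) y (y / rho r y).
Proof.
move=> r0; have p0 : 0 < r ^+ 2 + y ^+ 2 by rewrite ltr_wpDr ?sqr_ge0// exprn_gt0.
have h1 : dR (fun y : R => r ^+ 2 + y ^+ 2) y (2 * y) by dR_auto; ring.
have h2 : dR Num.sqrt (r ^+ 2 + y ^+ 2) (2 * Num.sqrt (r ^+ 2 + y ^+ 2))^-1 by exact: is_derive1_sqrt.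
have h3 := dRcomp h1 h2; apply: (dRe h3); rewrite -/(rho r y); field.
exact: lt0r_neq0 (rho_gt0 y r0).
Qed.

(** The derivative in [y] of a radial function [k] is [y] times the radial function [k' / x], so the
    process can be repeated. *)
Let dR_radial n k r : 0 < r -> dchain n.+1 k -> exists k1, [/\ dchain n k1,
   forall y, dR (fun y => k (rho r y)) y (y * k1 (rho r y)) & forall x, 0 < x -> dR k x (x * k1 x)].
Proof.
move=> r0 [k' [h1 h2]]; exists (fun x => k' x * x^-1); split.
- by apply: dchainM => //; exact: dchainV.
- move=> y; have := dRcomp (dR_rho y r0) (h1 _ (rho_gt0 y r0)) => h; apply: (dRe h); ring.
- move=> x x0; apply: (dRe (h1 x x0)); field; exact: lt0r_neq0.
Qed.

(** The Cartesian components of an axisymmetric field have the form [r * A - y * B] with [A] and [B]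
    radial. Repeated use of [dR_radial] leaves at [y = 0] only the terms without a factor [y]. *)
Lemma dR_axisym (g0 g1 g2 A B : R -> R) r (g3 a1 b1 : R) : 0 < r -> dchain 3 A -> dchain 3 B ->
  (forall y, g0 y = r * A (Num.sqrt (r ^+ 2 + y ^+ 2)) - y * B (Num.sqrt (r ^+ 2 + y ^+ 2))) ->
  (forall y, dR g0 y (g1 y)) -> (forall y, dR g1 y (g2 y)) -> dR g2 0 g3 ->
  dR A r a1 -> dR B r b1 ->
  [/\ g1 0 = - B r, g2 0 = a1 & g3 = - 3 * b1 / r].
Proof.
move=> r0 cA cB e0 d0 d1 d2 hA hB.
have [A1 [cA1 dA eA]] := dR_radial r0 cA; have [B1 [cB1 dB eB]] := dR_radial r0 cB.
have [A2 [cA2 dA1 _]] := dR_radial r0 cA1; have [B2 [cB2 dB1 _]] := dR_radial r0 cB1.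
have [A3 [_ dA2 _]] := dR_radial r0 cA2; have [B3 [_ dB2 _]] := dR_radial r0 cB2.
have rho0 : rho r 0 = r by rewrite /rho expr0n addr0 sqrtr_sqr gtr0_norm.
have eg1 : g1 = fun y => r * (y * A1 (rho r y)) - B (rho r y) - y * (y * B1 (rho r y)).
  apply/funext => y; have h := d0 y.
  have h' : dR g0 y (r * (y * A1 (rho r y)) - B (rho r y) - y * (y * B1 (rho r y))).
    have -> : g0 = fun y => r * A (rho r y) - y * B (rho r y) by apply/funext => y'; exact: e0.
    have h1 := dA y; have h2 := dB y.
    by dR_auto; ring.
  exact: dR_uniq h h'.
have eg2 : g2 = fun y => r * A1 (rho r y) + r * (y * (y * A2 (rho r y))) - 3 * (y * B1 (rho r y)) - y * (y * (y * B2 (rho r y))).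
  apply/funext => y; have h := d1 y.
  have h' : dR g1 y (r * A1 (rho r y) + r * (y * (y * A2 (rho r y))) - 3 * (y * B1 (rho r y)) - y * (y * (y * B2 (rho r y)))).
    rewrite eg1; have h1 := dA1 y; have h2 := dB1 y; have h3 := dB y.
    by dR_auto; ring.
  exact: dR_uniq h h'.
have h3 : dR g2 0 (- 3 * B1 (rho r 0)).
  rewrite eg2; have h1 := dA1 0; have h2 := dB1 0; have h3 := dA2 0; have h4 := dB2 0.
  by dR_auto; ring.
have := dR_uniq (eA r r0) hA; have := dR_uniq (eB r r0) hB => eb ea.
split.
- by rewrite eg1 rho0; ring.
- by rewrite eg2 rho0 -ea; ring.
- rewrite (dR_uniq d2 h3) rho0 -eb; field; exact: lt0r_neq0.
Qed.

End Chains.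

Section Plane.
Context {R : realType}.
Local Notation E := (R * 'rV[R]_3)%type.
Implicit Types (z : E) (i j k : 'I_3) (F : E -> R) (t x y h r : R).

Lemma shift_pt0 s t x y h : s *: dirv (Some 0) + pt t x y h = pt t (s + x) y h.
Proof.
apply: E_eq; first by rewrite shift1 dcoSN mulr0 add0r.
by apply: I3P; rewrite shift2 dco_diag ?pt0 ?pt1 ?pt2 /=; ring.
Qed.
Lemma shift_pt1 s t x y h : s *: dirv (Some 1) + pt t x y h = pt t x (s + y) h.
Proof.
apply: E_eq; first by rewrite shift1 dcoSN mulr0 add0r.
by apply: I3P; rewrite shift2 dco_diag ?pt0 ?pt1 ?pt2 /=; ring.
Qed.
Lemma shift_pt2 s t x y h : s *: dirv (Some 2) + pt t x y h = pt t x y (s + h).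
Proof.
apply: E_eq; first by rewrite shift1 dcoSN mulr0 add0r.
by apply: I3P; rewrite shift2 dco_diag ?pt0 ?pt1 ?pt2 /=; ring.
Qed.
Lemma shift_ptN s t x y h : s *: dirv None + pt t x y h = pt (s + t) x y h.
Proof.
apply: E_eq; first by rewrite shift1 dcoNN mulr1.
by apply: I3P; rewrite shift2 dcoNS ?pt0 ?pt1 ?pt2 /=; ring.
Qed.

Variables (a b : R).
Let U := slab a b.

Lemma dR_from0 (f : R -> R) x d : dR (fun s => f (s + x)) 0 d -> dR f x d.
Proof.
move=> h; have h1 : dR (fun s : R => s - x) x 1 by dR_auto; ring.
rewrite -(subrr x) in h; have h2 := dRcomp h1 h; rewrite mulr1 in h2.
by have <- : (fun s : R => f (s - x + x)) = f by apply/funext => s; rewrite subrK.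
Qed.

Lemma dR_t F t x y h : smf U F -> a < t < b -> dR (fun t => F (pt t x y h)) t (pd None F (pt t x y h)).
Proof.
move=> sF ht; apply: (dR_from0 (f := fun t => F (pt t x y h))).
have := smf_slice0 None sF (ht : U (pt t x y h)).
by have -> : (fun s => F (s *: dirv None + pt t x y h)) = (fun s => F (pt (s + t) x y h)) by apply/funext => s; rewrite shift_ptN.
Qed.
Lemma dR_x F t x y h : smf U F -> a < t < b -> dR (fun x => F (pt t x y h)) x (pd (Some 0) F (pt t x y h)).
Proof.
move=> sF ht; apply: (dR_from0 (f := fun x => F (pt t x y h))).
have := smf_slice0 (Some 0) sF (ht : U (pt t x y h)).
by have -> : (fun s => F (s *: dirv (Some 0) + pt t x y h)) = (fun s => F (pt t (s + x) y h)) by apply/funext => s; rewrite shift_pt0.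
Qed.
Lemma dR_y F t x y h : smf U F -> a < t < b -> dR (fun y => F (pt t x y h)) y (pd (Some 1) F (pt t x y h)).
Proof.
move=> sF ht; apply: (dR_from0 (f := fun y => F (pt t x y h))).
have := smf_slice0 (Some 1) sF (ht : U (pt t x y h)).
by have -> : (fun s => F (s *: dirv (Some 1) + pt t x y h)) = (fun s => F (pt t x (s + y) h)) by apply/funext => s; rewrite shift_pt1.
Qed.
Lemma dR_h F t x y h : smf U F -> a < t < b -> dR (fun h => F (pt t x y h)) h (pd (Some 2) F (pt t x y h)).
Proof.
move=> sF ht; apply: (dR_from0 (f := fun h => F (pt t x y h))).
have := smf_slice0 (Some 2) sF (ht : U (pt t x y h)).
by have -> : (fun s => F (s *: dirv (Some 2) + pt t x y h)) = (fun s => F (pt t x y (s + h))) by apply/funext => s; rewrite shift_pt2.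
Qed.

Lemma dchain_plane n F t h : smf U F -> a < t < b -> dchain n (fun x => F (pt t x 0 h)).
Proof.
move=> sF ht; elim: n F sF => [//|n IH] F sF; exists (fun x => pd (Some 0) F (pt t x 0 h)).
by split; [move=> x _; exact: dR_x|apply: IH; exact: smf_pd].
Qed.

Lemma axisym_derivs F t h r (A B : R -> R) (a1 b1 : R) : smf U F -> a < t < b -> 0 < r ->
  dchain 3 A -> dchain 3 B ->
  (forall y, F (pt t r y h) = r * A (Num.sqrt (r ^+ 2 + y ^+ 2)) - y * B (Num.sqrt (r ^+ 2 + y ^+ 2))) ->
  dR A r a1 -> dR B r b1 ->
  [/\ pd (Some 1) F (pt t r 0 h) = - B r, pd (Some 1) (pd (Some 1) F) (pt t r 0 h) = a1 &
      pd (Some 1) (pd (Some 1) (pd (Some 1) F)) (pt t r 0 h) = - 3 * b1 / r].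
Proof.
move=> sF ht r0 cA cB e hA hB; have s1 := smf_pd (Some 1) sF; have s2 := smf_pd (Some 1) s1.
apply: (@dR_axisym R _ (fun y => pd (Some 1) F (pt t r y h)) (fun y => pd (Some 1) (pd (Some 1) F) (pt t r y h))
  A B r _ a1 b1 r0 cA cB e _ _ _ hA hB) => [y|y|].
- exact: dR_y.
- exact: dR_y.
- exact: dR_y.
Qed.

Variables (A : R) (u : 'I_3 -> E -> R) (p : E -> R).
Hypothesis hs : sol a b A u p.
Let su i : smf U (u i). Proof. exact: (sol_u hs). Qed.
Let oU : open U. Proof. exact: slab_open. Qed.

(** The third component is radial itself; it is fitted to the common form by the constant
    denominator [r] in [A] and by [B = 0]. *)
Let ax y t r h : a < t < b -> 0 < r -> let rho := Num.sqrt (r ^+ 2 + y ^+ 2) in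
  [/\ u 0 (pt t r y h) = r * (u 0 (pt t rho 0 h) / rho) - y * (u 1 (pt t rho 0 h) / rho),
      u 1 (pt t r y h) = r * (u 1 (pt t rho 0 h) / rho) - y * (- (u 0 (pt t rho 0 h) / rho)) &
      u 2 (pt t r y h) = r * (u 2 (pt t rho 0 h) / r) - y * 0].
Proof.
move=> ht r0 rho; have r20 : 0 < r ^+ 2 + y ^+ 2 by rewrite ltr_wpDr ?sqr_ge0// exprn_gt0.
have rho0 : 0 < rho by rewrite sqrtr_gt0.
have rhoE : r ^+ 2 + y ^+ 2 = rho ^+ 2 by rewrite sqr_sqrtr// ltW.
have [e1 e2 e3] := sol_ax hs h ht rho0 rhoE.
have rn : rho != 0 by rewrite gt_eqF.
split; last by rewrite e3; field; rewrite gt_eqF.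
  by apply: (mulfI rn); rewrite e1; field.
by apply: (mulfI rn); rewrite e2; field.
Qed.

Section AtPoint.
Variables (t r h : R).
Hypotheses (ht : a < t < b) (r0 : 0 < r).
Local Notation P := (pt t r 0 h).
Let rn : r != 0. Proof. by rewrite gt_eqF. Qed.

Let dRdiv F s (s0 : s != 0) : smf U F -> dR (fun x => F (pt t x 0 h) / x) s
  (pd (Some 0) F (pt t s 0 h) / s - F (pt t s 0 h) / s ^+ 2).
Proof.
move=> sF; have h1 := dR_x s 0 h sF ht; have h2 := @dRV R (fun s => s) s 1 s0 (dRid s).
by apply: dRe; [exact: (dRM h1 h2)|cbv beta; field].
Qed.

Lemma u0_derivs : [/\ pd (Some 1) (u 0) P = - (u 1 P / r),
  pd (Some 1) (pd (Some 1) (u 0)) P = pd (Some 0) (u 0) P / r - u 0 P / r ^+ 2 &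
  pd (Some 1) (pd (Some 1) (pd (Some 1) (u 0))) P = - 3 * (pd (Some 0) (u 1) P / r - u 1 P / r ^+ 2) / r].
Proof.
apply: (@axisym_derivs _ t h r (fun x => u 0 (pt t x 0 h) / x) (fun x => u 1 (pt t x 0 h) / x)) => //.
- by apply: dchainM; [exact: dchain_plane|exact: dchainV].
- by apply: dchainM; [exact: dchain_plane|exact: dchainV].
- by move=> y; have [] := ax y h ht r0.
- exact: dRdiv.
- exact: dRdiv.
Qed.

Lemma u1_derivs : pd (Some 1) (u 1) P = u 0 P / r /\
  pd (Some 1) (pd (Some 1) (u 1)) P = pd (Some 0) (u 1) P / r - u 1 P / r ^+ 2.
Proof.
have [|||||e1 e2 _] := @axisym_derivs (u 1) t h r (fun x => u 1 (pt t x 0 h) / x) (fun x => - (u 0 (pt t x 0 h) / x))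
  (pd (Some 0) (u 1) P / r - u 1 P / r ^+ 2) (- (pd (Some 0) (u 0) P / r - u 0 P / r ^+ 2)) (su 1) ht r0.
- by apply: dchainM; [exact: dchain_plane|exact: dchainV].
- by apply: dchainN; apply: dchainM; [exact: dchain_plane|exact: dchainV].
- by move=> y; have [] := ax y h ht r0.
- exact: dRdiv.
- by apply: dRN; exact: dRdiv.
by rewrite e1 opprK.
Qed.

Lemma u2_derivs : pd (Some 1) (u 2) P = 0 /\
  pd (Some 1) (pd (Some 1) (u 2)) P = pd (Some 0) (u 2) P / r.
Proof.
have [|||||e1 e2 _] := @axisym_derivs (u 2) t h r (fun x => u 2 (pt t x 0 h) / r) (fun x => 0)
  (pd (Some 0) (u 2) P / r) 0 (su 2) ht r0.
- by apply: dchainM; [exact: dchain_plane|exact: dchainC].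
- exact: dchainC.
- by move=> y; have [] := ax y h ht r0.
- have h1 := dR_x r 0 h (su 2) ht; apply: dRe; first by apply: dRM; [exact: h1|exact: dRc].
  by rewrite mulr0 addr0.
- exact: dRc.
by rewrite e1 oppr0.
Qed.

End AtPoint.

End Plane.

Lemma om_arith (R : realType) (r u0x v0 v1 v2 u0h u2x u1h u1x o1 o2 o3 o4 o5 : R) :
  o1 - (o3 + (o2 / r - (u0h - u2x) / r ^+ 2) + o5) =
  - (v0 * o2 + (u0h * u0x - u0x * u2x) + (v1 * - (u1h / r) + (u1h * - (v1 / r) - u1x * 0))
     + (v2 * o4 + ((- u0x - v0 / r) * u0h - u2x * (- u0x - v0 / r)))) ->
  o1 + v0 * o2 + v2 * o4 - v0 / r * (u0h - u2x) =
  o3 + o2 / r - (u0h - u2x) / r ^+ 2 + o5 + 2 * (v1 / r) * u1h.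
Proof. by move/eqP; rewrite subr_eq => /eqP ->; ring. Qed.

Section PlaneEquations.
Context {R : realType}.
Local Notation E := (R * 'rV[R]_3)%type.
Implicit Types (z : E) (i j k : 'I_3) (F : E -> R) (t x y h r : R).

Lemma dR_eq_on (e : R) (f g : R -> R) x d : 0 < e ->
  (forall s, `|s - x| < e -> f s = g s) -> dR f x d -> dR g x d.
Proof.
move=> e0 fg; apply: dR_near; exists e => //= s; rewrite /ball_/= distrC; exact: fg.
Qed.

Lemma dist_pos (r s : R) : 0 < r -> `|s - r| < r -> 0 < s.
Proof. by move=> r0; rewrite ltr_norml; lra. Qed.

Variables (a b A : R) (u : 'I_3 -> E -> R) (p : E -> R).
Hypothesis hs : sol a b A u p.
Let U := slab a b.
Let su i : smf U (u i). Proof. exact: (sol_u hs). Qed.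
Let oU : open U. Proof. exact: slab_open. Qed.
Local Notation "u ^t" := (pd None u) (at level 2, format "u ^t").
Local Notation "u ^x" := (pd (Some 0) u) (at level 2, format "u ^x").
Local Notation "u ^y" := (pd (Some 1) u) (at level 2, format "u ^y").
Local Notation "u ^h" := (pd (Some 2) u) (at level 2, format "u ^h").

Section AtPoint.
Variables (t r h : R).
Hypotheses (ht : a < t < b) (r0 : 0 < r).
Local Notation P := (pt t r 0 h).
Let UP : U P. Proof. exact: ht. Qed.
Let rn : r != 0. Proof. by rewrite gt_eqF. Qed.

Let plane_t F (f : R -> R) d : smf U F -> (forall t', a < t' < b -> F (pt t' r 0 h) = f t') ->
  dR f t d -> pd None F P = d.
Proof.
move=> sF e df; apply: dR_uniq (df); have e0 : 0 < Num.min (t - a) (b - t) by rewrite lt_min !subr_gt0.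
apply: (dR_eq_on e0 _ (dR_t r 0 h sF ht)) => s; rewrite lt_min !ltr_norml => hsx.
by apply: e; apply/andP; lra.
Qed.
Let plane_x F (f : R -> R) d : smf U F -> (forall x, 0 < x -> F (pt t x 0 h) = f x) ->
  dR f r d -> pd (Some 0) F P = d.
Proof.
move=> sF e df; apply: dR_uniq (df).
apply: (dR_eq_on r0 _ (dR_x r 0 h sF ht)) => s; rewrite ltr_norml => hsx.
by apply: e; lra.
Qed.
Let plane_h F (f : R -> R) d : smf U F -> (forall h', F (pt t r 0 h') = f h') ->
  dR f h d -> pd (Some 2) F P = d.
Proof.
move=> sF e df; apply: dR_uniq (df).
by apply: (dR_eq_on r0 _ (dR_h r 0 h sF ht)) => s _.
Qed.

Lemma dR_overx F (s : R) (s0 : s != 0) : smf U F -> dR (fun x => F (pt t x 0 h) / x) s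
  (pd (Some 0) F (pt t s 0 h) / s - F (pt t s 0 h) / s ^+ 2).
Proof.
move=> sF; have h1 := dR_x s 0 h sF ht; have h2 := @dRV R (fun s => s) s 1 s0 (dRid s).
by apply: dRe; [exact: (dRM h1 h2)|cbv beta; field].
Qed.
Let dRdiv2 F (s : R) (s0 : s != 0) : smf U F -> dR (fun x => F (pt t x 0 h) / x ^+ 2) s
  (pd (Some 0) F (pt t s 0 h) / s ^+ 2 - 2 * F (pt t s 0 h) / s ^+ 3).
Proof.
move=> sF; have h1 := dR_x s 0 h sF ht.
have h2 : dR (fun s : R => s ^+ 2) s (2 * s) by dR_auto; ring.
have s2 : s ^+ 2 != 0 by rewrite expf_neq0.
have h3 := @dRV R (fun s => s ^+ 2) s (2 * s) s2 h2.
by apply: dRe; [exact: (dRM h1 h3)|cbv beta; field].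
Qed.

Let y0t : (u 0)^y^t P = - ((u 1)^t P / r).
Proof.
apply: (plane_t (f := fun t => - (u 1 (pt t r 0 h) / r))); first exact: smf_pd.
  by move=> t' ht'; have [] := u0_derivs hs h ht' r0.
have h1 := dR_t r 0 h (su 1) ht; by dR_auto; ring.
Qed.
Let y0x x : 0 < x -> (u 0)^y^x (pt t x 0 h) = - ((u 1)^x (pt t x 0 h) / x - u 1 (pt t x 0 h) / x ^+ 2).
Proof.
move=> x0; apply: dR_uniq (dR_x x 0 h (smf_pd (Some 1) (su 0)) ht) _.
apply: (dR_eq_on x0 (f := fun x => - (u 1 (pt t x 0 h) / x))).
  move=> s /(dist_pos x0) s0.
  by have [] := u0_derivs hs h ht s0.
by apply: dRN; apply: dR_overx => //; rewrite gt_eqF.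
Qed.
Let y0xx : (u 0)^y^x^x P = - ((u 1)^x^x P / r - 2 * (u 1)^x P / r ^+ 2 + 2 * u 1 P / r ^+ 3).
Proof.
apply: (plane_x (f := fun x => - ((u 1)^x (pt t x 0 h) / x - u 1 (pt t x 0 h) / x ^+ 2))).
- by do 2 apply: smf_pd.
- by move=> x x0; exact: y0x.
have h1 := dR_overx rn (smf_pd (Some 0) (su 1)); have h2 := dRdiv2 rn (su 1).
by dR_auto; field.
Qed.
Lemma u0_yh h' : (u 0)^y^h (pt t r 0 h') = - ((u 1)^h (pt t r 0 h') / r).
Proof.
apply: dR_uniq (dR_h r 0 h' (smf_pd (Some 1) (su 0)) ht) _.
apply: (dR_eq_on r0 (f := fun h => - (u 1 (pt t r 0 h) / r))).
  by move=> s _; have [] := u0_derivs hs s ht r0.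
have h1 := dR_h r 0 h' (su 1) ht; by dR_auto; ring.
Qed.
Let y0hh : (u 0)^y^h^h P = - ((u 1)^h^h P / r).
Proof.
apply: (plane_h (f := fun h => - ((u 1)^h (pt t r 0 h) / r))); first by do 2 apply: smf_pd.
  exact: u0_yh.
have h1 := dR_h r 0 h (smf_pd (Some 2) (su 1)) ht; by dR_auto; ring.
Qed.

Lemma lap3 F z : lap F z = F^x^x z + F^y^y z + F^h^h z.
Proof. exact: sum3. Qed.

Let eq1 : (u 1)^t P - ((u 1)^x^x P + ((u 1)^x P / r - u 1 P / r ^+ 2) + (u 1)^h^h P)
  + (u 0 P * (u 1)^x P + u 1 P * (u 0 P / r) + u 2 P * (u 1)^h P) + p^y P = 0.
Proof.
have [e1 e2] := u1_derivs hs h ht r0.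
by have := sol_ns hs 1 UP; rewrite lap3 sum3 e1 e2.
Qed.

(* The radial derivative of the pressure is minus the radial part [G] of the
   other terms, and axial symmetry makes [G^y] proportional to the angular part. *)
Lemma pressure_radial : p^y P + r * p^y^x P = 0.
Proof.
have [e1 e2 e3] := u0_derivs hs h ht r0; have [f1 f2] := u1_derivs hs h ht r0; have [g1 g2] := u2_derivs hs h ht r0.
rewrite (pdC (Some 1) (Some 0) oU (sol_p hs) UP).
pose G z := (u 0)^t z - lap (u 0) z + \sum_(i < 3) u i z * pd (Some i) (u 0) z.
have sA i : smf U (fun z => u i z * pd (Some i) (u 0) z) by exact: (smfM oU (su i) (smf_pd _ (su 0))).
have sS : smf U (fun z => \sum_(i < 3) u i z * pd (Some i) (u 0) z) by exact: (smf_sum _ oU sA).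
have sL := smf_lap oU (su 0); have sT := smf_pd None (su 0).
have sG : smf U G by exact: (smfD oU (smfB oU sT sL) sS).
have hp : p^x^y P = - G^y P.
  rewrite -(pdN _ sG UP); apply: (pd_eq _ oU _ UP) => z Uz.
  have := sol_ns hs 0 Uz; rewrite -/(G z) => h1; apply/eqP; rewrite -addr_eq0 addrC; exact/eqP.
have hG : G^y P = (u 0)^y^t P - ((u 0)^y^x^x P + (u 0)^y^y^y P + (u 0)^y^h^h P)
   + ((u 0)^y P * (u 0)^x P + u 0 P * (u 0)^y^x P
     + ((u 1)^y P * (u 0)^y P + u 1 P * (u 0)^y^y P)
     + ((u 2)^y P * (u 0)^h P + u 2 P * (u 0)^y^h P)).
  rewrite (pdD _ (smfB oU sT sL) sS UP) (pdB _ sT sL UP) (pd_sum _ _ oU sA UP).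
  rewrite (pd_lap _ oU (su 0) UP) lap3 (pdC None (Some 1) oU (su 0) UP).
  have hk i : pd (Some 1) (fun z => u i z * pd (Some i) (u 0) z) P =
      (u i)^y P * pd (Some i) (u 0) P + u i P * pd (Some i) ((u 0)^y) P.
    by rewrite (pdM (Some 1) (su i) (smf_pd (Some i) (su 0)) UP) (pdC (Some i) (Some 1) oU (su 0) UP).
  by congr (_ + _); rewrite big_seq_cond big_mkcond /=; under eq_bigr do rewrite mem_index_enum hk; rewrite sum3.
rewrite hp hG y0t y0xx e3 y0hh e1 (y0x r0) f1 e2 g1 u0_yh.
have := eq1; move: (p^y P) (u 0 P) (u 1 P) (u 2 P) => p1 v0 v1 v2.
move: ((u 1)^t P) ((u 1)^x^x P) ((u 1)^h^h P) ((u 1)^x P) ((u 1)^h P) ((u 0)^x P) ((u 0)^h P) => w1 w2 w3 w4 w5 w6 w7.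
move=> /eqP; rewrite addrC addr_eq0 => /eqP ->; field.
exact: rn.
Qed.
End AtPoint.

(** By [pressure_radial] the function [x * p^y] has zero derivative for x > 0, and it vanishes on
    the axis. This is axial symmetry of the pressure, deduced from that of the velocity. *)
Lemma pressure_angular t r h : a < t < b -> 0 < r -> p^y (pt t r 0 h) = 0.
Proof.
move=> ht r0.
have [|c /andP[c0 cr]] := @dR_MVT R (fun x => x * p^y (pt t x 0 h))
   (fun x => p^y (pt t x 0 h) + x * p^y^x (pt t x 0 h)) 0 r r0.
  move=> x _; have h1 := dR_x x 0 h (smf_pd (Some 1) (sol_p hs)) ht.
  by dR_auto; ring.
rewrite mul0r !subr0 (pressure_radial h ht c0) mul0r => /eqP.
by rewrite mulf_eq0 gt_eqF//= => /eqP.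
Qed.

Lemma swirl_eq t r h : a < t < b -> 0 < r -> let P := pt t r 0 h in
  (u 1)^t P + u 0 P * (u 1)^x P + u 2 P * (u 1)^h P + u 1 P * (u 0 P / r) =
  (u 1)^x^x P + (u 1)^x P / r - u 1 P / r ^+ 2 + (u 1)^h^h P.
Proof.
move=> ht r0 P; have [e1 e2] := u1_derivs hs h ht r0.
have UP : U P by exact: ht.
have := sol_ns hs 1 UP; rewrite lap3 sum3 e1 e2 (pressure_angular h ht r0) addr0.
rewrite -/P; move: ((u 1)^t P) ((u 1)^x^x P) ((u 1)^h^h P) ((u 1)^x P) ((u 1)^h P) (u 0 P) (u 1 P) (u 2 P) (r) => *.
lra.
Qed.

Lemma div_eq t r h : a < t < b -> 0 < r -> let P := pt t r 0 h in
  (u 0)^x P + u 0 P / r + (u 2)^h P = 0.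
Proof.
move=> ht r0 P; have [e1 e2] := u1_derivs hs h ht r0.
by have := sol_div hs (ht : U P); rewrite sum3 e1.
Qed.

Local Notation om := (vort u 2 0).

Lemma om_y t r h : a < t < b -> 0 < r -> let P := pt t r 0 h in
  om^y P = - ((u 1)^h P / r) /\ om^y^y P = om^x P / r - om P / r ^+ 2.
Proof.
move=> ht r0 P; have UP : U P by exact: ht.
have rn : r != 0 by rewrite gt_eqF.
have s0 i : smf U (pd (Some i) (u 0)) := smf_pd _ (su 0).
have s2 i : smf U (pd (Some i) (u 2)) := smf_pd _ (su 2).
have omy z : U z -> om^y z = (u 0)^y^h z - (u 2)^y^x z.
  by move=> Uz; rewrite (pd_vort hs _ _ _ Uz) (pdC _ _ oU (su 0) Uz) (pdC _ _ oU (su 2) Uz).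
split.
  rewrite (omy _ UP) (u0_yh ht r0 h).
  have -> : (u 2)^y^x P = 0; last by rewrite subr0.
  apply: dR_uniq (dR_x r 0 h (smf_pd _ (su 2)) ht) _.
  apply: (dR_eq_on r0 (f := fun=> 0)); last exact: dRc.
  move=> s /(dist_pos r0) s00.
  by have [-> _] := u2_derivs hs h ht s00.
rewrite (pd_eq (Some 1) oU omy UP) (pdB _ (smf_pd _ (s0 1)) (smf_pd _ (s2 1)) UP).
have q1 := pdC (Some 2) (Some 1) oU (s0 1) UP; have q2 := pdC (Some 0) (Some 1) oU (s2 1) UP.
rewrite [X in X - _]q1 [X in _ - X]q2 {q1 q2}.
have -> : (u 0)^y^y^h P = (u 0)^x^h P / r - (u 0)^h P / r ^+ 2.
  apply: dR_uniq (dR_h r 0 h (smf_pd _ (s0 1)) ht) _.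
  apply: (dR_eq_on r0 (f := fun h => (u 0)^x (pt t r 0 h) / r - u 0 (pt t r 0 h) / r ^+ 2)).
    by move=> s _; have [_ ->] := u0_derivs hs s ht r0.
  have h1 := dR_h r 0 h (su 0) ht; have h2 := dR_h r 0 h (s0 0) ht.
  by dR_auto; rewrite mulr0 addr0 mulr0 addr0.
have -> : (u 2)^y^y^x P = (u 2)^x^x P / r - (u 2)^x P / r ^+ 2.
  apply: dR_uniq (dR_x r 0 h (smf_pd _ (s2 1)) ht) _.
  apply: (dR_eq_on r0 (f := fun x => (u 2)^x (pt t x 0 h) / x)).
    move=> s /(dist_pos r0) s00.
    by have [_ ->] := u2_derivs hs h ht s00.
  exact: (dR_overx h ht rn (s2 0)).
have ox : om^x P = (u 0)^x^h P - (u 2)^x^x P.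
  by rewrite (pd_vort hs (Some 0) 2 0 UP) (pdC (Some 2) (Some 0) oU (su 0) UP).
have o1 : om P = (u 0)^h P - (u 2)^x P by [].
rewrite ox o1; move: ((u 0)^x^h P) ((u 0)^h P) ((u 2)^x^x P) ((u 2)^x P) => v1 v2 v3 v4.
by field.
Qed.

(** All y-derivatives are eliminated: [om_y] gives those of the vorticity, the divergence equation
    gives [(u 2)^h], and the only source that remains is the one produced by the swirl. *)
Lemma om_eq t r h : a < t < b -> 0 < r -> let P := pt t r 0 h in
  om^t P + u 0 P * om^x P + u 2 P * om^h P - u 0 P / r * om P =
  om^x^x P + om^x P / r - om P / r ^+ 2 + om^h^h P + 2 * (u 1 P / r) * (u 1)^h P.
Proof.
move=> ht r0 P; have UP : U P by exact: ht.
have [e1 e2] := om_y h ht r0.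
have ed : (u 0)^x P + u 0 P / r + (u 2)^h P = 0 := div_eq h ht r0.
have [f1 f2 _] := u0_derivs hs h ht r0; have [g1 _] := u2_derivs hs h ht r0.
have := vort_eq hs 2 0 UP; rewrite lap3 /vort_rhs sum3 e1 e2 f1 g1.
have -> : om P = (u 0)^h P - (u 2)^x P by [].
move: ed; move: ((u 0)^x P) (u 0 P) (u 1 P) (u 2 P) ((u 2)^h P) ((u 0)^h P) ((u 2)^x P) ((u 1)^h P) ((u 1)^x P)
  (om^t P) (om^x P) (om^x^x P) (om^h P) (om^h^h P) => u0x v0 v1 v2 u2h u0h u2x u1h u1x o1 o2 o3 o4 o5 ed e.
have ed' : u2h = - u0x - v0 / r.
  by move: ed => /eqP; rewrite addr_eq0 => /eqP ed; rewrite -opprD ed opprK.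
rewrite ed' in e.
exact: om_arith e.
Qed.

(** The component [j = 0] of [lap_vort_u]. The axial vorticity [vort u 1 0] does not contribute, as
    its y-derivative vanishes on the half-plane by axial symmetry. *)
Lemma radial_eq t r h : a < t < b -> 0 < r -> let P := pt t r 0 h in
  (u 0)^x^x P + (u 0)^x P / r - u 0 P / r ^+ 2 + (u 0)^h^h P = om^h P.
Proof.
move=> ht r0 P; have UP : U P by exact: ht.
have [f1 f2 _] := u0_derivs hs h ht r0.
have rn : r != 0 by rewrite gt_eqF.
have e := lap_vort_u hs 0 UP; rewrite lap3 sum3 f2 in e.
have e0 : (vort u 0 0)^x P = 0 by rewrite (pd_vort hs (Some 0) 0 0 UP) subrr.
suff e1 : (vort u 1 0)^y P = 0 by rewrite e0 e1 !add0r in e; rewrite -e addrA.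
have q := pdC (Some 0) (Some 1) oU (su 1) UP.
rewrite (pd_vort hs (Some 1) 1 0 UP) f2 q.
have -> : (u 1)^y^x P = (u 0)^x P / r - u 0 P / r ^+ 2; last by rewrite subrr.
apply: dR_uniq (dR_x r 0 h (smf_pd _ (su 1)) ht) _.
apply: (dR_eq_on r0 (f := fun x => u 0 (pt t x 0 h) / x)).
  move=> s /(dist_pos r0) s00.
  by have [-> _] := u1_derivs hs h ht s00.
exact: (dR_overx h ht rn (su 0)).
Qed.

Lemma odd_axis F t h : smf U F -> a < t < b ->
  (forall x, 0 < x -> F (pt t (- x) 0 h) = - F (pt t x 0 h)) -> F (pt t 0 0 h) = 0.
Proof.
move=> sF ht e.
have : dR (fun x => F (pt t x 0 h) + F (pt t (- x) 0 h)) 0 0.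
  have h1 := dR_x 0 0 h sF ht; rewrite -oppr0 in h1.
  have h2 : dR (fun x : R => - x) 0 (-1) by dR_auto.
  by have h3 := dRcomp h2 h1; rewrite oppr0 in h1 h3; dR_auto; ring.
move=> /dR_cont /cvgrPdist_lt hc; apply/eqP; rewrite -normr_eq0; apply/negPn/negP => n0.
have p0 : 0 < `|F (pt t 0 0 h)| by rewrite lt_neqAle eq_sym n0/=.
have [d /= d0 hd] := hc _ p0.
have := hd (d / 2); rewrite /ball_/= sub0r normrN gtr0_norm ?divr_gt0//.
have dd : d / 2 < d by lra.
move=> /(_ dd); rewrite (e (d / 2)) ?divr_gt0// subrr subr0 oppr0.
move: (F (pt t 0 0 h)) p0 => v v0.
have -> : v + v = 2 * v by ring.
by rewrite normrM ger0_norm//; lra.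
Qed.

(** Rotation by pi, the case [x = - r] of [sol_ax], makes the first two components odd and the third
    one even along the line [y = 0]. *)
Lemma axis_vanish t h : a < t < b ->
  [/\ u 0 (pt t 0 0 h) = 0, u 1 (pt t 0 0 h) = 0, (u 2)^x (pt t 0 0 h) = 0 & om (pt t 0 0 h) = 0].
Proof.
move=> ht.
have key x h' : 0 < x -> [/\ u 0 (pt t (- x) 0 h') = - u 0 (pt t x 0 h'), u 1 (pt t (- x) 0 h') = - u 1 (pt t x 0 h')
    & u 2 (pt t (- x) 0 h') = u 2 (pt t x 0 h')].
  move=> x0; have [|e1 e2 e3] := sol_ax hs h' ht x0 (x := - x) (y := 0); first by rewrite sqrrN expr0n addr0.
  have xn : x != 0 by rewrite gt_eqF.
  by split => //; apply: (mulfI xn); rewrite ?e1 ?e2; ring.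
have z0 h' : u 0 (pt t 0 0 h') = 0.
  by apply: odd_axis => // x x0; have [] := key x h' x0.
have z2 : (u 2)^x (pt t 0 0 h) = 0.
  apply: odd_axis => //; first exact: smf_pd.
  move=> x x0.
  have h1 : dR (fun s => u 2 (pt t s 0 h)) (- - x) ((u 2)^x (pt t x 0 h)).
    by rewrite opprK; exact: (dR_x x 0 h (su 2) ht).
  have h2 : dR (fun x : R => - x) (- x) (-1) by dR_auto.
  have h3 := dRcomp (g := fun s => u 2 (pt t s 0 h)) h2 h1; rewrite mulrN1 in h3.
  apply: dR_uniq (dR_x (- x) 0 h (su 2) ht) _.
  apply: (dR_eq_on x0 _ h3) => s; rewrite ltr_norml => hsx.
  have s0 : 0 < - s by lra.
  by have [_ _] := key (- s) h s0; rewrite opprK.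
split => //; first by apply: odd_axis => // x x0; have [] := key x h x0.
have -> : om (pt t 0 0 h) = (u 0)^h (pt t 0 0 h) - (u 2)^x (pt t 0 0 h) by [].
rewrite z2 subr0; apply: dR_uniq (dR_h 0 0 h (su 0) ht) _.
apply: (dR_eq_on ltr01 (f := fun=> 0)); last exact: dRc.
by move=> s _; rewrite z0.
Qed.

End PlaneEquations.

(** * Touching barriers and the moving disc *)

Arguments pt : simpl never.
Lemma ptt (R : realType) (t x y w : R) : (pt t x y w).1 = t. Proof. by []. Qed.

Section Touching.
Context {R : realType}.
Local Notation E := (R * 'rV[R]_3)%type.
Implicit Types (F G : E -> R) (t x h r : R).
Variables (a b : R) (G : E -> R) (t r h e : R).
Hypotheses (sG : smf (slab a b) G) (ht : a < t < b) (e0 : 0 < e).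
Local Notation P := (pt t r 0 h).

Let dR_at0 (f : R -> R) (x d : R) : dR f x d -> dR (fun s => f (s + x)) 0 d.
Proof.
move=> hf; have h1 : dR (fun s : R => s + x) 0 1 by dR_auto; ring.
have h2 : dR f (0 + x) d by rewrite add0r.
by have := dRcomp h1 h2; rewrite mulr1.
Qed.

(** Only past times are compared, as the minimum may be attained at the final time; hence an
    inequality and not an equality. *)
Lemma touch_time (f : R -> R) d :
  (forall s, - e < s <= 0 -> G P - f t <= G (pt (s + t) r 0 h) - f (s + t)) -> dR f t d ->
  pd None G P <= d.
Proof.
move=> hmin hf; rewrite -subr_ge0.
apply: (@dR_max_left _ (fun s => f (s + t) - G (pt (s + t) r 0 h)) _ e e0).
  have h1 := dR_at0 hf; have h2 := dR_at0 (dR_t r 0 h sG ht).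
  by dR_auto.
by move=> s hsx; have := hmin s hsx; rewrite !add0r; lra.
Qed.

Let touch_space (g f f' : R -> R) x (g' : R -> R) g'' d : (forall s, dR g s (g' s)) -> dR g' x g'' ->
  (forall s, `|s| < e -> g x - f x <= g (s + x) - f (s + x)) ->
  (forall s, `|s| < e -> dR f (s + x) (f' (s + x))) -> dR f' x d -> g' x = f' x /\ d <= g''.
Proof.
move=> dg dg' hmin df df'.
have [|||h1 h2] := @dR_max2 R (fun s => f (s + x) - g (s + x)) (fun s => f' (s + x) - g' (s + x)) (d - g'') e e0.
- move=> s se; have q1 : dR (fun s' : R => s' + x) s 1 by dR_auto; ring.
  have q2 := dRcomp q1 (df s se); have q3 := dRcomp q1 (dg (s + x)).
  by dR_auto; ring.
- have q1 := dR_at0 df'; have q2 := dR_at0 dg'; by dR_auto.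
- by move=> s se; have := hmin s se; rewrite !add0r; lra.
by rewrite !add0r in h1; lra.
Qed.

Lemma touch_x (f f' : R -> R) d :
  (forall s, `|s| < e -> G P - f r <= G (pt t (s + r) 0 h) - f (s + r)) ->
  (forall s, `|s| < e -> dR f (s + r) (f' (s + r))) -> dR f' r d ->
  pd (Some 0) G P = f' r /\ d <= pd (Some 0) (pd (Some 0) G) P.
Proof.
move=> hmin df df'.
apply: (touch_space (g := fun x => G (pt t x 0 h)) (g' := fun x => pd (Some 0) G (pt t x 0 h)) _ _ hmin df df').
  by move=> s; exact: (dR_x s 0 h sG ht).
exact: (dR_x r 0 h (smf_pd (Some 0) sG) ht).
Qed.

Lemma touch_h (f f' : R -> R) d :
  (forall s, `|s| < e -> G P - f h <= G (pt t r 0 (s + h)) - f (s + h)) ->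
  (forall s, `|s| < e -> dR f (s + h) (f' (s + h))) -> dR f' h d ->
  pd (Some 2) G P = f' h /\ d <= pd (Some 2) (pd (Some 2) G) P.
Proof.
move=> hmin df df'.
apply: (touch_space (g := fun x => G (pt t r 0 x)) (g' := fun x => pd (Some 2) G (pt t r 0 x)) _ _ hmin df df').
  by move=> s; exact: (dR_h r 0 s sG ht).
exact: (dR_h r 0 h (smf_pd (Some 2) sG) ht).
Qed.
End Touching.

Section MovingBall.
Context {R : realType}.
Local Notation E := (R * 'rV[R]_3)%type.
Implicit Types (z : E) (t x h r : R).

(** The expression is at most [- m * q ^+ 2 + D * q - 8 * s ^+ 2], where [D] collects the drift, the
    speed of the centre and the terms linear in [q]. The discriminant vanishes for
    [m = D ^+ 2 / (32 * s ^+ 2)]; the extra 1 makes the quadratic strictly negative. *)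
Lemma moving_ball_arith (m q x1 x2 s D c1 c2 b1 b2 B : R) : 0 < q -> 0 < s ->
  q = s ^+ 2 - x1 ^+ 2 - x2 ^+ 2 -> `|c1| <= 2 -> `|c2| <= 2 -> `|b1| <= B -> `|b2| <= B ->
  D = 8 * (B + 2) * s + 16 -> m = D ^+ 2 / (32 * s ^+ 2) + 1 ->
  - m * q ^+ 2 + 4 * q * (x1 * c1 + x2 * c2) - 4 * q * (b1 * x1 + b2 * x2) - 8 * (x1 ^+ 2 + x2 ^+ 2) + 8 * q < 0.
Proof.
move=> q0 s0 eq hc1 hc2 hb1 hb2 eD em.
have xs (x y : R) : s ^+ 2 - x ^+ 2 - y ^+ 2 = q -> `|x| <= s.
  move=> e; rewrite -ler_sqr ?nnegrE ?(ltW s0)// real_normK ?num_real//.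
  by have := sqr_ge0 y; lra.
have x1s : `|x1| <= s by apply: (xs x1 x2).
have x2s : `|x2| <= s by apply: (xs x2 x1); lra.
have B0 : 0 <= B by exact: le_trans hb1.
have dot_le x c w : `|x| <= s -> `|c| <= 2 -> `|w| <= B -> x * c - w * x <= (B + 2) * s.
  move=> hx hc hw; have -> : x * c - w * x = (c - w) * x by ring.
  apply: le_trans (ler_norm _) _; rewrite normrM; apply: ler_pM => //.
  by apply: le_trans (ler_normB _ _) _; lra.
have d1 := dot_le x1 c1 b1 x1s hc1 hb1; have d2 := dot_le x2 c2 b2 x2s hc2 hb2.
have hq : 4 * q * (x1 * c1 + x2 * c2) - 4 * q * (b1 * x1 + b2 * x2) <= 8 * q * ((B + 2) * s).
  have -> : 4 * q * (x1 * c1 + x2 * c2) - 4 * q * (b1 * x1 + b2 * x2) =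
    4 * q * ((x1 * c1 - b1 * x1) + (x2 * c2 - b2 * x2)) by ring.
  have -> : 8 * q * ((B + 2) * s) = 4 * q * ((B + 2) * s + (B + 2) * s) by ring.
  by rewrite ler_wpM2l ?mulr_ge0 ?(ltW q0)// lerD.
have e2 : x1 ^+ 2 + x2 ^+ 2 = s ^+ 2 - q by lra.
have s20 : 0 < s ^+ 2 by exact: exprn_gt0.
have key : - m * q ^+ 2 + D * q - 8 * s ^+ 2 < 0.
  have -> : - m * q ^+ 2 + D * q - 8 * s ^+ 2 = - ((32 * s ^+ 2)^-1 * (D * q - 16 * s ^+ 2) ^+ 2) - q ^+ 2.
    by rewrite em; field; rewrite gt_eqF.
  have : 0 <= (32 * s ^+ 2)^-1 * (D * q - 16 * s ^+ 2) ^+ 2.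
    by rewrite mulr_ge0 ?sqr_ge0// invr_ge0 mulr_ge0// ltW.
  have : 0 < q ^+ 2 by exact: exprn_gt0.
  move: ((32 * s ^+ 2)^-1 * _) => w; lra.
have eq2 : - m * q ^+ 2 + 8 * q * ((B + 2) * s) - 8 * (s ^+ 2 - q) + 8 * q = - m * q ^+ 2 + D * q - 8 * s ^+ 2.
  by rewrite eD; ring.
rewrite e2; move: hq key eq2.
move: (- m * q ^+ 2) (4 * q * (x1 * c1 + x2 * c2)) (4 * q * (b1 * x1 + b2 * x2)) (8 * q * ((B + 2) * s)) (D * q) (s ^+ 2).
by move=> w1 w2 w3 w4 w5 w6; lra.
Qed.

Lemma moving_ball_contra (g1 g2 g3 w1 w2 x y q eta m c1 c2 : R) : 0 < eta ->
  g1 + w1 * (eta * (- 4 * q * x)) + w2 * (eta * (- 4 * q * y)) = g2 + g3 ->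
  g1 <= eta * (- m * q ^+ 2 + 4 * q * (x * c1 + y * c2)) ->
  eta * (8 * x ^+ 2 - 4 * q) <= g2 -> eta * (8 * y ^+ 2 - 4 * q) <= g3 ->
  - m * q ^+ 2 + 4 * q * (x * c1 + y * c2) - 4 * q * (w1 * x + w2 * y) - 8 * (x ^+ 2 + y ^+ 2) + 8 * q < 0 -> False.
Proof.
move=> eta0 hE hT hx2 hh2 hneg.
have : 0 < eta * (- (- m * q ^+ 2 + 4 * q * (x * c1 + y * c2) - 4 * q * (w1 * x + w2 * y) - 8 * (x ^+ 2 + y ^+ 2) + 8 * q)).
  by rewrite mulr_gt0// oppr_gt0.
lra.
Qed.

Lemma past_time (t1 t2 t s : R) : - s < t - t1 -> s <= 0 -> t <= t2 -> t1 <= s + t <= t2.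
Proof. by move=> *; apply/andP; split; lra. Qed.

Lemma closed_ge0 (f : E -> R) : (forall z, cE f z) -> closed [set z | 0 <= f z].
Proof.
move=> cf; have : closed (f @^-1` [set x | 0 <= x]).
  by apply: closed_comp; [move=> z _; exact: cf|exact: closed_ge].
exact.
Qed.

(* The barrier is [exp (- m (t - t1)) (s^2 - |xi|^2)^2], [xi] being the position
   relative to the moving centre. *)
Lemma moving_ball a b (G b1 b2 : E -> R) (t1 t2 r1 h1 r2 h2 s B eta : R) :
  smf (slab a b) G -> a < t1 -> t2 < b -> t1 < t2 -> 0 < s -> 0 < eta ->
  `|(r2 - r1) / (t2 - t1)| <= 2 -> `|(h2 - h1) / (t2 - t1)| <= 2 ->
  (forall t r h, t1 <= t <= t2 ->
     (r - (r1 + (r2 - r1) / (t2 - t1) * (t - t1))) ^+ 2 + (h - (h1 + (h2 - h1) / (t2 - t1) * (t - t1))) ^+ 2 <= s ^+ 2 ->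
     let P := pt t r 0 h in
     [/\ 0 <= G P, `|b1 P| <= B, `|b2 P| <= B & pd None G P + b1 P * pd (Some 0) G P + b2 P * pd (Some 2) G P =
       pd (Some 0) (pd (Some 0) G) P + pd (Some 2) (pd (Some 2) G) P]) ->
  (forall r h, (r - r1) ^+ 2 + (h - h1) ^+ 2 <= s ^+ 2 -> eta * s ^+ 4 <= G (pt t1 r 0 h)) ->
  eta * s ^+ 4 * expR (- (((8 * (B + 2) * s + 16) ^+ 2 / (32 * s ^+ 2) + 1) * (t2 - t1))) <= G (pt t2 r2 0 h2).
Proof.
move=> sG at1 t2b t12 s0 eta0 hc1 hc2 hN hini.
set D := 8 * (B + 2) * s + 16; set m := D ^+ 2 / (32 * s ^+ 2) + 1.
set c1 := (r2 - r1) / (t2 - t1) in hc1 hN *; set c2 := (h2 - h1) / (t2 - t1) in hc2 hN *.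
pose X t r := r - (r1 + c1 * (t - t1)); pose Y t h := h - (h1 + c2 * (t - t1)).
pose q t r h := s ^+ 2 - X t r ^+ 2 - Y t h ^+ 2.
pose phi t r h := eta * expR (- (m * (t - t1))) * q t r h ^+ 2.
pose Rr := `|r1| + `|c1| * (t2 - t1) + s + 1; pose Rh := `|h1| + `|c2| * (t2 - t1) + s + 1.
(* The region swept by the moving disc, as a compact subset of space-time in the plane [y = 0]. *)
pose K := [set z : E | t1 <= z.1 <= t2 /\ (forall i : 'I_3, (if i == 0 then - Rr else if i == 1 then 0 else - Rh) <= z.2 0 i <= (if i == 0 then Rr else if i == 1 then 0 else Rh))]
   `&` [set z : E | 0 <= q z.1 (z.2 0 0) (z.2 0 2)].
have cq z : cE (fun z : E => q z.1 (z.2 0 0) (z.2 0 2)) z by rewrite /q /X /Y; cE_auto.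
have cK : compact K.
  apply: compact_closedI; first exact: box_compact.
  exact: (closed_ge0 cq).
have inK t r h : t1 <= t <= t2 -> 0 <= q t r h -> K (pt t r 0 h).
  move=> tt q0; split; last by rewrite /mkset ptt pt0 pt2.
  have X2 : X t r ^+ 2 <= s ^+ 2 by have := sqr_ge0 (Y t h); move: q0; rewrite /q; lra.
  have Y2 : Y t h ^+ 2 <= s ^+ 2 by have := sqr_ge0 (X t r); move: q0; rewrite /q; lra.
  have XY w c x0 : (x0 - (w + c * (t - t1))) ^+ 2 <= s ^+ 2 -> `|x0| <= `|w| + `|c| * (t2 - t1) + s + 1.
    rewrite -real_normK ?num_real// ler_sqr ?nnegrE ?(ltW s0)// => hh.
    have -> : x0 = (x0 - (w + c * (t - t1))) + w + c * (t - t1) by ring.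
    apply: le_trans (ler_normD _ _) _; apply: le_trans (lerD (ler_normD _ _) (lexx _)) _.
    rewrite normrM; have : `|c| * `|t - t1| <= `|c| * (t2 - t1) by rewrite ler_wpM2l// ger0_norm; lra.
    move: hh; move: (`|c| * _) (`|c| * _) `|x0 - _| `|w| => w1 w2 w3 w4; lra.
  split => //; apply: I3P; rewrite ?pt0 ?pt1 ?pt2 /= -?ler_norml ?oppr0 ?lexx//; exact: XY.
have hphi0 t r h : 0 <= phi t r h by rewrite mulr_ge0 ?sqr_ge0// mulr_ge0 ?expR_ge0// ltW.
have q2 : q t2 r2 h2 = s ^+ 2.
  have e : t2 - t1 != 0 by rewrite subr_eq0 gt_eqF.
  by rewrite /q /X /Y /c1 /c2 !divfK//; ring.
have K2 : K (pt t2 r2 0 h2).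
  apply: inK; first by rewrite lexx andbT ltW.
  by rewrite q2 exprn_ge0// ltW.
suff hmain : forall z, K z -> 0 <= G z - phi z.1 (z.2 0 0) (z.2 0 2).
  have := hmain _ K2; rewrite ptt pt0 pt2 /phi q2 subr_ge0.
  have -> : eta * s ^+ 4 = eta * (s ^+ 2) ^+ 2 by rewrite -exprM.
  by rewrite mulrAC.
have slK z : K z -> slab a b z.
  by move=> [[/andP[h3 h4] _] _]; apply/andP; split; [exact: lt_le_trans h3|exact: le_lt_trans t2b].
have cH z : K z -> cE (fun z : E => - (G z - phi z.1 (z.2 0 0) (z.2 0 2))) z.
  move=> Kz; apply: cE_N; apply: cE_D; first exact: (smf_cont sG (slK _ Kz)).
  apply: cE_N; rewrite /phi; apply: cE_M; last by apply: cE_X; exact: cq.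
  apply: cE_M; first exact: cE_cst.
  have ct : cE (fun z : E => - (m * (z.1 - t1))) z by cE_auto.
  exact: (cvg_comp _ _ ct (@continuous_expR R _)).
have [z1 Kz1 hmax] := compact_max (ex_intro _ _ K2) cK cH.
move=> z Kz; rewrite -oppr_le0; apply: le_trans (hmax _ Kz) _; rewrite oppr_le0 leNgt; apply/negP => hneg.
have [[/andP[u1 u2] ubox] uq] := Kz1.
have z1E : z1 = pt z1.1 (z1.2 0 0) 0 (z1.2 0 2).
  rewrite [LHS]ptE; congr (pt _ _ _ _); have := ubox 1; rewrite /= => hb; apply/eqP; rewrite eq_le andbC; exact: hb.
set t := z1.1 in hneg u1 u2 uq z1E; set r := z1.2 0 0 in hneg uq z1E; set h := z1.2 0 2 in hneg uq z1E.
have {}uq : 0 <= q t r h by exact: uq.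
rewrite z1E in hneg hmax.
have hmin t' r' h' : t1 <= t' <= t2 -> 0 <= q t' r' h' -> G (pt t r 0 h) - phi t r h <= G (pt t' r' 0 h') - phi t' r' h'.
  move=> tt qq; have := hmax _ (inK _ _ _ tt qq); cbv beta; rewrite lerN2 !ptt !pt0 !pt2.
  exact.
have tt : t1 <= t <= t2 by rewrite u1.
have hXY : X t r ^+ 2 + Y t h ^+ 2 <= s ^+ 2 by move: uq; rewrite /q; lra.
have [G0 hb1 hb2 hE] := hN t r h tt hXY.
(* On the rim the barrier vanishes while [G] is nonnegative, and at the initial time [hini] applies;
   so a negative minimum lies inside the disc and after [t1]. *)
have qpos : 0 < q t r h.
  rewrite lt_neqAle uq andbT eq_sym; apply/eqP => e0.
  by move: hneg; rewrite /phi e0 expr0n mulr0 subr0 ltNge G0.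
have tpos : t1 < t.
  rewrite lt_neqAle u1 andbT; apply/eqP => e0.
  have X1 : X t r = r - r1 by rewrite /X -e0; ring.
  have Y1 : Y t h = h - h1 by rewrite /Y -e0; ring.
  have := hini r h; rewrite -X1 -Y1 => /(_ hXY) hG.
  have hq : q t r h ^+ 2 <= s ^+ 4.
    have -> : s ^+ 4 = (s ^+ 2) ^+ 2 by rewrite -exprM.
    rewrite ler_sqr ?nnegrE ?exprn_ge0 ?(ltW s0)//.
    by rewrite /q -addrA -opprD gerBl addr_ge0 ?sqr_ge0.
  have hphi : phi t r h <= eta * s ^+ 4.
    by rewrite /phi -e0 subrr mulr0 oppr0 expR0 mulr1 e0 ler_wpM2l// ltW.
  rewrite e0 in hG; have := le_trans hphi hG.
  by rewrite -subr_ge0 leNgt hneg.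
have ht : a < t < b by apply/andP; split; [exact: lt_trans at1 tpos|exact: le_lt_trans u2 t2b].
set Eta := eta * expR (- (m * (t - t1))).
have Eta0 : 0 < Eta by rewrite mulr_gt0// expR_gt0.
have [d d0 hd] : exists2 d, 0 < d & forall z', near_pt d (pt t r 0 h) z' -> 0 < q z'.1 (z'.2 0 0) (z'.2 0 2).
  have /cont_nearP/(_ _ qpos) := cq (pt t r 0 h); cbv beta; rewrite ptt !pt0 !pt2 => -[d d0 hd].
  by exists d => // z' /hd; rewrite ltr_distl subrr => /andP[].
pose e := Num.min d (t - t1).
have e0 : 0 < e by rewrite lt_min d0 subr_gt0.
have ed (s' : R) : `|s'| < e -> `|s'| < d by rewrite lt_min => /andP[].
have hT : pd None G (pt t r 0 h) <= Eta * (- m * q t r h ^+ 2 + 4 * q t r h * (X t r * c1 + Y t h * c2)).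
  apply: (@touch_time R a b G t r h e sG ht e0 (fun t => phi t r h)).
    move=> s' /andP[s1 s2]; apply: hmin; first by move: s1; rewrite ltrNl lt_min => /andP[_ s3]; exact: past_time u2.
    have s'd : `|s'| < d by apply: ed; rewrite ler0_norm// ltrNl.
    have := hd _ (shift_near None (pt t r 0 h) s'd); rewrite shift_ptN ptt !pt0 !pt2.
    exact: ltW.
  rewrite /phi /q /X /Y.
  have hexp : dR (fun t : R => expR (- (m * (t - t1)))) t (expR (- (m * (t - t1))) * (- m)).
    apply: (dRcomp (f := fun t => - (m * (t - t1))) (g := @expR R)); last exact: dR_exp.
    by dR_auto; ring.
  by dR_auto; rewrite /Eta /q /X /Y; ring.
have [hx1 hx2] : pd (Some 0) G (pt t r 0 h) = Eta * (- 4 * q t r h * X t r) /\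
    Eta * (8 * X t r ^+ 2 - 4 * q t r h) <= pd (Some 0) (pd (Some 0) G) (pt t r 0 h).
  apply: (@touch_x R a b G t r h e sG ht e0 (fun r => phi t r h) (fun r => Eta * (- 4 * q t r h * X t r))).
  - move=> s' s1; apply: hmin => //.
    have := hd _ (shift_near (Some 0) (pt t r 0 h) (ed _ s1)); rewrite shift_pt0 ptt !pt0 !pt2.
    exact: ltW.
  - by move=> s' _; rewrite /phi -/Eta /q /X /Y; dR_auto; ring.
  - by rewrite /q /X /Y; dR_auto; ring.
have [hh1 hh2] : pd (Some 2) G (pt t r 0 h) = Eta * (- 4 * q t r h * Y t h) /\
    Eta * (8 * Y t h ^+ 2 - 4 * q t r h) <= pd (Some 2) (pd (Some 2) G) (pt t r 0 h).
  apply: (@touch_h R a b G t r h e sG ht e0 (fun h => phi t r h) (fun h => Eta * (- 4 * q t r h * Y t h))).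
  - move=> s' s1; apply: hmin => //.
    have := hd _ (shift_near (Some 2) (pt t r 0 h) (ed _ s1)); rewrite shift_pt2 ptt !pt0 !pt2.
    exact: ltW.
  - by move=> s' _; rewrite /phi -/Eta /q /X /Y; dR_auto; ring.
  - by rewrite /q /X /Y; dR_auto; ring.
rewrite hx1 hh1 in hE.
exact: moving_ball_contra Eta0 hE hT hx2 hh2 (moving_ball_arith qpos s0 (erefl : q t r h = _) hc1 hc2 hb1 hb2 (erefl D) (erefl m)).
Qed.

End MovingBall.

(** * The circulation away from its maximum *)

Section Integrals.
Context {R : realType}.
Local Notation E := (R * 'rV[R]_3)%type.
Implicit Types (c d : R) (f g : R -> R).

Definition itg c d f : R := \int[@lebesgue_measure R]_(x in `[c, d]) f x.

Definition cseg c d f := forall x, c <= x <= d -> {for x, continuous f}.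

Lemma cseg_integrable c d f : cseg c d f -> (@lebesgue_measure R).-integrable `[c, d] (EFin \o f).
Proof.
move=> cf; apply: continuous_compact_integrable; first exact: segment_compact.
by apply: continuous_in_subspaceT => x; rewrite inE/= in_itv/=; exact: cf.
Qed.

Lemma itg_eq c d f g : (forall x, c <= x <= d -> f x = g x) -> itg c d f = itg c d g.
Proof. by move=> fg; apply: eq_Rintegral => x; rewrite inE/= in_itv/= => h; exact: fg. Qed.

Lemma itgB c d f g : cseg c d f -> cseg c d g -> itg c d (fun x => f x - g x) = itg c d f - itg c d g.
Proof. by move=> cf cg; apply: RintegralB => //; exact: cseg_integrable. Qed.

Lemma itg_cst c d k : c <= d -> itg c d (fun=> k) = k * (d - c).
Proof.
move=> cd; rewrite /itg Rintegral_cst//.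
have e : @lebesgue_measure R `[c, d]%classic = (d - c)%:E.
  transitivity (if (c%:E < d%:E)%E then (d%:E - c%:E)%E else 0%:E : \bar R).
    exact: (lebesgue_measure_itv (Interval (BLeft c) (BRight d))).
  rewrite lte_fin; case: ltP => // dc.
  by congr EFin; apply/eqP; rewrite eq_sym subr_eq0 eq_le dc cd.
by rewrite -[d - c]/(fine (d - c)%:E) -e.
Qed.

Lemma cseg_cst c d k : cseg c d (fun=> k).
Proof. by move=> x _; exact: cvg_cst. Qed.

Lemma itg_le c d f g : cseg c d f -> cseg c d g -> (forall x, c <= x <= d -> f x <= g x) -> itg c d f <= itg c d g.
Proof.
move=> cf cg fg; apply: le_Rintegral; try exact: cseg_integrable; first exact: measurable_itv.
by move=> x /=; rewrite in_itv/=; exact: fg.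
Qed.

Lemma itg_bound c d f k : c <= d -> cseg c d f -> (forall x, c <= x <= d -> `|f x| <= k) -> `|itg c d f| <= k * (d - c).
Proof.
move=> cd cf fk; rewrite ler_norml -mulNr -(itg_cst k cd) -(itg_cst (- k) cd).
apply/andP; split; apply: itg_le => //; try exact: cseg_cst.
  by move=> x /fk; rewrite ler_norml => /andP[].
by move=> x /fk; rewrite ler_norml => /andP[].
Qed.

Lemma itg_ftc c d (F f : R -> R) : c < d -> (forall x, c <= x <= d -> dR F x (f x)) -> cseg c d f ->
  itg c d f = F d - F c.
Proof.
move=> cd dF cf; rewrite /itg /Rintegral.
have cF x : c <= x <= d -> {for x, continuous F} by move=> /dF; exact: dR_cont.
have hcd : c <= c <= d by rewrite lexx ltW.
have hdd : c <= d <= d by rewrite lexx ltW.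
rewrite (continuous_FTC2 (F := F) cd)//.
- by apply: continuous_in_subspaceT => x; rewrite inE/= in_itv/=; exact: cf.
- split.
  + by move=> x; rewrite in_itv/= => /andP[h1 h2]; case: (dF x); rewrite ?(ltW h1) ?(ltW h2).
  + by apply: cvg_at_right_filter; exact: cF.
  + by apply: cvg_at_left_filter; exact: cF.
- move=> x; rewrite in_itv/= => /andP[h1 h2]; rewrite derive1E.
  by case: (dF x); rewrite ?(ltW h1) ?(ltW h2).
Qed.

Lemma itg_dR c d (f f' : R -> R -> R) (x e k : R) : c <= d -> 0 < e ->
  (forall s, `|s - x| < e -> cseg c d (f s)) ->
  (forall s y, `|s - x| < e -> c <= y <= d -> dR (f^~ y) s (f' s y) /\ `|f' s y| <= k) ->
  dR (fun s => itg c d (f s)) x (itg c d (f' x)).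
Proof.
move=> cd e0 cf df.
have seg s : `](x - e), (x + e)[%classic s -> `|s - x| < e.
  by rewrite /= in_itv/= ltr_distl.
have Ix : `](x - e), (x + e)[%classic x by rewrite /= in_itv/=; apply/andP; split; lra.
have mB : measurable (`[c, d]%classic : set (measurableTypeR R)) by exact: measurable_itv.
have segc y : `[c, d]%classic y -> c <= y <= d by rewrite /= in_itv.
have h1 s : `](x - e), (x + e)[%classic s -> (@lebesgue_measure R).-integrable `[c, d] (EFin \o f s).
  by move=> /seg hs; apply: cseg_integrable; exact: cf.
have h2 s y : `](x - e), (x + e)[%classic s -> `[c, d]%classic y -> derivable (f^~ y) s 1.
  by move=> /seg hs /segc hy; have [[]] := df s y hs hy.
have k0 : 0 <= k.
  have xx : `|x - x| < e by rewrite subrr normr0.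
  have cc : c <= c <= d by rewrite lexx.
  by have [_] := df x c xx cc; apply: le_trans.
have hp s y : `|s - x| < e -> c <= y <= d -> partial1of2 f s y = f' s y.
  by move=> hs hy; rewrite partial1of2E; have [[]] := df s y hs hy.
have h3 : (@lebesgue_measure R).-integrable `[c, d] (EFin \o (fun=> k)).
  by apply: cseg_integrable; exact: cseg_cst.
have h4 s y : `](x - e), (x + e)[%classic s -> `[c, d]%classic y -> `|partial1of2 f s y| <= k.
  by move=> /seg hs /segc hy; rewrite hp//; have [_] := df s y hs hy.
apply: DeriveDef.
  exact: (derivable_under_integral mB Ix h1 h2 (G := fun=> k) (fun=> k0) h3 h4).
have := differentiation_under_integral mB Ix h1 h2 (G := fun=> k) (fun=> k0) h3 h4.
rewrite derive1E => ->; apply: itg_eq => y hy; apply: hp => //.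
by rewrite subrr normr0.
Qed.

Section Plane.
Variables (a b t1 t2 c d : R).
Hypotheses (at1 : a < t1) (t2b : t2 < b) (t12 : t1 < t2) (cd : c < d).
Implicit Types F G : E -> R.

Definition ith F t r : R := itg c d (fun h => F (pt t r 0 h)).
Definition itt F r : R := itg t1 t2 (fun t => ith F t r).

Lemma plane_bounded F r : smf (slab a b) F -> exists k : R, forall t x h,
  t1 <= t <= t2 -> `|x - r| <= 1 -> c <= h <= d -> `|F (pt t x 0 h)| <= k.
Proof.
move=> sF; pose lo (i : 'I_3) : R := if i == 0 then r - 1 else if i == 1 then 0 else c.
pose hi (i : 'I_3) : R := if i == 0 then r + 1 else if i == 1 then 0 else d.
pose K := [set z : E | t1 <= z.1 <= t2 /\ forall i, lo i <= z.2 0 i <= hi i].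
have inK t x h : t1 <= t <= t2 -> `|x - r| <= 1 -> c <= h <= d -> K (pt t x 0 h).
  move=> h1; rewrite ler_distl => h2 h3; split => //.
  by apply: I3P; rewrite ?pt0 ?pt1 ?pt2 /lo /hi /= ?lexx.
have cK : compact K by exact: box_compact.
have K0 : K (pt t1 r 0 c).
  by apply: inK; rewrite ?lexx ?(ltW t12) ?(ltW cd)// subrr normr0.
have [|z _ hz] := compact_max (F := fun z => `|F z|) (ex_intro _ _ K0) cK; last first.
  by exists `|F z| => t x h ? ? ?; apply: hz; exact: inK.
move=> z [/andP[h1 h2] _]; apply: cE_norm; apply: (smf_cont sF).
by apply/andP; split; [exact: lt_le_trans h1|exact: le_lt_trans t2b].
Qed.

Lemma cseg_h F t r : smf (slab a b) F -> a < t < b -> cseg c d (fun h => F (pt t r 0 h)).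
Proof. by move=> sF ht h _; exact: dR_cont (dR_h r 0 h sF ht). Qed.

Let tab t : t1 <= t <= t2 -> a < t < b.
Proof. by move=> /andP[h1 h2]; apply/andP; split; [exact: lt_le_trans h1|exact: le_lt_trans t2b]. Qed.

Lemma ith_dR_x F t r : smf (slab a b) F -> t1 <= t <= t2 -> dR (fun r => ith F t r) r (ith (pd (Some 0) F) t r).
Proof.
move=> sF ht; have [k hk] := plane_bounded r (smf_pd (Some 0) sF).
apply: (itg_dR (e := 1) (k := k) (f := fun r h => F (pt t r 0 h)) (f' := fun r h => pd (Some 0) F (pt t r 0 h)) (ltW cd)) => //.
  by move=> s _; apply: cseg_h => //; exact: tab.
by move=> s y /ltW hs hy; split; [exact: (dR_x s 0 y sF (tab ht))|exact: hk].
Qed.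

Lemma ith_dR_t F t r : smf (slab a b) F -> t1 <= t <= t2 -> dR (fun t => ith F t r) t (ith (pd None F) t r).
Proof.
move=> sF ht; have /andP[h1 h2] := tab ht.
pose e := Num.min (t - a) (b - t) / 2.
have e0 : 0 < e by rewrite divr_gt0// lt_min !subr_gt0 h1.
have et s : `|s - t| <= e -> (a + t) / 2 <= s <= (t + b) / 2.
  have e1 : e <= (t - a) / 2 by rewrite ler_pM2r// ge_min lexx.
  have e2 : e <= (b - t) / 2 by rewrite ler_pM2r// ge_min lexx orbT.
  by rewrite ler_distl => /andP[? ?]; apply/andP; split; lra.
have ets s : (a + t) / 2 <= s <= (t + b) / 2 -> a < s < b by move=> /andP[? ?]; apply/andP; split; lra.
have [k hk] : exists k : R, forall s h, (a + t) / 2 <= s <= (t + b) / 2 -> c <= h <= d -> `|pd None F (pt s r 0 h)| <= k.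
  pose lo (i : 'I_3) : R := if i == 0 then r else if i == 1 then 0 else c.
  pose hi (i : 'I_3) : R := if i == 0 then r else if i == 1 then 0 else d.
  pose K := [set z : E | (a + t) / 2 <= z.1 <= (t + b) / 2 /\ forall i, lo i <= z.2 0 i <= hi i].
  have inK s h : (a + t) / 2 <= s <= (t + b) / 2 -> c <= h <= d -> K (pt s r 0 h).
    by move=> ? ?; split => //; apply: I3P; rewrite ?pt0 ?pt1 ?pt2 /lo /hi /= ?lexx.
  have cK : compact K by exact: box_compact.
  have K0 : K (pt t r 0 c) by apply: inK; rewrite ?lexx ?(ltW cd)//; apply/andP; split; lra.
  have [|z _ hz] := compact_max (F := fun z => `|pd None F z|) (ex_intro _ _ K0) cK; last first.
    by exists `|pd None F z| => s h ? ?; apply: hz; exact: inK.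
  by move=> z [h3 _]; apply: cE_norm; apply: (smf_cont (smf_pd _ sF)); exact: ets.
apply: (itg_dR (e := e) (k := k) (f := fun t h => F (pt t r 0 h)) (f' := fun t h => pd None F (pt t r 0 h)) (ltW cd)) => //.
  by move=> s /ltW /et /ets hs; exact: cseg_h.
by move=> s y /ltW /et hs hy; split; [exact: (dR_t r 0 y sF (ets _ hs))|exact: hk].
Qed.

Lemma ith_pd2 F t r : smf (slab a b) F -> t1 <= t <= t2 -> ith (pd (Some 2) F) t r = F (pt t r 0 d) - F (pt t r 0 c).
Proof.
move=> sF ht; apply: (itg_ftc (F := fun h => F (pt t r 0 h)) cd).
  by move=> h _; exact: (dR_h r 0 h sF (tab ht)).
by apply: cseg_h; [exact: smf_pd|exact: tab].
Qed.

Lemma cseg_ith F r : smf (slab a b) F -> cseg t1 t2 (fun t => ith F t r).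
Proof. by move=> sF t ht; exact: dR_cont (ith_dR_t r sF ht). Qed.

Lemma itt_pdN F r : smf (slab a b) F -> itt (pd None F) r = ith F t2 r - ith F t1 r.
Proof.
move=> sF; apply: (itg_ftc (F := fun t => ith F t r) t12).
  by move=> t ht; exact: ith_dR_t.
by apply: cseg_ith; exact: smf_pd.
Qed.

Lemma ith_bound F t r k : smf (slab a b) F -> t1 <= t <= t2 ->
  (forall h, c <= h <= d -> `|F (pt t r 0 h)| <= k) -> `|ith F t r| <= k * (d - c).
Proof. by move=> sF ht; apply: itg_bound (ltW cd) _; apply: cseg_h => //; exact: tab. Qed.

Lemma itt_bound F r k : smf (slab a b) F ->
  (forall t h, t1 <= t <= t2 -> c <= h <= d -> `|F (pt t r 0 h)| <= k) -> `|itt F r| <= k * (d - c) * (t2 - t1).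
Proof.
move=> sF hF; apply: itg_bound (ltW t12) _ _; first exact: cseg_ith.
by move=> t ht; apply: ith_bound => // h; exact: hF.
Qed.

Lemma itt_dR_x F r : smf (slab a b) F -> dR (fun r => itt F r) r (itt (pd (Some 0) F) r).
Proof.
move=> sF; have [k hk] := plane_bounded r (smf_pd (Some 0) sF).
apply: (itg_dR (e := 1) (k := k * (d - c)) (f := fun r t => ith F t r) (f' := fun r t => ith (pd (Some 0) F) t r) (ltW t12)) => //.
  by move=> s _; exact: cseg_ith.
move=> s t /ltW hs ht; split; first exact: ith_dR_x.
by apply: ith_bound => //; [exact: smf_pd|move=> h hh; exact: hk].
Qed.

Lemma itt_eq F G r : (forall t h, t1 <= t <= t2 -> c <= h <= d -> F (pt t r 0 h) = G (pt t r 0 h)) -> itt F r = itt G r.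
Proof. by move=> FG; apply: itg_eq => t ht; apply: itg_eq => h hh; exact: FG. Qed.

Lemma ittB F G r : smf (slab a b) F -> smf (slab a b) G -> itt (fun z => F z - G z) r = itt F r - itt G r.
Proof.
move=> sF sG; rewrite /itt -itgB; [|exact: cseg_ith|exact: cseg_ith].
apply: itg_eq => t ht; rewrite /ith; apply: itgB; (apply: cseg_h; [|exact: tab]); [exact: sF|exact: sG].
Qed.

Lemma itt_pd2_0 F r : smf (slab a b) F ->
  (forall t, t1 <= t <= t2 -> F (pt t r 0 d) = 0 /\ F (pt t r 0 c) = 0) -> itt (pd (Some 2) F) r = 0.
Proof.
move=> sF hF; rewrite /itt (itg_eq (g := fun=> 0)) ?itg_cst ?mul0r ?(ltW t12)//.
by move=> t ht; rewrite ith_pd2//; have [-> ->] := hF t ht; rewrite subrr.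
Qed.

Lemma itt_pdN_0 F r : smf (slab a b) F ->
  (forall h, c <= h <= d -> F (pt t2 r 0 h) = 0 /\ F (pt t1 r 0 h) = 0) -> itt (pd None F) r = 0.
Proof.
move=> sF hF; rewrite itt_pdN// /ith.
rewrite (itg_eq (g := fun=> 0)); last by move=> h /hF[].
by rewrite [X in _ - X](itg_eq (g := fun=> 0)) ?subrr// => h /hF[].
Qed.

End Plane.
End Integrals.

(** * Interior gradient bound for a plane equation with drift *)

Section DriftGradient.
Context {R : realType}.
Local Notation E := (R * 'rV[R]_3)%type.
Implicit Types (z : E) (t x h r : R).

(** As [rho * (4 * B) <= 1], the drift takes up at most half of [m * rho], which leaves
    [m * rho <= 16 * S]. If [rho] is the first candidate, [m * rho] exceeds [17 * S]; if it is
    [(4 * B)^-1], then [m <= 64 * (B * S)]. The constants 17 and 65 just exceed 16 and 64. *)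
Lemma drift_arith (m rho B S q : R) : 0 < B -> 0 < S -> 0 < q -> 0 < m -> 0 < rho -> rho * (4 * B) <= 1 ->
  rho = (17 * S + 65 * B * S * q) / m \/ rho * (4 * B) = 1 -> 17 * S + 65 * B * S * q <= m * q ->
  m <= 8 * S / rho + 2 * (B * m) * rho -> False.
Proof.
move=> B0 S0 q0 m0 rho0 rB rE mq hm.
have BSq : 0 < B * S * q by rewrite !mulr_gt0.
have h6 : m * rho <= 8 * S + 2 * (B * m) * rho * rho.
  by have := ler_wpM2r (ltW rho0) hm; rewrite mulrDl divfK ?gt_eqF.
have h7 : 2 * (B * m) * rho * rho <= m * rho / 2.
  have -> : 2 * (B * m) * rho * rho = (m * rho / 2) * (rho * (4 * B)) by field.
  by rewrite ler_piMr// divr_ge0// mulr_ge0// ltW.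
have h5 : m * rho <= 16 * S by lra.
case: rE => rE.
  move: h5; rewrite rE mulrCA divff ?gt_eqF// mulr1 => h5.
  lra.
have h8 : m <= 64 * (B * S).
  have -> : m = (m * rho) * (4 * B) by rewrite -mulrA rE mulr1.
  have -> : 64 * (B * S) = 16 * S * (4 * B) by ring.
  by rewrite ler_pM2r// mulr_gt0.
have h9 := ler_wpM2r (ltW q0) h8.
by lra.
Qed.

Lemma drift_source (lN l0 l1 l2 g d0 d2 e0 e1 e2 c1 c2 B M : R) : lN = 1 -> l0 = 1 -> l1 = 0 -> l2 = 1 ->
  g + c1 * d0 + c2 * d2 = e0 + e2 -> `|c1| <= B -> `|c2| <= B -> `|d0| + `|d2| <= M ->
  `|lN * g - (l0 * e0 + l1 * e1 + l2 * e2)| <= B * M.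
Proof.
move=> -> -> -> -> h h1 h2 h3.
have -> : 1 * g - (1 * e0 + 0 * e1 + 1 * e2) = - (c1 * d0 + c2 * d2) by lra.
rewrite normrN; apply: le_trans (ler_normD _ _) _; rewrite !normrM.
have B0 : 0 <= B by apply: le_trans h1.
apply: le_trans (ler_wpM2l B0 h3); rewrite mulrDr.
by apply: lerD; apply: ler_wpM2r.
Qed.

(* At a point nearly maximising the gradient times the distance to the boundary
   the drift term is absorbed. *)
Lemma drift_gradient (a b : R) (G b1 b2 : E -> R) (t1 r1 h1 q B S : R) : smf (slab a b) G ->
  0 < q -> a < t1 - q ^+ 2 -> t1 < b -> 0 < B -> 0 < S ->
  (forall t r h, t1 - q ^+ 2 <= t <= t1 -> `|r - r1| <= q -> `|h - h1| <= q -> let P := pt t r 0 h in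
    [/\ `|G P| <= S, `|b1 P| <= B, `|b2 P| <= B &
      pd None G P + b1 P * pd (Some 0) G P + b2 P * pd (Some 2) G P =
       pd (Some 0) (pd (Some 0) G) P + pd (Some 2) (pd (Some 2) G) P]) ->
  `|pd (Some 0) G (pt t1 r1 0 h1)| + `|pd (Some 2) G (pt t1 r1 0 h1)| <= S * (34 / q + 130 * B).
Proof.
move=> sG q0 aq tb B0 S0 hG.
(* Freezing [y] at 0 extends the plane function to a function of three variables that is constant in
   [y], to which [heat_gradient] applies. *)
have [l [lN l0 l1 l2]] : exists l : option 'I_3 -> R, [/\ l None = 1, l (Some 0) = 1, l (Some 1) = 0 & l (Some 2) = 1].
  by exists (fun o => if o == Some 1 then 0 else 1).
pose fr := aff (0 : E) l.
have frE z : fr z = pt z.1 (z.2 0 0) 0 (z.2 0 2).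
  apply: E_eq; first by rewrite /fr /= add0r lN mul1r.
  by apply: I3P; rewrite ?pt0 ?pt1 ?pt2 /fr mxE mxE add0r ?l0 ?l1 ?l2 ?mul0r ?mul1r.
have frS z : slab a b z -> slab a b (fr z) by rewrite frE.
have oS := @slab_open R a b.
pose F := G \o fr.
have sF : smf (slab a b) F by apply: (smf_aff _ oS sG) => z; exact: frS.
have pdF H o z : smf (slab a b) H -> slab a b z -> pd o (H \o fr) z = l o * pd o H (fr z).
  by move=> sH Sz; have [_ ->] := pd_aff (smf_der (o := o) sH (frS _ Sz)).
have pdFF i z : slab a b z -> pd (Some i) (pd (Some i) F) z = l (Some i) * pd (Some i) (pd (Some i) G) (fr z).
  move=> Sz; have [->|i1] := eqVneq i 1.
    rewrite (pd_eq (G := fun=> 0) _ oS _ Sz) ?pd_cst ?l1 ?mul0r// => y Sy.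
    by rewrite pdF// l1 mul0r.
  have li : l (Some i) = 1 by move: i i1; apply: I3P; rewrite ?eqxx.
  rewrite -(pdF _ _ _ (smf_pd _ sG) Sz); apply: (pd_eq _ oS _ Sz) => y Sy.
  by rewrite pdF// li mul1r.
pose P1 := pt t1 r1 0 h1.
have inQ z : cyQ P1 q z -> [/\ t1 - q ^+ 2 <= z.1 <= t1, `|z.2 0 0 - r1| <= q & `|z.2 0 2 - h1| <= q].
  by move=> [h2 h3]; split => //; [have := h3 0; rewrite pt0|have := h3 2; rewrite pt2].
have QS z : cyQ P1 q z -> slab a b z by exact: (cyQ_slab (z := P1) aq tb).
pose M z := `|pd (Some 0) F z| + `|pd (Some 2) F z|.
pose N := 17 * S + 65 * B * S * q.
have N0 : 0 < N by rewrite addr_gt0 ?mulr_gt0.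
have ME z : slab a b z -> M z = `|pd (Some 0) G (fr z)| + `|pd (Some 2) G (fr z)|.
  by move=> Sz; rewrite /M !pdF// l0 l2 !mul1r.
have MP : M P1 = `|pd (Some 0) G P1| + `|pd (Some 2) G P1|.
  have SP : slab a b P1 by apply: QS; apply: cyQ_refl; exact: ltW.
  have fP : fr P1 = P1 by rewrite frE ptt pt0 pt2.
  by rewrite /M !pdF// fP l0 l2 !mul1r.
rewrite -/P1 -MP; have -> : S * (34 / q + 130 * B) = 2 * N / q by rewrite /N; field; rewrite gt_eqF.
rewrite ler_pdivlMr// leNgt; apply/negP => hN.
have [z1 [Qz1 M0 hQ hM]] : exists z1, [/\ cyQ P1 q z1, 0 < M z1, forall z, cyQ z1 (N / M z1) z -> cyQ P1 q z &
    forall z, cyQ z1 (N / M z1) z -> M z <= 2 * M z1].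
  apply: selection => //; last exact: ltW.
  move=> z Qz; split; last exact: addr_ge0.
  by apply: cE_D; apply: cE_norm; exact: (smf_cont (smf_pd _ sF) (QS _ Qz)).
have s0 : 0 < N / M z1 by exact: divr_gt0.
pose rho := Num.min (N / M z1) (4 * B)^-1.
have rho0 : 0 < rho by rewrite lt_min s0 invr_gt0 mulr_gt0.
have rs : rho <= N / M z1 by rewrite ge_min lexx.
have rB : rho * (4 * B) <= 1.
  by rewrite -ler_pdivlMr ?mulr_gt0// mul1r ge_min lexx orbT.
have Qr z : cyQ z1 rho z -> cyQ z1 (N / M z1) z by apply: cyQ_sub rs; exact: ltW.
have hF z : cyQ z1 rho z -> `|F z| <= S.
  move=> /Qr /hQ /inQ [h2 h3 h4]; rewrite /F /= frE.
  by have [] := hG z.1 (z.2 0 0) (z.2 0 2) h2 h3 h4.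
have hheat z : cyQ z1 rho z -> `|pd None F z - lap F z| <= B * (2 * M z1).
  move=> /Qr Qz; have Sz := QS _ (hQ _ Qz); have [h2 h3 h4] := inQ _ (hQ _ Qz).
  have [_ hb1 hb2 hE] := hG z.1 (z.2 0 0) (z.2 0 2) h2 h3 h4.
  rewrite lap3 !pdFF// pdF// -frE in hE *.
  have hM' := hM _ Qz; rewrite (ME _ Sz) in hM'.
  rewrite -frE in hb1 hb2.
  have hh := drift_source _ lN l0 l1 l2 hE hb1 hb2 hM'.
  exact: hh.
have hbot : a < z1.1 - rho ^+ 2.
  apply: lt_le_trans aq _; have [|/andP[h2 _] _] := hQ (z1.1 - rho ^+ 2, z1.2); last exact: h2.
  apply: Qr; split=> [/=|i]; last by rewrite subrr normr0 ltW.
  by rewrite lexx gerBl sqr_ge0.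
have htop : z1.1 < b by have /andP[] := QS _ Qz1.
have hg i := heat_gradient i sF hbot htop rho0 hF hheat.
have hfin : M z1 <= 8 * S / rho + 2 * (B * M z1) * rho.
  apply: le_trans (lerD (hg 0) (hg 2)) _.
  by rewrite le_eqVlt; apply/orP; left; apply/eqP; field; rewrite gt_eqF.
have m_q : N <= M z1 * q.
  rewrite mulrC -ler_pdivrMr// -(ler_pXn2r (n := 2))// ?nnegrE ?(ltW s0) ?(ltW q0)//.
  have [|/andP[h2 _] _] := hQ (z1.1 - (N / M z1) ^+ 2, z1.2).
    split=> [/=|i]; last by rewrite subrr normr0 ltW.
    by rewrite lexx gerBl sqr_ge0.
  have [/andP[_ h3] _] := Qz1.
  by move: h2 h3; rewrite /=; lra.
have rE : rho = N / M z1 \/ rho * (4 * B) = 1.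
  rewrite /rho; case: leP => _; [by left|right].
  by rewrite mulVf// gt_eqF// mulr_gt0.
exact: (drift_arith B0 S0 q0 M0 rho0 rB rE m_q hfin).
Qed.

End DriftGradient.

Section Coordinates.
Context {R : realType}.
Local Notation E := (R * 'rV[R]_3)%type.
Implicit Types (z : E) (U : set E).

Lemma smf_fst U : smf U (fun z : E => z.1).
Proof.
have d o (z : E) : derivable (fun z : E => z.1) z (dirv o) /\ pd o (fun z : E => z.1) z = dco o None :> R.
  apply: slice_derivable; have -> : (fun s : R => (s *: dirv o + z).1) = (fun s => s * dco o None + z.1).
    by apply/funext => s; rewrite shift1.
  by dR_auto; ring.
case=> [|n]; first by split; [move=> z _; exact: cE_fst|].
split; first by move=> z _; exact: cE_fst.
split; first by move=> o z _; have [] := d o z.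
move=> o; have -> : pd o (fun z : E => z.1) = fun=> dco o None by apply/funext => z; have [] := d o z.
exact: smf_cst.
Qed.

Lemma smf_snd U i : smf U (fun z : E => z.2 0 i).
Proof.
have d o (z : E) : derivable (fun z : E => z.2 0 i) z (dirv o) /\ pd o (fun z : E => z.2 0 i) z = dco o (Some i).
  apply: slice_derivable; have -> : (fun s : R => (s *: dirv o + z).2 0 i) = (fun s => s * dco o (Some i) + z.2 0 i).
    by apply/funext => s; rewrite shift2.
  by dR_auto; ring.
case=> [|n]; first by split; [move=> z _; exact: cE_snd|].
split; first by move=> z _; exact: cE_snd.
split; first by move=> o z _; have [] := d o z.
move=> o; have -> : pd o (fun z : E => z.2 0 i) = fun=> dco o (Some i) by apply/funext => z; have [] := d o z.
exact: smf_cst.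
Qed.

Lemma smfX U (F : E -> R) n : open U -> smf U F -> smf U (fun z => F z ^+ n).
Proof.
move=> oU sF; elim: n => [|n IH]; first by have -> : (fun z => F z ^+ 0) = (fun=> 1); [apply/funext|exact: smf_cst].
have -> : (fun z => F z ^+ n.+1) = (fun z => F z * F z ^+ n) by apply/funext => z; rewrite exprS.
exact: smfM.
Qed.

End Coordinates.

Ltac smf_step := first [ eassumption | match goal with
  | |- smf _ (fun z => ?c) => exact: smf_cst
  | |- smf _ (fun z => @?f z + @?g z) => refine (@smfD _ _ f g _ _ _)
  | |- smf _ (fun z => - @?f z) => refine (@smfN _ _ f _ _)
  | |- smf _ (fun z => @?f z * @?g z) => refine (@smfM _ _ f g _ _ _)
  | |- smf _ (fun z => @?f z ^+ ?n) => refine (@smfX _ _ f n _ _)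
  end | exact: slab_open | exact: smf_fst | exact: smf_snd ].
Ltac smf_auto := repeat smf_step.

(** * A flux identity for the circulation *)

Section MeasureStep.
Context {R : realType}.
Local Notation E := (R * 'rV[R]_3)%type.
Implicit Types (t r h x : R).

(** A product of squares, so that it vanishes together with its first derivatives on [x = 1], at the
    heights [- 2^-1] and [2^-1], and at the times -2 and -1, but not on the axis. *)
Definition bump t x h : R := (1 - x ^+ 2) ^+ 2 * (4^-1 - h ^+ 2) ^+ 2 * ((t + 2) * (- 1 - t)) ^+ 2.
Definition bump_x t x h : R := (- 4 * x * (1 - x ^+ 2)) * (4^-1 - h ^+ 2) ^+ 2 * ((t + 2) * (- 1 - t)) ^+ 2.
Definition bump_xx t x h : R := (12 * x ^+ 2 - 4) * (4^-1 - h ^+ 2) ^+ 2 * ((t + 2) * (- 1 - t)) ^+ 2.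
Definition bump_h t x h : R := (1 - x ^+ 2) ^+ 2 * (- 4 * h * (4^-1 - h ^+ 2)) * ((t + 2) * (- 1 - t)) ^+ 2.
Definition bump_hh t x h : R := (1 - x ^+ 2) ^+ 2 * (12 * h ^+ 2 - 1) * ((t + 2) * (- 1 - t)) ^+ 2.
Definition bump_t t x h : R := (1 - x ^+ 2) ^+ 2 * (4^-1 - h ^+ 2) ^+ 2 * (2 * ((t + 2) * (- 1 - t)) * (- 3 - 2 * t)).

Lemma ler_normM (x y c d : R) : `|x| <= c -> `|y| <= d -> `|x * y| <= c * d.
Proof. by move=> h1 h2; rewrite normrM ler_pM. Qed.

Lemma bump_bound t r h (B w0 w2 : R) : - 2 <= t <= - 1 -> 0 <= r <= 1 -> - 2^-1 <= h <= 2^-1 ->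
  1 <= B -> `|w0| <= B -> `|w2| <= B ->
  `|r * bump_t t r h + w0 * bump_x t r h + 3 * bump_x t r h + w2 * bump_h t r h + r * bump_xx t r h + r * bump_hh t r h| <= B.
Proof.
move=> /andP[t1 t2] /andP[r0 r1] /andP[h1 h2] B1 w0B w2B.
have nr : `|r| <= 1 by rewrite ger0_norm.
have nh2 : 0 <= h ^+ 2 <= 4^-1.
  by rewrite sqr_ge0/= expr2; nra.
have nr2 : 0 <= r ^+ 2 <= 1 by rewrite sqr_ge0/= expr_le1.
have nT : 0 <= (t + 2) * (- 1 - t) <= 4^-1.
  apply/andP; split; first by apply: mulr_ge0; lra.
  by have := sqr_ge0 (2 * t + 3); lra.
have nc : `|((t + 2) * (- 1 - t)) ^+ 2| <= 16^-1.
  by move: nT => /andP[]; set s := (t + 2) * _ => s0 s1; rewrite ger0_norm ?sqr_ge0// expr2; nra.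
have nct : `|2 * ((t + 2) * (- 1 - t)) * (- 3 - 2 * t)| <= 2 * 4^-1 * 1.
  apply: ler_normM; last by rewrite ler_norml; apply/andP; split; lra.
  apply: ler_normM; first by rewrite ger0_norm.
  by move: nT => /andP[s0 s1]; rewrite ger0_norm.
have nb : `|(4^-1 - h ^+ 2) ^+ 2| <= 16^-1.
  by move: nh2 => /andP[]; set s := h ^+ 2 => s0 s1; rewrite ger0_norm ?sqr_ge0// expr2; nra.
have nbh : `|- 4 * h * (4^-1 - h ^+ 2)| <= 4 * 2^-1 * 4^-1.
  apply: ler_normM; last by move: nh2 => /andP[s0 s1]; rewrite ler_norml; apply/andP; split; lra.
  apply: ler_normM; first by rewrite normrN ger0_norm.
  by rewrite ler_norml; apply/andP; split; lra.
have nbhh : `|12 * h ^+ 2 - 1| <= 2.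
  by move: nh2 => /andP[s0 s1]; rewrite ler_norml; apply/andP; split; lra.
have na : `|(1 - r ^+ 2) ^+ 2| <= 1.
  by move: nr2 => /andP[]; set s := r ^+ 2 => s0 s1; rewrite ger0_norm ?sqr_ge0// expr2; nra.
have nax : `|- 4 * r * (1 - r ^+ 2)| <= 4 * 1 * 1.
  apply: ler_normM; last by move: nr2 => /andP[s0 s1]; rewrite ler_norml; apply/andP; split; lra.
  by apply: ler_normM => //; rewrite normrN ger0_norm.
have naxx : `|12 * r ^+ 2 - 4| <= 8.
  by move: nr2 => /andP[s0 s1]; rewrite ler_norml; apply/andP; split; lra.
have k1 := ler_normM nr (ler_normM (ler_normM na nb) nct).
have k2 := ler_normM w0B (ler_normM (ler_normM nax nb) nc).
have n3 : `|3 : R| <= 3 by rewrite ger0_norm.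
have k3 := ler_normM n3 (ler_normM (ler_normM nax nb) nc).
have k4 := ler_normM w2B (ler_normM (ler_normM na nbh) nc).
have k5 := ler_normM nr (ler_normM (ler_normM naxx nb) nc).
have k6 := ler_normM nr (ler_normM (ler_normM na nbhh) nc).
rewrite -/(bump_t t r h) -/(bump_x t r h) -/(bump_h t r h) -/(bump_xx t r h) -/(bump_hh t r h) in k1 k2 k3 k4 k5 k6.
move: k1 k2 k3 k4 k5 k6; clear -B1.
move: (r * bump_t t r h) (w0 * bump_x t r h) (3 * bump_x t r h) (w2 * bump_h t r h) (r * bump_xx t r h) (r * bump_hh t r h).
move=> y1 y2 y3 y4 y5 y6; rewrite !ler_norml => /andP[a1 b1] /andP[a2 b2] /andP[a3 b3] /andP[a4 b4] /andP[a5 b5] /andP[a6 b6].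
by apply/andP; split; lra.
Qed.

(** The adjoint computation, with [v = S - G] and [f] the bump: in the divergence of the fluxes the
    equation for [G] and incompressibility cancel all derivatives of [v], so that [v] times
    derivatives of the bump remains. *)
Lemma measure_arith (r v gt gx gh gxx ghh v0 v2 v0x v2h f ft fx fh fxx fhh : R) : 0 < r ->
  v0x + v0 / r + v2h = 0 ->
  gt + v0 * gx + v2 * gh = gxx + ghh - gx / r ->
  (ft * (r * v) - f * (r * gt)) +
  (fx * (r * (v0 * v) + r * gx + 2 * v) + f * (v0 * v + r * (v0x * v) - r * (v0 * gx) + gx + r * gxx - 2 * gx)
    + v * fx - r * gx * fx + r * v * fxx) +
  (fh * (r * (v2 * v) + r * gh) + f * (r * (v2h * v) - r * (v2 * gh) + r * ghh) - r * gh * fh + r * v * fhh) =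
  v * (r * ft + (r * v0) * fx + 3 * fx + (r * v2) * fh + r * fxx + r * fhh).
Proof.
move=> r0 e1 e2; have rn : r != 0 by rewrite gt_eqF.
have e1' : v0 = - r * (v0x + v2h).
  have : r * (v0x + v0 / r + v2h) = 0 by rewrite e1 mulr0.
  have -> : r * (v0x + v0 / r + v2h) = v0 + r * (v0x + v2h) by field.
  by lra.
have e2' : gx = r * (gxx + ghh - gt - v0 * gx - v2 * gh).
  have -> : gxx + ghh - gt - v0 * gx - v2 * gh = gx / r by lra.
  by field.
set k := gx in e2' *.
have -> : (fx * (r * (v0 * v) + r * k + 2 * v) + f * (v0 * v + r * (v0x * v) - r * (v0 * k) + k + r * gxx - 2 * k) + v * fx - r * k * fx + r * v * fxx)
  = fx * (r * (v0 * v) + r * k + 2 * v) + f * v * (v0 + r * v0x) - f * k + f * (r * (gxx - v0 * k)) + v * fx - r * k * fx + r * v * fxx by ring.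
have -> : f * k = f * (r * (gxx + ghh - gt - v0 * k - v2 * gh)) by rewrite -e2'.
have -> : v0 + r * v0x = - r * v2h by rewrite e1'; ring.
by ring.
Qed.

Section Fluxes.
Variables (a b S : R) (u0 u2 G : E -> R).
Hypotheses (s0 : smf (slab a b) u0) (s2 : smf (slab a b) u2) (sG : smf (slab a b) G).

Definition fluxP (z : E) := bump z.1 (z.2 0 0) (z.2 0 2) * (z.2 0 0 * (S - G z)).
(** The equation is weighted by [r]. Since r G_xx - G_x = (r G_x)_x - 2 G_x, a flux [2 * (S - G z)]
    appears, the only one that survives at [r = 0]. *)
Definition fluxQ (z : E) := bump z.1 (z.2 0 0) (z.2 0 2) * (z.2 0 0 * (u0 z * (S - G z)) + z.2 0 0 * pd (Some 0) G z + 2 * (S - G z))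
  + z.2 0 0 * (S - G z) * bump_x z.1 (z.2 0 0) (z.2 0 2).
Definition fluxN (z : E) := bump z.1 (z.2 0 0) (z.2 0 2) * (z.2 0 0 * (u2 z * (S - G z)) + z.2 0 0 * pd (Some 2) G z)
  + z.2 0 0 * (S - G z) * bump_h z.1 (z.2 0 0) (z.2 0 2).

Let sG0 : smf (slab a b) (pd (Some 0) G). Proof. exact: smf_pd. Qed.
Let sG2 : smf (slab a b) (pd (Some 2) G). Proof. exact: smf_pd. Qed.
Lemma smf_fluxP : smf (slab a b) fluxP. Proof. by rewrite /fluxP /bump; smf_auto. Qed.
Lemma smf_fluxQ : smf (slab a b) fluxQ. Proof. by rewrite /fluxQ /bump /bump_x; smf_auto. Qed.
Lemma smf_fluxN : smf (slab a b) fluxN. Proof. by rewrite /fluxN /bump /bump_h; smf_auto. Qed.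
Lemma fluxPE t x h : fluxP (pt t x 0 h) = bump t x h * (x * (S - G (pt t x 0 h))).
Proof. by rewrite /fluxP ptt pt0 pt2. Qed.
Lemma fluxQE t x h : fluxQ (pt t x 0 h) = bump t x h * (x * (u0 (pt t x 0 h) * (S - G (pt t x 0 h))) + x * pd (Some 0) G (pt t x 0 h)
   + 2 * (S - G (pt t x 0 h))) + x * (S - G (pt t x 0 h)) * bump_x t x h.
Proof. by rewrite /fluxQ ptt pt0 pt2. Qed.
Lemma fluxNE t x h : fluxN (pt t x 0 h) = bump t x h * (x * (u2 (pt t x 0 h) * (S - G (pt t x 0 h))) + x * pd (Some 2) G (pt t x 0 h))
   + x * (S - G (pt t x 0 h)) * bump_h t x h.
Proof. by rewrite /fluxN ptt pt0 pt2. Qed.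
Lemma flux_bound t r h B : a < t < b -> - 2 <= t <= - 1 -> 0 < r <= 1 -> - 2^-1 <= h <= 2^-1 -> 1 <= B ->
  let P := pt t r 0 h in
    [/\ `|G P| <= S, `|r * u0 P| <= B, `|r * u2 P| <= B, pd (Some 0) u0 P + u0 P / r + pd (Some 2) u2 P = 0 &
      pd None G P + u0 P * pd (Some 0) G P + u2 P * pd (Some 2) G P =
       pd (Some 0) (pd (Some 0) G) P + pd (Some 2) (pd (Some 2) G) P - pd (Some 0) G P / r] ->
  `|pd None fluxP P + pd (Some 0) fluxQ P + pd (Some 2) fluxN P| <= (S - G P) * B.
Proof.
move=> tt ht hr hh B1 /= [gS rB0 rB2 ediv edrift]; have /andP[r0 r1] := hr.
have -> : pd None fluxP (pt t r 0 h) = bump_t t r h * (r * (S - G (pt t r 0 h))) - bump t r h * (r * pd None G (pt t r 0 h)).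
    apply: dR_uniq (dR_t r 0 h smf_fluxP tt) (dR_eq_on (f := fun t => bump t r h * (r * (S - G (pt t r 0 h)))) ltr01 (fun x _ => esym (fluxPE x r h)) _).
    have h1 := dR_t r 0 h sG tt.
    by rewrite /bump; dR_auto; rewrite /bump_t; ring.
  have -> : pd (Some 0) fluxQ (pt t r 0 h) = (bump_x t r h * (r * (u0 (pt t r 0 h) * (S - G (pt t r 0 h))) + r * pd (Some 0) G (pt t r 0 h) + 2 * (S - G (pt t r 0 h))) + bump t r h * (u0 (pt t r 0 h) * (S - G (pt t r 0 h)) + r * (pd (Some 0) u0 (pt t r 0 h) * (S - G (pt t r 0 h))) - r * (u0 (pt t r 0 h) * pd (Some 0) G (pt t r 0 h)) + pd (Some 0) G (pt t r 0 h) + r * pd (Some 0) (pd (Some 0) G) (pt t r 0 h) - 2 * pd (Some 0) G (pt t r 0 h))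
    + (S - G (pt t r 0 h)) * bump_x t r h - r * pd (Some 0) G (pt t r 0 h) * bump_x t r h + r * (S - G (pt t r 0 h)) * bump_xx t r h).
    apply: dR_uniq (dR_x r 0 h smf_fluxQ tt) (dR_eq_on (f := fun x => bump t x h * (x * (u0 (pt t x 0 h) * (S - G (pt t x 0 h))) + x * pd (Some 0) G (pt t x 0 h)
   + 2 * (S - G (pt t x 0 h))) + x * (S - G (pt t x 0 h)) * bump_x t x h) ltr01 (fun x _ => esym (fluxQE t x h)) _).
    have h1 := dR_x r 0 h sG tt; have h2 := dR_x r 0 h s0 tt; have h3 := dR_x r 0 h sG0 tt.
    by rewrite /bump /bump_x; dR_auto; rewrite /bump_xx; ring.
  have -> : pd (Some 2) fluxN (pt t r 0 h) = (bump_h t r h * (r * (u2 (pt t r 0 h) * (S - G (pt t r 0 h))) + r * pd (Some 2) G (pt t r 0 h)) + bump t r h * (r * (pd (Some 2) u2 (pt t r 0 h) * (S - G (pt t r 0 h))) - r * (u2 (pt t r 0 h) * pd (Some 2) G (pt t r 0 h)) + r * pd (Some 2) (pd (Some 2) G) (pt t r 0 h)) - r * pd (Some 2) G (pt t r 0 h) * bump_h t r h + r * (S - G (pt t r 0 h)) * bump_hh t r h).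
    apply: dR_uniq (dR_h r 0 h smf_fluxN tt) (dR_eq_on (f := fun h => bump t r h * (r * (u2 (pt t r 0 h) * (S - G (pt t r 0 h))) + r * pd (Some 2) G (pt t r 0 h))
   + r * (S - G (pt t r 0 h)) * bump_h t r h) ltr01 (fun x _ => esym (fluxNE t r x)) _).
    have h1 := dR_h r 0 h sG tt; have h2 := dR_h r 0 h s2 tt; have h3 := dR_h r 0 h sG2 tt.
    by rewrite /bump /bump_h; dR_auto; rewrite /bump_hh; field.
  rewrite (measure_arith _ _ _ _ _ _ _ r0 ediv edrift)// normrM.
  have v0 : 0 <= S - G (pt t r 0 h) by rewrite subr_ge0; apply: le_trans gS; exact: ler_norm.
  rewrite (ger0_norm v0); apply: ler_wpM2l => //; apply: bump_bound => //.
  by rewrite ltW.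
Qed.

End Fluxes.

(** [P] vanishes at both end times and [N] at both end heights, so their derivatives integrate to
    zero and may be added to complete the divergence. *)
Lemma itt_divergence (a b t1 t2 c d r : R) (P Q N : E -> R) : a < t1 -> t2 < b -> t1 < t2 -> c < d ->
  smf (slab a b) P -> smf (slab a b) Q -> smf (slab a b) N ->
  (forall h, c <= h <= d -> P (pt t2 r 0 h) = 0 /\ P (pt t1 r 0 h) = 0) ->
  (forall t, t1 <= t <= t2 -> N (pt t r 0 d) = 0 /\ N (pt t r 0 c) = 0) ->
  itt t1 t2 c d (pd (Some 0) Q) r = itt t1 t2 c d (fun z => pd None P z + pd (Some 0) Q z + pd (Some 2) N z) r.
Proof.
move=> at1 t2b t12 cd sP sQ sN P0 N0.
have sP' := smf_pd None sP; have sQ' := smf_pd (Some 0) sQ; have sN' := smf_pd (Some 2) sN.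
pose F (z : E) := pd None P z + pd (Some 0) Q z + pd (Some 2) N z.
have sF : smf (slab a b) F by rewrite /F; smf_auto.
have sFN : smf (slab a b) (fun z => F z - pd (Some 2) N z) by smf_auto.
transitivity (itt t1 t2 c d (fun z => (F z - pd (Some 2) N z) - pd None P z) r).
  by apply: itt_eq => t h _ _; rewrite /F; ring.
rewrite (ittB at1 t2b cd r sFN sP') (itt_pdN_0 at1 t2b t12 cd sP P0) subr0.
by rewrite (ittB at1 t2b cd r sF sN') (itt_pd2_0 at1 t2b t12 cd sN N0) subr0.
Qed.

(** The integral of 2 (1/4 - h^2)^2 over the heights is 1/15, and that of ((t + 2) (-1 - t))^2 over
    the times is 1/30. *)
Lemma bump_mass (S : R) (f : E -> R) : (forall t h, - 2 <= t <= - 1 -> - 2^-1 <= h <= 2^-1 ->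
    f (pt t 0 0 h) = 2 * S * ((t + 2) * (- 1 - t)) ^+ 2 * (4^-1 - h ^+ 2) ^+ 2) ->
  itt (- 2) (- 1) (- 2^-1) (2^-1) f 0 = S / 15 / 30.
Proof.
move=> hf; have t12 : - 2 < - 1 :> R by lra.
have cd : - 2^-1 < 2^-1 :> R by lra.
rewrite /itt (itg_eq (g := fun t => S / 15 * ((t + 2) * (- 1 - t)) ^+ 2)); last first.
  move=> t ht; rewrite /ith (itg_eq (g := fun h => 2 * S * ((t + 2) * (- 1 - t)) ^+ 2 * (4^-1 - h ^+ 2) ^+ 2)); last first.
    by move=> h hh; exact: hf.
  rewrite (@itg_ftc R _ _ (fun h => 2 * S * ((t + 2) * (- 1 - t)) ^+ 2 * (16^-1 * h - 6^-1 * h ^+ 3 + 5^-1 * h ^+ 5)) _ cd).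
  - by field.
  - by move=> x _; dR_auto; field.
  - move=> x _; have : dR (fun h => 2 * S * ((t + 2) * (- 1 - t)) ^+ 2 * (4^-1 - h ^+ 2) ^+ 2) x (2 * S * ((t + 2) * (- 1 - t)) ^+ 2 * (2 * (4^-1 - x ^+ 2) * (- (2 * x)))) by dR_auto; ring.
    exact: dR_cont.
rewrite (@itg_ftc R _ _ (fun t => S / 15 * (4 * t + 6 * t ^+ 2 + 13 / 3 * t ^+ 3 + 3 / 2 * t ^+ 4 + 5^-1 * t ^+ 5)) _ t12).
- by field.
- by move=> x _; dR_auto; field.
- move=> x _; have : dR (fun t => S / 15 * ((t + 2) * (- 1 - t)) ^+ 2) x (S / 15 * (2 * ((x + 2) * (- 1 - x)) * (- 3 - 2 * x))) by dR_auto; ring.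
  exact: dR_cont.
Qed.

Lemma sub_le2 (S g : R) : `|g| <= S -> S - g <= 2 * S.
Proof. by rewrite ler_norml => /andP[h _]; lra. Qed.

(** Since [k * B] is 1/1800, the flux changes by at most 2 S / 1800 on [0, k] and by at most S /
    1800 on [k, 1], which is too little to go from S / 450 = 4 S / 1800 to 0. *)
Lemma measure_final (k B S w1 w2 J0 J1 Jk : R) : 0 < k -> k < 1 -> k * B = 45^-1 * 40^-1 -> 0 < S -> J1 = 0 ->
  J0 = S / 15 / 30 -> Jk - J0 = w1 * (k - 0) -> J1 - Jk = w2 * (1 - k) ->
  `|w1| <= 2 * S * B -> `|w2| <= k * S * B -> False.
Proof.
move=> k0 k1 kB S0 -> ->; rewrite subr0 sub0r => e1 e2 b1' b2'.
have p1 : `|w1 * k| <= 2 * S * (45^-1 * 40^-1).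
  rewrite normrM (gtr0_norm k0); apply: le_trans (ler_wpM2r (ltW k0) b1') _.
  by rewrite -kB le_eqVlt; apply/orP; left; apply/eqP; ring.
have p2 : `|w2 * (1 - k)| <= S * (45^-1 * 40^-1).
  have k1' : 0 <= 1 - k by lra.
  have b0 : 0 <= k * S * B by apply: le_trans b2'.
  rewrite normrM (ger0_norm k1'); apply: le_trans (_ : k * S * B * 1 <= _).
    by apply: ler_pM => //; lra.
  by rewrite mulr1 mulrAC kB mulrC.
move: p1 p2; rewrite !ler_norml -e1 -e2 => /andP[p1 p1'] /andP[p2 p2'].
lra.
Qed.

(* The flux [fluxQ] through [r = kappa] is nearly [2 S] times the mass of the bump,
   as [G] vanishes on the axis; it has to vanish at [r = 1], so that the divergence
   identity forces a positive integral of [S - G]. *)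
Lemma measure_step (a b B S : R) (u0 u2 G : E -> R) : smf (slab a b) u0 -> smf (slab a b) u2 -> smf (slab a b) G ->
  a < - 2 -> - 1 < b -> 1 <= B -> 0 < S ->
  (forall t h, - 2 <= t <= - 1 -> - 2^-1 <= h <= 2^-1 -> G (pt t 0 0 h) = 0) ->
  (forall t r h, - 2 <= t <= - 1 -> 0 < r <= 1 -> - 2^-1 <= h <= 2^-1 -> let P := pt t r 0 h in
    [/\ `|G P| <= S, `|r * u0 P| <= B, `|r * u2 P| <= B, pd (Some 0) u0 P + u0 P / r + pd (Some 2) u2 P = 0 &
      pd None G P + u0 P * pd (Some 0) G P + u2 P * pd (Some 2) G P =
       pd (Some 0) (pd (Some 0) G) P + pd (Some 2) (pd (Some 2) G) P - pd (Some 0) G P / r]) ->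
  exists t r h, [/\ - 2 <= t <= - 1, (45 * (40 * B))^-1 <= r <= 1, - 2^-1 <= h <= 2^-1 &
    (45 * (40 * B))^-1 * S <= S - G (pt t r 0 h)].
Proof.
move=> s0 s2 sG a2 b1 B1 S0 G0 hG; set k := (45 * (40 * B))^-1.
have B0 : 0 < B by exact: lt_le_trans B1.
have k0 : 0 < k by rewrite invr_gt0; apply: mulr_gt0 => //; apply: mulr_gt0.
have kB : k * B = (45^-1 * 40^-1) by rewrite /k; field; rewrite gt_eqF.
have k1 : k < 1 by apply: le_lt_trans (_ : k * B < 1); [rewrite ler_peMr// ltW|rewrite kB; lra].
apply: contrapT => hno.
have small t r h : - 2 <= t <= - 1 -> k <= r <= 1 -> - 2^-1 <= h <= 2^-1 -> S - G (pt t r 0 h) <= k * S.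
  by move=> h1 h2 h3; rewrite leNgt; apply/negP => /ltW h4; apply: hno; exists t, r, h.
have oU := @slab_open R a b.
have sGo o := smf_pd o sG.
pose P := fluxP S G; pose Q := fluxQ S u0 G; pose N := fluxN S u2 G.
have PE t x h := fluxPE S G t x h; have QE t x h := fluxQE S u0 G t x h; have NE t x h := fluxNE S u2 G t x h.
rewrite -/P in PE; rewrite -/Q in QE; rewrite -/N in NE.
have sG0 := smf_pd (Some 0) sG; have sG2 := smf_pd (Some 2) sG.
have sP : smf (slab a b) P by exact: smf_fluxP.
have sQ : smf (slab a b) Q by exact: smf_fluxQ.
have sN : smf (slab a b) N by exact: smf_fluxN.
have tab t : - 2 <= t <= - 1 -> a < t < b by move=> /andP[h1 h2]; apply/andP; split; lra.
have key t r h : - 2 <= t <= - 1 -> 0 < r <= 1 -> - 2^-1 <= h <= 2^-1 ->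
   `|pd None P (pt t r 0 h) + pd (Some 0) Q (pt t r 0 h) + pd (Some 2) N (pt t r 0 h)| <= (S - G (pt t r 0 h)) * B.
  by move=> ht hr hh; exact: (flux_bound s0 s2 sG (tab _ ht) ht hr hh B1 (hG t r h ht hr hh)).
pose J r := itt (-2) (-1) (- 2^-1) (2^-1) Q r.
have t12 : - 2 < - 1 :> R by lra.
have cd : - 2^-1 < 2^-1 :> R by lra.
have sPt := smf_pd None sP; have sQx := smf_pd (Some 0) sQ; have sNh := smf_pd (Some 2) sN.
have dJ r : dR J r (itt (-2) (-1) (- 2^-1) (2^-1) (pd (Some 0) Q) r) by exact: (itt_dR_x a2 b1 t12 cd r sQ).
have dJb r w : 0 < r <= 1 -> (forall t h, - 2 <= t <= - 1 -> - 2^-1 <= h <= 2^-1 -> S - G (pt t r 0 h) <= w) ->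
    `|itt (-2) (-1) (- 2^-1) (2^-1) (pd (Some 0) Q) r| <= w * B.
  move=> hr hw.
  rewrite (itt_divergence a2 b1 t12 cd sP sQ sN); last first.
  - by move=> t _; rewrite !NE; split; rewrite /bump /bump_h; field.
  - by move=> h _; rewrite !PE; split; rewrite /bump; ring.
  have := @itt_bound R a b (-2) (-1) (- 2^-1) (2^-1) a2 b1 t12 cd (fun z => pd None P z + pd (Some 0) Q z + pd (Some 2) N z) r (w * B) _ _.
  have -> : w * B * (2^-1 - - 2^-1) * (- 1 - -2) = w * B by field.
  apply; first by smf_auto.
  move=> t h ht hh; apply: le_trans (key t r h ht hr hh) _.
  by rewrite ler_wpM2r// ?hw// ltW.
have J1 : J 1 = 0.
  have := @itt_bound R a b (-2) (-1) (- 2^-1) (2^-1) a2 b1 t12 cd Q 1 0 sQ.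
  rewrite !mul0r normr_le0 => /(_ _)/eqP; apply.
  by move=> t h _ _; rewrite QE /bump /bump_x expr1n subrr expr0n /= !mulr0 !mul0r mulr0 addr0 normr0.
have J0 : J 0 = S / 15 / 30.
  by apply: bump_mass => t h ht hh; rewrite QE (G0 t h ht hh) /bump /bump_x; ring.
have k01 : 0 < k by [].
have [c1 hc1 e1] := dR_MVT k01 (fun x _ => dJ x).
have [c2 hc2 e2] := dR_MVT k1 (fun x _ => dJ x).
have b1' : `|itt (-2) (-1) (- 2^-1) (2^-1) (pd (Some 0) Q) c1| <= 2 * S * B.
  have /andP[h1 h2] := hc1; have hc : 0 < c1 <= 1 by rewrite h1 ltW// (lt_trans h2).
  apply: dJb => // t h ht hh; have [gS _ _ _ _] := hG t c1 h ht hc hh.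
  exact: sub_le2.
have b2' : `|itt (-2) (-1) (- 2^-1) (2^-1) (pd (Some 0) Q) c2| <= k * S * B.
  have /andP[h1 h2] := hc2; have hc : 0 < c2 <= 1 by rewrite (lt_trans k0 h1) ltW.
  by apply: dJb => // t h ht hh; apply: small => //; rewrite !ltW.
exact: (measure_final k0 k1 kB S0 J1 J0 e1 e2 b1' b2').
Qed.

End MeasureStep.

(** * Decay of the circulation *)

Section PolynomialBounds.
Context {R : realType}.
Implicit Types (f g : R -> R) (B : R).

(** Stands for a bound by a power with an absolute exponent; constants are absorbed because the base
    is at least 2. *)
Definition pbounded f := exists k : nat, forall B, 2 <= B -> 0 <= f B <= B ^+ k.

Lemma pbC (c : R) : 0 <= c -> pbounded (fun=> c).
Proof.
move=> c0; have [k hk] := exp2_bound c; exists k => B B2; rewrite c0; apply: le_trans hk _.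
by rewrite lerXn2r ?nnegrE//; lra.
Qed.

Lemma pbid : pbounded (fun B => B).
Proof. by exists 1%N => B B2; rewrite expr1 lexx andbT; lra. Qed.

Lemma pbM f g : pbounded f -> pbounded g -> pbounded (fun B => f B * g B).
Proof.
move=> [k hk] [m hm]; exists (k + m)%N => B B2; rewrite exprD.
have /andP[f0 f1] := hk B B2; have /andP[g0 g1] := hm B B2.
by rewrite mulr_ge0//= ler_pM.
Qed.

Lemma pbD f g : pbounded f -> pbounded g -> pbounded (fun B => f B + g B).
Proof.
move=> [k hk] [m hm]; exists (maxn k m).+1 => B B2.
have /andP[f0 f1] := hk B B2; have /andP[g0 g1] := hm B B2.
have B1 : 1 <= B by lra.
have h1 : B ^+ k <= B ^+ maxn k m by rewrite ler_weXn2l ?leq_maxl.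
have h2 : B ^+ m <= B ^+ maxn k m by rewrite ler_weXn2l ?leq_maxr.
have h3 : 2 * B ^+ maxn k m <= B * B ^+ maxn k m by apply: ler_wpM2r => //; apply: exprn_ge0; lra.
by rewrite exprS addr_ge0//=; lra.
Qed.

Lemma pbX f n : pbounded f -> pbounded (fun B => f B ^+ n).
Proof.
move=> hf; elim: n => [|n IH]; first by have -> : (fun B => f B ^+ 0) = (fun=> 1); [apply/funext|exact: pbC].
have -> : (fun B => f B ^+ n.+1) = (fun B => f B * f B ^+ n) by apply/funext => B; rewrite exprS.
exact: pbM.
Qed.

End PolynomialBounds.

Ltac pb_auto := repeat first [ match goal with
  | |- pbounded (fun s => ?c) => apply: pbC; first [exact: ler0n | exact: ler01]
  | |- pbounded (fun s => s) => exact: pbid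
  | |- pbounded (fun s => @?f s + @?g s) => refine (@pbD _ f g _ _)
  | |- pbounded (fun s => @?f s * @?g s) => refine (@pbM _ f g _ _)
  | |- pbounded (fun s => @?f s ^+ ?n) => refine (@pbX _ f n _)
  end ].

Lemma circ_arith (R : realType) (c r w1 w2 w3 w4 w5 v0 v1 v2 : R) : r != 0 ->
  w1 + v0 * w2 + v2 * w3 + v1 * (v0 / r) = w4 + w2 / r - v1 / r ^+ 2 + w5 ->
  c * (r * w1) + v0 * (c * (v1 + r * w2)) + v2 * (c * (r * w3)) =
  c * (2 * w2 + r * w4) + c * (r * w5) - c * (v1 + r * w2) / r.
Proof.
move=> rn e.
have -> : w1 = w4 + w2 / r - v1 / r ^+ 2 + w5 - (v0 * w2 + v2 * w3 + v1 * (v0 / r)) by rewrite -e; ring.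
by field.
Qed.

Section Swirl.
Context {R : realType}.
Local Notation E := (R * 'rV[R]_3)%type.
Implicit Types (t r h x c : R).

(** [c] times the circulation on the half-plane y = 0, where the first coordinate is [r]. The values
    1 and -1 of [c] will give bounds from both sides. *)
Definition circ (u : 'I_3 -> E -> R) c (z : E) : R := c * (z.2 0 0 * u 1 z).

Variables (a b A : R) (u : 'I_3 -> E -> R) (p : E -> R).
Hypothesis hs : sol a b A u p.
Let su i : smf (slab a b) (u i). Proof. exact: (sol_u hs). Qed.

Lemma smf_circ c : smf (slab a b) (circ u c).
Proof. by have s1 := su 1; rewrite /circ; smf_auto. Qed.

Lemma circ_eq c t r h : a < t < b -> 0 < r -> let P := pt t r 0 h in let G := circ u c in
  pd None G P + u 0 P * pd (Some 0) G P + u 2 P * pd (Some 2) G P =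
    pd (Some 0) (pd (Some 0) G) P + pd (Some 2) (pd (Some 2) G) P - pd (Some 0) G P / r.
Proof.
move=> ht r0 P G; have sG := smf_circ c; have sG0 := smf_pd (Some 0) sG; have sG2 := smf_pd (Some 2) sG.
have GE t' x h' : G (pt t' x 0 h') = c * (x * u 1 (pt t' x 0 h')) by rewrite /G /circ pt0.
have s10 := smf_pd (Some 0) (su 1); have s12 := smf_pd (Some 2) (su 1).
have G0 x : pd (Some 0) G (pt t x 0 h) = c * (u 1 (pt t x 0 h) + x * pd (Some 0) (u 1) (pt t x 0 h)).
  apply: dR_uniq (dR_x x 0 h sG ht) (dR_eq_on (f := fun x => c * (x * u 1 (pt t x 0 h))) ltr01 (fun x _ => esym (GE t x h)) _).
  by have h1 := dR_x x 0 h (su 1) ht; dR_auto; ring.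
have G2 h' : pd (Some 2) G (pt t r 0 h') = c * (r * pd (Some 2) (u 1) (pt t r 0 h')).
  apply: dR_uniq (dR_h r 0 h' sG ht) (dR_eq_on (f := fun h => c * (r * u 1 (pt t r 0 h))) ltr01 (fun x _ => esym (GE t r x)) _).
  by have h1 := dR_h r 0 h' (su 1) ht; dR_auto; ring.
have GN : pd None G P = c * (r * pd None (u 1) P).
  apply: dR_uniq (dR_t r 0 h sG ht) (dR_eq_on (f := fun t => c * (r * u 1 (pt t r 0 h))) ltr01 (fun x _ => esym (GE x r h)) _).
  by have h1 := dR_t r 0 h (su 1) ht; dR_auto; ring.
have G00 : pd (Some 0) (pd (Some 0) G) P = c * (2 * pd (Some 0) (u 1) P + r * pd (Some 0) (pd (Some 0) (u 1)) P).
  apply: dR_uniq (dR_x r 0 h sG0 ht) (dR_eq_on (f := fun x => c * (u 1 (pt t x 0 h) + x * pd (Some 0) (u 1) (pt t x 0 h))) ltr01 (fun x _ => esym (G0 x)) _).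
  by have h1 := dR_x r 0 h (su 1) ht; have h2 := dR_x r 0 h s10 ht; dR_auto; ring.
have G22 : pd (Some 2) (pd (Some 2) G) P = c * (r * pd (Some 2) (pd (Some 2) (u 1)) P).
  apply: dR_uniq (dR_h r 0 h sG2 ht) (dR_eq_on (f := fun h => c * (r * pd (Some 2) (u 1) (pt t r 0 h))) ltr01 (fun x _ => esym (G2 x)) _).
  by have h1 := dR_h r 0 h s12 ht; dR_auto; ring.
rewrite GN G00 G22 /P G0 G2 -/P; have := swirl_eq hs h ht r0; cbv zeta; rewrite -/P.
move: (pd None (u 1) P) (pd (Some 0) (u 1) P) (pd (Some 2) (u 1) P) (pd (Some 0) (pd (Some 0) (u 1)) P)
  (pd (Some 2) (pd (Some 2) (u 1)) P) (u 0 P) (u 1 P) (u 2 P) => w1 w2 w3 w4 w5 v0 v1 v2 e.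
by apply: circ_arith e; rewrite gt_eqF.
Qed.

End Swirl.

(** * One step of the decay of the circulation *)

Section Osc.
Context {R : realType}.
Local Notation E := (R * 'rV[R]_3)%type.
Implicit Types (t r h B S : R).

(** The gradient bound of [drift_gradient] relative to [S], with [q = k / 4] and drift bound 2 (B +
    1) / k, where k = 1 / (1800 B) is the smallest radius allowed by [measure_step]. *)
Definition osc_L B := 136 * (45 * (40 * B)) + 130 * (2 * ((B + 1) * (45 * (40 * B)))).
(** The first term absorbs the factor [k / 2] of the starting value, the second the decay of the
    moving barrier over a time at most 2. *)
Definition osc_rate B := 2 * (45 * (40 * B)) +
  2 * ((8 * (2 * ((B + 1) * (45 * (40 * B))) + 2) + 16 * (4 * (osc_L B * (45 * (40 * B))))) ^+ 2 + 1).

Lemma osc_rate_pb : @pbounded R osc_rate.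
Proof. by rewrite /osc_rate /osc_L; pb_auto. Qed.

Lemma band_time (t q : R) : - 2 <= t -> q <= 1 -> - 3 <= t - q. Proof. lra. Qed.
Lemma band_r (k r r' : R) : k <= 1 -> 3 / 4 * k <= r -> r <= 3 / 2 -> r - k / 4 <= r' -> r' <= r + k / 4 -> k / 2 <= r' <= 2.
Proof. by move=> *; apply/andP; split; lra. Qed.
Lemma band_h (k h h' : R) : k <= 1 -> - (3 / 4) <= h -> h <= 3 / 4 -> h - k / 4 <= h' -> h' <= h + k / 4 -> - 1 <= h' <= 1.
Proof. by move=> *; apply/andP; split; lra. Qed.

Lemma quarter_sq (k : R) : 0 < k -> k <= 1 -> (k / 4) ^+ 2 <= 1.
Proof. by move=> k0 k1; rewrite expr_le1//; lra. Qed.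

Lemma sq_le (x y c : R) : 0 <= c -> x ^+ 2 + y ^+ 2 <= c ^+ 2 -> `|x| <= c /\ `|y| <= c.
Proof.
move=> c0 xy; rewrite -(ler_sqr (x := `|x|)) ?nnegrE// -(ler_sqr (x := `|y|)) ?nnegrE// !real_normK ?num_real//.
by have := sqr_ge0 x; have := sqr_ge0 y; split; lra.
Qed.

(** The centre moves linearly from [(r1, h1)] to [(1, 0)] and keeps a radius at least [k], so a disc
    of radius at most [k / 4] stays away from the axis. *)
Lemma path_arith (r1 h1 tau d r h k s : R) : 0 < k -> k <= r1 -> r1 <= 1 -> - 2^-1 <= h1 -> h1 <= 2^-1 ->
  0 < tau -> 0 <= d -> d <= tau -> 0 < s -> s <= k / 4 -> k <= 1 ->
  (r - (r1 + (1 - r1) / tau * d)) ^+ 2 + (h - (h1 + (0 - h1) / tau * d)) ^+ 2 <= s ^+ 2 ->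
  k / 2 <= r <= 2 /\ - 1 <= h <= 1.
Proof.
move=> k0 kr r1_1 hh1 hh2 tau0 d0 dt s0 sk k1 /(sq_le (ltW s0)).
have -> : (1 - r1) / tau * d = (1 - r1) * (d / tau) by field; rewrite gt_eqF.
have -> : (0 - h1) / tau * d = - h1 * (d / tau) by field; rewrite gt_eqF.
have l0 : 0 <= d / tau by rewrite divr_ge0// ltW.
have l1 : d / tau <= 1 by rewrite ler_pdivrMr// mul1r.
move: (d / tau) l0 l1 => l l0 l1; rewrite !ler_norml => -[/andP[a1 a2] /andP[a3 a4]].
have p1 : 0 <= (1 - r1) * l by apply: mulr_ge0 => //; lra.
have p2 : (1 - r1) * l <= 1 - r1 by rewrite ler_piMr//; lra.
have p3 : - 2^-1 <= h1 * (1 - l) <= 2^-1.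
  by rewrite -ler_norml normrM -[2^-1]mulr1 ler_pM//; rewrite ler_norml; apply/andP; split; lra.
by move: p3 => /andP[p3 p4]; split; apply/andP; split; lra.
Qed.

Lemma start_arith (k s r1 h1 x y : R) : k <= 1 -> s <= k / 4 -> k <= r1 -> r1 <= 1 -> - 2^-1 <= h1 -> h1 <= 2^-1 ->
  `|x - r1| <= s -> `|y - h1| <= s -> 3 / 4 * k <= x <= 3 / 2 /\ - (3 / 4) <= y <= 3 / 4.
Proof.
move=> k1 sk a1 a2 a3 a4; rewrite !ler_norml => /andP[a5 a6] /andP[a7 a8].
by split; apply/andP; split; lra.
Qed.

Lemma ler_norm2 (x y c : R) : `|x| + `|y| <= c -> `|x| <= c /\ `|y| <= c.
Proof. by have := normr_ge0 x; have := normr_ge0 y; move=> *; split; lra. Qed.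

Lemma between_dist (x c d s : R) : Num.min c d <= x <= Num.max c d -> `|d - c| <= s -> `|x - c| <= s.
Proof.
rewrite /Num.min /Num.max; case: ltP => cd /andP[h1 h2]; rewrite !ler_norml => /andP[h3 h4]; apply/andP; split; lra.
Qed.

Lemma start_final (k S g0 g1 g2 m : R) : k * S <= S - g0 -> `|g2 - g1| <= m -> `|g1 - g0| <= m -> m = k * S / 4 ->
  k * S / 2 <= S - g2.
Proof. by move=> h1; rewrite !ler_norml => /andP[h2 h3] /andP[h4 h5] e; move: e h1; move: (k * S) => w *; lra. Qed.

Lemma drift_shift (r v0 v2 gt gx gh gxx ghh : R) : gt + v0 * gx + v2 * gh = gxx + ghh - gx / r ->
  gt + (v0 + r^-1) * gx + v2 * gh = gxx + ghh.
Proof.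
move=> e; rewrite -[RHS](subrK (gx / r)) -e; ring.
Qed.

Lemma osc_final (K B' L' tau S g : R) : 0 < K -> 0 < B' -> 0 < L' -> 0 < tau -> tau <= 2 -> 0 < S ->
  K^-1 * S / 2 * expR (- (((8 * (B' + 2) * L'^-1 + 16) ^+ 2 / (32 * L'^-1 ^+ 2) + 1) * tau)) <= S - g ->
  g <= (1 - expR (- (2 * K + 2 * ((8 * (B' + 2) + 16 * L') ^+ 2 + 1)))) * S.
Proof.
move=> K0 B'0 L0 tau0 tau2 S0.
have -> : (8 * (B' + 2) * L'^-1 + 16) ^+ 2 / (32 * L'^-1 ^+ 2) = (8 * (B' + 2) + 16 * L') ^+ 2 / 32 by field; rewrite gt_eqF.
have := sqr_ge0 (8 * (B' + 2) + 16 * L'); move: (_ ^+ 2) => X X0 hg.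
suff : expR (- (2 * K + 2 * (X + 1))) * S <= S - g by rewrite mulrBl mul1r; lra.
apply: le_trans hg; rewrite (mulrAC K^-1) (mulrAC _ S) ler_pM2r// opprD expRD.
apply: ler_pM; rewrite ?expR_ge0//.
  rewrite expRN -invfM mulrC lef_pV2 ?posrE ?mulr_gt0 ?expR_gt0//.
  by apply: le_trans (expR_ge1Dx _); lra.
by rewrite ler_expR lerN2 mulrC ler_pM//; lra.
Qed.

Section Step.
Variables (a b B S : R) (u0 u2 G : E -> R).
Hypotheses (s0 : smf (slab a b) u0) (s2 : smf (slab a b) u2) (sG : smf (slab a b) G).
Hypotheses (a3 : a < - 3) (b0 : 0 < b) (B1 : 1 <= B) (S0 : 0 < S).
Hypothesis G0 : forall t h, a < t < b -> G (pt t 0 0 h) = 0.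
Hypothesis hE : forall t r h, a < t < b -> 0 < r -> let P := pt t r 0 h in
    pd (Some 0) u0 P + u0 P / r + pd (Some 2) u2 P = 0 /\
    pd None G P + u0 P * pd (Some 0) G P + u2 P * pd (Some 2) G P =
       pd (Some 0) (pd (Some 0) G) P + pd (Some 2) (pd (Some 2) G) P - pd (Some 0) G P / r.
Hypothesis hb : forall t r h, - 3 <= t <= 0 -> 0 < r <= 2 -> - 1 <= h <= 1 -> let P := pt t r 0 h in
    [/\ `|G P| <= S, `|r * u0 P| <= B & `|r * u2 P| <= B].

Let K := 45 * (40 * B).
Let k := K^-1.
Let B' := 2 * ((B + 1) * K).
Let L := osc_L B.
Let s := (4 * (L * K))^-1.

Let B'E : B' = B * (2 * K) + 2 * K. Proof. by rewrite /B'; ring. Qed.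
Let B0 : 0 < B. Proof. exact: lt_le_trans B1. Qed.
Let K0 : 0 < K. Proof. by rewrite /K; apply: mulr_gt0 => //; apply: mulr_gt0. Qed.
Let k0 : 0 < k. Proof. by rewrite invr_gt0. Qed.
Let K1 : 1 <= K.
Proof. by rewrite /K mulrA -natrM -[X in X <= _]mulr1 ler_pM// ler1n. Qed.
Let k1 : k <= 1. Proof. by rewrite invf_le1. Qed.
Let BK : 0 < (B + 1) * K. Proof. by rewrite mulr_gt0// ltr_wpDr. Qed.
Let L1 : 1 <= L. Proof. by rewrite /L /osc_L -/K; move: K1 BK; lra. Qed.
Let s_gt0 : 0 < s. Proof. by rewrite invr_gt0 !mulr_gt0//; apply: lt_le_trans L1. Qed.
Let sLk : s * L = k / 4.
Proof.
rewrite /s /k; have Ln : L != 0 by rewrite gt_eqF//; apply: lt_le_trans L1.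
have Kn : K != 0 by rewrite gt_eqF.
by field; rewrite Ln Kn.
Qed.
Let sk : s <= k / 4. Proof. by rewrite -sLk ler_peMr// ltW. Qed.

(** The term [- G_x / r] is counted as drift, which is bounded away from the axis. *)
Let drift t r h : - 3 <= t <= 0 -> k / 2 <= r <= 2 -> - 1 <= h <= 1 -> let P := pt t r 0 h in
  [/\ `|G P| <= S, `|u0 P + r^-1| <= B', `|u2 P| <= B' &
    pd None G P + (u0 P + r^-1) * pd (Some 0) G P + u2 P * pd (Some 2) G P =
       pd (Some 0) (pd (Some 0) G) P + pd (Some 2) (pd (Some 2) G) P].
Proof.
move=> ht /andP[r1 r2] hh P; have r0 : 0 < r by apply: lt_le_trans r1; rewrite divr_gt0.
have hr : 0 < r <= 2 by rewrite r0.
have ht' : a < t < b by have /andP[t1 t2] := ht; rewrite (lt_le_trans a3 t1) (le_lt_trans t2 b0).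
have [gS h0 h2] := hb ht hr hh; have [_ e] := hE h ht' r0.
have rV : r^-1 <= 2 * K.
  have -> : 2 * K = (k / 2)^-1 by rewrite /k invfM !invrK mulrC.
  by rewrite lef_pV2// posrE// divr_gt0.
have rV0 : 0 < r^-1 by rewrite invr_gt0.
have nV (x y : R) : `|r * x| <= y -> `|x| <= y * (2 * K).
  rewrite normrM (gtr0_norm r0) => hx.
  have -> : `|x| = (r * `|x|) * r^-1 by field; rewrite gt_eqF.
  by apply: ler_pM => //; [apply: mulr_ge0 => //; exact: ltW|exact: ltW].
split => //.
- apply: le_trans (ler_normD _ _) _; rewrite (gtr0_norm rV0).
  by rewrite B'E; apply: lerD => //; exact: nV.
- by apply: le_trans (nV _ _ h2) _; rewrite B'E lerDl; apply: mulr_ge0 => //; exact: ltW.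
- exact: drift_shift e.
Qed.

Let grad t r h : - 2 <= t <= 0 -> 3 / 4 * k <= r <= 3 / 2 -> - (3 / 4) <= h <= 3 / 4 ->
  `|pd (Some 0) G (pt t r 0 h)| + `|pd (Some 2) G (pt t r 0 h)| <= S * L.
Proof.
move=> /andP[t1 t2] /andP[r1 r2] /andP[h1 h2].
have q0 : 0 < k / 4 by rewrite divr_gt0.
have q1 : (k / 4) ^+ 2 <= 1 by exact: quarter_sq.
have B'0 : 0 < B' by rewrite /B' mulr_gt0.
have t3 : - 3 <= t - (k / 4) ^+ 2 by exact: band_time.
have aq : a < t - (k / 4) ^+ 2 by exact: lt_le_trans t3.
have tb : t < b by exact: le_lt_trans b0.
have -> : L = 34 / (k / 4) + 130 * B'.
  by rewrite /L /osc_L -/K /B' /k; field; rewrite gt_eqF.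
apply: (@drift_gradient R a b G (fun z => u0 z + (z.2 0 0)^-1) u2 t r h (k / 4) B' S sG q0 aq tb B'0 S0).
move=> t' r' h' /andP[t'1 t'2]; rewrite !ler_distl => /andP[r'1 r'2] /andP[h'1 h'2] P.
rewrite /P pt0; apply: drift.
- by rewrite (le_trans t3 t'1) (le_trans t'2 t2).
- exact: (band_r k1 r1 r2 r'1 r'2).
- exact: (band_h k1 h1 h2 h'1 h'2).
Qed.

Lemma osc_step : G (pt 0 1 0 0) <= (1 - expR (- osc_rate B)) * S.
Proof.
have a2 : a < - 2 by apply: lt_trans a3 _; rewrite ltrN2 ltr_nat.
have b1 : - 1 < b by apply: lt_trans b0; rewrite oppr_lt0.
have tab t : - 3 <= t <= 0 -> a < t < b by move=> /andP[h1 h2]; rewrite (lt_le_trans a3 h1) (le_lt_trans h2 b0).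
have t23 t : - 2 <= t <= - 1 -> - 3 <= t <= 0 by move=> /andP[h1 h2]; apply/andP; split; lra.
have hrh r h : 0 < r <= 1 -> - 2^-1 <= h <= 2^-1 -> 0 < r <= 2 /\ - 1 <= h <= 1.
  by move=> /andP[h1 h2] /andP[h3 h4]; split; apply/andP; split; lra.
have [||t1 [r1 [h1 [ht1 /andP[r11 r12] /andP[h11 h12] hv]]]] := measure_step s0 s2 sG a2 b1 B1 S0.
  by move=> t h ht _; apply: G0; apply: tab; exact: t23.
  move=> t r h ht hr hh P; have [hr' hh'] := hrh _ _ hr hh; have r0 : 0 < r by case/andP: hr.
  have [e1 e2] := hE h (tab _ (t23 _ ht)) r0.
  by have [h2 h3 h4] := hb (t23 _ ht) hr' hh'; split.
rewrite -/K -/k in r11 hv.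
pose v (z : E) := S - G z.
have sv : smf (slab a b) v by rewrite /v; smf_auto.
have pdv o z : slab a b z -> pd o v z = - pd o G z.
  by move=> Uz; rewrite /v (pdB o (smf_cst _ S) sG Uz) pd_cst sub0r.
have pdvv o z : slab a b z -> pd o (pd o v) z = - pd o (pd o G) z.
  move=> Uz; rewrite -(pdN o (smf_pd o sG) Uz); apply: (pd_eq o (@slab_open _ a b) _ Uz).
  by move=> y Uy; exact: pdv.
(* The barrier starts at half of the value [k * S] found at [(t1, r1, h1)]; since [s * L = k / 4],
   moving by [s] loses at most [k * S / 4] in each of the two variables. *)
pose eta := k * S / 2 / s ^+ 4.
have eta0 : 0 < eta by rewrite !divr_gt0// ?mulr_gt0// exprn_gt0.
have etas : eta * s ^+ 4 = k * S / 2 by rewrite divfK// gt_eqF// exprn_gt0.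
have [/andP[t11 t12] /andP[t13 t14]] := (ht1, t23 _ ht1).
have at1 : a < t1 by exact: lt_le_trans a3 t13.
have t10 : t1 < 0 by apply: le_lt_trans t12 _; rewrite oppr_lt0.
have tau1 : 1 <= 0 - t1 by rewrite sub0r lerNr.
have tau2 : 0 - t1 <= 2 by rewrite sub0r lerNl.
have tau0 : 0 < 0 - t1 by exact: lt_le_trans tau1.
have speed (x : R) : `|x| <= 1 -> `|x / (0 - t1)| <= 2.
  move=> x1; rewrite normrM normfV (gtr0_norm tau0) ler_pdivrMr//.
  by apply: le_trans x1 _; apply: le_trans tau1 _; rewrite ler_peMl ?ler1n// ltW.
have sp1 : `|(1 - r1) / (0 - t1)| <= 2.
  by apply: speed; rewrite ger0_norm ?subr_ge0// gerBl (le_trans (ltW k0)).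
have sp2 : `|(0 - h1) / (0 - t1)| <= 2.
  apply: speed; rewrite sub0r normrN; apply: le_trans (_ : 2^-1 <= _); first by rewrite ler_norml h11.
  by rewrite invf_le1// ler1n.
apply: (osc_final (K := K) (B' := B') (L' := 4 * (L * K)) (tau := 0 - t1)) => //.
- by rewrite /B' mulr_gt0.
- by rewrite !mulr_gt0//; exact: lt_le_trans L1.
rewrite -/s -/k -etas.
apply: (@moving_ball R a b v (fun z => u0 z + (z.2 0 0)^-1) u2 t1 0 r1 h1 1 0 s B' eta sv at1 b0 t10 s_gt0 eta0 sp1 sp2).
- move=> t r h /andP[tt1 tt2] hxy P.
  have d0 : 0 <= t - t1 by rewrite subr_ge0.
  have d1 : t - t1 <= 0 - t1 by rewrite lerD2r.
  have [hr hh] := path_arith k0 r11 r12 h11 h12 tau0 d0 d1 s_gt0 sk k1 hxy.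
  have ht : - 3 <= t <= 0 by rewrite (le_trans t13 tt1).
  have UP : slab a b P by exact: (tab _ ht).
  have [gS hb1 hb2 e] := drift ht hr hh.
  rewrite -/P in gS hb1 hb2 e *; rewrite !pdvv// !pdv// /P pt0 -/P; split => //.
    by rewrite /v subr_ge0; apply: le_trans (ler_norm _) gS.
  by rewrite !mulrN -!opprD e.
- move=> r h hxy; rewrite etas; have [xr xh] := sq_le (ltW s_gt0) hxy.
  have gr x y : `|x - r1| <= s -> `|y - h1| <= s ->
      `|pd (Some 0) G (pt t1 x 0 y)| <= S * L /\ `|pd (Some 2) G (pt t1 x 0 y)| <= S * L.
    move=> hx hy; have [x1 y1] := start_arith k1 sk r11 r12 h11 h12 hx hy.
    have ht : - 2 <= t1 <= 0 by rewrite t11 ltW.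
    have := grad ht x1 y1; exact: ler_norm2.
  have tt := tab _ (t23 _ ht1).
  have lx : `|G (pt t1 r 0 h) - G (pt t1 r1 0 h)| <= S * L * `|r - r1|.
    apply: (dR_lip (f := fun x => G (pt t1 x 0 h)) (df := fun x => pd (Some 0) G (pt t1 x 0 h))) => x hx.
    split; first exact: (dR_x x 0 h sG tt).
    by apply: (gr x h _ xh).1; exact: between_dist hx xr.
  have lh : `|G (pt t1 r1 0 h) - G (pt t1 r1 0 h1)| <= S * L * `|h - h1|.
    apply: (dR_lip (f := fun x => G (pt t1 r1 0 x)) (df := fun x => pd (Some 2) G (pt t1 r1 0 x))) => x hx.
    split; first exact: (dR_h r1 0 x sG tt).
    by apply: (gr r1 x _ _).2; [rewrite subrr normr0 ltW|exact: between_dist hx xh].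
  have SL0 : 0 <= S * L by apply: mulr_ge0; [exact: ltW|exact: le_trans L1].
  have SLs : S * L * s = k * S / 4 by rewrite -mulrA (mulrC L) sLk; ring.
  apply: (start_final hv (le_trans lx (ler_wpM2l SL0 xr)) (le_trans lh (ler_wpM2l SL0 xh)) SLs).
Qed.

End Step.
End Osc.

(** * Iteration of the decay over dyadic scales *)

Section SwirlDecay.
Context {R : realType}.
Local Notation E := (R * 'rV[R]_3)%type.
Implicit Types (t r h c B S rho : R).

Lemma osc_rate_gt0 B : 1 <= B -> 0 < osc_rate B.
Proof.
move=> B1; have B0 : 0 < B by exact: lt_le_trans B1.
rewrite /osc_rate; apply: ltr_pwDr; last by rewrite !mulr_ge0// ltW.
by apply: mulr_gt0 => //; apply: ltr_wpDl => //; exact: sqr_ge0.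
Qed.

(** [osc_step] speaks of radius 1, height 0 and time 0 only; every other point is moved there by a
    translation and a scaling with its own radius [r]. As [r <= rho / 2], the box used by the step
    is contained in the box of size [rho]. *)
Lemma circ_step a b A (u : 'I_3 -> E -> R) p B S rho c : sol a b A u p -> a < - rho ^+ 2 -> 0 < b -> 1 <= B -> 0 < S ->
  (forall t r h, - rho ^+ 2 <= t <= 0 -> 0 < r <= rho -> `|h| <= rho -> let P := pt t r 0 h in
    [/\ `|circ u c P| <= S, `|r * u 0 P| <= B & `|r * u 2 P| <= B]) ->
  forall t r h, - (rho / 2) ^+ 2 <= t <= 0 -> 0 < r <= rho / 2 -> `|h| <= rho / 2 ->
    circ u c (pt t r 0 h) <= (1 - expR (- osc_rate B)) * S.
Proof.
move=> hs ar b0 B1 S0 hb t r h /andP[t1 t2] /andP[r0 r1] hh.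
have rho0 : 0 < rho by have := lt_le_trans r0 r1; rewrite pmulr_lgt0 ?invr_gt0.
have r2n : 0 < r ^+ 2 by rewrite exprn_gt0.
have r2 : r ^+ 2 <= (rho / 2) ^+ 2 by rewrite ler_sqr ?nnegrE// ltW// ?divr_gt0.
have rhoE : rho ^+ 2 = 4 * (rho / 2) ^+ 2 by field.
have hv := sol_usc hs t h r0.
set a' := (a - t) / r ^+ 2 in hv; set b' := (b - t) / r ^+ 2 in hv; set v := usc t h r u in hv.
have a'3 : a' < - 3 by rewrite /a' ltr_pdivrMr//; move: ar rhoE r2 t1; move: (rho ^+ 2) (r ^+ 2) ((rho / 2) ^+ 2) => ? ? ? *; lra.
have b'0 : 0 < b' by rewrite divr_gt0// subr_gt0 (le_lt_trans t2).
have cv t' r' h' : circ v c (pt t' r' 0 h') = circ u c (pt (t + r ^+ 2 * t') (r * r') 0 (h + r * h')).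
  by rewrite /circ /v /usc sclmap_pt !pt0 mulr0; ring.
have -> : circ u c (pt t r 0 h) = circ v c (pt 0 1 0 0) by rewrite cv !mulr0 mulr1 !addr0.
apply: (@osc_step R a' b' B S (v 0) (v 2) (circ v c) (sol_u hv 0) (sol_u hv 2) (smf_circ hv c) a'3 b'0 B1 S0).
- by move=> t' h' _; rewrite /circ pt0 mul0r mulr0.
- by move=> t' r' h' ht' r'0; split; [exact: (div_eq hv h' ht' r'0)|exact: (circ_eq hv c h' ht' r'0)].
move=> t' r' h' /andP[t'1 t'2] /andP[r'0 r'1] /andP[h'1 h'2] P.
have k1 : - rho ^+ 2 <= t + r ^+ 2 * t' <= 0.
  have e1 : r ^+ 2 * (- 3) <= r ^+ 2 * t' by rewrite ler_pM2l.
  have e2 : r ^+ 2 * t' <= 0 by rewrite pmulr_rle0.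
  by move: rhoE r2 t1 t2 e1 e2; move: (rho ^+ 2) (r ^+ 2) ((rho / 2) ^+ 2) (r ^+ 2 * t') => ? ? ? ? *; apply/andP; split; lra.
have k2 : 0 < r * r' <= rho.
  rewrite mulr_gt0//=; apply: le_trans (_ : rho / 2 * 2 <= _); last by rewrite divfK.
  by apply: ler_pM => //; exact: ltW.
have k3 : `|h + r * h'| <= rho.
  apply: le_trans (ler_normD _ _) _; rewrite normrM (gtr0_norm r0) [rho](splitr rho).
  apply: lerD => //; rewrite -[rho / 2]mulr1; apply: ler_pM => //; first exact: ltW.
  by rewrite ler_norml h'1.
have [m1 m2 m3] := hb _ _ _ k1 k2 k3; rewrite cv; split => //.
- have -> : r' * v 0 P = r * r' * u 0 (pt (t + r ^+ 2 * t') (r * r') 0 (h + r * h')); last exact: m2.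
  by rewrite /v /usc /P sclmap_pt mulr0; ring.
- have -> : r' * v 2 P = r * r' * u 2 (pt (t + r ^+ 2 * t') (r * r') 0 (h + r * h')); last exact: m3.
  by rewrite /v /usc /P sclmap_pt mulr0; ring.
Qed.

(** The bound on [r * u i] is invariant under scaling, so the same rate applies at each scale. *)
Lemma swirl_decay a b A (u : 'I_3 -> E -> R) p B rho (n : nat) : sol a b A u p -> 0 < rho -> a < - rho ^+ 2 -> 0 < b -> 1 <= B ->
  (forall i t r h, - rho ^+ 2 <= t <= 0 -> 0 < r <= rho -> `|h| <= rho -> `|r * u i (pt t r 0 h)| <= B) ->
  forall t r h, - (rho / 2 ^+ n) ^+ 2 <= t <= 0 -> 0 < r <= rho / 2 ^+ n -> `|h| <= rho / 2 ^+ n ->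
    `|r * u 1 (pt t r 0 h)| <= (1 - expR (- osc_rate B)) ^+ n * B.
Proof.
move=> hs rho0 ar b0 B1 hb; elim: n => [|n IH] t r h.
  by rewrite expr0 invr1 mulr1 mul1r; exact: hb.
set s := rho / 2 ^+ n in IH.
have -> : rho / 2 ^+ n.+1 = s / 2 by rewrite /s exprSr invfM mulrA.
have s0 : 0 < s by rewrite divr_gt0// exprn_gt0.
have sr : s <= rho by rewrite /s ler_pdivrMr ?exprn_gt0// ler_peMr ?(ltW rho0)// exprn_ege1// ler1n.
have s2 : s ^+ 2 <= rho ^+ 2 by rewrite ler_sqr ?nnegrE// ltW.
have as2 : a < - s ^+ 2 by apply: lt_le_trans ar _; rewrite lerN2.
have q0 : 0 < 1 - expR (- osc_rate B).
  by rewrite subr_gt0 expR_lt1 oppr_lt0 osc_rate_gt0.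
move=> ht hr hh; have circE c (P : E) : circ u c P = c * (P.2 0 0 * u 1 P) by [].
have key c : `|c| = 1 -> circ u c (pt t r 0 h) <= (1 - expR (- osc_rate B)) * ((1 - expR (- osc_rate B)) ^+ n * B).
  move=> c1; apply: (circ_step (rho := s) hs as2 b0 B1 _ _ ht hr hh).
    by rewrite mulr_gt0 ?exprn_gt0// (lt_le_trans _ B1).
  move=> t' r' h' /andP[h1 h2] /andP[h3 h4] h5 P; split.
  - by rewrite circE normrM c1 mul1r pt0; apply: IH => //; rewrite ?h1 ?h3.
  - by apply: hb; rewrite ?h2 ?h3 ?andbT ?(le_trans _ h1) ?lerN2//= (le_trans _ sr).
  - by apply: hb; rewrite ?h2 ?h3 ?andbT ?(le_trans _ h1) ?lerN2//= (le_trans _ sr).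
have k1 := key 1 (normr1 _); have k2 := key (-1) (normrN1 _).
rewrite exprS -mulrA ler_norml; move: k1 k2; rewrite !circE pt0 mul1r mulN1r lerNl => -> ->.
by [].
Qed.

End SwirlDecay.

(** * Decay of the angular vorticity *)

Section Omega.
Context {R : realType}.
Local Notation E := (R * 'rV[R]_3)%type.
Implicit Types (t r h : R).

Lemma cE_inv (F : E -> R) z : F z != 0 -> cE F z -> cE (fun z => (F z)^-1) z.
Proof. by move=> n0 cF; apply: cvgV. Qed.

Lemma cE_exp (F : E -> R) z : cE F z -> cE (fun z => expR (F z)) z.
Proof. by move=> cF; exact: (cvg_comp _ _ cF (@continuous_expR R _)). Qed.

Lemma flat_cont (F : E -> R) t r h : cE F (pt t r 0 h) ->
  cE (fun z : E => F (pt z.1 (z.2 0 0) 0 (z.2 0 2))) (pt t r 0 h).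
Proof.
have [l [lN l0 l1 l2]] : exists l : option 'I_3 -> R, [/\ l None = 1, l (Some 0) = 1, l (Some 1) = 0 & l (Some 2) = 1].
  by exists (fun o => if o == Some 1 then 0 else 1).
have frE (z : E) : aff (0 : E) l z = pt z.1 (z.2 0 0) 0 (z.2 0 2).
  apply: E_eq; first by rewrite /= add0r lN mul1r.
  by apply: I3P; rewrite ?pt0 ?pt1 ?pt2 mxE mxE add0r ?l0 ?l1 ?l2 ?mul0r ?mul1r.
move=> cF; have -> : (fun z : E => F (pt z.1 (z.2 0 0) 0 (z.2 0 2))) = F \o aff (0 : E) l.
  by apply/funext => z; rewrite /= frE.
by apply: aff_cont; rewrite frE ptt pt0 pt2.
Qed.

Lemma plane_min (t1 t2 r1 r2 h1 h2 : R) (H : R -> R -> R -> R) : t1 <= t2 -> r1 <= r2 -> h1 <= h2 ->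
  (forall t r h, t1 <= t <= t2 -> r1 <= r <= r2 -> h1 <= h <= h2 ->
    cE (fun z : E => H z.1 (z.2 0 0) (z.2 0 2)) (pt t r 0 h)) ->
  exists t r h, [/\ t1 <= t <= t2, r1 <= r <= r2, h1 <= h <= h2 &
    forall t' r' h', t1 <= t' <= t2 -> r1 <= r' <= r2 -> h1 <= h' <= h2 -> H t r h <= H t' r' h'].
Proof.
move=> t12 r12 h12 cH.
pose lo (i : 'I_3) : R := if i == 0 then r1 else if i == 1 then 0 else h1.
pose hi (i : 'I_3) : R := if i == 0 then r2 else if i == 1 then 0 else h2.
pose K := [set z : E | t1 <= z.1 <= t2 /\ forall i, lo i <= z.2 0 i <= hi i].
have inK t r h : t1 <= t <= t2 -> r1 <= r <= r2 -> h1 <= h <= h2 -> K (pt t r 0 h).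
  by move=> h3 h4 h5; split => //; apply: I3P; rewrite ?pt0 ?pt1 ?pt2 /lo /hi /= ?lexx.
have Kpt z : K z -> [/\ t1 <= z.1 <= t2, r1 <= z.2 0 0 <= r2, h1 <= z.2 0 2 <= h2 & z = pt z.1 (z.2 0 0) 0 (z.2 0 2)].
  move=> [h3 h4]; split; [exact: h3|exact: (h4 0)|exact: (h4 2)|].
  rewrite [LHS]ptE; congr (pt _ _ _ _); have := h4 1; rewrite /lo /hi /= => hb; apply/eqP; rewrite eq_le andbC; exact: hb.
have cK : compact K by exact: box_compact.
have K0 : K (pt t1 r1 0 h1) by apply: inK; rewrite ?lexx.
have [|z Kz hz] := compact_max (F := fun z : E => - H z.1 (z.2 0 0) (z.2 0 2)) (ex_intro _ _ K0) cK.
  by move=> z /Kpt[h3 h4 h5 ->]; apply: cE_N; exact: cH.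
have [h3 h4 h5 _] := Kpt _ Kz; exists z.1, (z.2 0 0), (z.2 0 2); split => // t' r' h' h6 h7 h8.
by have := hz _ (inK _ _ _ h6 h7 h8); rewrite lerN2 ptt pt0 pt2.
Qed.

Lemma cube_bound (r : R) : 0 < r -> 2 * r - 1 <= 8 * r ^+ 3.
Proof.
move=> r0; have [r1|r1] := leP (2 * r) 1.
  by apply: le_trans (_ : 0 <= _); [lra|rewrite mulr_ge0// exprn_ge0// ltW].
have h : 0 <= (2 * r) * ((2 * r) ^+ 2 - 1).
  by rewrite mulr_ge0 ?mulr_ge0 ?(ltW r0)// subr_ge0 exprn_ege1// ltW.
have e : (2 * r) * ((2 * r) ^+ 2 - 1) = 8 * r ^+ 3 - 2 * r by ring.
by lra.
Qed.

Lemma omega_lin (c3 c3' c4a c4b c4c gx_r g_r2 gt gxx ghh s u0gx u2gh u0g w : R) :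
  gx_r - g_r2 = c4b + c3' -> u0gx - u0g <= c4c + c3 -> u2gh <= 4 * s / 7 -> c3 - c3' <= s / 2 ->
  7 * s <= c4a + c4b - c4c -> w <= s / 49 -> 0 < s -> gt <= w -> c4a <= gxx -> - (2 * w) <= ghh ->
  gxx + gx_r - g_r2 + ghh - 2 * s <= gt + u0gx + u2gh - u0g -> False.
Proof. by move=> *; lra. Qed.

(** The inequality at the touching point. The elliptic part of [sg * r * ex], where [ex] is exp
    (r^2), exceeds the contribution of a radial velocity at most 2 by
    [sg * r * ex * (7 + (2 * r - 1) ^+ 2)], hence by [7 * sg * r]. The source takes [2 * sg * r],
    and the terms in [u2], [k] and [w] together less than that. *)
Lemma omega_contra (sg r ex w l y k u0 u2 Sm q g gt gx gxx gh ghh : R) : 0 < sg -> 0 < r -> 1 <= ex -> 0 < w -> w <= 49^-1 ->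
  w * l = 7^-1 -> `|y| <= l -> k <= sg / 16 -> 0 < k -> `|u0| <= 2 -> `|u2| <= 2 ->
  g = - (r * Sm) + sg * r * (ex - w * q) - k -> gt <= sg * r * w ->
  gx = - Sm + sg * (ex - w * q) + 2 * sg * r ^+ 2 * ex -> sg * ex * (6 * r + 4 * r ^+ 3) <= gxx ->
  gh = - (2 * sg * r * w * y) -> - (2 * sg * w * r) <= ghh ->
  gxx + gx / r - g / r ^+ 2 + ghh - r * (2 * sg) <= gt + u0 * gx + u2 * gh - u0 / r * g -> False.
Proof.
move=> sg0 r0 ex1 w0 w1 wl yl ks k0 hu0 hu2 -> hgt -> hgxx -> hghh; have rn : r != 0 by rewrite gt_eqF.
set a := - Sm + sg * (ex - w * q).
have -> : - (r * Sm) + sg * r * (ex - w * q) - k = r * a - k by rewrite /a; ring.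
have ce : (a + 2 * sg * r ^+ 2 * ex) / r - (r * a - k) / r ^+ 2 = 2 * sg * r * ex + k / r ^+ 2 by field.
have c1 : u0 * (a + 2 * sg * r ^+ 2 * ex) - u0 / r * (r * a - k) <= 4 * sg * r ^+ 2 * ex + 2 * (k / r).
  have -> : u0 * (a + 2 * sg * r ^+ 2 * ex) - u0 / r * (r * a - k) = u0 * (2 * sg * r ^+ 2 * ex + k / r) by field.
  have -> : 4 * sg * r ^+ 2 * ex + 2 * (k / r) = 2 * (2 * sg * r ^+ 2 * ex + k / r) by ring.
  apply: ler_wpM2r; last by apply: le_trans hu0; exact: ler_norm.
  by rewrite addr_ge0 ?mulr_ge0 ?exprn_ge0 ?invr_ge0 ?(ltW sg0) ?(ltW r0) ?(ltW k0)//; apply: le_trans ex1.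
have c2 : u2 * - (2 * sg * r * w * y) <= 4 * sg * r / 7.
  have -> : u2 * - (2 * sg * r * w * y) = 2 * sg * r * (- (u2 * (w * y))) by ring.
  have -> : 4 * sg * r / 7 = 2 * sg * r * (2 * 7^-1) by ring.
  apply: ler_wpM2l; first by rewrite !mulr_ge0 ?(ltW sg0) ?(ltW r0).
  apply: le_trans (ler_norm _) _; rewrite normrN normrM; apply: ler_pM => //.
  by rewrite normrM (gtr0_norm w0) -wl ler_pM2l.
have c3 : 2 * (k / r) - k / r ^+ 2 <= sg / 2 * r.
  have -> : 2 * (k / r) - k / r ^+ 2 = k * (2 * r - 1) / r ^+ 2 by field.
  rewrite ler_pdivrMr ?exprn_gt0//; have -> : sg / 2 * r * r ^+ 2 = sg / 16 * (8 * r ^+ 3) by field.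
  apply: le_trans (_ : k * (8 * r ^+ 3) <= _); last by rewrite ler_wpM2r// mulr_ge0// exprn_ge0// ltW.
  by rewrite ler_pM2l//; exact: cube_bound.
have c4 : sg * ex * (6 * r + 4 * r ^+ 3) + 2 * sg * r * ex - 4 * sg * r ^+ 2 * ex >= 7 * sg * r.
  have -> : sg * ex * (6 * r + 4 * r ^+ 3) + 2 * sg * r * ex - 4 * sg * r ^+ 2 * ex = sg * r * (ex * (7 + (2 * r - 1) ^+ 2)) by ring.
  have -> : 7 * sg * r = sg * r * 7 by ring.
  rewrite ler_pM2l ?mulr_gt0//; have := sqr_ge0 (2 * r - 1); move: (_ ^+ 2) => X X0.
  have : 0 <= (ex - 1) * (7 + X) by apply: mulr_ge0; [rewrite subr_ge0|lra].
  by lra.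
have c5 : sg * r * w <= sg * r * 49^-1 by rewrite ler_pM2l ?mulr_gt0.
have c7 : 0 < sg * r by rewrite mulr_gt0.
rewrite (_ : sg / 2 * r = (sg * r) / 2) in c3; last by ring.
rewrite (_ : 4 * sg * r / 7 = 4 * (sg * r) / 7) in c2; last by ring.
rewrite (_ : 7 * sg * r = 7 * (sg * r)) in c4; last by ring.
rewrite (_ : 2 * sg * w * r = 2 * (sg * r * w)) in hghh; last by ring.
rewrite (_ : r * (2 * sg) = 2 * (sg * r)); last by ring.
exact: (omega_lin ce c1 c2 c3 c4 c5 c7 hgt hgxx hghh).
Qed.

Lemma omega_start (d x s k S ex g : R) : 0 < x -> 0 < s -> k <= d -> g = - ((S - s) * x) - d -> 1 < ex ->
  S - s * ex + k / x + g / x < 0.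
Proof.
move=> x0 s0 kd -> ex1.
have -> : S - s * ex + k / x + (- ((S - s) * x) - d) / x = - (s * (ex - 1)) - (d - k) / x by field; rewrite gt_eqF.
have h1 : 0 < s * (ex - 1) by rewrite mulr_gt0// subr_gt0.
have h2 : 0 <= (d - k) / x by rewrite divr_ge0 ?subr_ge0// ltW.
by lra.
Qed.

(** This and the next two give the sign of the barrier expression on the boundary. Far away in
    height or time the quadratic term outweighs exp (r^2); at the inner radius the term in 1 / r
    equals [S / 2]; at the outer radius the boundary value is at least [- (S / 2)]. *)
Lemma omega_bd1 (S s ex wq kr gr : R) : 0 < s -> 0 < kr -> - S <= gr -> ex <= wq ->
  0 <= S - s * (ex - wq) + kr + gr.
Proof.
move=> s0 k0 h1 h2; have : 0 <= s * (wq - ex) by rewrite mulr_ge0 ?subr_ge0// ltW.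
by rewrite mulrBr mulrBr; lra.
Qed.

Lemma omega_bd2 (S s ex wq L kr gr : R) : 0 < s -> 0 <= wq -> ex <= L -> s * L = S / 2 -> kr = S / 2 -> - S <= gr ->
  0 <= S - s * (ex - wq) + kr + gr.
Proof.
move=> s0 q0 h1 h2 h3 h4; have : 0 <= s * (L - ex) by rewrite mulr_ge0 ?subr_ge0// ltW.
have : 0 <= s * wq by rewrite mulr_ge0// ltW.
by rewrite !mulrBr; lra.
Qed.

Lemma omega_bd3 (S s ex wq L kr gr : R) : 0 < s -> 0 <= wq -> ex <= L -> s * L = S / 2 -> 0 < kr -> - (S / 2) <= gr ->
  0 <= S - s * (ex - wq) + kr + gr.
Proof.
move=> s0 q0 h1 h2 h3 h4; have : 0 <= s * (L - ex) by rewrite mulr_ge0 ?subr_ge0// ltW.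
have : 0 <= s * wq by rewrite mulr_ge0// ltW.
by rewrite !mulrBr; lra.
Qed.

Lemma past_low (x t c : R) : `|x| < t - c -> c <= x + t.
Proof. by rewrite ltr_norml => /andP[h _]; lra. Qed.

Lemma near_band (x r r1 r2 : R) : `|x| < r - r1 -> `|x| < r2 - r -> r1 <= x + r <= r2.
Proof. by rewrite !ltr_norml => /andP[h1 h2] /andP[h3 h4]; apply/andP; split; lra. Qed.

Lemma near_ball (x h c l : R) : `|x| < l - `|h - c| -> `|x + h - c| <= l.
Proof. by move=> hx; rewrite -addrA; apply: le_trans (ler_normD _ _) _; lra. Qed.

(* In the application [g] is the angular vorticity.  The barrier for [g / r + S] is,
   with [sigma = S / (2 L)] and a small [kappa],
   [sigma (exp (r^2) - L ((h - hs)^2 + ts - t) / l^2) - kappa / r]. *)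
Lemma omega_step a b (u0 u2 g : E -> R) (ts hs S r0 : R) : smf (slab a b) g -> 0 < S -> 1 <= r0 ->
  let L := expR (r0 ^+ 2) in let l := 7 * L in a < ts - l ^+ 2 -> ts < b ->
  (forall t r h, ts - l ^+ 2 <= t <= ts -> 0 < r <= r0 -> `|h - hs| <= l -> let P := pt t r 0 h in
    [/\ - (S * r) <= g P, `|u0 P| <= 2, `|u2 P| <= 2 &
     pd (Some 0) (pd (Some 0) g) P + pd (Some 0) g P / r - g P / r ^+ 2 + pd (Some 2) (pd (Some 2) g) P - r * (S / L) <=
     pd None g P + u0 P * pd (Some 0) g P + u2 P * pd (Some 2) g P - u0 P / r * g P]) ->
  (forall t h, ts - l ^+ 2 <= t <= ts -> `|h - hs| <= l -> - (S / 2 * r0) <= g (pt t r0 0 h)) ->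
  forall r, 0 < r <= r0 -> - (S * (1 - (2 * L)^-1) * r) <= g (pt ts r 0 hs).
Proof.
move=> sg S0 r01 L l al tb hg hg0 rs /andP[rs0 rs1].
have L1 : 1 <= L by rewrite /L -[X in X <= _]expR0 ler_expR sqr_ge0.
have L0 : 0 < L by exact: lt_le_trans L1.
have l0 : 0 < l by rewrite mulr_gt0.
have r00 : 0 < r0 by exact: lt_le_trans r01.
pose s := S / (2 * L).
have s0 : 0 < s by rewrite divr_gt0// mulr_gt0.
have sL : s * L = S / 2 by rewrite /s; field; rewrite gt_eqF.
have sE : S * (1 - (2 * L)^-1) = S - s by rewrite /s mulrBr mulr1.
rewrite sE leNgt; apply/negP => hneg.
pose d := - ((S - s) * rs) - g (pt ts rs 0 hs).
have d0 : 0 < d by rewrite subr_gt0.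
(* [d] is the amount by which the claim fails at [(ts, rs, hs)]. The bound [d] keeps [H] negative
   there, [s / 16] is what [omega_contra] asks for, and the last bound puts the inner radius [r1]
   below [rs]. *)
pose k := Num.min d (Num.min (s / 16) (rs * (S / 2))).
have k0 : 0 < k by rewrite !lt_min d0 divr_gt0//= mulr_gt0// divr_gt0.
have kd : k <= d by rewrite ge_min lexx.
have ks : k <= s / 16 by rewrite !ge_min lexx orbT.
have krs : k <= rs * (S / 2) by rewrite !ge_min lexx !orbT.
pose r1 := k / (S / 2).
have S20 : 0 < S / 2 by rewrite divr_gt0.
have r10 : 0 < r1 by rewrite divr_gt0.
have r1s : r1 <= rs by rewrite ler_pdivrMr.
have kr1 : k / r1 = S / 2 by rewrite /r1; field; rewrite !gt_eqF.
pose w := L / l ^+ 2.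
have w0 : 0 < w by rewrite divr_gt0// exprn_gt0.
have w1 : w <= 49^-1.
  have -> : w = 49^-1 * L^-1 by rewrite /w /l; field; rewrite gt_eqF.
  by rewrite ler_piMr// invf_le1.
have wl : w * l = 7^-1 by rewrite /w /l; field; rewrite gt_eqF.
have wl2 : w * l ^+ 2 = L by rewrite divfK// expf_neq0// gt_eqF.
pose psi t r h := S - s * (expR (r ^+ 2) - w * ((h - hs) ^+ 2 + (ts - t))) + k / r.
pose H t r h := psi t r h + g (pt t r 0 h) / r.
have [||||tm [rm [hm [/andP[t1 t2] /andP[rm1 rm2] hm1 hmin]]]] := @plane_min (ts - l ^+ 2) ts r1 r0 (hs - l) (hs + l) H.
- by rewrite gerBl sqr_ge0.
- exact: le_trans r1s rs1.
- by rewrite lerBlDr -addrA lerDl addr_ge0// ltW.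
- move=> t r h ht /andP[hr _] _.
  have rn : (pt t r 0 h).2 0 0 != 0 by rewrite pt0 gt_eqF// (lt_le_trans r10 hr).
  have c1 : cE (fun z : E => (z.2 0 0)^-1) (pt t r 0 h) by apply: cE_inv; [exact: rn|exact: cE_snd].
  have c2 : cE (fun z : E => expR (z.2 0 0 ^+ 2)) (pt t r 0 h) by apply: cE_exp; cE_auto.
  have c3 : cE (fun z : E => g (pt z.1 (z.2 0 0) 0 (z.2 0 2))) (pt t r 0 h).
    apply: flat_cont; apply: (smf_cont sg); apply/andP; split; [exact: lt_le_trans al (andP ht).1|exact: le_lt_trans (andP ht).2 tb].
  by rewrite /H /psi; cE_auto.
move: tm rm hm t1 t2 rm1 rm2 hm1 hmin => t r h t1 t2 rm1 rm2 hm1 hmin.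
have rp : 0 < r by exact: lt_le_trans rm1.
have hl : `|h - hs| <= l by rewrite ler_distl.
have tt : ts - l ^+ 2 <= t <= ts by rewrite t1.
have rr : 0 < r <= r0 by rewrite rp.
have [hP hu0 hu2 heq] := hg t r h tt rr hl.
pose m := - H t r h.
have m0 : 0 < m.
  rewrite oppr_gt0; apply: le_lt_trans (hmin ts rs hs _ _ _) _.
  - by rewrite lexx andbT gerBl sqr_ge0.
  - by rewrite r1s rs1.
  - by rewrite gerBl lerDl ltW.
  rewrite /H /psi !subrr expr0n /= addr0 mulr0 subr0.
  apply: (omega_start (d := d) rs0 s0 kd) => //; first by rewrite /d; ring.
  by rewrite -expR0 ltr_expR exprn_gt0.
have exL : expR (r ^+ 2) <= L by rewrite /L ler_expR ler_sqr ?nnegrE// ltW.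
have ex1 : 1 <= expR (r ^+ 2) by rewrite -[X in X <= _]expR0 ler_expR sqr_ge0.
have q0 : 0 <= (h - hs) ^+ 2 + (ts - t) by rewrite addr_ge0 ?sqr_ge0// subr_ge0.
have gr : - S <= g (pt t r 0 h) / r by rewrite ler_pdivlMr// mulNr.
have kr0 : 0 < k / r by rewrite divr_gt0.
have Hneg : H t r h < 0 by rewrite -oppr_gt0.
have wq c : c <= (h - hs) ^+ 2 + (ts - t) -> w * c <= w * ((h - hs) ^+ 2 + (ts - t)) by rewrite ler_pM2l.
have qlt : (h - hs) ^+ 2 + (ts - t) < l ^+ 2.
  rewrite ltNge; apply/negP => /wq; rewrite wl2 => hq.
  by move: Hneg; rewrite ltNge /H /psi (omega_bd1 s0 kr0 gr (le_trans exL hq)).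
have hlt : `|h - hs| < l.
  by rewrite -(ltr_sqr (x := `|h - hs|)) ?nnegrE ?(ltW l0)// real_normK ?num_real// (le_lt_trans _ qlt)// lerDl subr_ge0.
have tlt : ts - l ^+ 2 < t.
  by rewrite ltrBlDr -ltrBlDl (le_lt_trans _ qlt)// lerDr sqr_ge0.
have q0w : 0 <= w * ((h - hs) ^+ 2 + (ts - t)) by rewrite mulr_ge0// ltW.
have r1lt : r1 < r.
  rewrite lt_neqAle rm1 andbT; apply/eqP => e.
  by move: Hneg; rewrite ltNge /H /psi (omega_bd2 s0 q0w exL sL _ gr)// -e kr1.
have r0lt : r < r0.
  rewrite lt_neqAle rm2 andbT; apply/eqP => e.
  have gr0 : - (S / 2) <= g (pt t r 0 h) / r by rewrite ler_pdivlMr// mulNr e; exact: hg0.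
  by move: Hneg; rewrite ltNge /H /psi (omega_bd3 s0 q0w exL sL kr0 gr0).
(* [g - phi] is [x] times [H + m], where [- m] is the minimum of [H]; so [phi] touches [g] from
   below at the minimum. *)
pose phi t x h := - (x * (S + m)) + s * x * (expR (x ^+ 2) - w * ((h - hs) ^+ 2 + (ts - t))) - k.
have gphi t' x h' : 0 < x -> g (pt t' x 0 h') - phi t' x h' = x * (H t' x h' + m).
  by move=> x0; rewrite /phi /H /psi; field; rewrite gt_eqF.
have gP : g (pt t r 0 h) = phi t r h by apply/eqP; rewrite -subr_eq0 gphi// /m subrr mulr0.
have touch t' x h' : ts - l ^+ 2 <= t' <= ts -> r1 <= x <= r0 -> hs - l <= h' <= hs + l ->
    g (pt t r 0 h) - phi t r h <= g (pt t' x 0 h') - phi t' x h'.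
  move=> h3 h4 h5; have x0 : 0 < x by case/andP: h4 => h4 _; exact: lt_le_trans h4.
  rewrite gP subrr gphi//; apply: mulr_ge0; first exact: ltW.
  by rewrite /m subr_ge0; exact: hmin.
pose e := Num.min (Num.min (r - r1) (r0 - r)) (Num.min (l - `|h - hs|) (t - (ts - l ^+ 2))).
have e0 : 0 < e by rewrite !lt_min !subr_gt0 r1lt r0lt hlt.
have et (x : R) : `|x| < e -> [/\ `|x| < r - r1, `|x| < r0 - r, `|x| < l - `|h - hs| & `|x| < t - (ts - l ^+ 2)].
  by rewrite !lt_min => /andP[/andP[? ?] /andP[? ?]].
have ht : a < t < b by apply/andP; split; [exact: lt_le_trans al t1|exact: le_lt_trans t2 tb].
have hT : pd None g (pt t r 0 h) <= s * r * w.
  apply: (@touch_time R a b g t r h e sg ht e0 (fun t => phi t r h)).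
    move=> x /andP[x1 x2]; apply: touch; rewrite ?rm1//.
    have [_ _ _ x3] : [/\ True, True, True & `|x| < t - (ts - l ^+ 2)] by have [] := et x; rewrite ?ltr_norml ?x1//= (le_lt_trans x2).
    by rewrite (past_low x3) -[ts]add0r lerD.
  by rewrite /phi; dR_auto; ring.
have [hx1 hx2] : pd (Some 0) g (pt t r 0 h) = - (S + m) + s * (expR (r ^+ 2) - w * ((h - hs) ^+ 2 + (ts - t))) + 2 * s * r ^+ 2 * expR (r ^+ 2) /\
    s * expR (r ^+ 2) * (6 * r + 4 * r ^+ 3) <= pd (Some 0) (pd (Some 0) g) (pt t r 0 h).
  have dex (x : R) : dR (fun x : R => expR (x ^+ 2)) x (expR (x ^+ 2) * (2 * x)).
    apply: (dRcomp (f := fun x : R => x ^+ 2) (g := @expR R)); last exact: dR_exp.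
    by dR_auto; ring.
  apply: (@touch_x R a b g t r h e sg ht e0 (fun x => phi t x h)
    (fun r => - (S + m) + s * (expR (r ^+ 2) - w * ((h - hs) ^+ 2 + (ts - t))) + 2 * s * r ^+ 2 * expR (r ^+ 2))).
  - move=> x /et[x1 x2 _ _]; apply: touch => //; exact: near_band.
  - by move=> x _; have h1 := dex (x + r); rewrite /phi; dR_auto; ring.
  - by have h1 := dex r; dR_auto; ring.
have [hh1 hh2] : pd (Some 2) g (pt t r 0 h) = - (2 * s * r * w * (h - hs)) /\
    - (2 * s * w * r) <= pd (Some 2) (pd (Some 2) g) (pt t r 0 h).
  apply: (@touch_h R a b g t r h e sg ht e0 (fun h => phi t r h) (fun h => - (2 * s * r * w * (h - hs)))).
  - by move=> x /et[_ _ x1 _]; apply: touch; rewrite ?rm1// -ler_distl; exact: near_ball.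
  - by move=> x _; rewrite /phi; dR_auto; ring.
  - by dR_auto; ring.
have SL : S / L = 2 * s by rewrite /s; field; rewrite gt_eqF.
rewrite SL in heq.
exact: (omega_contra s0 rp ex1 w0 w1 wl hl ks k0 hu0 hu2 gP hT hx1 hx2 hh1 hh2 heq).
Qed.

End Omega.

(** * Iteration for the angular vorticity, and two one-variable estimates *)

Section OmegaDecay.
Context {R : realType}.
Local Notation E := (R * 'rV[R]_3)%type.
Implicit Types (t r h : R).

Lemma omega_source (c r v0 v2 w wt wx wxx wh whh g S : R) :
  wt + v0 * wx + v2 * wh - v0 / r * w = wxx + wx / r - w / r ^+ 2 + whh + g -> `|c * g| <= S ->
  c * wxx + c * wx / r - c * w / r ^+ 2 + c * whh - S <= c * wt + v0 * (c * wx) + v2 * (c * wh) - v0 / r * (c * w).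
Proof.
move=> e; rewrite ler_norml => /andP[h _].
have -> : c * wt + v0 * (c * wx) + v2 * (c * wh) - v0 / r * (c * w) = c * (wt + v0 * wx + v2 * wh - v0 / r * w) by ring.
rewrite e; have -> : c * (wxx + wx / r - w / r ^+ 2 + whh + g) = c * wxx + c * wx / r - c * w / r ^+ 2 + c * whh + c * g by ring.
by rewrite lerD2l.
Qed.

Lemma abs_diff_le (c d s : R) : 0 < c -> c < s -> 0 < d -> d < s -> `|c - d| <= s.
Proof. by move=> *; rewrite ler_norml; apply/andP; split; lra. Qed.

Lemma swirl_axis_arith (x y mu z : R) : `|x - y| <= 8 * z -> z <= mu / 16 -> `|y| <= mu / 2 -> `|x| <= mu.
Proof. by rewrite !ler_norml => /andP[h1 h2] h3 /andP[h4 h5]; apply/andP; split; lra. Qed.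

Lemma interpolate_arith (f1 f0 g1 g0 c d s x y : R) : 0 < s -> f1 - f0 = g1 * (x + s - x) -> x < y -> y < x + s ->
  `|g1 - g0| <= d * `|y - x| -> `|f0| <= c -> `|f1| <= c -> 0 <= d -> `|g0| <= 2 * c / s + d * s.
Proof.
move=> s0 e xy ys h1 h2 h3 d0.
have e1 : g1 = (f1 - f0) / s by rewrite e addrC addKr mulfK// gt_eqF.
have h4 : `|g1| <= 2 * c / s.
  rewrite e1 normrM normfV (gtr0_norm s0) ler_pM2r ?invr_gt0//.
  by apply: le_trans (ler_normB _ _) _; lra.
have h5 : d * `|y - x| <= d * s by apply: ler_wpM2l => //; rewrite gtr0_norm; lra.
have -> : g0 = g1 - (g1 - g0) by ring.
by apply: le_trans (ler_normB _ _) _; apply: lerD => //; exact: le_trans h5.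
Qed.

(** Each application of [omega_step] costs [l] in height and [l ^+ 2] in time. The level never falls
    below [eta], so the source [eta / L] and the boundary value [eta / 2] stay admissible; only the
    excess over [eta] decays geometrically. *)
Lemma omega_iter a b A (u : 'I_3 -> E -> R) p (T0 Z r0 eta S0 : R) : sol a b A u p -> 0 < eta -> 0 <= S0 -> 1 <= r0 ->
  a < - T0 -> 0 < b -> let L := expR (r0 ^+ 2) in let l := 7 * L in
  (forall t r h, - T0 <= t <= 0 -> 0 < r <= r0 -> `|h| <= Z -> let P := pt t r 0 h in
    [/\ `|vort u 2 0 P| <= S0 * r, `|u 0 P| <= 2, `|u 2 P| <= 2 &
     `|2 * (u 1 P / r) * pd (Some 2) (u 1) P| <= r * (eta / L)]) ->
  (forall t h, - T0 <= t <= 0 -> `|h| <= Z -> `|vort u 2 0 (pt t r0 0 h)| <= eta / 2 * r0) ->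
  forall (n : nat) t r h, - T0 + n%:R * l ^+ 2 <= t <= 0 -> 0 < r <= r0 -> `|h| <= Z - n%:R * l ->
    `|vort u 2 0 (pt t r 0 h)| <= (eta + S0 * (1 - (2 * L)^-1) ^+ n) * r.
Proof.
move=> hs eta0 S00 r01 aT b0 L l hb hb0.
have L1 : 1 <= L by rewrite /L -[X in X <= _]expR0 ler_expR sqr_ge0.
have L0 : 0 < L by exact: lt_le_trans L1.
have l0 : 0 < l by rewrite mulr_gt0.
have q0 : 0 <= 1 - (2 * L)^-1.
  have L2 : 1 <= 2 * L by lra.
  by rewrite subr_ge0 invf_le1// mulr_gt0.
elim=> [|n IH] t r h.
  rewrite mul0r addr0 mul0r subr0 expr0 mulr1 => ht hr hh; have [h1 _ _ _] := hb t r h ht hr hh.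
  apply: le_trans h1 _; rewrite mulrDl lerDr mulr_ge0 ?(ltW eta0)//; case/andP: hr => hr _; exact: ltW.
set S := eta + S0 * (1 - (2 * L)^-1) ^+ n in IH *.
have Sn0 : 0 <= S0 * (1 - (2 * L)^-1) ^+ n by rewrite mulr_ge0// exprn_ge0.
have etaS : eta <= S by rewrite lerDl.
have S0' : 0 < S by exact: lt_le_trans etaS.
have nat1 (x : R) : n.+1%:R * x = n%:R * x + x by rewrite -natr1 mulrDl mul1r.
rewrite !nat1 => /andP[t1 t2] hr hh.
have l20 : 0 <= n%:R * l ^+ 2 by rewrite mulr_ge0// sqr_ge0.
have nl0 : 0 <= n%:R * l by rewrite mulr_ge0// ltW.
have tl : - T0 + n%:R * l ^+ 2 <= t - l ^+ 2 by rewrite lerBrDr -addrA.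
have tT : - T0 <= t - l ^+ 2 by apply: le_trans tl; rewrite lerDl.
have al : a < t - l ^+ 2 by exact: lt_le_trans tT.
have tb : t < b by exact: le_lt_trans b0.
have oU := @slab_open R a b.
have so := smf_vort hs 2 0.
have box t' h' : t - l ^+ 2 <= t' <= t -> `|h' - h| <= l ->
    [/\ - T0 <= t' <= 0, - T0 + n%:R * l ^+ 2 <= t' <= 0, `|h'| <= Z & `|h'| <= Z - n%:R * l].
  move=> /andP[h1 h2] h3; have h4 : t' <= 0 by exact: le_trans t2.
  have h5 : `|h'| <= Z - n%:R * l.
    have -> : h' = (h' - h) + h by rewrite subrK.
    apply: le_trans (ler_normD _ _) _.
    have := lerD h3 hh; have -> : l + (Z - (n%:R * l + l)) = Z - n%:R * l by ring.
    by [].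
  split=> //; rewrite ?h4 ?andbT ?(le_trans tT)// ?(le_trans tl)//.
  by apply: le_trans h5 _; rewrite gerBl.
suff key c : `|c| = 1 -> - (S * (1 - (2 * L)^-1) * r) <= c * vort u 2 0 (pt t r 0 h).
  have h1 := key 1 (normr1 _); have h2 := key (-1) (normrN1 _).
  apply: le_trans (_ : S * (1 - (2 * L)^-1) * r <= _).
    by rewrite ler_norml; move: h1 h2; rewrite mul1r mulN1r lerN2 => -> ->.
  have r0' : 0 <= r by case/andP: hr => hr _; exact: ltW.
  rewrite ler_wpM2r// /S mulrDl exprSr mulrA lerD2r ler_piMr// ?(ltW eta0)//.
  by rewrite gerBl invr_ge0 mulr_ge0// ltW.
move=> c1.
pose g (z : E) := c * vort u 2 0 z.
have sg : smf (slab a b) g by rewrite /g; smf_auto.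
have pg o z : slab a b z -> pd o g z = c * pd o (vort u 2 0) z by move=> Uz; rewrite /g (pdZ c o so Uz).
have pgg o z : slab a b z -> pd o (pd o g) z = c * pd o (pd o (vort u 2 0)) z.
  move=> Uz; rewrite -(pdZ c o (smf_pd o so) Uz); apply: (pd_eq o oU _ Uz) => y Uy; exact: pg.
have -> : c * vort u 2 0 (pt t r 0 h) = g (pt t r 0 h) by [].
apply: (omega_step (u0 := u 0) (u2 := u 2) sg S0' r01 al tb) => //.
- move=> t' r' h' ht' hr' hh' P; have [k1 k2 k3 k4] := box t' h' ht' hh'.
  have [m1 m2 m3 m4] := hb t' r' h' k1 hr' k3; have m5 := IH t' r' h' k2 hr' k4.
  have r'0 : 0 < r' by case/andP: hr'.
  have tt : a < t' < b by have /andP[j1 j2] := k1; rewrite (lt_le_trans aT j1) (le_lt_trans j2 b0).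
  have UP : slab a b P by exact: tt.
  split => //.
    have : `|g P| <= S * r' by rewrite normrM c1 mul1r.
    by rewrite ler_norml => /andP[].
  rewrite !pgg// !pg//; have := om_eq hs h' tt r'0; cbv zeta; rewrite -/P => e.
  have m4' : `|c * (2 * (u 1 P / r') * pd (Some 2) (u 1) P)| <= r' * (S / L).
    rewrite normrM c1 mul1r; apply: le_trans m4 _.
    by rewrite ler_pM2l// ler_pM2r ?invr_gt0.
  exact: (omega_source e m4').
- move=> t' h' ht' hh'; have [k1 k2 k3 k4] := box t' h' ht' hh'.
  have := hb0 t' h' k1 k3 => h1.
  have : `|g (pt t' r0 0 h')| <= S / 2 * r0.
    rewrite normrM c1 mul1r; apply: le_trans h1 _.
    rewrite ler_pM2r ?ler_pM2r//; exact: lt_le_trans r01.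
  by rewrite ler_norml => /andP[].
Qed.

(** For [r >= rho] the bound on [r * f] suffices, as [f / r] is this product over [r ^+ 2]. Closer
    to the axis [f / r] is a value of the radial derivative, which differs by at most
    [8 * rho = mu / 2] from the one belonging to [rho]. *)
Lemma swirl_axis a b (f : E -> R) t h (mu eps rho r0 : R) : smf (slab a b) f -> a < t < b -> f (pt t 0 0 h) = 0 -> 0 < rho -> rho <= r0 ->
  (forall r, 0 <= r <= r0 -> `|pd (Some 0) (pd (Some 0) f) (pt t r 0 h)| <= 8) ->
  (forall r, 0 < r <= r0 -> `|r * f (pt t r 0 h)| <= eps) -> eps = mu * rho ^+ 2 / 2 -> rho = mu / 16 ->
  forall r, 0 < r <= r0 -> `|f (pt t r 0 h) / r| <= mu.
Proof.
move=> sf ht f0 rho0 rhor0 hf2 hg he hrho r /andP[rp rr0].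
have mu0 : 0 < mu by move: rho0; rewrite hrho pmulr_lgt0// invr_gt0.
have big s : rho <= s -> 0 < s <= r0 -> `|f (pt t s 0 h) / s| <= mu / 2.
  move=> rs hs; have s0 : 0 < s by case/andP: hs.
  have -> : f (pt t s 0 h) / s = (s * f (pt t s 0 h)) / s ^+ 2 by field; rewrite gt_eqF.
  rewrite normrM normfV (gtr0_norm (exprn_gt0 _ s0)) ler_pdivrMr ?exprn_gt0//.
  apply: le_trans (hg s hs) _; rewrite he mulrAC ler_pM2l ?divr_gt0//.
  by rewrite ler_sqr ?nnegrE// ltW.
have hr : 0 < r <= r0 by rewrite rp.
have [rle|rlt] := leP rho r.
  by apply: le_trans (big _ rle hr) _; rewrite ler_pdivrMr// ler_peMr ?ler1n// ltW.
have df x := dR_x x 0 h sf ht.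
have dff x := dR_x x 0 h (smf_pd (Some 0) sf) ht.
have slope s : 0 < s -> exists2 c, 0 < c < s & f (pt t s 0 h) / s = pd (Some 0) f (pt t c 0 h).
  move=> s0; have [c hc e] := dR_MVT s0 (fun x _ => df x).
  by exists c => //; move: e; rewrite f0 !subr0 => ->; rewrite mulfK// gt_eqF.
have [c /andP[c0 cr] ->] := slope r rp; have [d /andP[d0 dr] e] := slope rho rho0.
have hb := big rho (lexx _); rewrite rho0 e in hb.
have lip : `|pd (Some 0) f (pt t c 0 h) - pd (Some 0) f (pt t d 0 h)| <= 8 * `|c - d|.
  apply: (dR_lip (f := fun x => pd (Some 0) f (pt t x 0 h)) (df := fun x => pd (Some 0) (pd (Some 0) f) (pt t x 0 h))) => x /andP[x1 x2].
  split; first exact: dff.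
  apply: hf2; apply/andP; split.
    by apply: le_trans x1; rewrite le_min (ltW c0) (ltW d0).
  by apply: le_trans x2 _; rewrite ge_max (le_trans (ltW cr) rr0) (le_trans (ltW dr) rhor0).
have cd : `|c - d| <= rho by apply: abs_diff_le => //; exact: lt_trans rlt.
have := hb rhor0; move: lip cd; rewrite hrho => lip cd.
exact: swirl_axis_arith lip cd.
Qed.

(** The derivative equals a difference quotient over a step [s] up to the variation of [f'] over
    that step. *)
Lemma interpolate (f f' f'' : R -> R) x s c d : 0 < s -> (forall y, x <= y <= x + s -> [/\ dR f y (f' y), dR f' y (f'' y), `|f y| <= c & `|f'' y| <= d]) ->
  `|f' x| <= 2 * c / s + d * s.
Proof.
move=> s0 hf; have xs : x < x + s by rewrite ltrDl.
have [|y /andP[y1 y2] e] := dR_MVT xs (f := f) (df := f'); first by move=> y /hf[].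
have lip : `|f' y - f' x| <= d * `|y - x|.
  apply: (dR_lip (df := f'')) => z /andP[z1 z2].
  have xz : x <= z by apply: le_trans z1; rewrite le_min lexx ltW.
  have zs : z <= x + s by apply: le_trans z2 _; rewrite ge_max (ltW xs) ltW.
  have xzs : x <= z <= x + s by rewrite xz.
  by have [_ h1 _ h2] := hf z xzs.
have xx : x <= x <= x + s by rewrite lexx ltW.
have xx' : x <= x + s <= x + s by rewrite lexx ltW.
have [_ _ c1 d1] := hf x xx; have [_ _ c2 _] := hf (x + s) xx'.
exact: (interpolate_arith s0 e y1 y2 lip c1 c2 (le_trans (normr_ge0 _) d1)).
Qed.

End OmegaDecay.

(** * Smallness of the velocity near the axis *)

Section Radial.
Context {R : realType}.
Local Notation E := (R * 'rV[R]_3)%type.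
Implicit Types (t r h : R).

Lemma radial_contra (c r q z w g gx gxx ghh v0 v1 v2 v3 om : R) : 0 < r -> 0 < w -> q = z + w -> g < 0 ->
  v2 + v1 / r - v0 / r ^+ 2 + v3 = om -> `|c * om| <= w ->
  g = c * v0 -> gx = c * v1 -> gxx = c * v2 -> ghh = c * v3 ->
  gx = 2 * q * r -> 2 * q <= gxx -> - (4 * z) <= ghh -> False.
Proof.
move=> r0 w0 qE g0 e omw eg ex exx ehh hx hxx hhh.
have rn : r != 0 by rewrite gt_eqF.
have : c * om = gxx + gx / r - g / r ^+ 2 + ghh by rewrite -e eg ex exx ehh; ring.
have -> : gx / r = 2 * q by rewrite hx; field.
have : 0 < - g / r ^+ 2 by rewrite divr_gt0 ?oppr_gt0// exprn_gt0.
rewrite mulNr; move: (g / r ^+ 2) => gr gr0 eom.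
by move: omw; rewrite ler_norml => /andP[_]; rewrite eom qE in hxx *; lra.
Qed.

Lemma pm_bound (x y : R) : 0 <= x + -1 * y -> 0 <= x + 1 * y -> `|y| <= x.
Proof. by move=> *; rewrite ler_norml; apply/andP; split; lra. Qed.

Lemma radial_edge0 (al z g : R) : 0 <= z -> - al <= g -> 0 <= al + 2 * z + g.
Proof. lra. Qed.

Lemma radial_edge (al q g : R) : 0 < al -> 0 <= q -> - 2 <= g -> 0 <= al + 2 + q + g.
Proof. lra. Qed.

(** The radial part of the barrier contributes [- 4 * (Z ^- 2 + w)] to the operator and the part in
    [h] contributes [4 * Z ^- 2]; the sum [- 4 * w] beats the right-hand side. The barrier exceeds
    [u 0] on the axis, where [u 0] vanishes, at [r = X] by [al], and at [|h| = Z] by the value 2. *)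
Lemma radial_barrier a b A (u : 'I_3 -> E -> R) p t (al X Z w : R) : sol a b A u p -> a < t < b -> 0 < al -> 0 < X -> 0 < Z -> 0 < w ->
  (forall r h, 0 < r <= X -> `|h| <= Z -> `|u 0 (pt t r 0 h)| <= 2 /\ `|pd (Some 2) (vort u 2 0) (pt t r 0 h)| <= w) ->
  (forall h, `|h| <= Z -> `|u 0 (pt t X 0 h)| <= al) ->
  forall r h, 0 < r <= X -> `|h| <= Z ->
    `|u 0 (pt t r 0 h)| <= al + 2 * (h ^+ 2 * Z ^- 2) + (Z ^- 2 + w) * (X ^+ 2 - r ^+ 2).
Proof.
move=> hs ht al0 X0 Z0 w0 hb hbX.
pose q := Z ^- 2 + w.
have z0 : 0 < Z ^- 2 by rewrite invr_gt0 exprn_gt0.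
have q0 : 0 < q by rewrite addr_gt0.
have zZ : Z ^+ 2 * Z ^- 2 = 1 by rewrite divff// expf_neq0// gt_eqF.
have su := sol_u hs 0.
suff key c : `|c| = 1 -> forall r h, 0 < r <= X -> `|h| <= Z ->
    0 <= al + 2 * (h ^+ 2 * Z ^- 2) + q * (X ^+ 2 - r ^+ 2) + c * u 0 (pt t r 0 h).
  move=> r h hr hh; exact: pm_bound (key (-1) (normrN1 _) r h hr hh) (key 1 (normr1 _) r h hr hh).
move=> c1 rs hss hrs hhs; rewrite leNgt; apply/negP => hneg.
pose g (z : E) := c * u 0 z.
have sg : smf (slab a b) g by rewrite /g; smf_auto.
have UP r h : slab a b (pt t r 0 h) by exact: ht.
have pg o z : slab a b z -> pd o g z = c * pd o (u 0) z by move=> Uz; rewrite /g (pdZ c o su Uz).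
have pgg o z : slab a b z -> pd o (pd o g) z = c * pd o (pd o (u 0)) z.
  move=> Uz; rewrite -(pdZ c o (smf_pd o su) Uz); apply: (pd_eq o (@slab_open _ a b) _ Uz) => y Uy; exact: pg.
pose be r h := al + 2 * (h ^+ 2 * Z ^- 2) + q * (X ^+ 2 - r ^+ 2).
pose H (s r h : R) := be r h + g (pt s r 0 h).
have [||tm [r [h [/andP[t1 t2] /andP[r1 r2] hm hmin]]]] := @plane_min R t t 0 X (- Z) Z H (lexx t) (ltW X0).
- by rewrite ge0_cp ?ltW.
- move=> s r h /andP[s1 s2] _ _; have -> : s = t by apply/eqP; rewrite eq_le s1 s2.
  have c3 : cE (fun z : E => g (pt z.1 (z.2 0 0) 0 (z.2 0 2))) (pt t r 0 h) by apply: flat_cont; exact: (smf_cont sg (UP r h)).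
  by rewrite /H /be; cE_auto.
have et : tm = t by apply/eqP; rewrite eq_le t1 t2.
move: hmin; rewrite {tm t1 t2}et => hmin.
have Hneg : H t r h < 0.
  apply: le_lt_trans hneg; apply: (hmin t rs hss); rewrite ?lexx// -?ler_norml//.
  by case/andP: hrs => ? ->; rewrite andbT ltW.
have hZ : `|h| <= Z by rewrite ler_norml.
have h2 : h ^+ 2 <= Z ^+ 2 by rewrite -real_normK ?num_real// ler_sqr ?nnegrE// ltW.
have hz : 0 <= h ^+ 2 * Z ^- 2 by rewrite mulr_ge0 ?sqr_ge0// ltW.
have qX : 0 <= q * (X ^+ 2 - r ^+ 2).
  by rewrite mulr_ge0 ?(ltW q0)// subr_ge0 ler_sqr ?nnegrE// ltW.
have be0 : 0 <= be r h by rewrite /be addr_ge0// addr_ge0 ?(ltW al0)// mulr_ge0.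
have nu r' h' : `|g (pt t r' 0 h')| = `|u 0 (pt t r' 0 h')| by rewrite normrM c1 mul1r.
have r0 : 0 < r.
  rewrite lt_neqAle r1 andbT; apply/eqP => e; move: Hneg; rewrite ltNge /H /g -e.
  have [-> _ _ _] := axis_vanish hs h ht; rewrite -e in be0.
  by rewrite mulr0 addr0 be0.
have rX : r < X.
  rewrite lt_neqAle r2 andbT; apply/eqP => e; move: Hneg; rewrite ltNge /H e.
  have := hbX h hZ; rewrite -nu ler_norml => /andP[k1 _]; rewrite /be subrr mulr0 addr0.
  by rewrite radial_edge0.
have hr : 0 < r <= X by rewrite r0.
have hlt : `|h| < Z.
  rewrite lt_neqAle hZ andbT; apply/eqP => e; move: Hneg; rewrite ltNge /H.
  have [+ _] := hb r h hr hZ; rewrite -nu ler_norml => /andP[k1 _].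
  have -> : be r h = al + 2 + q * (X ^+ 2 - r ^+ 2) by rewrite /be -[h ^+ 2]real_normK ?num_real// e zZ mulr1.
  by rewrite radial_edge.
pose e := Num.min (Num.min r (X - r)) (Z - `|h|).
have e0 : 0 < e by rewrite !lt_min r0 !subr_gt0 rX hlt.
have et (x : R) : `|x| < e -> [/\ `|x| < r, `|x| < X - r & `|x| < Z - `|h|].
  by rewrite !lt_min => /andP[/andP[? ?] ?].
have tt : t <= t <= t by rewrite lexx.
have tch r' h' : 0 <= r' <= X -> `|h'| <= Z -> g (pt t r 0 h) - - be r h <= g (pt t r' 0 h') - - be r' h'.
  by move=> k1; rewrite ler_norml => k2; have := hmin t r' h' tt k1 k2; rewrite /H !opprK ![be _ _ + _]addrC.
have [hx1 hx2] : pd (Some 0) g (pt t r 0 h) = 2 * q * r /\ 2 * q <= pd (Some 0) (pd (Some 0) g) (pt t r 0 h).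
  apply: (@touch_x R a b g t r h e sg ht e0 (fun x => - be x h) (fun x => 2 * q * x)).
  - by move=> x /et[x1 x2 _]; apply: tch => //; apply: near_band => //; rewrite subr0.
  - by move=> x _; rewrite /be; dR_auto; ring.
  - by dR_auto; ring.
have [hh1 hh2] : pd (Some 2) g (pt t r 0 h) = - (4 * Z ^- 2 * h) /\ - (4 * Z ^- 2) <= pd (Some 2) (pd (Some 2) g) (pt t r 0 h).
  apply: (@touch_h R a b g t r h e sg ht e0 (fun x => - be r x) (fun x => - (4 * Z ^- 2 * x))).
  - move=> x /et[_ _ x1]; apply: tch; first by rewrite r1.
    by apply: le_trans (ler_normD _ _) _; rewrite -lerBrDr ltW.
  - by move=> x _; rewrite /be; dR_auto; ring.
  - by dR_auto; ring.
have [_ hom] := hb r h hr hZ.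
have g0 : g (pt t r 0 h) < 0.
  by apply: le_lt_trans Hneg; rewrite /H lerDr.
have e1 := radial_eq hs h ht r0; cbv zeta in e1.
apply: (radial_contra r0 w0 (erefl q) g0 e1 _ (erefl _) (pg _ _ (UP r h)) (pgg _ _ (UP r h)) (pgg _ _ (UP r h)) hx1 hx2 hh2).
by rewrite normrM c1 mul1r.
Qed.

End Radial.

(** * Bounds in a rescaled cylinder about the axis *)

Section Frame.
Context {R : realType}.
Local Notation E := (R * 'rV[R]_3)%type.
Implicit Types (t r h : R) (i : 'I_3).

Variables (a b A D K : R) (u : 'I_3 -> E -> R) (p : E -> R) (n : nat).
Hypotheses (hs : sol a b A u p) (aK : a < - K ^+ 2) (b0 : 0 < b) (D2 : 2 <= D).
Hypothesis hM : forall t r h, - K ^+ 2 <= t <= 0 -> 0 <= r <= K -> `|h| <= K ->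
  magn n.+3 u (pt t r 0 h) <= 2 /\ magn n.+3 u (pt t r 0 h) * r <= D.

Let su i : smf (slab a b) (u i). Proof. exact: (sol_u hs). Qed.
Let oU := @slab_open R a b.

Let tab t : - K ^+ 2 <= t <= 0 -> a < t < b.
Proof. by move=> /andP[h1 h2]; rewrite (lt_le_trans aK h1) (le_lt_trans h2 b0). Qed.

Lemma frame_pds w i t r h : (size w <= 3)%N -> - K ^+ 2 <= t <= 0 -> 0 <= r <= K -> `|h| <= K ->
  `|pds w (u i) (pt t r 0 h)| <= 2 ^+ (size w).+1 /\ `|pds w (u i) (pt t r 0 h)| * r ^+ (size w).+1 <= D ^+ (size w).+1.
Proof.
move=> sw ht hr hh; have [m2 mD] := hM ht hr hh; have r0 : 0 <= r by case/andP: hr.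
have h1 : `|pds w (u i) (pt t r 0 h)| <= magn n.+3 u (pt t r 0 h) ^+ (size w).+1.
  by apply: pds_magn; apply: leq_trans sw _.
have m0 := magn_ge0 n.+3 u (pt t r 0 h); split.
  by apply: le_trans h1 _; rewrite lerXn2r// nnegrE.
apply: le_trans (ler_wpM2r (exprn_ge0 _ r0) h1) _; rewrite -exprMn lerXn2r// nnegrE ?mulr_ge0//.
by apply: le_trans D2.
Qed.

Lemma frame_u i t r h : - K ^+ 2 <= t <= 0 -> 0 <= r <= K -> `|h| <= K ->
  `|u i (pt t r 0 h)| <= 2 /\ `|r * u i (pt t r 0 h)| <= D.
Proof.
move=> ht hr hh; have := @frame_pds [::] i t r h (leq0n _) ht hr hh; rewrite /= !expr1 => -[h1 h2]; split=> //.
have r0 : 0 <= r by case/andP: hr.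
by rewrite normrM mulrC (ger0_norm r0).
Qed.

Lemma frame_pd i j t r h : - K ^+ 2 <= t <= 0 -> 0 <= r <= K -> `|h| <= K ->
  `|pd (Some j) (u i) (pt t r 0 h)| <= 4 /\ `|pd (Some j) (u i) (pt t r 0 h)| * r ^+ 2 <= D ^+ 2.
Proof.
move=> ht hr hh; have := @frame_pds [:: j] i t r h isT ht hr hh; rewrite /= => -[h1 h2]; split=> //.
by apply: le_trans h1 _; rewrite -natrX ler_nat.
Qed.

Lemma frame_pd2 i j k t r h : - K ^+ 2 <= t <= 0 -> 0 <= r <= K -> `|h| <= K ->
  `|pd (Some k) (pd (Some j) (u i)) (pt t r 0 h)| <= 8.
Proof.
move=> ht hr hh; have := @frame_pds [:: k; j] i t r h isT ht hr hh; rewrite /= => -[h1 h2].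
by apply: le_trans h1 _; rewrite -natrX ler_nat.
Qed.

Lemma frame_pd3 i j k l t r h : - K ^+ 2 <= t <= 0 -> 0 <= r <= K -> `|h| <= K ->
  `|pd (Some l) (pd (Some k) (pd (Some j) (u i))) (pt t r 0 h)| <= 16.
Proof.
move=> ht hr hh; have := @frame_pds [:: l; k; j] i t r h isT ht hr hh; rewrite /= => -[h1 h2].
by apply: le_trans h1 _; rewrite -natrX ler_nat.
Qed.

Let om := vort u 2 0.

Lemma frame_om t r h : - K ^+ 2 <= t <= 0 -> 0 <= r <= K -> `|h| <= K ->
  [/\ `|om (pt t r 0 h)| * r ^+ 2 <= 2 * D ^+ 2, `|pd (Some 0) om (pt t r 0 h)| <= 16 &
      `|pd (Some 2) (pd (Some 2) om) (pt t r 0 h)| <= 32].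
Proof.
move=> ht hr hh; have Uz : slab a b (pt t r 0 h) by exact: tab.
split.
- have [_ h1] := frame_pd 0 2 ht hr hh; have [_ h2] := frame_pd 2 0 ht hr hh.
  apply: le_trans (ler_wpM2r (sqr_ge0 r) (ler_normB _ _)) _.
  by rewrite mulrDl mulrDl mul1r lerD.
- have h1 := frame_pd2 0 2 0 ht hr hh; have h2 := frame_pd2 2 0 0 ht hr hh.
  rewrite (pd_vort hs (Some 0) 2 0 Uz); apply: le_trans (ler_normB _ _) _.
  by apply: le_trans (lerD h1 h2) _; rewrite -natrD.
- have h1 := frame_pd3 0 2 2 2 ht hr hh; have h2 := frame_pd3 2 0 2 2 ht hr hh.
  have s1 := smf_pd (Some 2) (smf_pd (Some 2) (su 0)); have s2 := smf_pd (Some 2) (smf_pd (Some 0) (su 2)).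
  rewrite (pd_eq (Some 2) oU (fun z Sz => pd_vort hs (Some 2) 2 0 Sz) Uz) (pdB (Some 2) s1 s2 Uz).
  apply: le_trans (ler_normB _ _) _.
  by apply: le_trans (lerD h1 h2) _; rewrite -natrD.
Qed.

Let axis (f : E -> R) (c : R) t r h : smf (slab a b) f -> - K ^+ 2 <= t <= 0 -> 0 <= r <= K -> `|h| <= K ->
  f (pt t 0 0 h) = 0 -> (forall x, 0 <= x <= K -> `|pd (Some 0) f (pt t x 0 h)| <= c) ->
  `|f (pt t r 0 h)| <= c * r.
Proof.
move=> sf ht /andP[r0 rK] hh f0 hf.
have := @dR_lip R (fun x => f (pt t x 0 h)) (fun x => pd (Some 0) f (pt t x 0 h)) 0 r c _.
rewrite f0 !subr0 (ger0_norm r0); apply => x; rewrite (min_idPl r0) (max_idPr r0) => /andP[x0 x1].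
split; first exact: (dR_x x 0 h sf (tab ht)).
by apply: hf; rewrite x0 (le_trans x1).
Qed.

(** Both functions vanish on the axis and have bounded radial derivatives. The first bound starts
    the iteration for the vorticity, the second makes its source proportional to [r]. *)
Lemma frame_axis t r h : - K ^+ 2 <= t <= 0 -> 0 <= r <= K -> `|h| <= K ->
  `|om (pt t r 0 h)| <= 16 * r /\ `|pd (Some 2) (u 1) (pt t r 0 h)| <= 8 * r.
Proof.
move=> ht hr hh; have tt := tab ht; split.
  apply: axis => //; [exact: (smf_vort hs)|by have [] := axis_vanish hs h tt|].
  by move=> x hx; have [] := frame_om ht hx hh.
apply: axis => //; first exact: smf_pd.
  apply: dR_uniq (dR_h 0 0 h (su 1) tt) (dR_eq_on (f := fun=> 0) ltr01 _ (dRc 0 h)) => s _.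
  by have [] := axis_vanish hs s tt.
by move=> x hx; exact: frame_pd2.
Qed.

End Frame.

(** * Arithmetic with powers of a large scale and of its inverse *)

Section Scales.
Context {R : realType}.
Variables (Y y : R).
Hypotheses (Y16 : 16 <= Y) (yY : y = Y^-1).

Lemma scale_Y0 : 0 < Y. Proof. by apply: lt_le_trans Y16. Qed.
Lemma scale_y0 : 0 < y. Proof. by rewrite yY invr_gt0 scale_Y0. Qed.
Lemma scale_y1 : y <= 16^-1. Proof. by rewrite yY lef_pV2 ?posrE ?scale_Y0. Qed.

Lemma scale_yY j k : (k <= j)%N -> y ^+ j * Y ^+ k = y ^+ (j - k).
Proof.
move=> kj; rewrite -{1}(subnK kj) exprD -mulrA -exprMn yY mulVf ?expr1n ?mulr1//.
by rewrite gt_eqF// scale_Y0.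
Qed.

Lemma scale_yy j k : (k <= j)%N -> y ^+ j / y ^+ k = y ^+ (j - k).
Proof. by move=> kj; rewrite -{1}(subnK kj) exprD mulfK// expf_neq0// gt_eqF// scale_y0. Qed.

(** As [y <= 1 / 16], a factor up to 16 is paid for by one power of [y]. *)
Lemma scale_le j k (c : R) : (k < j)%N -> c <= 16 -> c * y ^+ j <= y ^+ k.
Proof.
move=> kj c16; have y0 := scale_y0; have y1 := scale_y1.
rewrite -(subnK (ltnW kj)) exprD mulrA ler_piMl ?exprn_ge0 ?(ltW y0)//.
have [m ->] : exists m, (j - k)%N = m.+1 by exists (j - k).-1; rewrite prednK// subn_gt0.
rewrite exprS mulrA; apply: le_trans (_ : 1 * 1 <= _); last by rewrite mulr1.
apply: le_trans (_ : 16 * 16^-1 * 1 <= _); last by rewrite divff.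
have ym : y ^+ m <= 1 by rewrite exprn_ile1 ?(ltW y0)// (le_trans y1)// invf_le1 ?ler1n.
have yp : 0 <= y ^+ m by rewrite exprn_ge0// ltW.
apply: le_trans (_ : 16 * y * y ^+ m <= _).
  by rewrite ler_wpM2r// ler_wpM2r// ltW.
by apply: ler_pM => //; [rewrite mulr_ge0// ltW|rewrite ler_pM2l].
Qed.

Lemma small_u0_arith (h r : R) : h ^+ 2 <= 9 -> y ^+ 24 * Y ^+ 16 = y ^+ 8 -> 0 <= y -> 0 <= r ->
  y ^+ 7 + 2 * (h ^+ 2 * y ^+ 24) + (y ^+ 24 + y ^+ 24) * ((Y ^+ 8) ^+ 2 - r ^+ 2) <= y ^+ 6.
Proof.
move=> h9 e y0 r0.
have h1 : 2 * (h ^+ 2 * y ^+ 24) <= 18 * y ^+ 24.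
  have -> : 18 * y ^+ 24 = 2 * (9 * y ^+ 24) by ring.
  by rewrite ler_pM2l// ler_wpM2r// exprn_ge0.
have h2 : (y ^+ 24 + y ^+ 24) * ((Y ^+ 8) ^+ 2 - r ^+ 2) <= 2 * y ^+ 8.
  apply: le_trans (_ : (y ^+ 24 + y ^+ 24) * (Y ^+ 8) ^+ 2 <= _).
    by rewrite ler_wpM2l ?addr_ge0 ?exprn_ge0// gerBl sqr_ge0.
  by rewrite -exprM mulrDl e; lra.
have h3 := @scale_le 24 8 16 isT (lexx _); have h4 := @scale_le 8 7 16 isT (lexx _); have h5 := @scale_le 7 6 16 isT (lexx _).
have h6 : 0 <= y ^+ 7 by rewrite exprn_ge0.
have h7 : 0 <= y ^+ 8 by rewrite exprn_ge0.
by lra.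
Qed.

Lemma small_u2_arith (D r v w e : R) : 0 < r -> r <= Y -> Y * y = 1 -> 0 <= y ->
  2 * e * Y <= 6 * y ^+ 3 -> 0 <= e ->
  `|v - w| <= (10 * y ^+ 3 + 2 * e * Y) * `|r - Y| -> `|Y * w| <= D -> `|v| <= (D + 1) * y.
Proof.
move=> r0 rY Yy y0 he e0 h1 h2.
have Y0 : 0 < Y by exact: lt_le_trans rY.
have h3 : `|r - Y| <= Y by rewrite ler0_norm ?opprB ?gerBl ?subr_le0// ltW.
have h4 : `|v - w| <= 16 * y ^+ 3 * Y.
  apply: le_trans h1 _; apply: ler_pM => //; last by lra.
  by rewrite addr_ge0// mulr_ge0 ?exprn_ge0// ?mulr_ge0// ltW.
have h5 : 16 * y ^+ 3 * Y <= y.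
  have -> : 16 * y ^+ 3 * Y = 16 * y ^+ 2 * (Y * y) by ring.
  by rewrite Yy mulr1; have := @scale_le 2 1 16 isT (lexx _); rewrite expr1.
have h6 : `|w| <= D * y.
  have -> : `|w| = `|Y * w| * y by rewrite normrM (gtr0_norm Y0) mulrAC Yy mul1r.
  by rewrite ler_wpM2r.
have -> : v = w + (v - w) by ring.
by apply: le_trans (ler_normD _ _) _; rewrite mulrDl mul1r; apply: lerD => //; exact: le_trans h5.
Qed.

(* [4 D^2 <= Y^2] beats the factor [Y^63 / Y^60]. *)
Lemma small_om_arith (D w : R) : 2 <= D -> 2 * D <= Y -> `|w| * (Y ^+ 21) ^+ 2 <= 2 * D ^+ 2 -> `|w| <= y ^+ 60 / 2 * Y ^+ 21.
Proof.
move=> D2 DY hw; have Y0 := scale_Y0; have Yp : 0 < (Y ^+ 21) ^+ 2 by rewrite !exprn_gt0.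
rewrite -(ler_pM2r Yp); apply: le_trans hw _.
have -> : y ^+ 60 / 2 * Y ^+ 21 * (Y ^+ 21) ^+ 2 = y ^+ 60 * Y ^+ 60 * Y ^+ 3 / 2 by ring.
rewrite scale_yY// expr0 mul1r.
have h1 : (2 * D) ^+ 2 <= Y ^+ 2.
  by rewrite ler_sqr ?nnegrE ?(ltW Y0)// mulr_ge0// (le_trans _ D2).
have h2 : Y ^+ 2 <= Y ^+ 3 by rewrite ler_weXn2l// (le_trans _ Y16)// ler1n.
by move: h1 h2; rewrite exprMn; lra.
Qed.

End Scales.

(** * Smallness of swirl, vorticity and velocity in the cylinder *)

Section FrameSmall.
Context {R : realType}.
Local Notation E := (R * 'rV[R]_3)%type.
Implicit Types (t r h : R) (i : 'I_3).

Variables (a b A D K Y : R) (u : 'I_3 -> E -> R) (p : E -> R) (n n1 n2 : nat).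
(** The hierarchy of scales: [eta] is the target for the angular vorticity over [r]; at the radius
    [r0] the decay like [D ^+ 2 / r ^+ 2] of the vorticity already meets it; [L] and [l] are the
    constants of [omega_step] for [r0]; [mu] bounds [u 1 / r] so that the source is at most
    [r * (eta / L)]; [K'] contains the space and time used by [n1] steps for the vorticity, and [K]
    allows [n2] halvings before that. *)
Let y := Y^-1.
Let eta := y ^+ 60.
Let r0 := Y ^+ 21.
Let L := expR (r0 ^+ 2).
Let l := 7 * L.
Let mu := eta / (16 * L).
Let K' := n1%:R * l ^+ 2 + r0 + 2.
Hypotheses (hs : sol a b A u p) (aK : a < - K ^+ 2) (b0 : 0 < b) (D2 : 2 <= D).
Hypothesis hM : forall t r h, - K ^+ 2 <= t <= 0 -> 0 <= r <= K -> `|h| <= K ->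
  magn n.+3 u (pt t r 0 h) <= 2 /\ magn n.+3 u (pt t r 0 h) * r <= D.
Hypotheses (Y16 : 16 <= Y) (DY : 2 * D <= Y) (KE : K = 2 ^+ n2 * K').
Hypothesis hn1 : 16 * (1 - (2 * L)^-1) ^+ n1 <= eta.
Hypothesis hn2 : (1 - expR (- osc_rate D)) ^+ n2 * D <= mu * (mu / 16) ^+ 2 / 2.

Let Y0 : 0 < Y := scale_Y0 Y16.
Let y0 : 0 < y := scale_y0 Y16 (erefl y).
Let y1 : y <= 16^-1 := scale_y1 Y16 (erefl y).
Let Y1 : 1 <= Y. Proof. by apply: le_trans Y16; rewrite ler1n. Qed.
Let r01 : 1 <= r0. Proof. exact: exprn_ege1. Qed.
Let L1 : 1 <= L. Proof. by rewrite /L -[X in X <= _]expR0 ler_expR sqr_ge0. Qed.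
Let L0 : 0 < L. Proof. exact: lt_le_trans L1. Qed.
Let l1 : 1 <= l. Proof. by rewrite /l -[X in X <= _]mulr1 ler_pM// ler1n. Qed.
Let l0 : 0 < l. Proof. exact: lt_le_trans l1. Qed.
Let nl : 0 <= n1%:R * l ^+ 2. Proof. by rewrite mulr_ge0// sqr_ge0. Qed.
Let nll : n1%:R * l <= n1%:R * l ^+ 2.
Proof. by rewrite ler_wpM2l// expr2 ler_peMl// ltW. Qed.
Let r00 : 0 < r0. Proof. exact: lt_le_trans r01. Qed.
Let K'1 : 1 <= K'. Proof. by rewrite /K'; move: nl r00; lra. Qed.
Let K'0 : 0 < K'. Proof. exact: lt_le_trans K'1. Qed.
Let KK' : K' <= K. Proof. by rewrite KE ler_peMl ?(ltW K'0)// exprn_ege1// ler1n. Qed.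
Let K1 : 1 <= K. Proof. exact: le_trans KK'. Qed.
Let K0 : 0 < K. Proof. exact: lt_le_trans K1. Qed.
Let K2 : K' ^+ 2 <= K ^+ 2. Proof. by rewrite ler_sqr ?nnegrE ?(ltW K0) ?(ltW K'0). Qed.
Let K'2 : K' <= K' ^+ 2. Proof. by rewrite expr2 ler_peMl// ltW. Qed.
Let r0K : r0 <= K'. Proof. by rewrite /K'; move: nl; lra. Qed.
Let eta0 : 0 < eta. Proof. exact: exprn_gt0. Qed.
Let mu0 : 0 < mu. Proof. by rewrite divr_gt0// mulr_gt0. Qed.
Let D1 : 1 <= D. Proof. by apply: le_trans D2; rewrite ler1n. Qed.
Let su i : smf (slab a b) (u i). Proof. exact: (sol_u hs). Qed.
Let eta1 : eta <= 1. Proof. by rewrite exprn_ile1 ?(ltW y0)// (le_trans y1)// invf_le1 ?ler1n. Qed.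
Let mu1 : mu <= 1.
Proof.
rewrite ler_pdivrMr ?mulr_gt0// mul1r (le_trans eta1)// -[X in X <= _]mulr1.
by apply: ler_pM => //; rewrite ler1n.
Qed.

Let box t h : - K' ^+ 2 <= t <= 0 -> `|h| <= K' -> - K ^+ 2 <= t <= 0 /\ `|h| <= K.
Proof.
move=> /andP[h1 h2] h3; split; last exact: le_trans KK'.
by rewrite h2 andbT (le_trans _ h1)// lerN2.
Qed.
Let boxr r : 0 < r <= K' -> 0 <= r <= K.
Proof. by move=> /andP[h1 h2]; rewrite ltW//= (le_trans h2). Qed.
Let tab t : - K ^+ 2 <= t <= 0 -> a < t < b.
Proof. by move=> /andP[h1 h2]; rewrite (lt_le_trans aK h1) (le_lt_trans h2 b0). Qed.

(** After [n2] halvings the box of size [K] has size [K']; there [swirl_decay] reaches the threshold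
    of [swirl_axis], which turns smallness of [r * u 1] into smallness of [u 1 / r]. *)
Lemma small_swirl t r h : - K' ^+ 2 <= t <= 0 -> 0 < r <= r0 -> `|h| <= K' -> `|u 1 (pt t r 0 h) / r| <= mu.
Proof.
move=> ht hr hh; have [ht' hh'] := box ht hh.
have KE' : K / 2 ^+ n2 = K' by rewrite KE mulrAC divff ?mul1r// expf_neq0// pnatr_eq0.
have hsw : forall r, 0 < r <= r0 -> `|r * u 1 (pt t r 0 h)| <= mu * (mu / 16) ^+ 2 / 2.
  move=> s /andP[s0 s1]; apply: le_trans hn2.
  have hsd := @swirl_decay R a b A u p D K n2 hs K0 aK b0 D1 _ t s h; rewrite KE' in hsd.
  apply: hsd => //; last by rewrite s0 (le_trans s1).
  move=> i t' r' h' ht'' /andP[hr1 hr2] hh''.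
  have hr'' : 0 <= r' <= K by rewrite ltW.
  by have [] := frame_u D2 hM i ht'' hr'' hh''.
have mr : mu / 16 <= r0.
  by apply: le_trans r01; rewrite ler_pdivrMr// mul1r (le_trans mu1)// ler1n.
apply: (swirl_axis (su 1) (tab ht') _ _ mr _ hsw (erefl _) (erefl _)) => //.
- by have [] := axis_vanish hs h (tab ht').
- by rewrite divr_gt0.
- move=> s /andP[s0 s1]; have hs' : 0 <= s <= K by rewrite s0 (le_trans s1)// (le_trans r0K).
  exact: (frame_pd2 D2 hM).
Qed.

(** The initial level 16 of [omega_iter] comes from [frame_axis]; after [n1] steps the excess over
    [eta] is at most [eta], and the unit of time and the heights named here are what is left of the
    box. *)
Lemma small_om t r h : - 1 <= t <= 0 -> 0 < r <= r0 -> `|h| <= Y ^+ 12 + 1 ->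
  `|vort u 2 0 (pt t r 0 h)| <= 2 * eta * r.
Proof.
move=> ht hr hh.
have aT : a < - (n1%:R * l ^+ 2 + 1).
  apply: lt_le_trans aK _; rewrite lerN2 (le_trans _ K2)// (le_trans _ K'2)// /K'.
  by move: r00; lra.
have TK t' : - (n1%:R * l ^+ 2 + 1) <= t' <= 0 -> - K' ^+ 2 <= t' <= 0.
  move=> /andP[h1 h2]; rewrite h2 andbT (le_trans _ h1)// lerN2 (le_trans _ K'2)// /K'.
  by move: r00; lra.
have ZK h' : `|h'| <= n1%:R * l + Y ^+ 12 + 1 -> `|h'| <= K'.
  move=> h1; apply: le_trans h1 _; rewrite /K'.
  have : Y ^+ 12 <= r0 by rewrite /r0 ler_weXn2l.
  by move: nll; lra.
have r0' : 0 <= r by case/andP: hr => hr _; exact: ltW.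
have e1 : - (n1%:R * l ^+ 2 + 1) + n1%:R * l ^+ 2 = - 1 by ring.
have e2 : n1%:R * l + Y ^+ 12 + 1 - n1%:R * l = Y ^+ 12 + 1 by ring.
have hO := @omega_iter R a b A u p (n1%:R * l ^+ 2 + 1) (n1%:R * l + Y ^+ 12 + 1) r0 eta 16 hs eta0 (ler0n _ _) r01 aT b0.
have := hO _ _ n1 t r h; rewrite e1 e2 => hO'.
apply: le_trans (hO' _ _ ht hr hh) _ => {hO hO'}.
- move=> t' r' h' /TK ht' hr' /ZK hh' P; have [k1 k2] := box ht' hh'.
  have hr2 : 0 < r' <= K' by case/andP: hr' => -> h1 /=; exact: le_trans r0K.
  have k3 := boxr hr2.
  have [m1 m2] := frame_axis hs aK b0 D2 hM k1 k3 k2.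
  have [m3 _] := frame_u D2 hM 0 k1 k3 k2; have [m4 _] := frame_u D2 hM 2 k1 k3 k2.
  have m5 := small_swirl ht' hr' hh'.
  split => //.
  have -> : r' * (eta / L) = 2 * mu * (8 * r') by rewrite /mu; field; rewrite gt_eqF.
  rewrite normrM; apply: ler_pM => //.
  by rewrite normrM (ger0_norm (ler0n _ _)) ler_pM2l.
- move=> t' h' /TK ht' /ZK hh'; have [k1 k2] := box ht' hh'.
  have hr2 : 0 <= r0 <= K by rewrite (ltW r00) (le_trans r0K).
  have [m1 _ _] := frame_om hs aK b0 D2 hM k1 hr2 k2.
  exact: (small_om_arith Y16 (erefl y) D2 DY m1).
rewrite ler_wpM2r//; have -> : 2 * eta = eta + eta by ring.
by rewrite lerD2l.
Qed.

Let hz t h c : - 1 <= t <= 0 -> `|h| <= c -> c <= Y ^+ 12 + 1 -> - K ^+ 2 <= t <= 0 /\ `|h| <= K.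
Proof.
move=> /andP[t1 t2] hh hc; split.
  by rewrite t2 andbT (le_trans _ t1)// lerN2 (le_trans K1)// expr2 ler_peMl// ltW.
apply: le_trans hh _; apply: le_trans hc _; apply: le_trans KK'.
have : Y ^+ 12 <= r0 by rewrite /r0 ler_weXn2l.
by rewrite /K'; move: nl; lra.
Qed.

Let hr8 r : 0 < r <= Y ^+ 8 -> 0 < r <= r0 /\ 0 <= r <= K.
Proof.
move=> /andP[h1 h2]; have h3 : r <= r0 by apply: le_trans h2 _; rewrite ler_weXn2l.
by rewrite h1 (ltW h1) h3 (le_trans h3)// (le_trans r0K).
Qed.

(** Interpolation with the step [y ^+ 26], which balances the vorticity, of order [y ^+ 52], against
    its second derivative, of order 1. *)
Lemma small_om_h t r h : - 1 <= t <= 0 -> 0 < r <= Y ^+ 8 -> `|h| <= Y ^+ 12 ->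
  `|pd (Some 2) (vort u 2 0) (pt t r 0 h)| <= y ^+ 24.
Proof.
move=> ht hr hh; have [hr1 hr2] := hr8 hr.
have s0 : 0 < y ^+ 26 by exact: exprn_gt0.
have s1 : y ^+ 26 <= 1 by rewrite exprn_ile1 ?(ltW y0)// (le_trans y1)// invf_le1 ?ler1n.
have so := smf_vort hs 2 0.
have := @interpolate R (fun h => vort u 2 0 (pt t r 0 h)) (fun h => pd (Some 2) (vort u 2 0) (pt t r 0 h))
  (fun h => pd (Some 2) (pd (Some 2) (vort u 2 0)) (pt t r 0 h)) h (y ^+ 26) (2 * eta * Y ^+ 8) 32 s0 _.
move=> hi; apply: le_trans (hi _) _ => {hi}.
  move=> h' /andP[h1 h2].
  have hh1 : `|h'| <= Y ^+ 12 + 1.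
    by have -> : h' = h + (h' - h); [ring|apply: le_trans (ler_normD _ _) _; apply: lerD => //; rewrite ger0_norm; lra].
  have [k1 k2] := hz ht hh1 (lexx _); have tt := tab k1.
  split; [exact: (dR_h r 0 h' so tt)|exact: (dR_h r 0 h' (smf_pd (Some 2) so) tt)| |].
    apply: le_trans (small_om ht hr1 hh1) _; rewrite ler_pM2l ?mulr_gt0//; by case/andP: hr.
  by have [] := frame_om hs aK b0 D2 hM k1 hr2 k2.
have -> : 2 * (2 * eta * Y ^+ 8) / y ^+ 26 = 4 * (y ^+ 60 * Y ^+ 8 / y ^+ 26) by rewrite /eta; ring.
rewrite (scale_yY Y16 (erefl y))// (scale_yy Y16 (erefl y))//.
have -> : (60 - 8 - 26 = 26)%N by [].
have h1 := @scale_le R Y y Y16 (erefl y) 25 24 3 isT; have h2 := @scale_le R Y y Y16 (erefl y) 26 25 16 isT (lexx _).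
by have := h1 _; rewrite ler_nat => /(_ isT); move: h2; lra.
Qed.

(** The radial barrier with [X = Y ^+ 8] and [Z = Y ^+ 12]. At [r = X] the bound [D / r] is at most
    [y ^+ 7]; the other terms of the barrier are at most [18 * y ^+ 24] and [2 * y ^+ 8] for heights
    up to 3. *)
Lemma small_u0 t r h : - 1 <= t <= 0 -> 0 < r <= Y ^+ 8 -> `|h| <= 3 -> `|u 0 (pt t r 0 h)| <= y ^+ 6.
Proof.
move=> ht hr hh; have X0 : 0 < Y ^+ 8 by exact: exprn_gt0.
have Z0 : 0 < Y ^+ 12 by exact: exprn_gt0.
have Y12 : Y ^+ 12 <= Y ^+ 12 + 1 by rewrite lerDl.
have hh12 : `|h| <= Y ^+ 12.
  apply: le_trans hh _; apply: le_trans (_ : Y <= _); last by rewrite -[X in X <= _]expr1 ler_weXn2l.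
  by apply: le_trans Y16; rewrite ler_nat.
have [k1 k2] := hz ht hh12 Y12.
have := @radial_barrier R a b A u p t (y ^+ 7) (Y ^+ 8) (Y ^+ 12) (y ^+ 24) hs (tab k1) (exprn_gt0 _ y0) X0 Z0 (exprn_gt0 _ y0).
move=> hB; apply: le_trans (hB _ _ r h hr hh12) _ => {hB}.
- move=> r' h' hr' hh'; have [k3 k4] := hz ht hh' Y12; have [k5 k6] := hr8 hr'.
  by have [m1 _] := frame_u D2 hM 0 k3 k6 k4; split; [exact: m1|exact: small_om_h].
- move=> h' hh'; have [k3 k4] := hz ht hh' Y12.
  have hX8 : 0 < Y ^+ 8 <= Y ^+ 8 by rewrite X0 lexx.
  have [k5 k6] := hr8 hX8.
  have [_ m1] := frame_u D2 hM 0 k3 k6 k4.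
  rewrite -(ler_pM2l X0) -[X in X * `|_|](gtr0_norm X0) -normrM; apply: le_trans m1 _.
  have -> : Y ^+ 8 * y ^+ 7 = Y * (y ^+ 7 * Y ^+ 7) by ring.
  by rewrite (scale_yY Y16 (erefl y))// expr0 mulr1; move: DY D2; lra.
have h2 : h ^+ 2 <= 9.
  have -> : 9 = 3 ^+ 2 :> R by ring.
  by rewrite -real_normK ?num_real// ler_sqr ?nnegrE.
have zE : (Y ^+ 12) ^- 2 = y ^+ 24 by rewrite /y exprVn -exprM.
rewrite zE; apply: (small_u0_arith (y := y) (Y := Y)) => //.
- by have := @scale_yY R Y y Y16 (erefl y) 24 16 isT.
- exact: ltW.
- by case/andP: hr => h3 _; exact: ltW.
Qed.

(** Interpolation between [y ^+ 6] for the function and 8 for its second derivative, with the step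
    [y ^+ 3]. *)
Lemma small_u0_h t r h : - 1 <= t <= 0 -> 0 < r <= Y ^+ 8 -> `|h| <= 1 -> `|pd (Some 2) (u 0) (pt t r 0 h)| <= 10 * y ^+ 3.
Proof.
move=> ht hr hh; have [hr1 hr2] := hr8 hr.
have s0 : 0 < y ^+ 3 by exact: exprn_gt0.
have s1 : y ^+ 3 <= 1 by rewrite exprn_ile1 ?(ltW y0)// (le_trans y1)// invf_le1 ?ler1n.
have Y3 : 3 <= Y ^+ 12 + 1.
  apply: le_trans (_ : Y <= _); first by apply: le_trans Y16; rewrite ler_nat.
  by apply: le_trans (_ : Y ^+ 12 <= _); [rewrite -[X in X <= _]expr1 ler_weXn2l|rewrite lerDl].
have := @interpolate R (fun h => u 0 (pt t r 0 h)) (fun h => pd (Some 2) (u 0) (pt t r 0 h))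
  (fun h => pd (Some 2) (pd (Some 2) (u 0)) (pt t r 0 h)) h (y ^+ 3) (y ^+ 6) 8 s0 _.
move=> hi; apply: le_trans (hi _) _ => {hi}.
  move=> h' /andP[h1 h2].
  have hh1 : `|h'| <= 3.
    have -> : h' = h + (h' - h) by ring.
    by apply: le_trans (ler_normD _ _) _; rewrite [`|h' - h|]ger0_norm; lra.
  have [k1 k2] := hz ht hh1 Y3; have tt := tab k1.
  split; [exact: (dR_h r 0 h' (su 0) tt)|exact: (dR_h r 0 h' (smf_pd (Some 2) (su 0)) tt)|exact: small_u0|].
  exact: (frame_pd2 D2 hM).
have -> : 2 * y ^+ 6 / y ^+ 3 = 2 * (y ^+ 6 / y ^+ 3) by ring.
by rewrite (scale_yy Y16 (erefl y))// subSS; lra.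
Qed.

(** The third component dominates: its value at [r = Y] is at most [D * y], and integrating a radial
    derivative of size [16 * y ^+ 3] over a length at most [Y] adds at most [y]. *)
Lemma frame_small i t r h : - 1 <= t <= 0 -> 0 < r <= Y -> `|h| <= 1 -> `|u i (pt t r 0 h)| <= (D + 1) * y.
Proof.
move=> ht hr hh.
have hYr s : 0 < s <= Y -> 0 < s <= Y ^+ 8.
  by move=> /andP[-> h1] /=; apply: le_trans h1 _; rewrite -[X in X <= _]expr1 ler_weXn2l.
have [hr1 hr2] := hr8 (hYr _ hr).
have Y12 : 1 <= Y ^+ 12 + 1 by rewrite lerDr exprn_ge0// ltW.
have [k1 k2] := hz ht hh Y12; have tt := tab k1.
have yD : y <= (D + 1) * y by rewrite ler_peMl ?(ltW y0)// lerDr (le_trans _ D2).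
move: i; apply: I3P.
- apply: le_trans (_ : y ^+ 6 <= _).
    by apply: small_u0 => //; [exact: hYr|apply: le_trans hh _; rewrite ler1n].
  apply: le_trans yD; rewrite -[X in _ <= X]expr1.
  have := @scale_le R Y y Y16 (erefl y) 6 1 1 isT _; rewrite mul1r; apply; by rewrite ler1n.
- have tK : - K' ^+ 2 <= t <= 0.
    by move: ht => /andP[h1 ->]; rewrite andbT (le_trans _ h1)// lerN2 expr_ge1// ltW.
  have hK : `|h| <= K' by exact: le_trans K'1.
  have m1 := small_swirl tK hr1 hK; have /andP[r0' rY] := hr.
  move: m1; rewrite normrM normfV (gtr0_norm r0') ler_pdivrMr// => m1.
  apply: le_trans m1 _; apply: le_trans yD.
  apply: le_trans (_ : eta * Y <= _).
    apply: ler_pM => //; [exact: ltW|exact: ltW|].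
    by rewrite /mu ler_pdivrMr ?mulr_gt0// ler_peMr ?(ltW eta0)// -[X in X <= _]mulr1 ler_pM// ler1n.
  rewrite -[Y]expr1 (scale_yY Y16 (erefl y))// -[X in _ <= X]expr1.
  have := @scale_le R Y y Y16 (erefl y) 59 1 1 isT _; rewrite mul1r; apply; by rewrite ler1n.
have /andP[r0' rY] := hr.
have hYY : 0 < Y <= Y by rewrite Y0 lexx.
have [_ hY2] := hr8 (hYr _ hYY); have [_ m1] := frame_u D2 hM 2 k1 hY2 k2.
have lip : `|u 2 (pt t r 0 h) - u 2 (pt t Y 0 h)| <= (10 * y ^+ 3 + 2 * eta * Y) * `|r - Y|.
  apply: (dR_lip (f := fun x => u 2 (pt t x 0 h)) (df := fun x => pd (Some 0) (u 2) (pt t x 0 h))) => x.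
  rewrite (min_idPr rY) (max_idPl rY) => /andP[x1 x2].
  split; first exact: (dR_x x 0 h (su 2) tt).
  have hx : 0 < x <= Y by rewrite (lt_le_trans r0' x1).
  have [hx1 hx2] := hr8 (hYr _ hx).
  have -> : pd (Some 0) (u 2) (pt t x 0 h) = pd (Some 2) (u 0) (pt t x 0 h) - vort u 2 0 (pt t x 0 h) by rewrite /vort; ring.
  apply: le_trans (ler_normB _ _) _; apply: lerD; first by apply: small_u0_h => //; exact: hYr.
  have hh1 : `|h| <= Y ^+ 12 + 1 by exact: le_trans Y12.
  apply: le_trans (small_om ht hx1 hh1) _; rewrite ler_pM2l ?mulr_gt0//.
have Yy : Y * y = 1 by rewrite /y mulfV// gt_eqF.
have he : 2 * eta * Y <= 6 * y ^+ 3.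
  have e60 := @scale_yY R Y y Y16 (erefl y) 60 1 isT; rewrite expr1 in e60.
  have h1 := @scale_le R Y y Y16 (erefl y) 59 3 2 isT.
  rewrite -mulrA /eta e60; apply: le_trans (h1 _) _; first by rewrite ler_nat.
  by rewrite ler_peMl ?ler1n// exprn_ge0// ltW.
exact: (small_u2_arith Y16 (erefl y) r0' rY Yy (ltW y0) he (ltW eta0) lip m1).
Qed.

End FrameSmall.

(** * The bound on the magnitude *)

Section Params.
Context {R : realType}.
Implicit Types (D Y : R).

Lemma nat_ceil (x : R) : 0 <= x -> exists n : nat, x <= n%:R <= x + 1.
Proof.
move=> x0; exists (Num.truncn x).+1; have /andP[h1 h2] := truncn_itv x0.
by rewrite ltW//= -natr1 lerD2r.
Qed.

Lemma exp_pow_decay (e : R) (m : nat) : 0 <= e -> e <= 1 -> (1 - e) ^+ m <= expR (- (m%:R * e)).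
Proof.
move=> e0 e1; rewrite mulrC -mulNr expRM_natr lerXn2r ?nnegrE ?subr_ge0 ?expR_ge0//.
by have := expR_ge1Dx (- e).
Qed.

Lemma le_expR (x : R) : x <= expR x.
Proof. by apply: le_trans (expR_ge1Dx x); rewrite lerDr. Qed.

Lemma scale_exp Y (k : nat) : 0 <= Y -> Y ^+ k <= expR (k%:R * Y).
Proof. by move=> Y0; rewrite mulrC expRM_natr lerXn2r ?nnegrE ?expR_ge0//; exact: le_expR. Qed.

Lemma two_pow_exp (m : nat) : 2 ^+ m <= expR (m%:R : R).
Proof.
rewrite -[m%:R : R]mul1r expRM_natr lerXn2r ?nnegrE ?expR_ge0//.
by apply: le_trans (expR_ge1Dx 1); rewrite -natr1.
Qed.

Lemma exponent_arith (P Q o m : R) : 1 <= o -> 0 <= Q -> m <= P * o + 1 -> m + Q <= (P + 1 + Q) * o.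
Proof.
move=> o1 Q0 hm; have : 0 <= (1 + Q) * (o - 1) by rewrite mulr_ge0 ?subr_ge0// addr_ge0.
rewrite mulrBr mulr1 mulrDl mul1r; have -> : (P + 1 + Q) * o = P * o + o + Q * o by ring.
by lra.
Qed.

Lemma exponent_ge0 Y : 0 <= Y -> 0 <= 49 * (123 * Y) + Y ^+ 21 + 2.
Proof. by move=> Y0; have := exprn_ge0 21 Y0; lra. Qed.

Lemma frac_le (x E W : R) : 0 < E -> 0 < W -> x * W <= E -> E^-1 * x <= W^-1.
Proof.
move=> E0 W0 h; rewrite -(ler_pM2r W0) mulVf ?gt_eqF// -mulrA mulrC ler_pdivrMr//.
by rewrite mul1r.
Qed.

(** Written for [Y = c * D]. The first group and [osc_rate D] come from the exponent of 2 in [K],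
    which is of order exp (osc_rate D); the last group bounds the logarithm of the other factor of
    [K]. *)
Definition kappa (c D : R) : R := (187 * (c * D) + 3 * (c * D) ^+ 42) + osc_rate D + 1 + (3 * (c * D) ^+ 42 + (49 * (123 * (c * D)) + (c * D) ^+ 21 + 2)).

Lemma kappa_pb (c : R) : 0 <= c -> @pbounded R (kappa c).
Proof.
move=> c0; have hc := pbC c0; have ho := @osc_rate_pb R.
have h1 : pbounded (fun D : R => c * D) by apply: pbM hc (@pbid R).
have h42 : pbounded (fun D : R => (c * D) ^+ 42) by apply: pbX.
have h21 : pbounded (fun D : R => (c * D) ^+ 21) by apply: pbX.
have k1 (x : nat) : @pbounded R (fun=> x%:R) by apply: pbC; exact: ler0n.
apply: pbD; [apply: pbD; [apply: pbD; [apply: pbD; [exact: pbM|exact: pbM]|exact: ho]|exact: pbC]|].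
by apply: pbD; [exact: pbM|apply: pbD; [apply: pbD; [apply: pbM => //; exact: pbM|]|exact: pbC]].
Qed.

Lemma params (c D : R) : 16 <= c -> 2 <= D -> let Y := c * D in let y := Y^-1 in let L := expR ((Y ^+ 21) ^+ 2) in
  let mu := y ^+ 60 / (16 * L) in
  exists n1 n2 : nat, [/\ 16 * (1 - (2 * L)^-1) ^+ n1 <= y ^+ 60,
    (1 - expR (- osc_rate D)) ^+ n2 * D <= mu * (mu / 16) ^+ 2 / 2 &
    2 ^+ n2 * (n1%:R * (7 * L) ^+ 2 + Y ^+ 21 + 2) <= expR (expR (kappa c D))].
Proof.
move=> c16 D2 Y y L mu.
have D1 : 1 <= D by apply: le_trans D2; rewrite ler1n.
have D0 : 0 < D by exact: lt_le_trans D1.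
have c0 : 0 < c by apply: lt_le_trans c16.
have Y0 : 0 < Y by rewrite mulr_gt0.
have Y16 : 16 <= Y by apply: le_trans c16 _; rewrite ler_peMr// ltW.
have DY : D <= Y by rewrite ler_peMl ?(ltW D0)// (le_trans _ c16)// ler1n.
have Y1 : 1 <= Y by exact: le_trans DY.
have L1 : 1 <= L by rewrite /L -[X in X <= _]expR0 ler_expR sqr_ge0.
have L0 : 0 < L by exact: lt_le_trans L1.
have LE : L = expR (Y ^+ 42) by rewrite /L -exprM.
have Yn0 := ltW Y0.
(* With this many steps the vorticity factor is at most exp (- 61 Y), and exp (61 Y) dominates 16
   Y^60. *)
have [|n1 /andP[n1a n1b]] := @nat_ceil (2 * L * (61 * Y)); first by rewrite !mulr_ge0// ltW.
have o0 := osc_rate_gt0 D1.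
(* The threshold is cubic in [mu], hence of order Y^(-180) L^(-3). Here exp (3 Y^42) is L^3, and exp
   (187 Y) dominates Y^187, whose seven additional powers of Y absorb [D], 16^3 and 2 * 16^2. *)
have [|n2 /andP[n2a n2b]] := @nat_ceil ((187 * Y + 3 * Y ^+ 42) * expR (osc_rate D)).
  by rewrite mulr_ge0 ?expR_ge0// addr_ge0// mulr_ge0// exprn_ge0.
exists n1, n2; split.
- have L2 : 0 < 2 * L by rewrite mulr_gt0.
  have i1 : (2 * L)^-1 <= 1 by rewrite invf_le1//; apply: le_trans L1 _; rewrite ler_peMl// ?ler1n// ltW.
  apply: le_trans (ler_wpM2l _ (exp_pow_decay n1 _ i1)) _ => //; first by rewrite invr_ge0 ltW.
  have h1 : 61 * Y <= n1%:R * (2 * L)^-1 by rewrite ler_pdivlMr// mulrC.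
  have h2 : expR (- (n1%:R / (2 * L))) <= expR (- (61 * Y)) by rewrite ler_expR lerN2.
  apply: le_trans (ler_wpM2l _ h2) _ => //.
  rewrite expRN /y exprVn ler_pdivrMr ?expR_gt0// mulrC ler_pdivlMr ?exprn_gt0//.
  have -> : 61 * Y = Y + 60%:R * Y by ring.
  by rewrite expRD; apply: ler_pM => //; [exact: exprn_ge0|apply: le_trans Y16 _; exact: le_expR|exact: scale_exp].
- set e := expR (- osc_rate D).
  have e0 : 0 < e by exact: expR_gt0.
  have e1 : e <= 1 by rewrite /e -[X in _ <= X]expR0 ler_expR oppr_le0 ltW.
  apply: le_trans (ler_wpM2r (ltW D0) (exp_pow_decay n2 (ltW e0) e1)) _.
  have h1 : 187 * Y + 3 * Y ^+ 42 <= n2%:R * e by rewrite /e expRN ler_pdivlMr ?expR_gt0.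
  apply: le_trans (_ : expR (- (187 * Y + 3 * Y ^+ 42)) * D <= _).
    by rewrite ler_pM2r// ler_expR lerN2.
  have -> : mu * (mu / 16) ^+ 2 / 2 = (16 ^+ 3 * (16 ^+ 2 * 2) * Y ^+ 180 * L ^+ 3)^-1.
    by rewrite /mu /y exprVn; field; rewrite !gt_eqF.
  rewrite expRN; apply: frac_le; rewrite ?expR_gt0// ?mulr_gt0 ?exprn_gt0//.
  rewrite expRD; apply: le_trans (_ : Y ^+ 187 * L ^+ 3 <= _); last first.
    apply: ler_pM; rewrite ?exprn_ge0 ?(ltW L0)//; first exact: scale_exp.
    by rewrite LE mulrC -expRM_natr mulrC.
  rewrite mulrA ler_pM2r ?exprn_gt0// mulrA.
  rewrite (_ : Y ^+ 187 = Y * Y ^+ 3 * Y ^+ 3 * Y ^+ 180); last by ring.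
  rewrite ler_pM2r ?exprn_gt0// -[X in _ <= X]mulrA.
  apply: ler_pM => //; first exact: ltW.
  have h3 : 16 ^+ 3 <= Y ^+ 3 by rewrite lerXn2r ?nnegrE.
  apply: ler_pM => //.
  apply: le_trans h3; rewrite [X in _ <= X]exprSr ler_wpM2l ?exprn_ge0// ler_nat//.
- have tw := two_pow_exp n2.
  set Q := 3 * Y ^+ 42 + (49 * (123 * Y) + Y ^+ 21 + 2).
  have hQ : n1%:R * (7 * L) ^+ 2 + Y ^+ 21 + 2 <= expR Q.
    have L3 : 1 <= L ^+ 3 by rewrite exprn_ege1.
    have h1 : n1%:R * (7 * L) ^+ 2 <= 49 * (123 * Y) * L ^+ 3.
      have h2 : n1%:R <= 123 * Y * L.
        apply: le_trans n1b _; have : 1 <= Y * L by rewrite -[X in X <= _]mulr1 ler_pM.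
        by lra.
      have -> : 49 * (123 * Y) * L ^+ 3 = 123 * Y * L * (7 * L) ^+ 2 by ring.
      by rewrite ler_wpM2r// sqr_ge0.
    apply: le_trans (_ : (49 * (123 * Y) + Y ^+ 21 + 2) * L ^+ 3 <= _).
      have -> : (49 * (123 * Y) + Y ^+ 21 + 2) * L ^+ 3 = 49 * (123 * Y) * L ^+ 3 + Y ^+ 21 * L ^+ 3 + 2 * L ^+ 3 by ring.
      by apply: lerD; [apply: lerD => //|]; rewrite ler_peMr// exprn_ge0.
    rewrite /Q expRD mulrC; apply: ler_pM; rewrite ?exprn_ge0 ?(ltW L0)//.
    - exact: exponent_ge0.
    - by rewrite LE mulrC -expRM_natr mulrC.
    - exact: le_expR.
  apply: le_trans (ler_pM _ _ tw hQ) _; rewrite ?exprn_ge0//.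
    by apply: addr_ge0 => //; apply: addr_ge0; [apply: mulr_ge0 => //; exact: sqr_ge0|exact: exprn_ge0].
  rewrite -expRD ler_expR.
  have Q0 : 0 <= Q by apply: addr_ge0; [apply: mulr_ge0 => //; exact: exprn_ge0|exact: exponent_ge0].
    apply: le_trans (_ : (187 * Y + 3 * Y ^+ 42 + 1 + Q) * expR (osc_rate D) <= _).
    have e1 : 1 <= expR (osc_rate D) by rewrite -[X in X <= _]expR0 ler_expR ltW.
    exact: exponent_arith.
  have -> : kappa c D = (187 * Y + 3 * Y ^+ 42 + 1 + Q) + osc_rate D by rewrite /kappa /Q /Y; ring.
  by rewrite [X in _ <= X]expRD ler_wpM2r ?expR_ge0// le_expR.
Qed.

End Params.

Section MainBound.
Context {R : realType}.
Local Notation E := (R * 'rV[R]_3)%type.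
Implicit Types (t r h x : R) (i : 'I_3).

(** Rotation preserves the Euclidean norm, and 2 rounds up the square root of 3. *)
Lemma sol_rot_le a b A (u : 'I_3 -> E -> R) p t x x' h r (c : R) i : sol a b A u p -> a < t < b -> 0 < r ->
  x ^+ 2 + x' ^+ 2 = r ^+ 2 -> (forall i, `|u i (pt t r 0 h)| <= c) -> `|u i (pt t x x' h)| <= 2 * c.
Proof.
move=> hs ht r0 e hc; have c0 : 0 <= c by apply: le_trans (hc 0).
have := sol_rot h hs ht r0 e; rewrite !sum3 => er.
have sq j : u j (pt t r 0 h) ^+ 2 <= c ^+ 2 by rewrite -real_normK ?num_real// ler_sqr ?nnegrE.
have le3 : u i (pt t x x' h) ^+ 2 <= u 0 (pt t x x' h) ^+ 2 + u 1 (pt t x x' h) ^+ 2 + u 2 (pt t x x' h) ^+ 2.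
  have q0 := sqr_ge0 (u 0 (pt t x x' h)); have q1 := sqr_ge0 (u 1 (pt t x x' h)); have q2 := sqr_ge0 (u 2 (pt t x x' h)).
  by move: i {hc}; apply: I3P; lra.
rewrite -(ler_sqr (x := `|_|)) ?nnegrE ?mulr_ge0// real_normK ?num_real//.
apply: le_trans le3 _; rewrite er; have := sq 0; have := sq 1; have := sq 2; have := sqr_ge0 c.
by rewrite exprMn; move: (c ^+ 2) (_ ^+ 2) (_ ^+ 2) (_ ^+ 2) => *; lra.
Qed.

Lemma main_final (K D k P : R) : K <= expR (expR k) -> 1 <= D -> 0 <= K -> 0 <= k -> k + (10 + 4 * D) <= P ->
  2 * (2 * K + 2 * D) <= expR (expR P).
Proof.
move=> hK D1 K0 k0 hP; have D0 : 0 <= D by apply: le_trans D1.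
apply: le_trans (_ : expR (expR k) * (4 + 4 * D) <= _).
  have h1 : 1 <= expR (expR k) by rewrite -[X in X <= _]expR0 ler_expR expR_ge0.
  have h2 : 0 <= (expR (expR k) - 1) * (4 * D) by rewrite mulr_ge0 ?subr_ge0// mulr_ge0.
  by move: h2; rewrite mulrBl mul1r mulrDr; lra.
apply: le_trans (_ : expR (expR k) * expR (4 + 4 * D) <= _).
  by rewrite ler_wpM2l ?expR_ge0// le_expR.
rewrite -expRD ler_expR; apply: le_trans (_ : expR (k + (10 + 4 * D)) <= _); last by rewrite ler_expR.
rewrite expRD; have ek : 1 <= expR k by rewrite -[X in X <= _]expR0 ler_expR.
have h1 : 0 <= (expR k - 1) * (4 + 4 * D) by rewrite mulr_ge0 ?subr_ge0// addr_ge0// mulr_ge0.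
apply: le_trans (_ : expR k * (1 + (10 + 4 * D)) <= _).
  by move: h1 ek; rewrite mulrBl mul1r !mulrDr; lra.
by rewrite ler_wpM2l ?expR_ge0// expR_ge1Dx.
Qed.

(** A selected point is rescaled to magnitude 1. [far_bound] puts it near the axis and supplies the
    decay like 1 / r needed for [frame_small], so the velocity is below the threshold [d] near the
    point, and [small_ctrl] forces its magnitude below 1. The order [n + 3] provides the three
    derivatives of the velocity used in the frame. *)
Lemma main_bound n : exists k : nat, forall a b A (u : 'I_3 -> E -> R) p z (rho : R), 2 <= A -> sol a b A u p ->
  0 < rho -> a < z.1 - rho ^+ 2 -> z.1 < b -> magn n.+3 u z * rho <= expR (expR (A ^+ k)).
Proof.
have [e e0 he] := @magn_small R n.+3.
have Bc0 : 0 < (2 : R) ^+ n.+3.+2 by exact: exprn_gt0.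
have [d d0 hd] := small_ctrl n.+2 Bc0 e0.
have [k1 hk1] := exp2_bound (8 / d).
have [kf hkf] := far_bound n.+2 (R := R).
(* With [y = 1 / (c * D)], twice the bound [(D + 1) * y] plus [4 * y] is at most
   [8 * D * y = 8 / c <= d]; the factor 2 is paid for the rotation, [4 * y] for points on the
   axis. *)
pose c : R := 2 ^+ (k1 + 4).
have c16 : 16 <= c.
  by rewrite /c exprD (_ : 2 ^+ 4 = 16 :> R); [rewrite ler_peMl// exprn_ege1// ler1n|ring].
have cd : 8 / d <= c by apply: le_trans hk1 _; rewrite /c ler_weXn2l ?ler1n// leq_addr.
have c0 : 0 < c by exact: lt_le_trans c16.
have [kk hkk] : @pbounded R (fun D => kappa c D + (10 + 4 * D)).
  by apply: pbD; [apply: kappa_pb; exact: ltW|pb_auto].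
have [kp hkp] := kappa_pb (ltW c0).
exists (kf.+1 * kk)%N => a b A u p z0 rho A2 hs rho0 ha hb.
have A1 : 1 <= A by apply: le_trans A2; rewrite ler1n.
have A0 : 0 < A by exact: lt_le_trans A1.
(* One more power of [A] covers the factor 2 lost when [far_bound] is used at radius [r / 2], and
   makes [A ^+ kf < D] strict. *)
set D := A ^+ kf.+1.
have Akf : A ^+ kf * 2 <= D by rewrite /D exprSr ler_pM2l// exprn_gt0.
have Akf0 : 1 <= A ^+ kf by rewrite exprn_ege1.
have D2 : 2 <= D by apply: le_trans Akf; rewrite -[X in X <= _]mul1r ler_pM2r.
have D0 : 0 < D by apply: lt_le_trans D2.
have AkD : A ^+ kf < D by apply: lt_le_trans Akf; rewrite ltr_pMr ?ltr1n// exprn_gt0.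
have [n1 [n2 [hn1 hn2 hK]]] := params c16 D2.
set Y := c * D in hn1 hn2 hK.
set K := 2 ^+ n2 * _ in hK.
have Y16 : 16 <= Y by apply: le_trans c16 _; rewrite ler_peMr ?(ltW c0)// (le_trans _ D2)// ler1n.
have Y0 : 0 < Y by apply: lt_le_trans Y16.
have DY : 16 * D <= Y by rewrite ler_pM2r.
have K2 : 2 <= K.
  apply: le_trans (_ : 1 * 2 <= _); first by rewrite mul1r.
  apply: ler_pM => //; first by rewrite exprn_ege1// ler1n.
  rewrite lerDr; apply: addr_ge0; [apply: mulr_ge0 => //; exact: sqr_ge0|exact: exprn_ge0 (ltW Y0)].
have K0 : 0 < K by apply: lt_le_trans K2.
rewrite exprM -/D.
suff : magn n.+3 u z0 * rho <= 2 * (2 * K + 2 * D).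
  move=> h1; apply: le_trans h1 _; have /andP[_ h2] := hkk D D2.
  have D1 : 1 <= D by apply: le_trans D2; rewrite ler1n.
  have /andP[k0 _] := hkp D D2.
  exact: (main_final hK D1 (ltW K0) k0 h2).
rewrite leNgt; apply/negP => /ltW hN.
(* The transverse coordinates of the rescaled point are at most [2 * D], so the cylinder of size [N]
   about it contains the one of size [K] about the axis; [2 * K] leaves room in time for [far_bound]
   at radius [r / 2]. *)
set N := 2 * K + 2 * D in hN.
have N0 : 0 < N by rewrite addr_gt0// mulr_gt0.
have QS z : cyQ z0 rho z -> slab a b z by exact: cyQ_slab.
have [z1 [Qz1 M0 hQ hM]] : exists z1, [/\ cyQ z0 rho z1, 0 < magn n.+3 u z1, forall z, cyQ z1 (N / magn n.+3 u z1) z -> cyQ z0 rho z &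
    forall z, cyQ z1 (N / magn n.+3 u z1) z -> magn n.+3 u z <= 2 * magn n.+3 u z1].
  apply: selection => // z Qz; split; [exact: magn_cont hs (QS _ Qz)|exact: magn_ge0].
set M1 := magn n.+3 u z1 in M0 hQ hM.
pose l := M1^-1; have l0 : 0 < l by rewrite invr_gt0.
have lM : l * M1 = 1 by rewrite mulVf// gt_eqF.
have Nl : N / M1 = N * l by [].
have hv := sol_usc hs z1.1 (z1.2 0 2) l0.
set a' := (a - z1.1) / l ^+ 2 in hv; set b' := (b - z1.1) / l ^+ 2 in hv.
set v := usc z1.1 (z1.2 0 2) l u in hv.
pose z1' := pt 0 (M1 * z1.2 0 0) (M1 * z1.2 0 1) 0.
have Tz1 : sclmap z1.1 (z1.2 0 2) l z1' = z1.
  rewrite /z1' sclmap_pt [RHS]ptE; congr (pt _ _ _ _); first by ring.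
  - by rewrite mulrA lM mul1r.
  - by rewrite mulrA lM mul1r.
  - by ring.
have aN : a' < - N ^+ 2.
  have [|/andP[h2 _] _] := hQ (z1.1 - (N * l) ^+ 2, z1.2).
    by split=> [/=|i]; [rewrite Nl lexx gerBl sqr_ge0|rewrite subrr normr0 Nl ltW// mulr_gt0].
  rewrite /a' ltr_pdivrMr ?exprn_gt0// mulNr -exprMn ltrBlDl; exact: lt_le_trans h2.
have b'0 : 0 < b'.
  by rewrite divr_gt0 ?exprn_gt0// subr_gt0; have /andP[] := QS _ Qz1.
have inN (z : E) : - N ^+ 2 <= z.1 <= 0 -> (forall i, `|z.2 0 i - z1'.2 0 i| <= N) -> slab a' b' z /\ magn n.+3 v z <= 2.
  move=> /andP[h1 h2] h3.
  have Sz : slab a' b' z by apply/andP; split; [exact: lt_le_trans h1|exact: le_lt_trans b'0].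
  split => //; rewrite (magn_usc n.+3 (z1.2 0 2) hs l0 Sz) -(ler_pM2r M0) mulrAC lM mul1r.
  apply: hM; split.
    rewrite sclmap1 Nl exprMn; apply/andP; split; last by rewrite gerDl pmulr_rle0// exprn_gt0.
    by rewrite lerD2l -mulNr mulrC ler_pM2l// exprn_gt0.
  move=> i; have -> : (sclmap z1.1 (z1.2 0 2) l z).2 0 i - z1.2 0 i = l * (z.2 0 i - z1'.2 0 i).
    have e1 : z1.2 0 i = (if i == 2 then z1.2 0 2 else 0) + l * z1'.2 0 i by rewrite -(sclmap2 z1.1) Tz1.
    by rewrite sclmap2 [X in _ - X]e1; ring.
  by rewrite normrM (gtr0_norm l0) Nl mulrC ler_pM2r.
have Sz1' : slab a' b' z1' by apply/andP; split; rewrite /z1' ptt// (lt_le_trans aN)// oppr_le0 sqr_ge0.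
have magn1 : magn n.+3 v z1' = 1 by rewrite (magn_usc n.+3 (z1.2 0 2) hs l0 Sz1') Tz1.
have KN1 : K <= N by rewrite /N; move: K0 D0; lra.
have DN : D <= N by rewrite /N; move: K0 D0; lra.
have small1 : `|z1'.2 0 0| <= 2 * D /\ `|z1'.2 0 1| <= 2 * D.
  have aD : a' < z1'.1 - D ^+ 2.
    by rewrite /z1' ptt sub0r; apply: lt_le_trans aN _; rewrite lerN2 ler_sqr ?nnegrE ?(ltW N0) ?(ltW D0).
  have b1' : z1'.1 < b' by rewrite /z1' ptt.
  have hf := hkf a' b' A v _ z1' D A2 hv D0 aD b1'.
  split; rewrite leNgt; apply/negP => /ltW h1.
    by have := hf (or_introl h1); rewrite magn1 mul1r leNgt AkD.
  by have := hf (or_intror h1); rewrite magn1 mul1r leNgt AkD.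
have [x1D x2D] := small1.
have aK : a' < - K ^+ 2.
  by apply: lt_le_trans aN _; rewrite lerN2 ler_sqr ?nnegrE ?(ltW K0) ?(ltW N0).
have z12 : z1'.2 0 2 = 0 by rewrite /z1' pt2.
have hF t r h : - K ^+ 2 <= t <= 0 -> 0 <= r <= K -> `|h| <= K -> magn n.+3 v (pt t r 0 h) <= 2 /\ magn n.+3 v (pt t r 0 h) * r <= D.
  move=> /andP[t1 t2] /andP[r1 r2] hh.
  have KN : K ^+ 2 + (K / 2) ^+ 2 <= N ^+ 2.
    have K20 : 0 <= 2 * K by rewrite mulr_ge0// ltW.
    have N00 : 0 <= N by exact: ltW.
    have K2N : 2 * K <= N by rewrite lerDl mulr_ge0// ltW.
    have : (2 * K) ^+ 2 <= N ^+ 2 by rewrite ler_sqr ?nnegrE.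
    by rewrite exprMn expr_div_n; have := sqr_ge0 K; move: (K ^+ 2) (N ^+ 2) => *; lra.
  have hN2 : - N ^+ 2 <= t <= 0.
    by rewrite t2 andbT (le_trans _ t1)// lerN2; apply: le_trans KN; rewrite lerDl sqr_ge0.
  have [] := inN (pt t r 0 h); first by rewrite ptt.
    apply: I3P.
    - rewrite pt0; apply: le_trans (ler_normB _ _) _; rewrite (ger0_norm r1).
      by apply: le_trans (lerD r2 x1D) _; rewrite /N lerD2r ler_peMl ?(ltW K0)// ler1n.
    - rewrite pt1 sub0r normrN; apply: le_trans x2D _; by rewrite /N lerDr mulr_ge0// ltW.
    - rewrite pt2 z12 subr0; apply: le_trans hh _.
      by rewrite /N -[X in X <= _]addr0 lerD ?mulr_ge0 ?(ltW D0)// ler_peMl ?(ltW K0)// ler1n.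
  move=> Sz m2; split => //; have [->|rn] := eqVneq r 0; first by rewrite mulr0 ltW.
  have r0 : 0 < r by rewrite lt_neqAle eq_sym rn.
  have r20 : 0 < r / 2 by rewrite divr_gt0.
  have ar : a' < (pt t r 0 h).1 - (r / 2) ^+ 2.
    rewrite ptt; apply: lt_le_trans aN _; rewrite lerNl opprB; apply: le_trans KN; rewrite addrC lerD//.
      by rewrite lerNl.
    by rewrite ler_sqr ?nnegrE ?divr_ge0 ?(ltW K0)// ler_pM2r ?invr_gt0.
  have tb' : (pt t r 0 h).1 < b' by rewrite ptt (le_lt_trans t2).
  have := hkf a' b' A v _ (pt t r 0 h) (r / 2) A2 hv r20 ar tb'.
  move=> h1; have /h1 h2 : 2 * (r / 2) <= `|(pt t r 0 h).2 0 0| \/ 2 * (r / 2) <= `|(pt t r 0 h).2 0 1|.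
    by left; rewrite pt0 mulrC divfK// ger0_norm.
  apply: le_trans Akf; have -> : magn n.+3 v (pt t r 0 h) * r = magn n.+3 v (pt t r 0 h) * (r / 2) * 2 by field.
  by rewrite ler_pM2r.
have DY2 : 2 * D <= Y by apply: le_trans DY; rewrite ler_pM2r// ler_nat.
have hsm i t r h := @frame_small R a' b' A D K Y v _ n n1 n2 hv aK b'0 D2 hF Y16 DY2 (erefl _) hn1 hn2 i t r h.
pose y := Y^-1; have y0 : 0 < y by rewrite invr_gt0.
have yd : 2 * ((D + 1) * y + 4 * y) <= d.
  apply: le_trans (_ : 8 / c <= _); last by rewrite ler_pdivrMr// mulrC -ler_pdivrMr.
  have -> : 8 / c = 8 * D * y by rewrite /y /Y; field; rewrite !gt_eqF.
  have -> : 2 * ((D + 1) * y + 4 * y) = (2 * D + 10) * y by ring.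
  by rewrite ler_pM2r//; move: D2; lra.
have y1 : y <= 1 by rewrite invf_le1// (le_trans _ Y16)// ler1n.
have K1 : 1 <= K by apply: le_trans K2; rewrite ler1n.
have N1 : 1 <= N by apply: le_trans DN; apply: le_trans D2; rewrite ler1n.
have cy1 (z : E) : cyQ z1' 1 z -> - 1 <= z.1 <= 0.
  by move=> [+ _]; rewrite /z1' ptt expr1n sub0r.
have hsmall (z : E) i : cyQ z1' 1 z -> `|v i z| <= d.
  move=> Qz; have ht := cy1 _ Qz; have [_ h3] := Qz.
  rewrite [z]ptE; have hh := h3 2; rewrite z12 subr0 in hh.
  have xb j : `|z1'.2 0 j| <= 2 * D -> `|z.2 0 j| <= 2 * D + 1.
    move=> hj; have -> : z.2 0 j = z1'.2 0 j + (z.2 0 j - z1'.2 0 j) by ring.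
    by apply: le_trans (ler_normD _ _) _; apply: lerD.
  have xx := xb 0 x1D; have xx' := xb 1 x2D.
  move: (z.1) (z.2 0 0) (z.2 0 1) (z.2 0 2) ht hh xx xx' => t x x' h ht hh xx xx' {z Qz h3 xb}.
  have tK : - K ^+ 2 <= t <= 0.
    by move: ht => /andP[t1 ->]; rewrite andbT (le_trans _ t1)// lerN2 exprn_ege1.
  have tt : a' < t < b' by have /andP[t1 t2] := tK; rewrite (lt_le_trans aK t1) (le_lt_trans t2 b'0).
  (* A point on the axis is compared with the one at radius [y], using the gradient bound 4. *)
  have [e0'|ne] := eqVneq (x ^+ 2 + x' ^+ 2) 0.
    move: e0' => /eqP; rewrite paddr_eq0 ?sqr_ge0// !sqrf_eq0 => /andP[/eqP -> /eqP ->].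
    have hy : 0 < y <= Y by rewrite y0 (le_trans y1)// (le_trans _ Y16)// ler1n.
    have h1 := hsm i t y h ht hy hh.
    have lip : `|v i (pt t y 0 h) - v i (pt t 0 0 h)| <= 4 * `|y - 0|.
      apply: (dR_lip (f := fun x => v i (pt t x 0 h)) (df := fun x => pd (Some 0) (v i) (pt t x 0 h))) => s.
      rewrite (min_idPl (ltW y0)) (max_idPr (ltW y0)) => /andP[s0 s1].
      split; first exact: (dR_x s 0 h (sol_u hv i) tt).
      have hs' : 0 <= s <= K by rewrite s0 (le_trans s1)// (le_trans y1).
      by have [] := frame_pd D2 hF i 0 tK hs' (le_trans hh K1).
    rewrite subr0 (gtr0_norm y0) in lip.
    have h2 : 0 <= (D + 1) * y + 4 * y by rewrite addr_ge0// mulr_ge0 ?(ltW y0)// addr_ge0// ltW.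
    apply: le_trans yd; apply: le_trans (_ : (D + 1) * y + 4 * y <= _); last by rewrite ler_peMl ?ler1n.
    have -> : v i (pt t 0 0 h) = v i (pt t y 0 h) - (v i (pt t y 0 h) - v i (pt t 0 0 h)) by ring.
    by apply: le_trans (ler_normB _ _) _; exact: lerD.
  have xp : 0 < x ^+ 2 + x' ^+ 2 by rewrite lt_neqAle eq_sym ne addr_ge0 ?sqr_ge0.
  pose r := Num.sqrt (x ^+ 2 + x' ^+ 2).
  have r0 : 0 < r by rewrite sqrtr_gt0.
  have r2 : x ^+ 2 + x' ^+ 2 = r ^+ 2 by rewrite sqr_sqrtr// ltW.
  have rY : r <= Y.
    apply: le_trans (_ : `|x| + `|x'| <= _).
      rewrite -(ler_sqr (x := r)) ?nnegrE ?addr_ge0 ?(ltW r0)// -r2 sqrrD !real_normK ?num_real//.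
      by rewrite [X in _ <= X]addrAC lerDl mulrn_wge0// mulr_ge0.
    apply: le_trans (lerD xx xx') _; apply: le_trans DY; move: D2; lra.
  have hr : 0 < r <= Y by rewrite r0.
  apply: le_trans (sol_rot_le i hv tt r0 r2 (fun j => hsm j t r h ht hr hh)) _.
  by apply: le_trans yd; rewrite ler_pM2l// lerDl mulr_ge0// ltW.
have : ctrl n.+3 e v z1'.
  apply: (hd a' b' A v _ hv) => //.
  - rewrite /z1' ptt sub0r (lt_le_trans aN)// lerN2 exprn_ege1//.
  - move=> z Qz; apply: ctrl_magn; first by rewrite ler1n.
    have /andP[t1 t2] := cy1 _ Qz; have [_ h3] := Qz.
    have [] := inN z => //; last by move=> i; exact: le_trans (h3 i) N1.
    by rewrite t2 andbT (le_trans _ t1)// lerN2 exprn_ege1.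
by move=> /he; rewrite magn1 ltxx.
Qed.

End MainBound.

(** * Solutions in coordinates *)

Section SmoothCoordinates.
Context {R : realType}.
Local Notation E := (R * 'rV[R]_3)%type.
Variables (V : normedModType R) (c : V -> R).
Hypotheses (cc : continuous c) (cB : forall v w, c (v - w) = c v - c w) (cZ : forall k v, c (k *: v) = k * c v).

Lemma derive_coord (G : E -> R) (z v : E) (q : R -> V) (L : V) : q @ 0^' --> L ->
  (forall h, c (q h) = h^-1 * (G (h *: v + z) - G z)) -> derivable G z v /\ 'D_v G z = c L.
Proof.
move=> qL hq.
have key : (fun h : R => h^-1 *: ((G \o shift z) (h *: v) - G z)) @ 0^' --> c L.
  have -> : (fun h : R => h^-1 *: ((G \o shift z) (h *: v) - G z)) = c \o q.
    by apply/funext => h; rewrite /= hq.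
  by apply: cvg_comp qL _; exact: cc.
by split; [apply/cvg_ex; exists (c L)|exact: cvg_lim].
Qed.

Variables (T : R) (f : R -> 'rV[R]_3 -> V).
Hypothesis sf : smooth `[0, T] f.
Let I := `[0, T]%classic.
Let coord w (z : E) : R := c (mixed I w f z.1 z.2).

(** Inside the open slab all small time increments stay in the closed interval, so the relative
    continuity and the restricted time quotients of [smooth] become ordinary ones. *)
Lemma coord_pd w (z : E) : slab 0 T z -> {for z, continuous (coord w)} /\
  forall o, derivable (coord w) z (dirv o) /\ pd o (coord w) z = coord (o :: w) z.
Proof.
move=> Sz; have [cw dw] := sf w; have /andP[t0 tT] := Sz.
have It : I z.1 by rewrite /I /= in_itv/= !ltW.
split.
  have cz : {for z, continuous (fun z : E => mixed I w f z.1 z.2)}.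
    have : \forall z' \near z, (I `*` setT) z'.
      have [d d0 hd] := open_near (@slab_open R 0 T) Sz.
      apply/nbhs_near_pt; exists d => // z' /hd /andP[h1 h2]; split=> //.
      by rewrite /I /= in_itv/= !ltW.
    move=> Iz; have h := (@subspace_continuousP _ _ _ _).1 cw z (nbhs_singleton Iz).
    by rewrite within_interior in h.
  by apply: (@cvg_comp _ _ _ (fun z : E => mixed I w f z.1 z.2) c _ _ _ cz); exact: cc.
have [hdt hdx] := dw z.1 z.2 It.
case=> [i|].
  apply: (@derive_coord _ _ _ (fun h => h^-1 *: ((mixed I w f z.1 \o shift z.2) (h *: ebasis i) - mixed I w f z.1 z.2)) _ (hdx i)).
  by move=> h; rewrite cZ cB /coord /= ?scaler0 ?mulr0 add0r.
apply: (@derive_coord _ _ _ (dt_quotient (mixed I w f) z.1 z.2) (dt I (mixed I w f) z.1 z.2)).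
  move=> U /hdt hU; have hI : \forall h \near (0 : R), I (z.1 + h).
    apply/nbhs_ballP; exists (Num.min z.1 (T - z.1)); first by rewrite /= lt_min t0 subr_gt0.
    move=> h; rewrite /ball/= sub0r normrN lt_min => /andP[].
    rewrite !ltr_norml => /andP[h1 _] /andP[_ h2].
    by rewrite /I /= in_itv/=; apply/andP; split; lra.
  have hI' : \forall h \near (0 : R)^', I (z.1 + h).
    by apply: (@filterS _ (nbhs (0 : R)) _ _ (fun h => h != 0 -> I (z.1 + h)) _ hI) => h Ih _.
  have hU' : \forall h \near (0 : R)^', I (z.1 + h) -> U (dt_quotient (mixed I w f) z.1 z.2 h) := hU.
  by apply: filterS (filterI hU' hI') => h [h1 h2]; exact: h1.
move=> h; rewrite cZ cB /coord /=.
have -> : h *: (1 : R) = h by exact: mulr1.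
by rewrite scaler0 add0r (addrC h).
Qed.

Lemma smf_coord w : smf (slab 0 T) (coord w).
Proof.
move=> n; elim: n w => [|n IH] w.
  by split=> // z Sz; have [] := coord_pd w Sz.
split; first by move=> z Sz; have [] := coord_pd w Sz.
split; first by move=> o z Sz; have [_ /(_ o)[]] := coord_pd w Sz.
move=> o; apply: (Cn_eq (@slab_open R 0 T) _ (IH (o :: w))) => z Sz.
by have [_ /(_ o)[]] := coord_pd w Sz.
Qed.

Lemma pd_coord o w z : slab 0 T z -> pd o (coord w) z = coord (o :: w) z.
Proof. by move=> Sz; have [_ /(_ o)[]] := coord_pd w Sz. Qed.

Lemma pds_coord w z : slab 0 T z -> pds w (coord [::]) z = c (foldr dx (f z.1) w z.2).
Proof.
move=> Sz; suff -> : pds w (coord [::]) z = coord (map Some w) z.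
  rewrite /coord; congr c; elim: w z.2 {Sz} => [|i w IH] x //=.
  by congr (dx i _ x); apply/funext => y; exact: IH.
elim: w z Sz => [|i w IH] z Sz //=.
by rewrite (pd_eq (Some i) (@slab_open R 0 T) IH Sz) pd_coord.
Qed.

End SmoothCoordinates.

Section Conversion.
Context {R : realType}.
Local Notation E := (R * 'rV[R]_3)%type.
Implicit Types (t x y h r th : R).

Let co (i : 'I_3) (M : 'rV[R]_3) : R := M 0 i.
Let coB i v w : co i (v - w) = co i v - co i w. Proof. by rewrite /co !mxE. Qed.
Let coZ i k v : co i (k *: v) = k * co i v. Proof. by rewrite /co !mxE. Qed.
Let coC i : continuous (co i). Proof. exact: coord_continuous. Qed.
Let idB (v w : R) : id (v - w) = id v - id w. Proof. by []. Qed.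
Let idZ (k v : R) : id (k *: (v : R^o)) = k * id v. Proof. by []. Qed.
Let idC : continuous (@id R). Proof. by move=> x; exact: cvg_id. Qed.

Definition vel (u : R -> 'rV[R]_3 -> 'rV[R]_3) (i : 'I_3) (z : E) : R := u z.1 z.2 0 i.
Definition pre (p : R -> 'rV[R]_3 -> R) (z : E) : R := p z.1 z.2.

Variables (T : R) (u : R -> 'rV[R]_3 -> 'rV[R]_3) (p : R -> 'rV[R]_3 -> R).
Hypotheses (su : smooth `[0, T] u) (sp : smooth `[0, T] p) (ns : navier_stokes `[0, T] u p).

Lemma smf_vel i : smf (slab 0 T) (vel u i).
Proof. exact: (smf_coord (@coC i) (coB i) (coZ i) su [::]). Qed.

Lemma smf_pre : smf (slab 0 T) (pre p).
Proof. exact: (smf_coord idC idB idZ sp [::]). Qed.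

Lemma pds_vel w i z : slab 0 T z -> pds w (vel u i) z = (foldr dx (u z.1) w z.2) 0 i.
Proof. exact: (pds_coord (@coC i) (coB i) (coZ i) su w). Qed.

Let slabI (z : E) : slab 0 T z -> `[0, T]%classic z.1.
Proof. by move=> /andP[h1 h2]; rewrite /= in_itv/= !ltW. Qed.

Lemma ns_vel z k : slab 0 T z ->
  pd None (vel u k) z - lap (vel u k) z + (\sum_(i < 3) vel u i z * pd (Some i) (vel u k) z) + pd (Some k) (pre p) z = 0.
Proof.
move=> Sz; have [e _] := ns z.2 (slabI Sz).
have e' : dt `[0, T] u z.1 z.2 0 k - laplacian (u z.1) z.2 0 k + advect (u z.1) (u z.1) z.2 0 k + dx k (p z.1) z.2 = 0.
  by have := congr1 (fun M : 'rV[R]_3 => M 0 k) e; rewrite !mxE.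
have e1 : pd None (vel u k) z = dt `[0, T] u z.1 z.2 0 k.
  exact: (pd_coord (@coC k) (coB k) (coZ k) su None [::] Sz).
have e2 : lap (vel u k) z = laplacian (u z.1) z.2 0 k.
  rewrite /lap /laplacian summxE; apply: eq_bigr => i _.
  exact: (pds_vel [:: i; i] k Sz).
have e3 : \sum_(i < 3) vel u i z * pd (Some i) (vel u k) z = advect (u z.1) (u z.1) z.2 0 k.
  rewrite /advect summxE; apply: eq_bigr => i _; rewrite mxE; congr (_ * _).
  exact: (pds_vel [:: i] k Sz).
have e4 : pd (Some k) (pre p) z = dx k (p z.1) z.2 := pd_coord idC idB idZ sp (Some k) [::] Sz.
by rewrite e1 e2 e3 e4.
Qed.

Lemma div_vel z : slab 0 T z -> \sum_(i < 3) pd (Some i) (vel u i) z = 0.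
Proof.
move=> Sz; have [_ e] := ns z.2 (slabI Sz).
rewrite -[RHS]e /divergence; apply: eq_bigr => i _; exact: (pds_vel [:: i] i Sz).
Qed.

Lemma dR_const (f : R -> R) x y : (forall s, dR f s 0) -> f x = f y.
Proof.
move=> hf; have h : `|f x - f y| <= 0 * `|x - y|.
  by apply: (dR_lip (df := fun=> 0)) => s _; rewrite normr0.
by move: h; rewrite mul0r normr_le0 subr_eq0 => /eqP.
Qed.

Lemma polar x y r : 0 < r -> x ^+ 2 + y ^+ 2 = r ^+ 2 -> exists th, x = r * cos th /\ y = r * sin th.
Proof.
move=> r0 e; have rn : r != 0 by rewrite gt_eqF.
have e1 : (x / r) ^+ 2 + (y / r) ^+ 2 = 1 by rewrite !expr_div_n -mulrDl e divff// expf_neq0.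
have hx : -1 <= x / r <= 1.
  by rewrite -ler_norml -(ler_sqr (x := `|_|)) ?nnegrE// real_normK ?num_real// expr1n -e1 lerDl sqr_ge0.
have c1 : cos (acos (x / r)) = x / r by rewrite acosK// in_itv.
have s1 : sin (acos (x / r)) = `|y / r| by rewrite sin_acos// -e1 addrAC subrr add0r sqrtr_sqr.
have [y0|y0] := leP 0 (y / r).
  exists (acos (x / r)); rewrite c1 s1 (ger0_norm y0).
  by split; field.
exists (- acos (x / r)); rewrite cosN sinN c1 s1 (ltr0_norm y0).
by split; field.
Qed.

Lemma rotation_arith (c s r a0 a1 a2 b0 b1 b2 : R) : c ^+ 2 + s ^+ 2 = 1 ->
  a0 * 0 + a1 * 0 + a2 * 1 = b0 * 0 + b1 * 0 + b2 * 1 ->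
  a0 * - s + a1 * c + a2 * 0 = b0 * - 0 + b1 * 1 + b2 * 0 ->
  a0 * c + a1 * s + a2 * 0 = b0 * 1 + b1 * 0 + b2 * 0 ->
  [/\ r * a0 = r * c * b0 - r * s * b1, r * a1 = r * s * b0 + r * c * b1 & a2 = b2].
Proof.
move=> cs e2 e1 e0.
have -> : b0 = a0 * c + a1 * s by lra.
have -> : b1 = a0 * - s + a1 * c by lra.
split; last by lra.
- by rewrite -[LHS]mulr1 -cs; ring.
- by rewrite -[LHS]mulr1 -cs; ring.
Qed.

(** The three polar components have zero derivative in the angle, hence equal values at the angles
    [th] and 0; solving for the Cartesian components gives the rotation. *)
Lemma axisym_vel t x y h r : axisymmetric (u t) -> 0 < r -> x ^+ 2 + y ^+ 2 = r ^+ 2 ->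
  [/\ r * vel u 0 (pt t x y h) = x * vel u 0 (pt t r 0 h) - y * vel u 1 (pt t r 0 h),
      r * vel u 1 (pt t x y h) = y * vel u 0 (pt t r 0 h) + x * vel u 1 (pt t r 0 h) &
      vel u 2 (pt t x y h) = vel u 2 (pt t r 0 h)].
Proof.
move=> hax r0 e; have [th [ex ey]] := polar r0 e.
have d0 : forall s, dR (fun s => dot (u t (cyl r s h)) (e_r s)) s 0 by move=> s; have [] := hax r s h r0.
have d1 : forall s, dR (fun s => dot (u t (cyl r s h)) (e_th s)) s 0 by move=> s; have [] := hax r s h r0.
have d2 : forall s, dR (fun s => dot (u t (cyl r s h)) e_3) s 0 by move=> s; have [] := hax r s h r0.
have := dR_const th 0 d0; have := dR_const th 0 d1; have := dR_const th 0 d2.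
have c0 : cyl r 0 h = (pt t r 0 h).2 by rewrite /cyl cos0 sin0 mulr1 mulr0.
have cth : cyl r th h = (pt t x y h).2 by rewrite /cyl -ex -ey.
rewrite c0 cth /dot !sum3 /e_r /e_th /e_3 !mxE /= cos0 sin0.
rewrite -!/(vel u _ (pt t x y h)) -!/(vel u _ (pt t r 0 h)).
have := cos2Dsin2 th; rewrite ex ey; move: (cos th) (sin th) => c s.
move: (vel u 0 (pt t _ _ h)) (vel u 1 (pt t _ _ h)) (vel u 2 (pt t _ _ h)) => a0 a1 a2.
move: (vel u 0 (pt t _ _ h)) (vel u 1 (pt t _ _ h)) (vel u 2 (pt t _ _ h)) => b0 b1 b2.
exact: rotation_arith.
Qed.

End Conversion.

(** * The weak norm *)

Section Tube.
Import HBNNSimple.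
Context {R : realType}.
Local Notation M := (measurableTypeR R).
Local Notation leb := (@lebesgue_measure R).

(* No measurability is needed: the integral of a nonnegative function is a supremum
   over simple functions. *)
Lemma le_integral_nonneg d (T : measurableType d) (mu : {measure set T -> \bar R}) (f g : T -> \bar R) :
  (forall x, 0 <= f x)%E -> (forall x, f x <= g x)%E -> (\int[mu]_x f x <= \int[mu]_x g x)%E.
Proof.
move=> f0 fg; have g0 x : (0 <= g x)%E by exact: le_trans (fg x).
rewrite !ge0_integralTE//; apply: ereal_sup_le => y [h hf <-].
by exists h => // x; exact: le_trans (fg x).
Qed.

Lemma integral_ge_cst d (T : measurableType d) (mu : {measure set T -> \bar R}) (D : set T) (c : R) (g : T -> \bar R) :
  measurable D -> 0 <= c -> (forall x, 0 <= g x)%E -> (forall x, D x -> c%:E <= g x)%E -> (c%:E * mu D <= \int[mu]_x g x)%E.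
Proof.
move=> mD c0 g0 gc; rewrite -integral_cst// integral_mkcond; apply: le_integral_nonneg.
  by move=> x; rewrite patchE; case: ifP => //; rewrite lee_fin.
by move=> x; rewrite patchE; case: ifPn => [/set_mem /gc|].
Qed.

(** The squares of the two roots differ by [4 * r * s], and the sum of the roots is at most
    [2 * r]. *)
Lemma section_length (x r s : R) : 0 < s -> 2 * s <= r -> 0 <= x -> x <= r / 2 ->
  s <= Num.sqrt ((r + s) ^+ 2 - x ^+ 2) - Num.sqrt ((r - s) ^+ 2 - x ^+ 2).
Proof.
move=> s0 sr x0 xr.
have a0 : 0 <= (r - s) ^+ 2 - x ^+ 2 by rewrite subr_ge0 ler_sqr ?nnegrE; lra.
have b0 : 0 <= (r + s) ^+ 2 - x ^+ 2 by rewrite subr_ge0 ler_sqr ?nnegrE; lra.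
have pa := sqrtr_ge0 ((r - s) ^+ 2 - x ^+ 2); have pb := sqrtr_ge0 ((r + s) ^+ 2 - x ^+ 2).
have sa := sqr_sqrtr a0; have sb := sqr_sqrtr b0.
set p := Num.sqrt ((r - s) ^+ 2 - x ^+ 2) in pa sa *; set q := Num.sqrt ((r + s) ^+ 2 - x ^+ 2) in pb sb *.
have x2 := sqr_ge0 x.
have pr : p <= r - s by rewrite -(ler_sqr (x := p)) ?nnegrE; lra.
have qr : q <= r + s by rewrite -(ler_sqr (x := q)) ?nnegrE; lra.
have e : (q - p) * (q + p) = 4 * r * s by rewrite -subr_sqr sa sb; ring.
rewrite leNgt; apply/negP => h.
have qp : 0 <= q + p by lra.
have : (q - p) * (q + p) <= s * (3 * r).
  apply: le_trans (ler_wpM2r qp (ltW h)) _; apply: ler_wpM2l; lra.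
have rs0 : 0 < r * s by rewrite mulr_gt0//; lra.
by rewrite e => h2; lra.
Qed.

Lemma leb_itv (c d : R) (S : set M) : c <= d -> measurable S -> (forall y, c <= y <= d -> S y) -> ((d - c)%:E <= leb S)%E.
Proof.
move=> cd mS h.
have e : leb `[c, d]%classic = (d - c)%:E.
  transitivity (if (c%:E < d%:E)%E then (d%:E - c%:E)%E else 0%:E : \bar R).
    exact: (lebesgue_measure_itv (Interval (BLeft c) (BRight d))).
  rewrite lte_fin; case: ltP => // dc.
  by congr EFin; apply/eqP; rewrite eq_sym subr_eq0 eq_le dc cd.
rewrite -e; apply: le_measure; rewrite ?inE// => y /=; rewrite in_itv/=; exact: h.
Qed.

(* On this part of the ring [| |q| - r | <= s] the chords in the second variable have
   length at least [s]. *)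
Definition annulus (r s : R) : set (M * M) :=
  [set q | [/\ 0 <= q.1 <= r / 2, 0 <= q.2 & (r - s) ^+ 2 <= q.1 ^+ 2 + q.2 ^+ 2 <= (r + s) ^+ 2]].

Lemma annulus_measurable r s : measurable (annulus r s).
Proof.
have m1 : measurable_fun setT (fun q : M * M => q.1 : R) := measurable_fst.
have m2 : measurable_fun setT (fun q : M * M => q.2 : R) := measurable_snd.
have m3 : measurable_fun setT (fun q : M * M => (q.1 : R) ^+ 2 + (q.2 : R) ^+ 2).
  by apply: measurable_realfun.measurable_funD; apply: measurable_realfun.measurable_funX.
have -> : annulus r s = (setT `&` (fun q : M * M => q.1 : R) @^-1` `[0, r / 2]) `&`
   (setT `&` (fun q : M * M => q.2 : R) @^-1` `[0, +oo[) `&`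
   (setT `&` (fun q : M * M => (q.1 : R) ^+ 2 + (q.2 : R) ^+ 2) @^-1` `[(r - s) ^+ 2, (r + s) ^+ 2]).
  apply/seteqP; split => q /=; rewrite !in_itv/= ?andbT; first by move=> [].
  by move=> [[[_ ?] [_ ?]] [_ ?]].
apply: measurableI; [apply: measurableI|].
- by apply: m1 => //; exact: measurable_itv.
- by apply: m2 => //; exact: measurable_itv.
- by apply: m3 => //; exact: measurable_itv.
Qed.

(** Integration of the chord length, at least [s], over an interval of length [r / 2]. *)
Lemma annulus_measure r s : 0 < s -> 2 * s <= r -> ((s * (r / 2))%:E <= (leb \x leb)%E (annulus r s))%E.
Proof.
move=> s0 sr; have r0 : 0 <= r / 2 by lra.
have mr : measurable (`[0, r / 2]%classic : set M) by exact: measurable_itv.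
have hr : ((r / 2)%:E <= leb (`[0%R, (r / 2)%R]%classic))%E.
  have := @leb_itv 0 (r / 2) (`[0%R, (r / 2)%R]%classic) r0 mr; rewrite subr0; apply.
  by move=> y; rewrite /= in_itv.
rewrite EFinM; apply: le_trans (_ : s%:E * leb (`[0%R, (r / 2)%R]%classic) <= _)%E.
  by rewrite lee_pmul2l// lte_fin.
apply: (@integral_ge_cst _ _ leb _ s (fun x => leb (xsection (annulus r s) x)) mr (ltW s0)); first by move=> x; exact: measure_ge0.
move=> x; rewrite /= in_itv/= => /andP[x0 x1].
have hl := section_length s0 sr x0 x1.
apply: le_trans (_ : (Num.sqrt ((r + s) ^+ 2 - x ^+ 2) - Num.sqrt ((r - s) ^+ 2 - x ^+ 2))%:E <= _)%E; first by rewrite lee_fin.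
apply: leb_itv; first by rewrite -subr_ge0 (le_trans _ hl)// ltW.
  exact: measurable_xsection (annulus_measurable r s).
move=> y /andP[y1 y2]; rewrite /xsection /= inE /annulus /=.
have a0 : 0 <= (r - s) ^+ 2 - x ^+ 2 by rewrite subr_ge0 ler_sqr ?nnegrE; lra.
have b0 : 0 <= (r + s) ^+ 2 - x ^+ 2 by rewrite subr_ge0 ler_sqr ?nnegrE; lra.
have y0 : 0 <= y by apply: le_trans y1; exact: sqrtr_ge0.
split; [by rewrite x0|by []|].
have h1 : (r - s) ^+ 2 - x ^+ 2 <= y ^+ 2 by rewrite -(sqr_sqrtr a0) ler_sqr ?nnegrE ?sqrtr_ge0.
have h2 : y ^+ 2 <= (r + s) ^+ 2 - x ^+ 2 by rewrite -(sqr_sqrtr b0) ler_sqr ?nnegrE ?sqrtr_ge0.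
by apply/andP; split; lra.
Qed.

(** Iterated integration from below. Over each point of the annulus the vertical section contains an
    interval of length [2 * s], and the section is closed by continuity; so only measurability of
    sections enters. *)
Lemma tube_volume (v : 'rV[R]_3 -> 'rV[R]_3) (r h s l : R) : 0 < s -> 2 * s <= r ->
  (forall x y, continuous (fun z : R => enorm (v (vec3 x y z)))) ->
  (forall x y z rho, 0 < rho -> x ^+ 2 + y ^+ 2 = rho ^+ 2 -> `|rho - r| <= s -> `|z - h| <= s -> l <= enorm (v (vec3 x y z))) ->
  ((r * s ^+ 2)%:E <= vol3 [set q | (l <= enorm (v (of_triple q)))%R])%E.
Proof.
move=> s0 sr cv hv; set S := [set q | _].
have hA := annulus_measure s0 sr.
apply: le_trans (_ : (2 * s)%:E * (leb \x leb)%E (annulus r s) <= _)%E.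
  have -> : r * s ^+ 2 = 2 * s * (s * (r / 2)) by field.
  by rewrite EFinM lee_pmul2l// lte_fin mulr_gt0.
apply: (@integral_ge_cst _ _ (leb \x leb)%E _ (2 * s) (fun x => leb (xsection S x)) (annulus_measurable r s)).
- by rewrite mulr_ge0// ltW.
- by move=> x; exact: measure_ge0.
move=> [x y] [/= hx hy /andP[h1 h2]].
have -> : 2 * s = (h + s) - (h - s) by ring.
have e z : xsection S (x, y) z <-> l <= enorm (v (vec3 x y z)) by rewrite /xsection /= inE.
apply: leb_itv; first by lra.
  have -> : xsection S (x, y) = (fun z : R => enorm (v (vec3 x y z))) @^-1` [set w | l <= w].
    by apply/seteqP; split => z /e.
  apply: measurable_realfun.closed_measurable; apply: closed_comp; [by move=> z _; exact: cv|exact: closed_ge].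
move=> z hz; apply/e.
have rs : 0 < (r - s) ^+ 2 by rewrite exprn_gt0//; lra.
have p0 : 0 < x ^+ 2 + y ^+ 2 by lra.
apply: (hv x y z (Num.sqrt (x ^+ 2 + y ^+ 2))); first by rewrite sqrtr_gt0.
- by rewrite sqr_sqrtr// ltW.
- have q := sqrtr_ge0 (x ^+ 2 + y ^+ 2); rewrite ler_distl.
  by apply/andP; split; rewrite -ler_sqr ?nnegrE ?sqr_sqrtr ?(ltW p0)//; lra.
- by rewrite ler_distl.
Qed.

(** The definition of the weak norm at the single level [l], with the volume of the tube bounded
    from below. *)
Lemma weak_tube (v : 'rV[R]_3 -> 'rV[R]_3) (A r h s l : R) : 0 <= A -> 0 < s -> 2 * s <= r -> 0 < l ->
  (weakL3_norm v <= A%:E)%E ->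
  (forall x y, continuous (fun z : R => enorm (v (vec3 x y z)))) ->
  (forall x y z rho, 0 < rho -> x ^+ 2 + y ^+ 2 = rho ^+ 2 -> `|rho - r| <= s -> `|z - h| <= s -> l <= enorm (v (vec3 x y z))) ->
  l ^+ 3 * r * s ^+ 2 <= A ^+ 3.
Proof.
move=> A0 s0 sr l0 hA cv hv; have hV := tube_volume s0 sr cv hv.
have w0 : 0 <= r * s ^+ 2 by rewrite mulr_ge0 ?sqr_ge0//; lra.
have h1 : (l%:E * (r * s ^+ 2)%:E `^ 3^-1 <= A%:E)%E.
  apply: le_trans hA; apply: le_trans (_ : l%:E * vol3 [set q | (l <= enorm (v (of_triple q)))%R] `^ 3^-1 <= _)%E.
    rewrite lee_pmul2l ?lte_fin//; apply: gt0_ler_poweR => //; rewrite ?in_itv/= ?lee_fin ?w0 ?leey//.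
    by rewrite andbT; exact: measure_ge0.
  by apply: ereal_sup_ubound; exists l.
have h2 : l * (r * s ^+ 2) `^ 3^-1 <= A by move: h1; rewrite poweR_EFin -EFinM lee_fin.
have p0 := powR_ge0 (r * s ^+ 2) 3^-1.
have : (l * (r * s ^+ 2) `^ 3^-1) ^+ 3 <= A ^+ 3 by rewrite lerXn2r ?nnegrE// mulr_ge0// ltW.
rewrite exprMn -(powR_mulrn 3 p0) -powRrM mulVf ?pnatr_eq0// powRr1//.
by rewrite mulrA.
Qed.

End Tube.

Section Assembly.
Context {R : realType}.
Local Notation E := (R * 'rV[R]_3)%type.
Local Notation leb := (@lebesgue_measure R).

Lemma leb_setT : (0 < leb [set: R])%E.
Proof.
apply: lt_le_trans (_ : (1 - 0)%:E <= _)%E; first by rewrite lte_fin subr0.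
by apply: leb_itv => //; exact: measurableT.
Qed.

Lemma weakL3_ge0 (v : 'rV[R]_3 -> 'rV[R]_3) : (0 <= weakL3_norm v)%E.
Proof.
apply: le_trans (ereal_sup_ubound (x := 1%:E * vol3 [set q | (1 <= enorm (v (of_triple q)))%R] `^ 3^-1)%E _).
  by rewrite mul1e; exact: poweR_ge0.
by exists 1 => //=.
Qed.

(** The norm bound holds outside a null set, and a null set contains no interval of positive
    length. *)
Lemma good_time (T A t d : R) (u : R -> 'rV[R]_3 -> 'rV[R]_3) : 0 < d -> 0 < t - d -> t + d < T ->
  (Linfty_weakL3_norm T u <= A%:E)%E -> exists t', [/\ 0 < t' < T, `|t' - t| <= d & (weakL3_norm (u t') <= A%:E)%E].
Proof.
move=> d0 td tdT; rewrite /Linfty_weakL3_norm unlock leb_setT => /ess_sup_inf.ess_supP [B [mB B0 hB]].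
apply: contrapT => hn.
have : (((t + d) - (t - d))%:E <= leb B)%E.
  apply: leb_itv => //; first by lra.
  move=> y /andP[y1 y2]; apply: hB => /= hy; apply: hn; exists y.
  have yT : 0 < y < T by apply/andP; split; lra.
  split=> //; first by rewrite ler_distl y1 y2.
  move: hy; rewrite patchE ifT; last by rewrite inE /= in_itv/=; move: yT => /andP[a b]; rewrite !ltW.
  by rewrite gee0_abs ?weakL3_ge0.
by rewrite B0 lee_fin; lra.
Qed.

(** The box is compact, so a strict lower bound for continuous [G] persists at all nearby times
    uniformly over the box. *)
Lemma near_times (G : E -> R) (T t r0 h0 s l m : R) : smf (slab 0 T) G -> 0 < t < T -> m < l ->
  (forall r h, `|r - r0| <= s -> `|h - h0| <= s -> l <= G (pt t r 0 h)) ->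
  \forall t' \near t, forall r h, `|r - r0| <= s -> `|h - h0| <= s -> m < G (pt t' r 0 h).
Proof.
move=> sG ht ml hG.
pose lo (i : 'I_3) : R := if i == 0 then r0 - s else if i == 1 then 0 else h0 - s.
pose hi (i : 'I_3) : R := if i == 0 then r0 + s else if i == 1 then 0 else h0 + s.
have cK := @box_compact R t t lo hi.
set K := [set z | _] in cK.
have h1 : \forall t' \near t, K `<=` (fun z : E => m < G (t', z.2)).
  apply: ((compact_near_coveringP _).1 cK R (nbhs t) (fun t' z => m < G (t', z.2))) => z [zt zi].
  have z1 : z.1 = t by apply/eqP; rewrite eq_le andbC.
  have lG : l <= G (t, z.2).
    rewrite -z1 -surjective_pairing (_ : z = pt t (z.2 0 0) 0 (z.2 0 2)).
      by apply: hG; rewrite ler_distl; [exact: (zi 0)|exact: (zi 2)].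
    rewrite [LHS]ptE z1; congr pt; have := zi 1; rewrite /lo /hi /= => hb; apply/eqP; rewrite eq_le andbC; exact: hb.
  have c : {for (t, z.2), continuous G} by apply: (smf_cont sG).
  have cc : (fun q : E * R => G (q.2, q.1.2)) @ (z, t) --> G (t, z.2).
    have c2 : (fun q : E * R => q.1.2) @ (z, t) --> z.2.
      by apply: (@cvg_comp _ _ _ fst snd _ (nbhs z)); [exact: cvg_fst|exact: cvg_snd].
    have c1 : (fun q : E * R => (q.2, q.1.2)) @ (z, t) --> (t, z.2).
      exact: (cvg_pair (@cvg_snd _ _ (nbhs z) (nbhs t) _) c2).
    by apply: (@cvg_comp _ _ _ (fun q : E * R => (q.2, q.1.2)) G _ (nbhs (t, z.2))); [exact: c1|exact: c].
  exact: (cvgr_gt (G (t, z.2)) cc m (lt_le_trans ml lG)).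
apply: filterS h1 => t' h1 r h hr hh.
have := h1 (pt t r 0 h); apply; split; first by rewrite /pt /= lexx.
by apply: I3P; rewrite ?pt0 ?pt1 ?pt2 /lo /hi /= ?lexx// -ler_distl.
Qed.

(** The level is lowered from [l] to [l / 2] in order to pass to a nearby time at which the norm
    bound holds; the cube of this loss is the factor 8. *)
Lemma tube_vel (T A : R) (u : R -> 'rV[R]_3 -> 'rV[R]_3) (t r0 h0 s l : R) : 0 <= A -> smooth `[0, T] u ->
  (forall t : R, 0 <= t <= T -> axisymmetric (u t)) -> (Linfty_weakL3_norm T u <= A%:E)%E ->
  0 < t < T -> 0 < s -> 2 * s <= r0 -> 0 < l ->
  (forall r h, `|r - r0| <= s -> `|h - h0| <= s -> l ^+ 2 <= \sum_(i < 3) vel u i (pt t r 0 h) ^+ 2) ->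
  l ^+ 3 * r0 * s ^+ 2 <= 8 * A ^+ 3.
Proof.
move=> A0 su hax hA ht s0 sr l0 hl.
have sG : smf (slab 0 T) (fun z => \sum_(i < 3) vel u i z ^+ 2).
  have sv i := smf_vel su i.
  apply: (smf_eq (@slab_open R 0 T) (F := fun z => vel u 0 z * vel u 0 z + vel u 1 z * vel u 1 z + vel u 2 z * vel u 2 z)).
    by move=> z _; rewrite sum3 !expr2.
  by do ?[exact: smfD|apply: (smfD (@slab_open R 0 T))]; apply: (smfM (@slab_open R 0 T)).
have ml : (l / 2) ^+ 2 < l ^+ 2 by rewrite ltr_sqr ?nnegrE; lra.
have /nbhs_ballP [e /= e0 he] := near_times sG ht ml hl.
have /andP[t0 tT] := ht.
pose d := Num.min (e / 2) (Num.min (t / 2) ((T - t) / 2)).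
have [d1 d2 d3] : [/\ d <= e / 2, d <= t / 2 & d <= (T - t) / 2].
  by rewrite /d !ge_min !lexx !orbT.
have d0 : 0 < d by rewrite /d !lt_min; apply/and3P; split; lra.
have [|| t' [ht' dt' wt']] := @good_time T A t d u d0 _ _ hA; [lra|lra|].
have sq v : dot v v = \sum_(i < 3) v 0 i ^+ 2 by apply: eq_bigr => i _; rewrite expr2.
have := @weak_tube R (u t') A r0 h0 s (l / 2) A0 s0 sr _ wt' _ _.
rewrite expr_div_n.
move=> hw; have : l ^+ 3 / 2 ^+ 3 * r0 * s ^+ 2 <= A ^+ 3.
  apply: hw; first by rewrite divr_gt0.
    move=> x y z.
    apply: (@cvg_comp _ _ _ (fun z : R => dot (u t' (vec3 x y z)) (u t' (vec3 x y z))) Num.sqrt); last exact: sqrt_continuous.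
    have c i : {for z, continuous (fun z => vel u i (pt t' x y z))} by apply: (dR_cont (dR_h x y z (smf_vel su i) ht')).
    have cM i : (fun z => vel u i (pt t' x y z) ^+ 2) @ z --> vel u i (pt t' x y z) ^+ 2.
      rewrite expr2; under eq_fun do rewrite expr2.
      by apply: cvgM; exact: c.
    rewrite sq sum3; under eq_fun do rewrite sq sum3.
    exact: (cvgD (cvgD (cM 0) (cM 1)) (cM 2)).
  move=> x y z rho rho0 exy hr hz.
  have hax' := hax t'; have /andP[t'0 t'T] := ht'; rewrite !ltW// in hax'.
  have e3 := axisym_vel z (hax' isT) rho0 exy.
  have e4 : \sum_(i < 3) vel u i (pt t' x y z) ^+ 2 = \sum_(i < 3) vel u i (pt t' rho 0 z) ^+ 2.
    exact: (rot_sum (f := fun i => vel u i (pt t' x y z)) (g := fun i => vel u i (pt t' rho 0 z)) rho0 exy e3).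
  have hb : ball t e t' by rewrite /ball/= distrC (le_lt_trans dt')//; lra.
  have hm := he t' hb rho z hr hz.
  rewrite /enorm sq -[l / 2]ger0_norm ?divr_ge0 ?(ltW l0)// -sqrtr_sqr ler_wsqrtr// ltW//.
  by apply: lt_le_trans hm _; rewrite -e4.
have -> : l ^+ 3 / 2 ^+ 3 * r0 * s ^+ 2 = l ^+ 3 * r0 * s ^+ 2 / 8 by field.
by rewrite ler_pdivrMr// [_ * 8]mulrC.
Qed.

Lemma sol_vel (T A : R) (u : R -> 'rV[R]_3 -> 'rV[R]_3) p : 0 <= A -> smooth `[0, T] u -> smooth `[0, T] p ->
  navier_stokes `[0, T] u p ->
  (forall t : R, 0 <= t <= T -> axisymmetric (u t)) -> (Linfty_weakL3_norm T u <= A%:E)%E ->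
  sol 0 T A (vel u) (pre p).
Proof.
move=> A0 su sp ns hax hA; split.
- by move=> i; exact: smf_vel.
- exact: smf_pre.
- by move=> z k Sz; exact: (ns_vel su sp ns).
- by move=> z Sz; exact: (div_vel su ns).
- by move=> t x y h r /andP[t0 tT] r0 e; apply: axisym_vel => //; apply: hax; rewrite !ltW.
- by move=> t r0 h0 s l ht s0 sr l0 hl; exact: (tube_vel A0 su hax hA ht s0 sr l0 hl).
Qed.

End Assembly.

(** * Conclusion *)

Section Conclusion.
Context {R : realType}.
Local Notation E := (R * 'rV[R]_3)%type.

Lemma Linfty_le (g : 'rV[R]_3 -> R) (c : R) : 0 <= c -> (forall x, `|g x| <= c) -> (Linfty_norm g <= c%:E)%E.
Proof.
move=> c0 h; rewrite /Linfty_norm unlock; case: ifP => // _.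
by apply/ess_sup_inf.ess_supP; apply: nearW => q /=; rewrite lee_fin.
Qed.

Lemma nabla_le j (v : 'rV[R]_3 -> 'rV[R]_3) x (c : R) : 0 <= c ->
  (forall (w : seq 'I_3) i, size w = j -> `|(foldr dx v w x) 0 i| <= c ^+ j.+1) ->
  `|nabla_norm j v x| <= (3 * c) ^+ j.+1.
Proof.
move=> c0 h; have c30 : 0 <= (3 * c) ^+ j.+1 by rewrite exprn_ge0// mulr_ge0.
rewrite ger0_norm ?sqrtr_ge0// -[leRHS]ger0_norm// -sqrtr_sqr ler_wsqrtr//.
apply: le_trans (_ : \sum_(w : j.-tuple 'I_3) 3 * (c ^+ j.+1) ^+ 2 <= _).
  apply: ler_sum => w _; rewrite sqr_sqrtr; last by apply: sumr_ge0 => i _; rewrite -expr2 sqr_ge0.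
  have hi i : (foldr dx v w x) 0 i * (foldr dx v w x) 0 i <= (c ^+ j.+1) ^+ 2.
    by rewrite -expr2 -real_normK ?num_real// ler_sqr ?nnegrE ?exprn_ge0// h// size_tuple.
  rewrite /dot sum3; have := hi 0; have := hi 1; have := hi 2.
  by move: (_ * _) (_ * _) (_ * _) (_ ^+ 2) => *; lra.
(* There are 3^j words with three components each, and 3^(j+1) is at most the square of itself. *)
rewrite sumr_const card_tuple card_ord -[X in X <= _]mulr_natl natrX mulrA -exprSr.
rewrite [(3 * c) ^+ _]exprMn [(_ * _) ^+ 2]exprMn ler_wpM2r ?sqr_ge0//.
by rewrite -exprM ler_weXn2l// ?ler1n// leq_pmulr.
Qed.

(** The interior theory lives on the open slab; smoothness up to the end of the interval carries the
    bound to the time [T]. *)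
Lemma closed_time (T c : R) (u : R -> 'rV[R]_3 -> 'rV[R]_3) x w i s : smooth `[0, T] u -> 0 < s -> s < T ->
  (forall t, s < t < T -> `|(foldr dx (u t) w x) 0 i| <= c) -> `|(foldr dx (u T) w x) 0 i| <= c.
Proof.
move=> su s0 sT h; rewrite leNgt; apply/negP => hc.
have [cw _] := su (map Some w).
have wE t y : mixed `[0, T] (map Some w) u t y = foldr dx (u t) w y.
  elim: w y {h hc cw} => [|k w IH] y //=.
  by congr (dx k _ y); apply/funext => y'; exact: IH.
have IT : (`[0, T]%classic `*` [set: 'rV[R]_3]) (T, x).
  by split=> //=; rewrite in_itv/= lexx andbT; lra.
have h1 := (@subspace_continuousP _ _ _ _).1 cw (T, x) IT.
have h2 : (fun z : E => `|(mixed `[0, T] (map Some w) u z.1 z.2) 0 i|) @ within (`[0, T] `*` setT) (nbhs (T, x)) -->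
    `|(mixed `[0, T] (map Some w) u T x) 0 i|.
  apply: cvg_norm.
  by apply: (@cvg_comp _ _ _ (fun z : E => mixed `[0, T] (map Some w) u z.1 z.2) (fun M : 'rV[R]_3 => M 0 i) _ _ _ h1); exact: coord_continuous.
rewrite wE in h2; have h3 := cvgr_gt _ h2 c hc.
have h4 : \forall z \near (T, x), (`[0, T]%classic `*` [set: 'rV[R]_3]) z -> c < `|(mixed `[0, T] (map Some w) u z.1 z.2) 0 i|.
  exact: (h3 (within_filter _ (nbhs_filter _))).
have [d d0 hd] := (nbhs_near_pt _ _).1 h4.
pose t := T - Num.min (d / 2) ((T - s) / 2).
have [m0 m1 m2] : [/\ 0 < Num.min (d / 2) ((T - s) / 2), Num.min (d / 2) ((T - s) / 2) <= d / 2 & Num.min (d / 2) ((T - s) / 2) <= (T - s) / 2].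
  by rewrite !ge_min !lexx !orbT lt_min; split=> //; apply/andP; split; lra.
have ht : s < t < T by rewrite /t; move: m0 m2; move: (Num.min _ _) => m m0 m2; apply/andP; split; lra.
have := hd (t, x); rewrite /= wE ltNge h//.
suff: near_pt d (T, x) (t, x) /\ (`[0, T]%classic `*` [set: 'rV[R]_3]) (t, x) by move=> [a b] /(_ a b).
split; last by split=> //=; rewrite in_itv/=; move/andP: ht => [a b]; apply/andP; split; lra.
split=> /= [|k]; last by rewrite subrr normr0.
by rewrite /t; move: m0 m1; move: (Num.min _ _) => m m0 m1; rewrite ltr_norml; apply/andP; split; lra.
Qed.

(** By 6 <= exp 6 and j + 1 <= exp j the constants are moved up one exponential after another. They
    end in the exponent [a ^+ k + 6 + j], which is below [a ^+ k * (1 + (j + 7))], and 1 + (j + 7)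
    <= 2^(j+7). *)
Lemma expexp_pow (a b : R) j k : 2 <= a -> b <= expR (expR (a ^+ k)) ->
  0 <= b -> (6 * b) ^+ j.+1 <= expR (expR (a ^+ (k + j + 7))).
Proof.
move=> a2 hb b0; have ak : 1 <= a ^+ k by rewrite exprn_ege1//; lra.
have h6 : 6 * b <= expR (6 + expR (a ^+ k)).
  rewrite expRD; apply: ler_pM => //.
  by apply: le_trans (expR_ge1Dx 6); rewrite lerDr.
apply: le_trans (_ : expR (6 + expR (a ^+ k)) ^+ j.+1 <= _).
  by rewrite lerXn2r ?nnegrE ?expR_ge0// mulr_ge0.
rewrite -expRM_natl ler_expR.
have h7 : 6 + expR (a ^+ k) <= expR (a ^+ k + 6).
  have := expR_ge1Dx (6 : R); have e1 := expR_ge1Dx (a ^+ k).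
  move=> e6; rewrite expRD; apply: le_trans (_ : expR (a ^+ k) * (1 + 6) <= _).
    by move: e1 ak; move: (expR (a ^+ k)) (a ^+ k) => X Y; lra.
  by rewrite ler_wpM2l// expR_ge0.
have h8 : j.+1%:R <= expR (j%:R) :> R by apply: le_trans (expR_ge1Dx _); rewrite -natr1 addrC.
apply: le_trans (_ : expR j%:R * expR (a ^+ k + 6) <= _).
  by apply: ler_pM; rewrite ?ler0n//; apply: addr_ge0 => //; exact: expR_ge0.
rewrite -expRD ler_expR.
have h9 : 1 + (j + 7)%:R <= 2 ^+ (j + 7) :> R.
  rewrite -natrX -[1]/(1%:R) -natrD ler_nat add1n; exact: ltn_expl.
have h10 : 2 ^+ (j + 7) <= a ^+ (j + 7) by rewrite lerXn2r ?nnegrE//; lra.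
rewrite -addnA exprD; apply: le_trans (_ : a ^+ k * (1 + (j + 7)%:R) <= _); last first.
  by rewrite ler_wpM2l; [|lra|exact: le_trans h10].
have h11 : 0 <= (a ^+ k - 1) * (j + 7)%:R by rewrite mulr_ge0// subr_ge0.
by move: h11; rewrite natrD; lra.
Qed.

Lemma powR_half (t : R) j : 0 < t -> t `^ (- ((1 + j%:R) / 2)) = (Num.sqrt t)^-1 ^+ j.+1.
Proof.
move=> t0; rewrite powRN [_ / 2]mulrC powRrM powR12_sqrt ?ltW// nat1r powR_mulrn ?sqrtr_ge0//.
by rewrite exprVn.
Qed.

Lemma word_bound j k T A (u : R -> 'rV[R]_3 -> 'rV[R]_3) p t x w i :
  (forall (a b A : R) (u : 'I_3 -> E -> R) p z (rho : R), 2 <= A -> sol a b A u p ->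
    0 < rho -> a < z.1 - rho ^+ 2 -> z.1 < b -> magn j.+3 u z * rho <= expR (expR (A ^+ k))) ->
  2 <= A -> smooth `[0, T] u -> sol 0 T A (vel u) (pre p) -> 0 < t <= T -> size w = j ->
  `|(foldr dx (u t) w x) 0 i| <= (2 * expR (expR (A ^+ k)) / Num.sqrt t) ^+ j.+1.
Proof.
move=> hk A2 su hs /andP[t0 tT] sw.
have q0 : 0 < Num.sqrt t by rewrite sqrtr_gt0.
have qq : (Num.sqrt t / 2) ^+ 2 = t / 4 by rewrite expr_div_n sqr_sqrtr ?ltW//; congr (_ / _); ring.
have q20 : 0 < Num.sqrt t / 2 by rewrite divr_gt0.
(* One radius, [Num.sqrt t / 2], serves all times after [t / 4], so the bound is uniform as [t']
   tends to [T]. *)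
have inner t' : t / 4 < t' < T ->
    `|(foldr dx (u t') w x) 0 i| <= (2 * expR (expR (A ^+ k)) / Num.sqrt t) ^+ j.+1.
  move=> /andP[t1 t2]; have Sz : slab 0 T (t', x) by apply/andP; split => //=; lra.
  have := hk 0 T A (vel u) (pre p) (t', x) (Num.sqrt t / 2) A2 hs q20.
  rewrite qq /= subr_gt0 => /(_ t1 t2) hm.
  rewrite -(pds_vel su w i Sz); apply: le_trans (pds_magn _ _ _ (m := j.+3) _) _.
    by rewrite sw ltnW// ltnW.
  rewrite sw; rewrite lerXn2r ?nnegrE ?magn_ge0 ?divr_ge0 ?mulr_ge0 ?expR_ge0 ?(ltW q0)//.
  rewrite ler_pdivlMr//; move: hm; move: (magn _ _ _) (expR _) (Num.sqrt t) => X Y Z; lra.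
case: (ltgtP t T) tT => // [tT _|tT _]; first by apply: inner; apply/andP; split; lra.
by rewrite {1}tT; apply: (closed_time su (s := t / 4)); [lra|lra|exact: inner].
Qed.

End Conclusion.

Theorem theorem1p1 (R : realType) :
  exists (A0 : R) (C : nat -> R),
    1 < A0 /\ (forall j : nat, 1 < C j) /\
    forall (T A : R) (u : R -> 'rV[R]_3 -> 'rV[R]_3),
      0 < T -> A0 <= A ->
      classical_solution T u ->
      (forall t : R, 0 <= t <= T -> axisymmetric (u t)) ->
      (Linfty_weakL3_norm T u <= A%:E)%E ->
      forall (j : nat) (t : R), 0 < t <= T ->
        (Linfty_norm (nabla_norm j (u t)) <=
          (t `^ (- ((1 + j%:R) / 2)) * expR (expR (A `^ C j)))%:E)%E.
Proof.
have [k hk] := choice (@main_bound R).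
(* [A >= 2] lets powers of [A] absorb constants; the addition of [j + 7] comes from [expexp_pow],
   which absorbs the factor 6 and the power [j + 1]. *)
exists 2, (fun j => (k j + j + 7)%:R); split; first by rewrite ltr1n.
split=> [j|T A u T0 A2 [p [su sp ns]] hax hA j t ht]; first by rewrite ltr1n; lia.
have A0 : 0 <= A by lra.
have hs := sol_vel A0 su sp ns hax hA.
have t0 : 0 < t by case/andP: ht.
have q0 : 0 < Num.sqrt t by rewrite sqrtr_gt0.
set X := expR (expR (A ^+ k j)).
have X0 : 0 <= X := expR_ge0 _.
have c0 : 0 <= 2 * X / Num.sqrt t by rewrite divr_ge0 ?mulr_ge0// ltW.
apply: le_trans (_ : ((3 * (2 * X / Num.sqrt t)) ^+ j.+1)%:E <= _)%E.
  apply: Linfty_le => [|x]; first by rewrite exprn_ge0// mulr_ge0.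
  by apply: nabla_le => // w i sw; exact: (word_bound x i (hk j) A2 su hs ht sw).
rewrite lee_fin powR_half// powR_mulrn//.
have -> : 3 * (2 * X / Num.sqrt t) = (Num.sqrt t)^-1 * (6 * X) by ring.
rewrite exprMn ler_wpM2l ?exprn_ge0 ?invr_ge0 ?sqrtr_ge0//.
exact: expexp_pow.
Qed.
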